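(* Let $c(n)$, $n\ge 0$, be the Fourier coefficients of the modular invariant $j$. Then the sequence $\{\sqrt[n]{c(n)}\}_{n\ge 1}$ is log-convex.
   Context: The modular invariant $j$ is defined for $\tau$ in the upper half-plane, with $q=e^{2\pi i\tau}$, by $$j(\tau)=\frac{\left(1+240\sum_{n\ge 1}\sigma_3(n)q^n\right)^3}{q\prod_{n\ge 1}(1-q^n)^{24}}=q^{-1}+\sum_{n\ge 0}c(n)q^n=q^{-1}+744+196884q+21493760q^2+\cdots,$$ where $\sigma_3(n)=\sum_{d\mid n}d^3$. This defines the integers $c(n)$, $n\ge 0$. A sequence $\{a_n\}_{n\ge n_0}$ is log-convex if $a_na_{n+2}-a_{n+1}^2\ge 0$ for all $n\ge n_0$. *)

(* Defs.v *)
From Stdlib Require Import Reals ZArith Arith List.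
From Coquelicot Require Import Coquelicot.

Local Open Scope R_scope.

Definition divisor_sigma (k n : nat) : nat :=
  list_sum (map (fun d => Nat.pow d k)
                (filter (fun d => Nat.eqb (Nat.modulo n d) 0) (seq 1 n))).

(** q = e^{2 pi i tau}, i.e. e^{- 2 pi Im tau} (cos (2 pi Re tau) + i sin (2 pi Re tau));
    Coquelicot has no complex exponential. *)
Definition nome (tau : C) : C :=
  (RtoC (exp (- (2 * PI * Im tau)))
   * (cos (2 * PI * Re tau), sin (2 * PI * Re tau)))%C.

(** [CSeries] and [CLim_seq] are total, like Coquelicot's [RInt]: the value is
    meaningful when the series (resp. sequence) converges. *)
Definition CSeries (a : nat -> C) : C :=
  @iota C_CompleteNormedModule (fun l : C => is_series a l).

Definition CLim_seq (u : nat -> C) : C :=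
  @iota C_CompleteNormedModule (fun l : C => filterlim u eventually (locally l)).

Definition Cprod (f : nat -> C) (l : list nat) : C :=
  fold_right Cmult (RtoC 1) (map f l).

(** The sum over n >= 1 is reindexed to start at 0. *)
Definition eisenstein4 (q : C) : C :=
  (1 + 240 * CSeries (fun n => RtoC (INR (divisor_sigma 3 (S n))) * Cpow q (S n)))%C.

Definition euler_prod24 (q : C) : C :=
  CLim_seq (fun N => Cprod (fun n => Cpow (1 - Cpow q n) 24) (seq 1 N)).

Definition j_invariant (tau : C) : C :=
  let q := nome tau in
  (Cpow (eisenstein4 q) 3 / (q * euler_prod24 q))%C.

(** c(0), c(1), ... are the coefficients in j = q^{-1} + sum_{n >= 0} c(n) q^n,
    an identity (with convergence of the series) on the whole upper half-plane;
    this determines c uniquely. *)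
Definition is_j_coefficients (c : nat -> Z) : Prop :=
  forall tau : C, 0 < Im tau ->
    is_series (fun n => RtoC (IZR (c n)) * Cpow (nome tau) n)%C
              (j_invariant tau - / nome tau)%C.

(** The positive n-th root of x, for x > 0 and n >= 1. *)
Definition nth_root (n : nat) (x : R) : R := Rpower x (/ INR n).

Definition log_convex_from (n0 : nat) (a : nat -> R) : Prop :=
  forall n : nat, (n0 <= n)%nat -> a n * a (n + 2)%nat - a (n + 1)%nat ^ 2 >= 0.

(* Main.v *)
(** Modularity of [j] makes its behaviour near [q = 1] explicit: for [s = - i tau] one has
    [j(1/s) = j(s)], so [j(s)] is within a constant of [exp (2 pi / s)] when [Re (1/s)] is bounded
    below.  The same holds for the power series with coefficients
    [M(n) = (2 pi / sqrt n) I_1 (4 pi sqrt n)], while away from [q = 1] the product formula shows that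
    [j] is much smaller than on the positive axis.  Cauchy's estimate on the circle [Re s = 1 / sqrt n]
    then gives [|c(n) - M(n)| <= M(n) / n^2] for [n >= 121].  The Bessel equation shows that
    [ln M(x) / x] has second derivative at least [44 / x^3], which dominates the error [8 / n^3] in the
    second difference of [ln c(n) / n].  The remaining [n] are checked by computing [c(n)] exactly.
    The modularity of [E_4] and of the discriminant product comes from the partial fractions of
    [1 / sinh^2] and [1 / sinh^4], with double sums over [(m, j)] exchanged after subtracting a
    telescoping term. *)

Require Import Defs.
From Stdlib Require Import Reals ZArith Arith List Lia Lra Psatz.
From Coquelicot Require Import Coquelicot.

Local Open Scope R_scope.

(** * Convergence of complex sequences and series *)

(** The second difference of $\ln M(x)/x$ is really of order $x^{-5/2}$, so a relative error
    $n^{-2}$ for $c(n)$, hence $O(n^{-3})$ for $\ln c(n)/n$, is good enough: only the dominant pole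
    matters, and no exact series for $c(n)$ is needed. The circle $\operatorname{Re} s=1/\sqrt n$ is
    the saddle: there the peak of $|e^{2\pi/s}|$ and the factor $|q|^{-n}$ both equal
    $X=e^{2\pi\sqrt n}$, and $M(n)$ has size $X^2$ up to a power of $n$. Away from $q=1$ the bound
    on $j$ gains $n^{-3}$; the elementary lower bound $M(n)\ge(X^2-2)/(4n)$ gives one factor $n$
    back, and $n^{-2}$ remains. Near $q=1$ the argument rests on $c(n)\ge 0$, which bounds $j-1/q$
    on a whole disc by one real value. Complex analysis is kept elementary: contour integrals become
    averages over roots of unity, partial fractions come from duplication formulas, and
    differentiation happens only along real segments. *)

Definition cvg (u : nat -> C) (l : C) : Prop :=
  is_lim_seq (fun n => Cmod (u n - l)) 0.

Fixpoint Csum (a : nat -> C) (n : nat) : C :=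
  match n with O => 0 | S m => (Csum a m + a m)%C end.

(** Convergence is measured by the real sequence of moduli, so that limit arguments become squeezes
    of real sequences. Partial sums run over [k < n]; having the empty sum makes shifts and tails
    uniform. *)
Definition csum (a : nat -> C) (l : C) : Prop := cvg (Csum a) l.

Fixpoint Rsum (a : nat -> R) (n : nat) : R :=
  match n with O => 0 | S m => Rsum a m + a m end.

Definition rsum (a : nat -> R) (l : R) : Prop := is_lim_seq (Rsum a) l.

Lemma is_lim_seq_squeeze0 (u v : nat -> R) :
  (forall n, 0 <= u n <= v n) -> is_lim_seq v 0 -> is_lim_seq u 0.
Proof.
  intros H Hv.
  apply (is_lim_seq_le_le (fun _ => 0) u v); auto.
  apply is_lim_seq_const.
Qed.

Lemma cvg_bound (u : nat -> C) (e : nat -> R) (l : C) :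
  (forall n, Cmod (u n - l) <= e n) -> is_lim_seq e 0 -> cvg u l.
Proof.
  intros H He. apply (is_lim_seq_squeeze0 _ e); auto.
  intro n; split; auto. apply Cmod_ge_0.
Qed.

Lemma cvg_ext (u v : nat -> C) (l : C) : (forall n, u n = v n) -> cvg u l -> cvg v l.
Proof.
  intros H Hu. apply is_lim_seq_ext with (2 := Hu). intro n; now rewrite H.
Qed.

Lemma cvg_eq (u : nat -> C) (l m : C) : cvg u l -> l = m -> cvg u m.
Proof. now intros H <-. Qed.

Lemma cvg_const (l : C) : cvg (fun _ => l) l.
Proof.
  apply cvg_bound with (fun _ => 0). 2: apply is_lim_seq_const.
  intros _. replace (l - l)%C with (RtoC 0) by ring. rewrite Cmod_0; lra.
Qed.

Lemma is_lim_seq_plus0 (u v : nat -> R) :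
  is_lim_seq u 0 -> is_lim_seq v 0 -> is_lim_seq (fun n => u n + v n) 0.
Proof.
  intros Hu Hv. replace (Finite 0) with (Finite (0 + 0)) by (f_equal; ring).
  now apply is_lim_seq_plus'.
Qed.

Lemma is_lim_seq_scal0 (k : R) (u : nat -> R) :
  is_lim_seq u 0 -> is_lim_seq (fun n => k * u n) 0.
Proof.
  intros Hu. replace (Finite 0) with (Rbar_mult k 0) by (simpl; f_equal; ring).
  now apply is_lim_seq_scal_l.
Qed.

Lemma cvg_plus (u v : nat -> C) (l m : C) :
  cvg u l -> cvg v m -> cvg (fun n => u n + v n)%C (l + m)%C.
Proof.
  intros Hu Hv.
  apply cvg_bound with (fun n => Cmod (u n - l) + Cmod (v n - m)).
  - intro n. replace (u n + v n - (l + m))%C with ((u n - l) + (v n - m))%C by ring.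
    apply Cmod_triangle.
  - now apply is_lim_seq_plus0.
Qed.

Lemma cvg_scal (k : C) (u : nat -> C) (l : C) :
  cvg u l -> cvg (fun n => k * u n)%C (k * l)%C.
Proof.
  intros Hu.
  apply cvg_bound with (fun n => Cmod k * Cmod (u n - l)).
  - intro n. replace (k * u n - k * l)%C with (k * (u n - l))%C by ring.
    rewrite Cmod_mult; lra.
  - now apply is_lim_seq_scal0.
Qed.

Lemma cvg_minus (u v : nat -> C) (l m : C) :
  cvg u l -> cvg v m -> cvg (fun n => u n - v n)%C (l - m)%C.
Proof.
  intros Hu Hv. replace (l - m)%C with (l + (-(1)) * m)%C by ring.
  apply cvg_ext with (fun n => u n + (-(1)) * v n)%C. intro n; ring.
  apply cvg_plus; auto. now apply cvg_scal.
Qed.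

Lemma cvg_norm_bounded (u : nat -> C) (l : C) :
  cvg u l -> exists K, 0 <= K /\ forall n, Cmod (u n) <= K.
Proof.
  intros Hu.
  destruct (filterlim_bounded (fun n => Cmod (u n - l)) (ex_intro _ 0 Hu)) as [M HM].
  exists (M + Cmod l). split.
  - specialize (HM O). unfold norm in HM; simpl in HM. unfold abs in HM; simpl in HM.
    generalize (Rabs_pos (Cmod (u O - l))) (Cmod_ge_0 l). lra.
  - intro n. specialize (HM n). unfold norm in HM; simpl in HM. unfold abs in HM; simpl in HM.
    rewrite Rabs_pos_eq in HM by apply Cmod_ge_0.
    replace (u n) with ((u n - l) + l)%C by ring.
    eapply Rle_trans. apply Cmod_triangle. lra.
Qed.

Lemma cvg_mult (u v : nat -> C) (l m : C) :
  cvg u l -> cvg v m -> cvg (fun n => u n * v n)%C (l * m)%C.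
Proof.
  intros Hu Hv. destruct (cvg_norm_bounded _ _ Hu) as [K [HK0 HK]].
  apply cvg_bound with (fun n => K * Cmod (v n - m) + Cmod m * Cmod (u n - l)).
  - intro n. replace (u n * v n - l * m)%C with (u n * (v n - m) + m * (u n - l))%C by ring.
    eapply Rle_trans. apply Cmod_triangle. rewrite !Cmod_mult.
    apply Rplus_le_compat_r. apply Rmult_le_compat_r; auto. apply Cmod_ge_0.
  - apply is_lim_seq_plus0; now apply is_lim_seq_scal0.
Qed.

Lemma cvg_norm_le (u : nat -> C) (l a : C) (K : R) :
  cvg u l -> eventually (fun n => Cmod (u n - a) <= K) -> Cmod (l - a) <= K.
Proof.
  intros Hu HK.
  assert (H : Rbar_le (Cmod (l - a)) K); auto.
  apply (is_lim_seq_le_loc (fun n => Cmod (l - a) ) (fun n => K + Cmod (u n - l))).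
  - destruct HK as [N HN]. exists N. intros n Hn.
    replace (l - a)%C with ((u n - a) + - (u n - l))%C by ring.
    eapply Rle_trans. apply Cmod_triangle. rewrite Cmod_opp. specialize (HN n Hn); lra.
  - apply is_lim_seq_const.
  - replace (Finite K) with (Finite (K + 0)) by (f_equal; ring).
    apply is_lim_seq_plus'. apply is_lim_seq_const. exact Hu.
Qed.

Lemma cvg_norm_le0 (u : nat -> C) (l : C) (K : R) :
  cvg u l -> (forall n, Cmod (u n) <= K) -> Cmod l <= K.
Proof.
  intros Hu HK. replace l with (l - 0)%C by ring.
  apply (cvg_norm_le u); auto. exists O; intros n _.
  replace (u n - 0)%C with (u n) by ring. auto.
Qed.

Lemma cvg_unique (u : nat -> C) (l m : C) : cvg u l -> cvg u m -> l = m.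
Proof.
  intros Hl Hm.
  assert (H : cvg (fun n => u n - u n)%C (l - m)%C) by now apply cvg_minus.
  assert (Cmod (l - m) <= 0).
  { apply (cvg_norm_le0 _ _ _ H). intro n.
    replace (u n - u n)%C with (RtoC 0) by ring. rewrite Cmod_0; lra. }
  assert (E : (l - m)%C = 0) by (apply Cmod_eq_0; generalize (Cmod_ge_0 (l - m)); lra).
  replace l with ((l - m) + m)%C by ring. rewrite E; ring.
Qed.

Lemma cvg_comp (u : nat -> C) (l : C) (f : nat -> nat) :
  filterlim f eventually eventually -> cvg u l -> cvg (fun n => u (f n)) l.
Proof.
  intros Hf Hu. unfold cvg, is_lim_seq in *.
  apply (filterlim_comp _ _ _ f (fun n => Cmod (u n - l)) _ _ _ Hf Hu).
Qed.

Lemma cvg_incr (u : nat -> C) (l : C) : cvg (fun n => u (S n)) l <-> cvg u l.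
Proof. symmetry. apply (is_lim_seq_incr_1 (fun n => Cmod (u n - l))). Qed.

Lemma cvg_inv (u : nat -> C) (l : C) : l <> 0 -> cvg u l -> cvg (fun n => / u n)%C (/ l)%C.
Proof.
  intros Hl Hu.
  assert (Hl' : 0 < Cmod l) by now apply Cmod_gt_0.
  assert (He : eventually (fun n => Cmod l / 2 <= Cmod (u n))).
  { assert (E := Hu). apply is_lim_seq_spec in E.
    destruct (E (mkposreal (Cmod l / 2) ltac:(lra))) as [N HN]. exists N. intros n Hn.
    specialize (HN n Hn). simpl in HN. rewrite Rminus_0_r, Rabs_pos_eq in HN by apply Cmod_ge_0.
    assert (Cmod l <= Cmod (u n) + Cmod (u n - l)).
    { replace l with (u n + - (u n - l))%C at 1 by ring.
      eapply Rle_trans. apply Cmod_triangle. rewrite Cmod_opp; lra. }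
    lra. }
  unfold cvg.
  apply is_lim_seq_le_le_loc with (fun _ => 0) (fun n => (2 / (Cmod l * Cmod l)) * Cmod (u n - l)).
  - destruct He as [N HN]. exists N. intros n Hn. split. apply Cmod_ge_0.
    specialize (HN n Hn).
    assert (Hn0 : u n <> 0) by (apply Cmod_gt_0; lra).
    replace (/ u n - / l)%C with (- (u n - l) / (u n * l))%C by (field; auto).
    rewrite Cmod_div by now apply Cmult_neq_0.
    rewrite Cmod_opp, Cmod_mult.
    replace (2 / (Cmod l * Cmod l) * Cmod (u n - l)) with (Cmod (u n - l) * / (Cmod l / 2 * Cmod l)) by (field; lra).
    apply Rmult_le_compat_l. apply Cmod_ge_0. apply Rinv_le_contravar. nra. nra.
  - apply is_lim_seq_const.
  - now apply is_lim_seq_scal0.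
Qed.

(** * Finite sums, complex and real *)

Lemma Csum_ext (a b : nat -> C) (n : nat) :
  (forall k, (k < n)%nat -> a k = b k) -> Csum a n = Csum b n.
Proof.
  induction n; simpl; intros H; auto. rewrite IHn, H; auto.
Qed.

Lemma Csum_plus (a b : nat -> C) (n : nat) :
  Csum (fun k => a k + b k)%C n = (Csum a n + Csum b n)%C.
Proof. induction n; simpl. ring. rewrite IHn; ring. Qed.

Lemma Csum_minus (a b : nat -> C) (n : nat) :
  Csum (fun k => a k - b k)%C n = (Csum a n - Csum b n)%C.
Proof. induction n; simpl. ring. rewrite IHn; ring. Qed.

Lemma Csum_scal (k : C) (a : nat -> C) (n : nat) :
  Csum (fun i => k * a i)%C n = (k * Csum a n)%C.
Proof. induction n; simpl. ring. rewrite IHn; ring. Qed.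

Lemma Csum_const (k : C) (n : nat) : Csum (fun _ => k) n = (INR n * k)%C.
Proof.
  induction n. simpl; ring.
  change (Csum (fun _ => k) (S n)) with (Csum (fun _ => k) n + k)%C.
  rewrite IHn, S_INR, RtoC_plus; ring.
Qed.

Lemma Csum_S (a : nat -> C) (n : nat) :
  Csum a (S n) = (a O + Csum (fun k => a (S k)) n)%C.
Proof.
  induction n. simpl; ring.
  change (Csum a (S (S n))) with (Csum a (S n) + a (S n))%C. rewrite IHn. simpl; ring.
Qed.

Lemma Csum_add (a : nat -> C) (n m : nat) :
  Csum a (n + m) = (Csum a n + Csum (fun k => a (n + k)%nat) m)%C.
Proof.
  induction m. rewrite Nat.add_0_r; simpl; ring.
  rewrite Nat.add_succ_r; simpl. rewrite IHm; ring.
Qed.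

Lemma Csum_rev (a : nat -> C) (n : nat) :
  Csum a n = Csum (fun k => a (n - 1 - k)%nat) n.
Proof.
  induction n. reflexivity.
  rewrite (Csum_S (fun k => a (S n - 1 - k)%nat)). simpl. rewrite !Nat.sub_0_r, IHn, Cplus_comm.
  f_equal. apply Csum_ext. intros k Hk. f_equal; lia.
Qed.

Lemma Csum_swap (a : nat -> nat -> C) (n m : nat) :
  Csum (fun i => Csum (a i) m) n = Csum (fun j => Csum (fun i => a i j) n) m.
Proof.
  induction n; simpl.
  - induction m; simpl; auto. rewrite <- IHm; ring.
  - rewrite IHn, <- Csum_plus. reflexivity.
Qed.

Lemma Csum_norm (a : nat -> C) (b : nat -> R) (n : nat) :
  (forall k, (k < n)%nat -> Cmod (a k) <= b k) -> Cmod (Csum a n) <= Rsum b n.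
Proof.
  induction n; simpl; intros H. rewrite Cmod_0; lra.
  eapply Rle_trans. apply Cmod_triangle.
  apply Rplus_le_compat; auto.
Qed.

Lemma Rsum_ext (a b : nat -> R) (n : nat) :
  (forall k, (k < n)%nat -> a k = b k) -> Rsum a n = Rsum b n.
Proof.
  induction n; simpl; intros H; auto. rewrite IHn, H; auto.
Qed.

Lemma Rsum_scal (k : R) (a : nat -> R) (n : nat) :
  Rsum (fun i => k * a i) n = k * Rsum a n.
Proof. induction n; simpl. ring. rewrite IHn; ring. Qed.

Lemma Rsum_plus (a b : nat -> R) (n : nat) :
  Rsum (fun i => a i + b i) n = Rsum a n + Rsum b n.
Proof. induction n; simpl. ring. rewrite IHn; ring. Qed.

Lemma Rsum_const (k : R) (n : nat) : Rsum (fun _ => k) n = INR n * k.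
Proof.
  induction n. simpl; ring.
  change (Rsum (fun _ => k) (S n)) with (Rsum (fun _ => k) n + k). rewrite IHn, S_INR; ring.
Qed.

Lemma Rsum_S (a : nat -> R) (n : nat) :
  Rsum a (S n) = a O + Rsum (fun k => a (S k)) n.
Proof.
  induction n. simpl; ring.
  change (Rsum a (S (S n))) with (Rsum a (S n) + a (S n)). rewrite IHn. simpl; ring.
Qed.

Lemma Rsum_le (a b : nat -> R) (n : nat) :
  (forall k, (k < n)%nat -> a k <= b k) -> Rsum a n <= Rsum b n.
Proof.
  induction n; simpl; intros H. lra.
  apply Rplus_le_compat; auto.
Qed.

Lemma Rsum_nonneg (a : nat -> R) (n : nat) :
  (forall k, (k < n)%nat -> 0 <= a k) -> 0 <= Rsum a n.
Proof.
  induction n; simpl; intros H. lra.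
  apply Rplus_le_le_0_compat; auto.
Qed.

Lemma Rsum_mono (a : nat -> R) (n m : nat) :
  (forall k, 0 <= a k) -> (n <= m)%nat -> Rsum a n <= Rsum a m.
Proof.
  intros H L. induction L; simpl. lra. specialize (H m); lra.
Qed.

Lemma RtoC_Rsum (a : nat -> R) (n : nat) :
  RtoC (Rsum a n) = Csum (fun k => RtoC (a k)) n.
Proof. induction n; simpl; auto. now rewrite RtoC_plus, IHn. Qed.

Lemma Rsum_sum_n (a : nat -> R) (n : nat) : Rsum a (S n) = sum_n a n.
Proof.
  induction n. simpl. rewrite sum_O. ring.
  rewrite sum_Sn, <- IHn. reflexivity.
Qed.

(** * Convergent real and complex series *)

Lemma rsum_is_series (a : nat -> R) (l : R) : rsum a l <-> is_series a l.
Proof.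
  unfold rsum. rewrite is_lim_seq_incr_1. split; intros H.
  - apply (is_lim_seq_ext _ (sum_n a)) in H. exact H. intro n; apply Rsum_sum_n.
  - apply (is_lim_seq_ext (sum_n a)). intro n; symmetry; apply Rsum_sum_n. exact H.
Qed.

Lemma rsum_cvg (a : nat -> R) (l : R) : rsum a l <-> csum (fun k => RtoC (a k)) (RtoC l).
Proof.
  unfold rsum, csum, cvg.
  assert (E : forall n, Cmod (Csum (fun k => RtoC (a k)) n - RtoC l) = Rabs (Rsum a n - l)).
  { intro n. now rewrite <- RtoC_Rsum, <- RtoC_minus, Cmod_R. }
  split; intros H.
  - apply is_lim_seq_ext with (fun n => Rabs (Rsum a n - l)). intro; now rewrite E.
    apply -> is_lim_seq_abs_0.
    replace (Finite 0) with (Finite (l - l)) by (f_equal; ring).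
    apply is_lim_seq_minus'; auto. apply is_lim_seq_const.
  - apply is_lim_seq_ext with (fun n => (Rsum a n - l) + l). intro; ring.
    replace (Finite l) with (Finite (0 + l)) by (f_equal; ring).
    apply is_lim_seq_plus'. 2: apply is_lim_seq_const.
    apply <- is_lim_seq_abs_0. apply is_lim_seq_ext with (2 := H). exact E.
Qed.

Lemma rsum_ext (a b : nat -> R) (l : R) : (forall n, a n = b n) -> rsum a l -> rsum b l.
Proof.
  intros H. apply is_lim_seq_ext. intro n. apply Rsum_ext; auto.
Qed.

Lemma rsum_scal (k : R) (a : nat -> R) (l : R) :
  rsum a l -> rsum (fun n => k * a n) (k * l).
Proof.
  intros H. apply is_lim_seq_ext with (fun n => k * Rsum a n). intro; now rewrite Rsum_scal.
  apply (is_lim_seq_scal_l _ k l H).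
Qed.

Lemma rsum_partial_le (a : nat -> R) (l : R) (n : nat) :
  (forall k, 0 <= a k) -> rsum a l -> Rsum a n <= l.
Proof.
  intros Ha H.
  apply (is_lim_seq_incr_compare (Rsum a)); auto. intro m; simpl; specialize (Ha m); lra.
Qed.

Lemma rsum_nonneg (a : nat -> R) (l : R) : (forall n, 0 <= a n) -> rsum a l -> 0 <= l.
Proof. intros Ha H. apply (rsum_partial_le a l O) in H; auto. Qed.

Lemma rsum_tail_lim (a : nat -> R) (l : R) : rsum a l -> is_lim_seq (fun n => l - Rsum a n) 0.
Proof.
  intros H. replace (Finite 0) with (Finite (l - l)) by (f_equal; ring).
  apply is_lim_seq_minus'; auto. apply is_lim_seq_const.
Qed.

Lemma rsum_ex_le (a b : nat -> R) (m : R) :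
  (forall n, 0 <= a n <= b n) -> rsum b m -> exists l, rsum a l.
Proof.
  intros H Hb.
  destruct (ex_finite_lim_seq_incr (Rsum a) m) as [l Hl].
  - intro n; simpl; specialize (H n); lra.
  - intro n. eapply Rle_trans. 2: apply (rsum_partial_le b m n); auto.
    apply Rsum_le; intros; apply H. intro k; specialize (H k); lra.
  - now exists l.
Qed.

Lemma csum_ext (a b : nat -> C) (l : C) : (forall n, a n = b n) -> csum a l -> csum b l.
Proof. intros H. apply cvg_ext. intro n; apply Csum_ext; auto. Qed.

Lemma csum_unique (a : nat -> C) (l m : C) : csum a l -> csum a m -> l = m.
Proof. apply cvg_unique. Qed.

Lemma csum_plus (a b : nat -> C) (l m : C) :
  csum a l -> csum b m -> csum (fun n => a n + b n)%C (l + m)%C.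
Proof.
  intros Ha Hb. apply cvg_ext with (fun n => Csum a n + Csum b n)%C.
  intro; now rewrite Csum_plus. now apply cvg_plus.
Qed.

Lemma csum_minus (a b : nat -> C) (l m : C) :
  csum a l -> csum b m -> csum (fun n => a n - b n)%C (l - m)%C.
Proof.
  intros Ha Hb. apply cvg_ext with (fun n => Csum a n - Csum b n)%C.
  intro; now rewrite Csum_minus. now apply cvg_minus.
Qed.

Lemma csum_scal (k : C) (a : nat -> C) (l : C) :
  csum a l -> csum (fun n => k * a n)%C (k * l)%C.
Proof.
  intros Ha. apply cvg_ext with (fun n => k * Csum a n)%C.
  intro; now rewrite Csum_scal. now apply cvg_scal.
Qed.

Lemma csum_incr (a : nat -> C) (l : C) :
  csum (fun n => a (S n)) l <-> csum a (a O + l)%C.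
Proof.
  unfold csum. rewrite <- (cvg_incr (Csum a)). split; intros H.
  - apply cvg_ext with (fun n => a O + Csum (fun k => a (S k)) n)%C.
    intro n; now rewrite Csum_S. apply cvg_plus; auto. apply cvg_const.
  - replace l with ((a O + l) - a O)%C by ring.
    apply cvg_ext with (fun n => Csum a (S n) - a O)%C.
    intro n; rewrite Csum_S; ring. apply cvg_minus; auto. apply cvg_const.
Qed.

Lemma csum_fin (a : nat -> C) (N : nat) :
  (forall n, (N <= n)%nat -> a n = 0) -> csum a (Csum a N).
Proof.
  intros H. unfold csum, cvg.
  apply is_lim_seq_ext_loc with (fun _ => 0). 2: apply is_lim_seq_const.
  exists N. intros n Hn. replace n with (N + (n - N))%nat by lia.
  rewrite Csum_add, (Csum_ext (fun k => a (N + k)%nat) (fun _ => RtoC 0)).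
  rewrite Csum_const. replace (_ - _)%C with (RtoC 0) by ring. now rewrite Cmod_0.
  intros k _. apply H; lia.
Qed.

Lemma csum_norm_le (a : nat -> C) (b : nat -> R) (l : C) (m : R) :
  (forall n, Cmod (a n) <= b n) -> csum a l -> rsum b m -> Cmod l <= m.
Proof.
  intros H Ha Hb. apply (cvg_norm_le0 (Csum a)); auto. intro n.
  eapply Rle_trans. apply Csum_norm. intros; apply H.
  apply rsum_partial_le; auto. intro k. eapply Rle_trans. apply Cmod_ge_0. apply H.
Qed.

(** The bound depends on the majorant alone, hence is uniform over all series below it; [csum_swap]
    and [lambert_tail] rely on this uniformity. *)
Lemma csum_tail_le (a : nat -> C) (b : nat -> R) (l : C) (m : R) (N : nat) :
  (forall n, Cmod (a n) <= b n) -> csum a l -> rsum b m ->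
  Cmod (l - Csum a N) <= m - Rsum b N.
Proof.
  intros H Ha Hb. apply (cvg_norm_le (Csum a)); auto. exists N. intros n Hn.
  replace n with (N + (n - N))%nat by lia. rewrite Csum_add.
  replace (_ - _)%C with (Csum (fun k => a (N + k)%nat) (n - N)) by ring.
  eapply Rle_trans. apply Csum_norm. intros; apply H.
  assert (Hb0 : forall k, 0 <= b k) by (intro k; eapply Rle_trans; [apply Cmod_ge_0 | apply H]).
  assert (L := rsum_partial_le b m (N + (n - N)) Hb0 Hb).
  assert (E : Rsum b (N + (n - N)) = Rsum b N + Rsum (fun k => b (N + k)%nat) (n - N)).
  { generalize (n - N)%nat as p. induction p. rewrite Nat.add_0_r; simpl; ring.
    rewrite Nat.add_succ_r; simpl. rewrite IHp; ring. }
  lra.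
Qed.

Lemma csum_ex (a : nat -> C) (b : nat -> R) (m : R) :
  (forall n, Cmod (a n) <= b n) -> rsum b m -> exists l, csum a l.
Proof.
  intros H Hb. rewrite rsum_is_series in Hb.
  assert (Hre : ex_series (fun n => Re (a n))).
  { apply (ex_series_le (K := R_AbsRing) (V := R_CompleteNormedModule) _ b). 2: now exists m.
    intro n. eapply Rle_trans. 2: apply H. eapply Rle_trans. 2: apply Rmax_Cmod. apply Rmax_l. }
  assert (Him : ex_series (fun n => Im (a n))).
  { apply (ex_series_le (K := R_AbsRing) (V := R_CompleteNormedModule) _ b). 2: now exists m.
    intro n. eapply Rle_trans. 2: apply H. eapply Rle_trans. 2: apply Rmax_Cmod. apply Rmax_r. }
  destruct Hre as [x Hx]. destruct Him as [y Hy].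
  apply rsum_is_series, rsum_cvg in Hx. apply rsum_is_series, rsum_cvg in Hy.
  exists (x + Ci * y)%C.
  apply csum_ext with (fun n => RtoC (Re (a n)) + Ci * RtoC (Im (a n)))%C.
  - intro n. destruct (a n) as [u v]. unfold Ci, RtoC, Cplus, Cmult; simpl. f_equal; ring.
  - apply csum_plus; auto. now apply csum_scal.
Qed.

Lemma csum_term0 (a : nat -> C) (l : C) : csum a l -> cvg a 0.
Proof.
  intros H. replace (RtoC 0) with (l - l)%C by ring.
  apply cvg_ext with (fun n => Csum a (S n) - Csum a n)%C. intro n; simpl; ring.
  apply cvg_minus; auto. now apply cvg_incr.
Qed.

Lemma csum_telescope (v : nat -> C) (l : C) :
  cvg v l -> csum (fun n => v n - v (S n))%C (v O - l)%C.
Proof.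
  intros H. apply cvg_ext with (fun n => v O - v n)%C.
  - induction n; simpl. ring. rewrite <- IHn; ring.
  - apply cvg_minus; auto. apply cvg_const.
Qed.

Lemma Rsum_geom (r : R) (n : nat) : (1 - r) * Rsum (fun k => r ^ k) n = 1 - r ^ n.
Proof. induction n; simpl. ring. rewrite Rmult_plus_distr_l, IHn; ring. Qed.

Lemma rsum_geom (r : R) : 0 <= r < 1 -> rsum (fun n => r ^ n) (/ (1 - r)).
Proof.
  intros H. apply rsum_is_series. apply is_series_geom. rewrite Rabs_pos_eq; lra.
Qed.

Lemma is_lim_seq_pow0 (r : R) : 0 <= r < 1 -> is_lim_seq (fun n => r ^ n) 0.
Proof. intros H. apply is_lim_seq_geom. rewrite Rabs_pos_eq; lra. Qed.

Lemma csum_geom (q : C) : Cmod q < 1 -> csum (fun n => q ^ n)%C (/ (1 - q))%C.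
Proof.
  intros H.
  assert (Hq : (1 - q)%C <> 0).
  { intro E. assert (q = 1) by (replace q with (1 - (1 - q))%C by ring; rewrite E; ring).
    subst q. rewrite Cmod_1 in H; lra. }
  assert (E : forall n, Csum (fun n => q ^ n)%C n = ((1 - q ^ n) / (1 - q))%C).
  { induction n. simpl. field; auto. cbn [Csum]. rewrite IHn, Cpow_S. field; auto. }
  apply cvg_bound with (fun n => / Cmod (1 - q) * Cmod q ^ n).
  - intro n. rewrite E. replace (_ - _)%C with (- (q ^ n) / (1 - q))%C by (field; auto).
    rewrite Cmod_div, Cmod_opp, Cmod_pow by auto. right. unfold Rdiv; ring.
  - apply is_lim_seq_scal0, is_lim_seq_pow0. split; auto. apply Cmod_ge_0.
Qed.

(** Fubini with a product majorant. After [J] columns, row [m] has a remainder of at most [x m]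
    times the tail of [y], so the total defect is at most [X * (Y - Rsum y J)], which tends to 0. *)
Lemma csum_swap (a : nat -> nat -> C) (x y : nat -> R) (X Y : R) (r c : nat -> C) (L : C) :
  (forall m j, Cmod (a m j) <= x m * y j) -> (forall m, 0 <= x m) -> (forall j, 0 <= y j) ->
  rsum x X -> rsum y Y ->
  (forall m, csum (a m) (r m)) -> (forall j, csum (fun m => a m j) (c j)) ->
  csum r L -> csum c L.
Proof.
  intros H Hx0 Hy0 HX HY Hr Hc HL.
  apply cvg_bound with (fun J => X * (Y - Rsum y J)).
  2: apply is_lim_seq_scal0, rsum_tail_lim; auto.
  intro J.
  assert (HJ : csum (fun m => Csum (a m) J) (Csum c J)).
  { clear -Hc. induction J; simpl.
    - replace (RtoC 0) with (Csum (fun _ => RtoC 0) 0) by reflexivity.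
      apply csum_fin; auto.
    - apply csum_plus; auto. }
  assert (Hd : csum (fun m => r m - Csum (a m) J)%C (L - Csum c J)%C) by now apply csum_minus.
  rewrite <- Cmod_opp. replace (- (Csum c J - L))%C with (L - Csum c J)%C by ring.
  rewrite Rmult_comm.
  apply (csum_norm_le _ (fun m => (Y - Rsum y J) * x m) _ _) with (2 := Hd).
  - intro m. replace ((Y - Rsum y J) * x m) with (x m * Y - Rsum (fun j => x m * y j) J)
      by (rewrite Rsum_scal; ring).
    apply (csum_tail_le (a m)); auto. now apply rsum_scal.
  - now apply rsum_scal.
Qed.

(** Padding with zeros only repeats partial sums. This serves to separate even exponents in
    [power_sum_dup] and to sort a double series by divisors in [divisor_series]. *)
Lemma csum_multiples (d : nat) (b : nat -> C) (l : C) :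
  (0 < d)%nat -> csum b l ->
  csum (fun n => if Nat.eqb (n mod d) 0 then b (n / d)%nat else 0) l.
Proof.
  intros Hd Hb.
  set (a := fun n => if Nat.eqb (n mod d) 0 then b (n / d)%nat else RtoC 0).
  (* The case [k = d] is included because it is the start of the next block, which is what the
     induction on [m] needs. *)
  assert (E : forall m k, (k <= d)%nat ->
     Csum a (d * m + k) = if Nat.eqb k 0 then Csum b m else Csum b (S m)).
  { assert (Z : forall m k, (k < d)%nat -> a (d * m + k)%nat = if Nat.eqb k 0 then b m else 0).
    { intros m k Hk. unfold a. rewrite Nat.add_comm, Nat.mul_comm, Nat.Div0.mod_add, Nat.mod_small by auto.
      destruct (Nat.eqb k 0) eqn:Ek; auto.
      rewrite Nat.div_add, Nat.div_small by lia. auto. }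
    induction m.
    - induction k; intros Hk.
      + rewrite Nat.mul_0_r; reflexivity.
      + rewrite Nat.add_succ_r. cbn [Csum]. rewrite IHk, Z by lia.
        destruct k; simpl; ring.
    - induction k; intros Hk.
      + replace (d * S m + 0)%nat with (d * m + d)%nat by lia. rewrite IHm by auto.
        destruct d; [lia | reflexivity].
      + rewrite Nat.add_succ_r. cbn [Csum]. rewrite IHk, Z by lia.
        destruct k; simpl; ring. }
  apply cvg_ext with (fun n => Csum b (if Nat.eqb (n mod d) 0 then n / d else S (n / d))).
  - intro n. rewrite (Nat.div_mod n d) at 4 by lia. fold a. rewrite E.
    destruct (Nat.eqb (n mod d) 0); auto.
    assert (n mod d < d)%nat by (apply Nat.mod_upper_bound; lia). lia.
  - apply (cvg_comp (Csum b) l); auto.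
    intros P [N HN]. exists (d * N)%nat. intros n Hn. apply HN.
    assert (N <= n / d)%nat by (apply Nat.div_le_lower_bound; lia).
    destruct (Nat.eqb (n mod d) 0); lia.
Qed.

(** * Agreement with the limits and series of the definitions *)

Lemma cvg_filterlim (u : nat -> C) (l : C) :
  cvg u l <-> filterlim u eventually (@locally C_UniformSpace l).
Proof.
  unfold cvg. rewrite <- is_lim_seq_spec.
  etransitivity.
  2: { symmetry. apply (filterlim_locally_ball_norm (K := C_AbsRing) (U := C_NormedModule) u l). }
  unfold ball_norm. split; intros H eps; destruct (H eps) as [N HN]; exists N; intros n Hn;
    specialize (HN n Hn).
  - rewrite Rminus_0_r, Rabs_pos_eq in HN by apply Cmod_ge_0. exact HN.
  - rewrite Rminus_0_r, Rabs_pos_eq by apply Cmod_ge_0. exact HN.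
Qed.

Lemma Csum_sum_n (a : nat -> C) (n : nat) : Csum a (S n) = sum_n a n.
Proof.
  induction n. simpl. rewrite sum_O. apply Cplus_0_l.
  rewrite sum_Sn, <- IHn. reflexivity.
Qed.

Lemma csum_is_series (a : nat -> C) (l : C) : csum a l <-> is_series a l.
Proof.
  unfold csum. rewrite <- cvg_incr, cvg_filterlim. unfold is_series.
  split; apply filterlim_ext; intro n; [|symmetry]; apply Csum_sum_n.
Qed.

Lemma CSeries_csum (a : nat -> C) (l : C) : csum a l -> CSeries a = l.
Proof.
  intros H. unfold CSeries.
  assert (E := iota_correct (V := C_CompleteNormedModule) (fun l : C => is_series a l)).
  apply csum_is_series in H.
  assert (H2 : is_series a (@iota C_CompleteNormedModule (fun l : C => is_series a l))).
  { apply E. exists l. split; auto. intros m Hm. apply csum_is_series in H, Hm.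
    now apply (csum_unique a). }
  apply csum_is_series in H, H2. now apply (csum_unique a).
Qed.

Lemma CLim_seq_cvg (u : nat -> C) (l : C) : cvg u l -> CLim_seq u = l.
Proof.
  intros H. unfold CLim_seq.
  assert (E := iota_correct (V := C_CompleteNormedModule) (fun l : C => filterlim u eventually (locally l))).
  assert (H2 : filterlim u eventually
     (@locally C_UniformSpace (@iota C_CompleteNormedModule (fun l : C => filterlim u eventually (locally l))))).
  { apply E. exists l. apply cvg_filterlim in H. split; auto. intros m Hm. apply cvg_filterlim in H, Hm.
    now apply (cvg_unique u). }
  apply cvg_filterlim in H2. now apply (cvg_unique u).
Qed.

(** * The complex exponential *)

Definition Cexp (z : C) : C := (exp (Re z) * cos (Im z), exp (Re z) * sin (Im z)).

Lemma C_ext (z w : C) : Re z = Re w -> Im z = Im w -> z = w.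
Proof. destruct z, w; simpl; now intros -> ->. Qed.

Ltac csimpl := unfold Cexp, RtoC, Re, Im in *; simpl in *.

Lemma Cexp_plus (z w : C) : Cexp (z + w) = (Cexp z * Cexp w)%C.
Proof.
  apply C_ext; csimpl; rewrite exp_plus.
  - rewrite cos_plus; ring.
  - rewrite sin_plus; ring.
Qed.

Lemma Cexp_RtoC (x : R) : Cexp x = exp x.
Proof. apply C_ext; csimpl; [rewrite cos_0 | rewrite sin_0]; ring. Qed.

Lemma Cexp_0 : Cexp 0 = 1.
Proof. now rewrite Cexp_RtoC, exp_0. Qed.

Lemma Cexp_opp_l (z : C) : (Cexp (- z) * Cexp z)%C = 1.
Proof. rewrite <- Cexp_plus. replace (- z + z)%C with (RtoC 0) by ring. apply Cexp_0. Qed.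

Lemma Cexp_nz (z : C) : Cexp z <> 0.
Proof.
  intro E. generalize (Cexp_opp_l z). rewrite E, Cmult_0_r. intro H.
  apply RtoC_inj in H; lra.
Qed.

Lemma Cexp_opp (z : C) : Cexp (- z) = (/ Cexp z)%C.
Proof.
  assert (H := Cexp_nz z). rewrite <- (Cmult_1_r (Cexp (- z))), <- (Cinv_r (Cexp z)) by auto.
  rewrite Cmult_assoc, Cexp_opp_l; ring.
Qed.

Lemma Cmod_Cexp (z : C) : Cmod (Cexp z) = exp (Re z).
Proof.
  unfold Cmod; csimpl.
  match goal with |- sqrt ?u = _ =>
    replace u with (exp (fst z) * exp (fst z) * (Rsqr (sin (snd z)) + Rsqr (cos (snd z))))
      by (unfold Rsqr; ring) end.
  rewrite sin2_cos2, Rmult_1_r. apply sqrt_square. left; apply exp_pos.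
Qed.

Lemma Cexp_pow (z : C) (n : nat) : (Cexp z ^ n)%C = Cexp (INR n * z).
Proof.
  induction n.
  - simpl. replace (0 * z)%C with (RtoC 0) by ring. now rewrite Cexp_0.
  - rewrite Cpow_S, IHn, <- Cexp_plus, S_INR, RtoC_plus. f_equal. ring.
Qed.

(** * Derivatives of complex-valued functions of a real variable *)

Definition cder (f : R -> C) (t : R) (l : C) : Prop :=
  is_derive (fun x => Re (f x)) t (Re l) /\ is_derive (fun x => Im (f x)) t (Im l).

Lemma cder_ext (f g : R -> C) (t : R) (l m : C) :
  (forall x, f x = g x) -> l = m -> cder f t l -> cder g t m.
Proof.
  intros H <- [H1 H2]. split; eapply is_derive_ext; try eassumption; intro x; simpl; now rewrite H.
Qed.

Lemma cder_const (z : C) (t : R) : cder (fun _ => z) t 0.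
Proof.
  split; [change (is_derive (fun _ : R => Re z) t 0) | change (is_derive (fun _ : R => Im z) t 0)];
  apply (is_derive_const (K := R_AbsRing) (V := R_NormedModule)).
Qed.

Lemma cder_RtoC (t : R) : cder RtoC t 1.
Proof.
  split; [change (is_derive (fun x : R => x) t 1) | change (is_derive (fun _ : R => 0) t 0)].
  apply (is_derive_id (K := R_AbsRing)).
  apply (is_derive_const (K := R_AbsRing) (V := R_NormedModule)).
Qed.

Lemma cder_plus (f g : R -> C) (t : R) (l m : C) :
  cder f t l -> cder g t m -> cder (fun x => f x + g x)%C t (l + m)%C.
Proof.
  intros [H1 H2] [H3 H4].
  split; [change (is_derive (fun x => Re (f x) + Re (g x)) t (Re l + Re m))
         | change (is_derive (fun x => Im (f x) + Im (g x)) t (Im l + Im m))];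
  now apply (is_derive_plus (K := R_AbsRing) (V := R_NormedModule)).
Qed.

Lemma is_derive_lin_mult (f g h k : R -> R) (t f' g' h' k' : R) (e : R) :
  is_derive f t f' -> is_derive g t g' -> is_derive h t h' -> is_derive k t k' ->
  is_derive (fun x => f x * g x + e * (h x * k x)) t
    (f' * g t + f t * g' + e * (h' * k t + h t * k')).
Proof.
  intros Hf Hg Hh Hk.
  apply (is_derive_plus (K := R_AbsRing) (V := R_NormedModule) (fun x => f x * g x)).
  - apply is_derive_Reals, derivable_pt_lim_mult; now apply is_derive_Reals.
  - apply is_derive_scal, is_derive_Reals, derivable_pt_lim_mult; now apply is_derive_Reals.
Qed.

Lemma cder_mult (f g : R -> C) (t : R) (l m : C) :
  cder f t l -> cder g t m -> cder (fun x => f x * g x)%C t (l * g t + f t * m)%C.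
Proof.
  intros [H1 H2] [H3 H4]. split.
  - apply is_derive_ext with (fun x => Re (f x) * Re (g x) + (-1) * (Im (f x) * Im (g x))).
    intro x; csimpl; ring.
    replace (Re _) with (Re l * Re (g t) + Re (f t) * Re m +
        (-1) * (Im l * Im (g t) + Im (f t) * Im m)) by (csimpl; ring).
    now apply is_derive_lin_mult.
  - apply is_derive_ext with (fun x => Re (f x) * Im (g x) + 1 * (Im (f x) * Re (g x))).
    intro x; csimpl; ring.
    replace (Im _) with (Re l * Im (g t) + Re (f t) * Im m +
        1 * (Im l * Re (g t) + Im (f t) * Re m)) by (csimpl; ring).
    now apply is_derive_lin_mult.
Qed.

Lemma cder_scal (k : C) (f : R -> C) (t : R) (l : C) :
  cder f t l -> cder (fun x => k * f x)%C t (k * l)%C.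
Proof.
  intros H. eapply cder_ext. 3: apply (cder_mult (fun _ => k) f); [apply cder_const | apply H].
  reflexivity. simpl; ring.
Qed.

Lemma cder_pow (f : R -> C) (t : R) (l : C) (n : nat) :
  cder f t l -> cder (fun x => f x ^ S n)%C t (INR (S n) * f t ^ n * l)%C.
Proof.
  intros H. induction n.
  - eapply cder_ext. 3: apply H. intro x; csimpl; ring. simpl; ring.
  - eapply cder_ext. 3: apply (cder_mult _ _ _ _ _ H IHn). reflexivity.
    rewrite (S_INR (S n)), RtoC_plus, !Cpow_S. ring.
Qed.

Lemma cder_inv (f : R -> C) (t : R) (l : C) :
  f t <> 0 -> cder f t l -> cder (fun x => / f x)%C t (- l / (f t * f t))%C.
Proof.
  intros Hf [H1 H2].
  assert (Hn : Re (f t) * Re (f t) + Im (f t) * Im (f t) <> 0).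
  { intro E. apply Hf. apply C_ext; csimpl; nra. }
  assert (H1' : derivable_pt_lim (fun x => Re (f x)) t (Re l)) by now apply is_derive_Reals.
  assert (H2' : derivable_pt_lim (fun x => Im (f x)) t (Im l)) by now apply is_derive_Reals.
  set (N := fun x => Re (f x) * Re (f x) + Im (f x) * Im (f x)).
  assert (HN : derivable_pt_lim N t (Re l * Re (f t) + Re (f t) * Re l
              + (Im l * Im (f t) + Im (f t) * Im l))).
  { apply derivable_pt_lim_plus; now apply derivable_pt_lim_mult. }
  assert (Hn' : N t <> 0) by exact Hn.
  set (a := Re (f t)) in *. set (b := Im (f t)) in *.
  assert (EN : N t = a * a + b * b) by reflexivity.
  assert (Ef : f t = (a, b)) by (apply C_ext; reflexivity).
  assert (Hz : a * a + b * b <> 0) by now rewrite <- EN.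
  assert (Hz2 : (a * a - b * b) * (a * a - b * b) + (2 * a * b) * (2 * a * b) <> 0).
  { intro E. apply (Rmult_integral_contrapositive _ _ (conj Hz Hz)). rewrite <- E; ring. }
  split.
  - apply is_derive_ext with (fun x => Re (f x) / N x).
    { intro x; unfold N, Re, Im, Cinv; simpl. unfold Rdiv; f_equal; f_equal; ring. }
    apply is_derive_Reals.
    replace (Re _) with ((Re l * N t - (Re l * a + a * Re l + (Im l * b + b * Im l)) * a) / Rsqr (N t)).
    apply (derivable_pt_lim_div (fun x => Re (f x)) N); auto.
    rewrite EN, Ef. destruct l as [u v]. unfold Rsqr, Re, Im; simpl. field. split.
    + intro E; apply Hz2. rewrite <- E. ring.
    + auto.
  - apply is_derive_ext with (fun x => (- Im (f x)) / N x).
    { intro x; unfold N, Re, Im, Cinv; simpl. unfold Rdiv; f_equal; f_equal; ring. }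
    apply is_derive_Reals.
    replace (Im _) with (((- Im l) * N t - (Re l * a + a * Re l + (Im l * b + b * Im l)) * (- b)) / Rsqr (N t)).
    apply (derivable_pt_lim_div (fun x => - Im (f x)) N); auto.
    now apply derivable_pt_lim_opp.
    rewrite EN, Ef. destruct l as [u v]. unfold Rsqr, Re, Im; simpl. field. split.
    + intro E; apply Hz2. rewrite <- E. ring.
    + auto.
Qed.

Lemma cder_Cexp (f : R -> C) (t : R) (l : C) :
  cder f t l -> cder (fun x => Cexp (f x)) t (l * Cexp (f t))%C.
Proof.
  intros [H1 H2].
  assert (He : is_derive (fun x => exp (Re (f x))) t (Re l * exp (Re (f t)))).
  { apply (is_derive_comp exp (fun x => Re (f x))); auto. apply is_derive_Reals, derivable_pt_lim_exp. }
  assert (Hc : is_derive (fun x => cos (Im (f x))) t (Im l * - sin (Im (f t)))).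
  { apply (is_derive_comp cos (fun x => Im (f x))); auto. apply is_derive_Reals, derivable_pt_lim_cos. }
  assert (Hs : is_derive (fun x => sin (Im (f x))) t (Im l * cos (Im (f t)))).
  { apply (is_derive_comp sin (fun x => Im (f x))); auto. apply is_derive_Reals, derivable_pt_lim_sin. }
  split; apply is_derive_Reals.
  - replace (Re _) with (Re l * exp (Re (f t)) * cos (Im (f t)) + exp (Re (f t)) * (Im l * - sin (Im (f t))))
      by (csimpl; ring).
    apply (derivable_pt_lim_mult (fun x => exp (Re (f x))) (fun x => cos (Im (f x)))); now apply is_derive_Reals.
  - replace (Im _) with (Re l * exp (Re (f t)) * sin (Im (f t)) + exp (Re (f t)) * (Im l * cos (Im (f t))))
      by (csimpl; ring).
    apply (derivable_pt_lim_mult (fun x => exp (Re (f x))) (fun x => sin (Im (f x)))); now apply is_derive_Reals.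
Qed.

Lemma Cmod_le_abs (z : C) : Cmod z <= Rabs (Re z) + Rabs (Im z).
Proof.
  replace z with (RtoC (Re z) + Ci * RtoC (Im z))%C at 1.
  2: apply C_ext; csimpl; ring.
  eapply Rle_trans. apply Cmod_triangle. rewrite Cmod_mult, !Cmod_R.
  replace (Cmod Ci) with 1. lra.
  unfold Cmod, Ci; simpl. replace (_ + _) with 1 by ring. now rewrite sqrt_1.
Qed.

Lemma Re_le_Cmod (z : C) : Rabs (Re z) <= Cmod z.
Proof. eapply Rle_trans. 2: apply Rmax_Cmod. apply Rmax_l. Qed.

Lemma Im_le_Cmod (z : C) : Rabs (Im z) <= Cmod z.
Proof. eapply Rle_trans. 2: apply Rmax_Cmod. apply Rmax_r. Qed.

(** The mean value theorem is applied to the real and the imaginary part separately, at different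
    intermediate points; adding the two bounds costs the factor 2. *)
Lemma cder_mean_value (f f' : R -> C) (K : R) :
  (forall t, 0 <= t <= 1 -> cder f t (f' t) /\ Cmod (f' t) <= K) ->
  Cmod (f 1 - f 0) <= 2 * K.
Proof.
  intros H.
  assert (P : forall p : C -> R, (forall z, Rabs (p z) <= Cmod z) ->
    (forall t, 0 <= t <= 1 -> is_derive (fun x => p (f x)) t (p (f' t))) ->
    Rabs (p (f 1) - p (f 0)) <= K).
  { intros p Hp Hd.
    destruct (MVT_gen (fun x => p (f x)) 0 1 (fun t => p (f' t))) as [c [Hc E]].
    - intros x Hx. rewrite Rmin_left, Rmax_right in Hx by lra. apply Hd; lra.
    - intros x Hx. rewrite Rmin_left, Rmax_right in Hx by lra.
      apply derivable_continuous_pt. exists (p (f' x)). apply is_derive_Reals, Hd; lra.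
    - rewrite Rmin_left, Rmax_right in Hc by lra. rewrite E.
      replace (p (f' c) * (1 - 0)) with (p (f' c)) by ring.
      eapply Rle_trans. apply Hp. now apply H. }
  eapply Rle_trans. apply Cmod_le_abs.
  replace (Re (f 1 - f 0)) with (Re (f 1) - Re (f 0)) by (csimpl; ring).
  replace (Im (f 1 - f 0)) with (Im (f 1) - Im (f 0)) by (csimpl; ring).
  assert (A := P Re Re_le_Cmod (fun t Ht => proj1 (proj1 (H t Ht)))).
  assert (B := P Im Im_le_Cmod (fun t Ht => proj2 (proj1 (H t Ht)))).
  lra.
Qed.

Lemma exp_mono (x y : R) : x <= y -> exp x <= exp y.
Proof. intros [H | ->]. left; now apply exp_increasing. apply Rle_refl. Qed.

Definition Cexp_poly (z : C) (n : nat) : C := Csum (fun k => z ^ k / INR (fact k))%C n.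

Lemma INR_fact_C_nz (k : nat) : RtoC (INR (fact k)) <> 0.
Proof. intro E. apply RtoC_inj in E. now apply (INR_fact_neq_0 k). Qed.

Lemma cder_Cexp_poly (z : C) (t : R) (n : nat) :
  cder (fun x => Cexp_poly (x * z) (S n)) t (z * Cexp_poly (t * z) n)%C.
Proof.
  unfold Cexp_poly. induction n.
  - eapply cder_ext. 3: apply (cder_const 1 t). intro x; simpl; field. simpl; ring.
  - cbn [Csum] in *.
    eapply cder_ext. 3: apply cder_plus; [apply IHn|].
    3: { apply (cder_scal (/ INR (fact (S n)))%C (fun x => (x * z) ^ S n)%C).
         apply (cder_pow (fun x => x * z)%C).
         apply (cder_ext (fun x => z * x)%C _ _ (z * 1)%C (z * 1)%C). intro; ring. reflexivity.
         apply cder_scal, cder_RtoC. }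
    intro x; simpl. unfold Cdiv. ring.
    cbn [Csum]. change (fact (S n)) with (S n * fact n)%nat. rewrite mult_INR, RtoC_mult.
    field. split. apply INR_fact_C_nz.
    intro E; apply RtoC_inj in E. apply (not_0_INR (S n)) in E; auto.
Qed.

(** The function $t\mapsto e^{-tz}P(tz)$, with $P$ the Taylor polynomial of degree $n$, has
    derivative $-z\,e^{-tz}(tz)^n/n!$ since all other terms telescope. It moves little between 0 and
    1, and multiplying by $e^z$ gives the claim. *)
Lemma Cexp_taylor (z : C) (n : nat) :
  Cmod (Cexp_poly z (S n) - Cexp z) <= 2 * exp (2 * Cmod z) * Cmod z ^ S n / INR (fact n).
Proof.
  set (g := fun t : R => (Cexp (t * - z) * Cexp_poly (t * z) (S n))%C).
  set (g' := fun t : R => (- z * Cexp (t * - z) * ((t * z) ^ n / INR (fact n)))%C).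
  assert (Hf : 0 < INR (fact n)) by apply INR_fact_lt_0.
  assert (H : Cmod (g 1 - g 0) <= 2 * (exp (Cmod z) * Cmod z ^ S n / INR (fact n))).
  { apply (cder_mean_value g g'). intros t Ht. split.
    - unfold g. eapply cder_ext. 3: apply cder_mult.
      3: { apply (cder_Cexp (fun t => t * - z)%C).
           apply (cder_ext (fun x => - z * x)%C _ _ (- z * 1)%C (- z * 1)%C). intro; ring. reflexivity.
           apply cder_scal, cder_RtoC. }
      3: apply cder_Cexp_poly.
      reflexivity. unfold g'. unfold Cexp_poly; cbn [Csum]. ring.
    - unfold g'. rewrite !Cmod_mult, Cmod_opp, Cmod_Cexp, Cmod_div, Cmod_pow, Cmod_mult by apply INR_fact_C_nz.
      rewrite !Cmod_R, (Rabs_pos_eq (INR _)), (Rabs_pos_eq t) by lra.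
      assert (E1 : exp (Re (t * - z)) <= exp (Cmod z)).
      { apply exp_mono. eapply Rle_trans. apply Rle_abs. eapply Rle_trans. apply Re_le_Cmod.
        rewrite Cmod_mult, Cmod_opp, Cmod_R, Rabs_pos_eq by lra.
        generalize (Cmod_ge_0 z); nra. }
      assert (E2 : (t * Cmod z) ^ n <= Cmod z ^ n).
      { apply pow_incr. generalize (Cmod_ge_0 z); nra. }
      assert (E3 : 0 <= (t * Cmod z) ^ n) by (apply pow_le; generalize (Cmod_ge_0 z); nra).
      replace (Cmod z * exp (Re (t * - z)) * ((t * Cmod z) ^ n / INR (fact n)))
        with ((Cmod z * / INR (fact n)) * (exp (Re (t * - z)) * (t * Cmod z) ^ n)) by (unfold Rdiv; ring).
      replace (exp (Cmod z) * Cmod z ^ S n / INR (fact n))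
        with ((Cmod z * / INR (fact n)) * (exp (Cmod z) * Cmod z ^ n)) by (simpl; unfold Rdiv; ring).
      apply Rmult_le_compat_l.
      + apply Rmult_le_pos. apply Cmod_ge_0. left; now apply Rinv_0_lt_compat.
      + apply Rmult_le_compat; auto. left; apply exp_pos. }
  assert (E0 : g 0 = 1).
  { unfold g. replace (0 * - z)%C with (RtoC 0) by ring. rewrite Cexp_0.
    replace (0 * z)%C with (RtoC 0) by ring. unfold Cexp_poly. rewrite Csum_S.
    rewrite (Csum_ext _ (fun _ => RtoC 0)), Csum_const. simpl. field.
    intros k _. simpl. field. apply (INR_fact_C_nz (S k)). }
  assert (E1 : (g 1 * Cexp z)%C = Cexp_poly z (S n)).
  { unfold g. replace (1 * - z)%C with (- z)%C by ring. replace (1 * z)%C with z by ring.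
    rewrite <- (Cmult_1_l (Cexp_poly z (S n))) at 2. rewrite <- (Cexp_opp_l z). ring. }
  rewrite <- E1. replace (g 1 * Cexp z - Cexp z)%C with ((g 1 - g 0) * Cexp z)%C by (rewrite E0; ring).
  rewrite Cmod_mult, Cmod_Cexp.
  assert (E2 : exp (Re z) <= exp (Cmod z)).
  { apply exp_mono. eapply Rle_trans. apply Rle_abs. apply Re_le_Cmod. }
  replace (2 * exp (2 * Cmod z) * Cmod z ^ S n / INR (fact n))
    with (2 * (exp (Cmod z) * Cmod z ^ S n / INR (fact n)) * exp (Cmod z)).
  - apply Rmult_le_compat; auto. apply Cmod_ge_0. left; apply exp_pos.
  - replace (2 * Cmod z) with (Cmod z + Cmod z) by ring. rewrite exp_plus. unfold Rdiv; ring.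
Qed.

Lemma Cexp_csum (z : C) : csum (fun k => z ^ k / INR (fact k))%C (Cexp z).
Proof.
  apply cvg_incr.
  apply cvg_bound with (fun n => (2 * exp (2 * Cmod z) * Cmod z) * (Cmod z ^ n / INR (fact n))).
  - intro n. eapply Rle_trans. apply (Cexp_taylor z n). right. simpl. unfold Rdiv; ring.
  - apply is_lim_seq_scal0.
    assert (H := exist_exp (Cmod z)). destruct H as [l Hl].
    apply is_lim_seq_ext with (fun n => / INR (fact n) * Cmod z ^ n). intro; unfold Rdiv; ring.
    apply ex_series_lim_0. exists l. apply is_series_Reals. exact Hl.
Qed.

Lemma Cexp_bound1 (z : C) : Cmod z <= 1 / 2 -> Cmod (Cexp z - 1) <= 6 * Cmod z.
Proof.
  intros H.
  assert (T := Cexp_taylor z 0). unfold Cexp_poly in T; simpl in T.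
  rewrite <- Cmod_opp. replace (- (Cexp z - 1))%C with (0 + 1 / 1 - Cexp z)%C
    by field.
  eapply Rle_trans. apply T. unfold Rdiv. rewrite Rinv_1, !Rmult_1_r.
  assert (E := exp_le_3). assert (exp (2 * Cmod z) <= exp 1) by (apply exp_mono; lra).
  generalize (Cmod_ge_0 z); nra.
Qed.

(** * Lattice sums *)

(** [Csh u = sinh (pi u) / pi] and [Cch u = cosh (pi u)]. *)
Definition Csh (u : C) : C := ((Cexp (PI * u) - Cexp (- (PI * u))) / (2 * PI))%C.
Definition Cch (u : C) : C := ((Cexp (PI * u) + Cexp (- (PI * u))) / 2)%C.

Lemma CPI_nz : RtoC PI <> 0.
Proof. intro E; apply RtoC_inj in E. generalize PI_RGT_0; lra. Qed.

Lemma C2_nz : RtoC 2 <> 0.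
Proof. intro E; apply RtoC_inj in E; lra. Qed.

Lemma RtoC_nz (x : R) : x <> 0 -> RtoC x <> 0.
Proof. intros H E; apply RtoC_inj in E; auto. Qed.

Lemma pow2_C_nz (n : nat) : RtoC (2 ^ n) <> 0.
Proof. apply RtoC_nz, pow_nonzero; lra. Qed.

Ltac cfield := field; repeat split; auto using CPI_nz, C2_nz, Ci_nz, pow2_C_nz, Cexp_nz.

Lemma Ci_sq : (Ci * Ci)%C = (- (1))%C.
Proof. apply C_ext; unfold Ci; csimpl; ring. Qed.

Lemma Cexp_iPI2 : Cexp (PI * (Ci / 2)) = Ci.
Proof.
  replace (PI * (Ci / 2))%C with (0, PI / 2).
  - unfold Cexp; csimpl. rewrite exp_0, cos_PI2, sin_PI2. unfold Ci. f_equal; ring.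
  - replace (PI * (Ci / 2))%C with (RtoC (PI / 2) * Ci)%C by (rewrite RtoC_div by lra; cfield).
    unfold Ci, RtoC, Cmult; simpl. f_equal; ring.
Qed.

Lemma Cexp_iPI2_opp : Cexp (- (PI * (Ci / 2))) = (- Ci)%C.
Proof.
  rewrite Cexp_opp, Cexp_iPI2.
  assert (Ci <> 0) by apply Ci_nz.
  replace (- Ci)%C with (- (Ci * Ci) * / Ci)%C by cfield. rewrite Ci_sq. cfield.
Qed.

Lemma Csh_plus (u v : C) : Csh (u + v) = (Csh u * Cch v + Cch u * Csh v)%C.
Proof.
  unfold Csh, Cch. replace (PI * (u + v))%C with (PI * u + PI * v)%C by ring.
  replace (- (PI * u + PI * v))%C with (- (PI * u) + - (PI * v))%C by ring.
  rewrite !Cexp_plus. cfield.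
Qed.

Lemma Cch_plus (u v : C) : Cch (u + v) = (Cch u * Cch v + PI * PI * (Csh u * Csh v))%C.
Proof.
  unfold Csh, Cch. replace (PI * (u + v))%C with (PI * u + PI * v)%C by ring.
  replace (- (PI * u + PI * v))%C with (- (PI * u) + - (PI * v))%C by ring.
  rewrite !Cexp_plus. cfield.
Qed.

Lemma Cch_sq (u : C) : (Cch u * Cch u)%C = (1 + PI * PI * (Csh u * Csh u))%C.
Proof.
  unfold Csh, Cch. rewrite Cexp_opp. cfield.
Qed.

Lemma Csh_half_i : Csh (Ci / 2) = (Ci / PI)%C.
Proof.
  unfold Csh. rewrite Cexp_iPI2_opp, Cexp_iPI2. cfield.
Qed.

Lemma Cch_half_i : Cch (Ci / 2) = 0.
Proof.
  unfold Cch. rewrite Cexp_iPI2_opp, Cexp_iPI2. cfield.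
Qed.

Lemma Csh_half (u : C) : Csh ((u + Ci) / 2) = (Ci / PI * Cch (u / 2))%C.
Proof.
  replace ((u + Ci) / 2)%C with (u / 2 + Ci / 2)%C by cfield.
  rewrite Csh_plus, Csh_half_i, Cch_half_i. ring.
Qed.

Lemma Cch_half (u : C) : Cch ((u + Ci) / 2) = (Ci * PI * Csh (u / 2))%C.
Proof.
  replace ((u + Ci) / 2)%C with (u / 2 + Ci / 2)%C by cfield.
  rewrite Cch_plus, Csh_half_i, Cch_half_i. cfield.
Qed.

Lemma Csh_double (u : C) : Csh u = (2 * (Csh (u / 2) * Cch (u / 2)))%C.
Proof.
  replace u with (u / 2 + u / 2)%C at 1 by cfield.
  rewrite Csh_plus. ring.
Qed.

Lemma Cch_double (u : C) :
  Cch u = (Cch (u / 2) * Cch (u / 2) + PI * PI * (Csh (u / 2) * Csh (u / 2)))%C.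
Proof.
  replace u with (u / 2 + u / 2)%C at 1 by cfield.
  now rewrite Cch_plus.
Qed.

Lemma Csh_i : Csh Ci = 0.
Proof.
  rewrite Csh_double. rewrite Cch_half_i. ring.
Qed.

Lemma Cch_i : Cch Ci = (- (1))%C.
Proof.
  rewrite Cch_double, Cch_half_i, Csh_half_i. 
  replace (PI * PI * (Ci / PI * (Ci / PI)))%C with (Ci * Ci)%C by cfield.
  rewrite Ci_sq; ring.
Qed.

Lemma Csh_plus_i (u : C) : Csh (u + Ci) = (- Csh u)%C.
Proof. rewrite Csh_plus, Csh_i, Cch_i; ring. Qed.

Lemma Cch_plus_i (u : C) : Cch (u + Ci) = (- Cch u)%C.
Proof. rewrite Cch_plus, Csh_i, Cch_i; ring. Qed.

Lemma Csh_minus_i (u : C) : Csh (u - Ci) = (- Csh u)%C.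
Proof. replace u with ((u - Ci) + Ci)%C at 2 by ring. rewrite Csh_plus_i; ring. Qed.

Lemma Cch_minus_i (u : C) : Cch (u - Ci) = (- Cch u)%C.
Proof. replace u with ((u - Ci) + Ci)%C at 2 by ring. rewrite Cch_plus_i; ring. Qed.

Lemma Copp_nz (z : C) : z <> 0 -> (- z)%C <> 0.
Proof. intros H E. apply H. replace z with (- - z)%C by ring. rewrite E; ring. Qed.

Lemma Cmult_nz_l (z w : C) : (z * w)%C <> 0 -> z <> 0.
Proof. intros H E; apply H; rewrite E; ring. Qed.

Lemma Cmult_nz_r (z w : C) : (z * w)%C <> 0 -> w <> 0.
Proof. intros H E; apply H; rewrite E; ring. Qed.

Lemma Csh_half_nz (u : C) : Csh u <> 0 -> Csh (u / 2) <> 0 /\ Cch (u / 2) <> 0.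
Proof.
  rewrite Csh_double. intros H. apply Cmult_nz_r in H. split.
  eapply Cmult_nz_l, H. eapply Cmult_nz_r, H.
Qed.

Lemma Csh_nz_shift (s : C) (j : nat) : Csh s <> 0 -> Csh (s + Ci * INR j) <> 0.
Proof.
  intros H. induction j.
  - replace (s + Ci * INR 0)%C with s by (simpl; ring). auto.
  - replace (s + Ci * INR (S j))%C with ((s + Ci * INR j) + Ci)%C by (rewrite S_INR, RtoC_plus; ring).
    rewrite Csh_plus_i. now apply Copp_nz.
Qed.

Lemma Csh_nz_pow2 (s : C) (n : nat) : Csh s <> 0 -> Csh (s / RtoC (2 ^ n)) <> 0.
Proof.
  intros H. induction n.
  - replace (s / RtoC (2 ^ 0))%C with s. auto. simpl. field.
  - apply Csh_half_nz in IHn. destruct IHn as [IH _].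
    replace (s / RtoC (2 ^ S n))%C with (s / RtoC (2 ^ n) / 2)%C. auto.
    simpl. rewrite RtoC_mult. cfield.
Qed.

Lemma Csh_nz_Re (s : C) : 0 < Re s -> Csh s <> 0.
Proof.
  intros H E. unfold Csh in E.
  assert (E2 : Cexp (PI * s) = Cexp (- (PI * s))).
  { replace (Cexp (PI * s)) with (Cexp (- (PI * s)) + (2 * PI) * ((Cexp (PI * s) - Cexp (- (PI * s))) / (2 * PI)))%C.
    rewrite E; ring. cfield. }
  apply (f_equal Cmod) in E2. rewrite !Cmod_Cexp in E2. apply exp_inv in E2.
  rewrite re_opp, re_scal_l in E2. generalize PI_RGT_0; nra.
Qed.

(** Splitting [j] by parity shows that $\sum_j (u+ij)^{-k}$ satisfies this relation. Iterating it
    writes [f] as a scaled sum over $2^J$ points close to the segment between 0 and $i$, where only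
    the behaviour at the pole matters; this is Herglotz's trick. *)
Definition dyadic_distribution (f : C -> C) (k : nat) : Prop :=
  forall u, Csh u <> 0 ->
    f u = ((f (u / 2) + f ((u + Ci) / 2)) / 2 ^ k)%C /\ f (u - Ci)%C = f u.

Lemma distribution_aux (f : C -> C) (k : nat) (s : C) (J : nat) :
  dyadic_distribution f k -> Csh s <> 0 ->
  f s = (Csum (fun j => f ((s + Ci * INR j) / RtoC (2 ^ J))) (2 ^ J) / RtoC (2 ^ J) ^ k)%C.
Proof.
  intros Hf Hs. induction J.
  - simpl. replace ((s + Ci * 0) / 1)%C with s by (field).
    rewrite Cpow_1_l. field.
  - rewrite IHJ.
    assert (E : (Csum (fun j => f ((s + Ci * INR j) / RtoC (2 ^ J))) (2 ^ J)
      = Csum (fun j => f ((s + Ci * INR j) / RtoC (2 ^ S J))) (2 ^ S J) / 2 ^ k)%C).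
    { transitivity (Csum (fun j => / 2 ^ k * (f ((s + Ci * INR j) / RtoC (2 ^ S J))
          + f ((s + Ci * INR (2 ^ J + j)) / RtoC (2 ^ S J))))%C (2 ^ J)).
      - apply Csum_ext. intros j _.
        assert (Hn := Csh_nz_pow2 _ J (Csh_nz_shift _ j Hs)).
        rewrite (proj1 (Hf _ Hn)).
        unfold Cdiv at 1. rewrite Cmult_comm. f_equal. f_equal; f_equal.
        + simpl. rewrite RtoC_mult. cfield.
        + rewrite plus_INR, pow_INR. change (INR 2) with (1 + 1). replace (1 + 1) with 2 by ring.
          simpl. rewrite RtoC_mult, RtoC_plus. cfield.
      - rewrite Csum_scal, Csum_plus.
        replace (2 ^ S J)%nat with (2 ^ J + 2 ^ J)%nat by (simpl; lia). rewrite Csum_add.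
        unfold Cdiv. ring. }
    rewrite E. simpl (2 ^ S J). rewrite RtoC_mult, Cpow_mult_l. 
    field. split; apply Cpow_nz. apply pow2_C_nz. apply C2_nz.
Qed.

(** The upper half of the translates is moved down by the period [Ci], so that every argument has
    imaginary part at most about $1/2$ and 0 is the only pole nearby. *)
Lemma distribution (f : C -> C) (k : nat) (s : C) (J : nat) :
  dyadic_distribution f k -> Csh s <> 0 ->
  f s = (Csum (fun j => f ((s + Ci * INR j) / RtoC (2 ^ S J)) + f ((s - Ci * INR (S j)) / RtoC (2 ^ S J))) (2 ^ J)
         / RtoC (2 ^ S J) ^ k)%C.
Proof.
  intros Hf Hs. rewrite (distribution_aux f k s (S J) Hf Hs) at 1. f_equal.
  replace (2 ^ S J)%nat with (2 ^ J + 2 ^ J)%nat by (simpl; lia).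
  rewrite Csum_add, Csum_plus. f_equal.
  rewrite (Csum_rev (fun j => f ((s - Ci * INR (S j)) / RtoC (2 ^ S J))%C)).
  apply Csum_ext. intros j Hj.
  assert (Hn := Csh_nz_pow2 _ (S J) (Csh_nz_shift _ (2 ^ J + j) Hs)).
  rewrite <- (proj2 (Hf _ Hn)). f_equal.
  replace (S (2 ^ J - 1 - j)) with (2 ^ J - j)%nat by lia.
  rewrite plus_INR, minus_INR, pow_INR by lia. change (INR 2) with (1 + 1). replace (1 + 1) with 2 by ring.
  simpl. rewrite RtoC_mult, RtoC_plus, RtoC_minus. cfield.
Qed.

(** There are $N/2$ pairs of terms for $N=2^{J+1}$, so an error $K/N^2$ per pair adds up to
    $O(1/N)$. *)
Lemma distribution_cvg (f : C -> C) (k : nat) (s : C) (K N0 : R) :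
  dyadic_distribution f k -> Csh s <> 0 ->
  (forall (N : R) (j : nat), N0 <= N -> 2 * (INR j + 1) <= N ->
    Cmod ((f ((s + Ci * INR j) / N) + f ((s - Ci * INR (S j)) / N)) / N ^ k
         - (/ (s + Ci * INR j) ^ k + / (s - Ci * INR (S j)) ^ k))%C <= K / (N * N)) ->
  cvg (fun J => Csum (fun j => / (s + Ci * INR j) ^ k + / (s - Ci * INR (S j)) ^ k)%C (2 ^ J)) (f s).
Proof.
  intros Hf Hs H.
  assert (HN : eventually (fun J => N0 <= 2 ^ S J)).
  { assert (L : is_lim_seq (fun n => 2 ^ n) p_infty) by (apply is_lim_seq_geom_p; lra).
    apply is_lim_seq_incr_1 in L. apply is_lim_seq_spec in L. destruct (L N0) as [n Hn].
    exists n. intros m Hm. left; now apply Hn. }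
  unfold cvg.
  apply is_lim_seq_le_le_loc with (fun _ => 0) (fun J => K * (/ 2) ^ J).
  - destruct HN as [n0 HN]. exists n0. intros J HJ. specialize (HN J HJ). split. apply Cmod_ge_0.
    rewrite (distribution f k s J Hf Hs) at 1.
    set (N := 2 ^ S J) in *.
    assert (HNp : 0 < N) by (apply pow_lt; lra).
    unfold Cdiv at 1. rewrite Cmult_comm, <- Csum_scal.
    rewrite <- Csum_minus.
    eapply Rle_trans. apply (Csum_norm _ (fun _ => K / (N * N))).
    + intros j Hj. rewrite <- Cmod_opp.
      assert (Hj2 : 2 * (INR j + 1) <= N).
      { unfold N. simpl. apply Rmult_le_compat_l. lra.
        rewrite <- S_INR. replace 2 with (INR 2) by (simpl; ring). rewrite <- pow_INR. apply le_INR; lia. }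
      specialize (H N j HN Hj2).
      match type of H with Cmod ?x <= _ => match goal with |- Cmod ?y <= _ => replace y with x; [exact H|] end end.
      unfold Cdiv. ring.
    + rewrite Rsum_const, pow_INR. change (INR 2) with (1 + 1). replace (1 + 1) with 2 by ring.
      assert (HK : 0 <= K).
      { assert (Hj2 : 2 * (INR 0 + 1) <= N).
        { unfold N. simpl. assert (1 <= 2 ^ J) by (apply pow_R1_Rle; lra). lra. }
        specialize (H N O HN Hj2).
        assert (0 <= K / (N * N)) by (eapply Rle_trans; [apply Cmod_ge_0 | exact H]).
        replace K with (K / (N * N) * (N * N)) by (field; lra). apply Rmult_le_pos; nra. }
      unfold N. simpl. rewrite pow_inv.
      assert (P : 0 < 2 ^ J) by (apply pow_lt; lra).
      replace (2 ^ J * (K / (2 * 2 ^ J * (2 * 2 ^ J)))) with ((K * / 2 ^ J) * / 4) by (field; lra).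
      assert (0 <= K * / 2 ^ J) by (apply Rmult_le_pos; auto; left; now apply Rinv_0_lt_compat). lra.
  - apply is_lim_seq_const.
  - apply is_lim_seq_scal0, is_lim_seq_pow0. lra.
Qed.

(** * Estimates for sinh near its zero at the origin *)

Lemma PI_lt_7_2 : PI < 7 / 2.
Proof.
  assert (H := proj2 (PI_ineq 1)). unfold tg_alt, PI_tg in H. simpl in H. lra.
Qed.

Lemma sinh_ge (t : R) : 0 <= t -> 2 * t <= exp t - exp (- t).
Proof.
  intros Ht.
  destruct (MVT_gen (fun t => exp t - exp (- t)) 0 t (fun t => exp t + exp (- t))) as [c [Hc E]].
  - intros x _. auto_derive; auto; ring.
  - intros x _. apply derivable_continuous_pt. exists (exp x + exp (- x)).
    apply is_derive_Reals. auto_derive; auto; ring.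
  - assert (2 <= exp c + exp (- c)).
    { rewrite exp_Ropp. assert (P := exp_pos c). 
      replace (exp c + / exp c) with (2 + (exp c - 1) * (exp c - 1) / exp c) by (field; lra).
      assert (0 <= (exp c - 1) * (exp c - 1) / exp c).
      { apply Rmult_le_pos. apply Rle_0_sqr. left; now apply Rinv_0_lt_compat. } lra. }
    rewrite Ropp_0, exp_0 in E. nra.
Qed.

Lemma sinh_sq_ge (t : R) : 4 * (t * t) <= (exp t - exp (- t)) * (exp t - exp (- t)).
Proof.
  destruct (Rle_dec 0 t) as [H | H].
  - assert (L := sinh_ge t H). nra.
  - assert (L := sinh_ge (- t) ltac:(lra)). rewrite Ropp_involutive in L. nra.
Qed.

(** The range goes up to 2 in order to contain $11\pi/20$, given $\pi<7/2$. *)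
Lemma sin_ge_third (t : R) : 0 <= t <= 2 -> t / 3 <= sin t.
Proof.
  intros Ht.
  assert (P := PI2_3_2).
  destruct (SIN t ltac:(lra) ltac:(lra)) as [H _].
  unfold sin_lb, sin_approx, sin_term in H. simpl in H.
  assert (E : t / 3 <= t - t * t * t / 6 + t * t * t * t * t / 120 - t * t * t * t * t * t * t / 5040).
  { replace (t - t * t * t / 6 + t * t * t * t * t / 120 - t * t * t * t * t * t * t / 5040)
      with (t / 3 + t * (2 / 3 - (t * t) / 6 + (t * t) * (t * t) * (/ 120 - (t * t) / 5040))) by field.
    assert (Hu : 0 <= t * t <= 4) by nra. revert Hu. generalize (t * t). intros u Hu.
    assert (H1 : 0 <= u * u * (/ 120 - u / 5040)) by (apply Rmult_le_pos; [apply Rle_0_sqr | lra]).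
    assert (0 <= t * (2 / 3 - u / 6 + u * u * (/ 120 - u / 5040))).
    { apply Rmult_le_pos; [lra|]. set (w := u * u * (/ 120 - u / 5040)) in *. lra. }
    rewrite <- (Rplus_0_r (t / 3)) at 1. now apply Rplus_le_compat_l. }
  eapply Rle_trans. apply E. eapply Rle_trans. 2: apply H. right. field.
Qed.

Lemma Cmod_Csh_sq (u : C) :
  Cmod (Csh u) ^ 2 = ((exp (PI * Re u) - exp (- (PI * Re u))) ^ 2 / 4 + sin (PI * Im u) ^ 2) / PI ^ 2.
Proof.
  assert (P := PI_RGT_0).
  assert (E : Csh u = ((exp (PI * Re u) - exp (- (PI * Re u))) * cos (PI * Im u) / (2 * PI),
                       (exp (PI * Re u) + exp (- (PI * Re u))) * sin (PI * Im u) / (2 * PI))).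
  { replace (Csh u) with (RtoC (/ (2 * PI)) * (Cexp (PI * u) - Cexp (- (PI * u))))%C.
    2: { unfold Csh, Cdiv. rewrite RtoC_inv, RtoC_mult by lra. ring. }
    unfold Cexp. rewrite !re_opp, !im_opp, !re_scal_l, !im_scal_l, cos_neg, sin_neg.
    unfold RtoC, Cmult, Cminus, Cplus, Copp; simpl. f_equal; field; lra. }
  rewrite Cmod2_alt, E. unfold Re at 1, Im at 2; simpl.
  assert (H := sin2_cos2 (PI * Im u)). unfold Rsqr in H.
  assert (H2 : exp (PI * Re u) * exp (- (PI * Re u)) = 1) by (rewrite <- exp_plus, Rplus_opp_r; apply exp_0).
  set (a := exp (PI * Re u)) in *. set (b := exp (- (PI * Re u))) in *.
  set (c := cos _) in *. set (d := sin _) in *.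
  replace (_ + _) with (((a - b) * (a - b) * (c * c) + ((a - b) * (a - b) + 4 * (a * b)) * (d * d)) / (4 * (PI * PI)))
    by (field; lra).
  rewrite H2. replace (c * c) with (1 - d * d) by lra. field. lra.
Qed.

(** The translates have imaginary part at most $1/2$ plus a small displacement caused by [s]; the
    margin $1/20$ makes room for it and still stays away from the zeros $\pm i$. *)
Lemma Csh_lower (u : C) : Rabs (Im u) <= 11 / 20 -> Cmod u <= 3 * Cmod (Csh u).
Proof.
  intros H. assert (P := PI_RGT_0). assert (P2 := PI_lt_7_2).
  apply Rsqr_incr_0_var. 2: generalize (Cmod_ge_0 (Csh u)); lra.
  unfold Rsqr. replace (Cmod u * Cmod u) with (Cmod u ^ 2) by ring.
  replace (3 * Cmod (Csh u) * (3 * Cmod (Csh u))) with (9 * Cmod (Csh u) ^ 2) by ring.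
  rewrite Cmod_Csh_sq, Cmod2_alt.
  assert (A := sinh_sq_ge (PI * Re u)).
  assert (B : (PI * Im u) * (PI * Im u) <= 9 * (sin (PI * Im u) * sin (PI * Im u))).
  { assert (Q : forall y, 0 <= y <= 11 / 20 -> (PI * y) * (PI * y) <= 9 * (sin (PI * y) * sin (PI * y))).
    { intros y Hy. assert (L := sin_ge_third (PI * y) ltac:(nra)). assert (0 <= PI * y) by nra. nra. }
    destruct (Rle_dec 0 (Im u)) as [H0 | H0].
    - rewrite Rabs_pos_eq in H by auto. apply Q; lra.
    - rewrite Rabs_left in H by lra. specialize (Q (- Im u) ltac:(lra)).
      replace (PI * - Im u) with (- (PI * Im u)) in Q by ring. rewrite sin_neg in Q. nra. }
  set (x := Re u) in *. set (y := Im u) in *.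
  set (a := exp (PI * x) - exp (- (PI * x))) in *. set (d := sin (PI * y)) in *.
  replace (9 * ((a ^ 2 / 4 + d ^ 2) / PI ^ 2)) with ((9 * (a * a) / 4 + 9 * (d * d)) / (PI * PI)) by (field; lra).
  apply Rmult_le_reg_r with (PI * PI). nra.
  replace ((9 * (a * a) / 4 + 9 * (d * d)) / (PI * PI) * (PI * PI)) with (9 * (a * a) / 4 + 9 * (d * d)) by (field; lra).
  nra.
Qed.

(** The quadratic Taylor polynomials at $\pm\pi u$ differ by exactly $2\pi u$ because their even
    terms cancel, so second-order Taylor already yields a cubic error. *)
Lemma Csh_near_id : exists K, 0 < K /\ forall u, Cmod u <= 2 -> Cmod (Csh u - u) <= K * Cmod u ^ 3.
Proof.
  assert (P := PI_RGT_0).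
  exists (exp (4 * PI) * PI ^ 2). split.
  { apply Rmult_lt_0_compat. apply exp_pos. apply pow_lt; lra. }
  intros u Hu.
  assert (T1 := Cexp_taylor (PI * u) 2). assert (T2 := Cexp_taylor (- (PI * u)) 2).
  unfold Cexp_poly in T1, T2.
  rewrite Cmod_opp in T2.
  assert (Em : Cmod (PI * u) = PI * Cmod u) by (rewrite Cmod_mult, Cmod_R, Rabs_pos_eq; lra).
  rewrite Em in T1, T2.
  set (p := fun z : C => Csum (fun k => z ^ k / INR (fact k))%C 3).
  fold (p (PI * u)%C) in T1. fold (p (- (PI * u))%C) in T2.
  assert (Ep : forall z : C, (p z - p (- z))%C = (2 * z)%C).
  { intro z. unfold p. simpl. replace (1 + 1) with 2 by ring. field. }
  replace (Csh u - u)%C with (((p (- (PI * u)) - Cexp (- (PI * u))) - (p (PI * u) - Cexp (PI * u))) / (2 * PI))%C.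
  2: { unfold Csh. replace (Cexp (PI * u)) with ((Cexp (PI * u) - p (PI * u)) + p (PI * u))%C at 2 by ring.
       assert (E := Ep (PI * u)%C).
       replace (p (PI * u)%C) with (2 * (PI * u) + p (- (PI * u)))%C by (rewrite <- E; ring). cfield. }
  rewrite Cmod_div. 2: apply Cmult_neq_0; auto using C2_nz, CPI_nz.
  rewrite Cmod_mult, !Cmod_R, !Rabs_pos_eq by lra.
  assert (T : Cmod (p (- (PI * u)) - Cexp (- (PI * u)) - (p (PI * u) - Cexp (PI * u)))%C
     <= 2 * (2 * exp (2 * (PI * Cmod u)) * (PI * Cmod u) ^ 3 / 2)).
  { unfold Cminus at 1. eapply Rle_trans. apply Cmod_triangle. rewrite Cmod_opp.
    change (INR (fact 2)) with (1 + 1) in T1, T2. replace (1 + 1) with 2 in T1, T2 by ring. lra. }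
  apply Rmult_le_reg_r with (2 * PI). lra.
  unfold Rdiv. rewrite Rmult_assoc, Rinv_l, Rmult_1_r by lra.
  eapply Rle_trans. apply T.
  replace (2 * (2 * exp (2 * (PI * Cmod u)) * (PI * Cmod u) ^ 3 / 2)) with
    ((2 * (PI * Cmod u) ^ 3) * exp (2 * (PI * Cmod u))) by field.
  replace (exp (4 * PI) * PI ^ 2 * Cmod u ^ 3 * (2 * PI)) with ((2 * (PI * Cmod u) ^ 3) * exp (4 * PI)) by ring.
  apply Rmult_le_compat_l.
  - apply Rmult_le_pos. lra. apply pow_le. generalize (Cmod_ge_0 u); nra.
  - apply exp_mono. nra.
Qed.

Lemma Csh_inv_near : exists K, 0 < K /\ forall u : C, u <> 0 -> Cmod u <= 2 -> Rabs (Im u) <= 11 / 20 ->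
  Csh u <> 0 /\ Cmod (/ Csh u) <= 3 / Cmod u /\ Cmod (/ Csh u - / u) <= K * Cmod u.
Proof.
  destruct Csh_near_id as [K [HK H]].
  exists (3 * K). split. lra. intros u Hu H2 Hi.
  assert (L := Csh_lower u Hi). assert (P : 0 < Cmod u) by (apply Cmod_gt_0; exact Hu).
  assert (Hs : Csh u <> 0) by (apply Cmod_gt_0; lra).
  assert (Hi3 : / Cmod (Csh u) <= 3 / Cmod u).
  { replace (3 / Cmod u) with (/ (Cmod u / 3)) by (field; lra). apply Rinv_le_contravar; lra. }
  repeat split; auto.
  - rewrite Cmod_inv; auto.
  - replace (/ Csh u - / u)%C with (- (Csh u - u) * / u * / Csh u)%C by (field; auto).
    rewrite !Cmod_mult, Cmod_opp, !Cmod_inv by auto.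
    specialize (H u H2).
    apply Rle_trans with (K * Cmod u ^ 3 * / Cmod u * (3 / Cmod u)).
    + apply Rmult_le_compat; auto.
      * apply Rmult_le_pos. apply Cmod_ge_0. left; now apply Rinv_0_lt_compat.
      * left; apply Rinv_0_lt_compat; lra.
      * apply Rmult_le_compat_r; auto. left; now apply Rinv_0_lt_compat.
    + right. field. lra.
Qed.

(** The sums of [(u + i j)^-2] and [(u + i j)^-4] over all integers [j], in closed form. *)
Definition lam2 (u : C) : C := (/ Csh u * / Csh u)%C.
Definition lam4 (u : C) : C := (lam2 u * lam2 u + (2 * (PI * PI) / 3) * lam2 u)%C.
(** This is $\pi\coth(\pi u)$, the sum of $1/(u+ij)$ over all integers with [j] and [-j] paired. *)
Definition kap (u : C) : C := (Cch u / Csh u)%C.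

Lemma lam2_half (u : C) : Cch (u / 2) <> 0 ->
  lam2 ((u + Ci) / 2) = (- (PI * PI) / (Cch (u / 2) * Cch (u / 2)))%C.
Proof.
  intros H. unfold lam2. rewrite Csh_half.
  replace (- (PI * PI))%C with (/ (Ci * Ci) * (PI * PI))%C.
  2: rewrite Ci_sq; field. cfield.
Qed.

(** The shift by $i/2$ exchanges sinh and cosh, so this is $1/\sinh^2-1/\cosh^2=1/(\sinh\cosh)^2$ at
    $\pi u/2$. *)
Lemma lam2_distribution : dyadic_distribution lam2 2.
Proof.
  intros u Hu. destruct (Csh_half_nz u Hu) as [H1 H2]. split.
  - rewrite lam2_half by auto. unfold lam2. rewrite Csh_double.
    transitivity ((Cch (u / 2) * Cch (u / 2) - PI * PI * (Csh (u / 2) * Csh (u / 2)))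
       / (4 * (Csh (u / 2) * Csh (u / 2)) * (Cch (u / 2) * Cch (u / 2))))%C.
    + rewrite Cch_sq at 1. field. auto.
    + field. auto.
  - unfold lam2. rewrite Csh_minus_i. field. auto.
Qed.

Lemma lam4_distribution : dyadic_distribution lam4 4.
Proof.
  intros u Hu. destruct (Csh_half_nz u Hu) as [H1 H2]. split.
  - unfold lam4. rewrite lam2_half by auto. unfold lam2. rewrite Csh_double.
    assert (E := Cch_sq (u / 2)).
    set (x := (Csh (u / 2) * Csh (u / 2))%C) in *. set (y := (Cch (u / 2) * Cch (u / 2))%C) in *.
    assert (Hx : x <> 0) by now apply Cmult_neq_0.
    assert (Hy : y <> 0) by now apply Cmult_neq_0.
    assert (E1 : (/ (2 * (Csh (u / 2) * Cch (u / 2))) * / (2 * (Csh (u / 2) * Cch (u / 2))))%C = (/ (4 * x * y))%C).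
    { unfold x, y. field. auto. }
    assert (E2 : (/ Csh (u / 2) * / Csh (u / 2))%C = (/ x)%C) by (unfold x; field; auto).
    rewrite E1, E2. rewrite E in Hy |- *. field. auto.
  - unfold lam4, lam2. rewrite Csh_minus_i. field. auto.
Qed.

Lemma kap_distribution : dyadic_distribution kap 1.
Proof.
  intros u Hu. destruct (Csh_half_nz u Hu) as [H1 H2]. split.
  - unfold kap. rewrite Csh_half, Cch_half, Csh_double, Cch_double. cfield.
  - unfold kap. rewrite Csh_minus_i, Cch_minus_i. field. auto.
Qed.

(** Distance from the poles $ij$, $j\in\mathbb Z$. Besides the right half-plane it covers $s=i/2$,
    where the zeta values are read off. *)
Definition offlat (s : C) (rho : R) : Prop :=
  0 < rho /\ forall j : nat, rho <= Cmod (s + Ci * INR j) /\ rho <= Cmod (s - Ci * INR j).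

Lemma Cmod_Ci_mult (z : C) : Cmod (Ci * z) = Cmod z.
Proof.
  rewrite Cmod_mult. replace (Cmod Ci) with 1. ring.
  unfold Cmod, Ci; simpl. replace (0 * (0 * 1) + 1 * (1 * 1)) with 1 by ring. now rewrite sqrt_1.
Qed.

Lemma Cmod_Ci_INR (j : nat) : Cmod (Ci * INR j) = INR j.
Proof. rewrite Cmod_Ci_mult, Cmod_R. apply Rabs_pos_eq, pos_INR. Qed.

Lemma Cmod_triangle_rev (z w : C) : Cmod w - Cmod z <= Cmod (z + w).
Proof.
  assert (H := Cmod_triangle (z + w) (- z)). rewrite Cmod_opp in H.
  replace (z + w + - z)%C with w in H by ring. lra.
Qed.

Lemma offlat_Re (s : C) : 0 < Re s -> offlat s (Re s).
Proof.
  intros H. split; auto. intros j.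
  assert (E : forall z : C, Re (s + Ci * z) = Re s - Im z) by (intro z; csimpl; ring).
  split; (eapply Rle_trans; [|apply Re_le_Cmod]).
  - rewrite E. rewrite im_RtoC, Rabs_pos_eq; lra.
  - replace (s - Ci * INR j)%C with (s + Ci * (- INR j))%C by ring. rewrite E.
    rewrite im_opp, im_RtoC, Rabs_pos_eq; lra.
Qed.

(** For large [j] the triangle inequality gives linear growth, for small [j] the gap [rho] is
    available; the chosen [d] turns both into one linear lower bound. *)
Lemma offlat_lower (s : C) (rho : R) : offlat s rho ->
  let d := rho / (rho + Cmod s + 1) in
  0 < d /\ forall j : nat, d * (INR j + 1) <= Cmod (s + Ci * INR j)
      /\ d * (INR j + 1) <= Cmod (s - Ci * INR (S j)).
Proof.
  intros [Hr H] d. assert (Hs := Cmod_ge_0 s).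
  assert (Q : forall x y, rho <= x -> y <= x + Cmod s + 1 -> d * y <= x).
  { intros x y Hx Hy. unfold d. apply Rmult_le_reg_r with (rho + Cmod s + 1). lra.
    replace (rho / (rho + Cmod s + 1) * y * (rho + Cmod s + 1)) with (rho * y) by (field; lra). nra. }
  split. { apply Rdiv_lt_0_compat; lra. }
  intro j. split; apply Q; try apply H.
  - assert (L := Cmod_triangle_rev s (Ci * INR j)). rewrite Cmod_Ci_INR in L. lra.
  - assert (L := Cmod_triangle_rev s (- (Ci * INR (S j)))). rewrite Cmod_opp, Cmod_Ci_INR, S_INR in L.
    unfold Cminus. rewrite S_INR. lra.
Qed.

Lemma rsum_inv_sq_ex : exists l, rsum (fun j => / (INR j + 1) ^ 2) l.
Proof.
  apply rsum_ex_le with (fun j => 2 * (/ (INR j + 1) - / (INR j + 2))) (2 * 1).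
  - intro n. assert (P := pos_INR n). split.
    + left. apply Rinv_0_lt_compat, pow_lt; lra.
    + replace (2 * (/ (INR n + 1) - / (INR n + 2))) with (/ ((INR n + 1) * (INR n + 2) / 2)) by (field; lra).
      apply Rinv_le_contravar; nra.
  - apply rsum_scal.
    assert (E : forall n, Rsum (fun j => / (INR j + 1) - / (INR j + 2)) n = 1 - / (INR n + 1)).
    { induction n. simpl. replace (0 + 1) with 1 by ring. field.
      cbn [Rsum]. rewrite IHn, S_INR. assert (P := pos_INR n). field. lra. }
    apply is_lim_seq_ext with (fun n => 1 - / (INR n + 1)). intro; now rewrite E.
    replace (Finite 1) with (Finite (1 - 0)) by (f_equal; ring).
    apply is_lim_seq_minus'. apply is_lim_seq_const.
    apply is_lim_seq_ext with (fun n => / (INR (S n))). intro; now rewrite S_INR.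
    apply (is_lim_seq_incr_1 (fun n => / INR n)).
    replace (Finite 0) with (Rbar_inv p_infty) by reflexivity.
    apply is_lim_seq_inv. apply is_lim_seq_INR. discriminate.
Qed.

Lemma cvg_inv_shift (s : C) (c : R) (k : nat) :
  (forall j : nat, 0 < c /\ c * (INR j + 1) <= Cmod (s + Ci * INR j)) ->
  cvg (fun j => / (s + Ci * INR j) ^ S k)%C 0.
Proof.
  intros H. 
  assert (Hc : 0 < c) by apply (H O).
  apply cvg_bound with (fun j => (/ c ^ S k) * / INR (S j)).
  - intro j. destruct (H j) as [_ Hj]. assert (P := pos_INR j).
    assert (Hp : 0 < Cmod (s + Ci * INR j)) by nra.
    assert (Hn : (s + Ci * INR j)%C <> 0) by now apply Cmod_gt_0.
    replace (/ (s + Ci * INR j) ^ S k - 0)%C with (/ (s + Ci * INR j) ^ S k)%C by ring.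
    rewrite Cmod_inv, Cmod_pow by now apply Cpow_nz.
    rewrite <- Rinv_mult, S_INR.
    apply Rinv_le_contravar. apply Rmult_lt_0_compat. now apply pow_lt. lra.
    apply Rle_trans with ((c * (INR j + 1)) ^ S k).
    + rewrite Rpow_mult_distr. apply Rmult_le_compat_l. left; now apply pow_lt.
      rewrite <- (Rmult_1_r (INR j + 1)) at 1. simpl. apply Rmult_le_compat_l. lra.
      apply pow_R1_Rle. lra.
    + apply pow_incr. nra.
  - apply is_lim_seq_scal0. apply (is_lim_seq_incr_1 (fun n => / INR n)).
    replace (Finite 0) with (Rbar_inv p_infty) by reflexivity.
    apply is_lim_seq_inv. apply is_lim_seq_INR. discriminate.
Qed.

(** Two repairs of the output of [distribution_cvg]. Absolute convergence extends the limit along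
    $2^J$ to all partial sums, and subtracting a telescoping series replaces the pairing of [j] with
    [-(j+1)] by that of [j] with [-j], which splits off the term at 0. *)
Lemma lattice_sum (f : C -> C) (k : nat) (s : C) (rho K : R) :
  offlat s rho ->
  cvg (fun J => Csum (fun j => / (s + Ci * INR j) ^ S k + / (s - Ci * INR (S j)) ^ S k)%C (2 ^ J)) (f s) ->
  (forall j : nat, Cmod (/ (s + Ci * INR j) ^ S k + / (s - Ci * INR (S j)) ^ S k) <= K * / (INR j + 1) ^ 2) ->
  csum (fun j => / (s + Ci * INR (S j)) ^ S k + / (s - Ci * INR (S j)) ^ S k)%C (f s - / s ^ S k)%C.
Proof.
  intros Hs Hc HK. destruct (offlat_lower s rho Hs) as [Hd HL].
  set (a := fun j => (/ (s + Ci * INR j) ^ S k + / (s - Ci * INR (S j)) ^ S k)%C) in *.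
  destruct rsum_inv_sq_ex as [z Hz].
  assert (Ha : csum a (f s)).
  { destruct (csum_ex a (fun j => K * / (INR j + 1) ^ 2) (K * z)) as [l Hl]; auto.
    now apply rsum_scal.
    assert (H2 := cvg_comp (Csum a) l (fun J => 2 ^ J)%nat).
    replace (f s) with l; auto. apply (cvg_unique (fun J => Csum a (2 ^ J))); auto.
    apply H2; auto. intros P [N HN]. exists N. intros n Hn. apply HN.
    assert (n < 2 ^ n)%nat by (apply Nat.pow_gt_lin_r; lia). lia. }
  assert (Ht := csum_telescope (fun j => / (s + Ci * INR j) ^ S k)%C 0).
  apply csum_ext with (fun j => a j - (/ (s + Ci * INR j) ^ S k - / (s + Ci * INR (S j)) ^ S k))%C.
  intro n; unfold a; ring.
  apply csum_minus; auto.
  replace (/ s ^ S k)%C with (/ (s + Ci * INR 0) ^ S k - 0)%C.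
  apply Ht. apply cvg_inv_shift with (rho / (rho + Cmod s + 1)). intro j; split; auto. apply HL.
  simpl (INR 0). replace (s + Ci * 0)%C with s by ring. ring.
Qed.

(** The hypotheses give $|s|+j+1\le N/20+N/2=11N/20$, whence the bound on the imaginary part. *)
Lemma offlat_scaled (s : C) (rho N : R) (j : nat) :
  offlat s rho -> 20 * (Cmod s + 1) <= N -> 2 * (INR j + 1) <= N ->
  let d := rho / (rho + Cmod s + 1) in
  (0 < d /\ 0 < N) /\
  (((s + Ci * INR j) / N)%C <> 0 /\ Cmod ((s + Ci * INR j) / N) <= 2
     /\ Rabs (Im ((s + Ci * INR j) / N)) <= 11 / 20 /\ d * (INR j + 1) / N <= Cmod ((s + Ci * INR j) / N)) /\
  (((s - Ci * INR (S j)) / N)%C <> 0 /\ Cmod ((s - Ci * INR (S j)) / N) <= 2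
     /\ Rabs (Im ((s - Ci * INR (S j)) / N)) <= 11 / 20 /\ d * (INR j + 1) / N <= Cmod ((s - Ci * INR (S j)) / N)).
Proof.
  intros Hs HN Hj d. destruct (offlat_lower s rho Hs) as [Hd HL]. fold d in Hd, HL.
  destruct (HL j) as [L1 L2]. assert (P := pos_INR j). assert (Ps := Cmod_ge_0 s).
  assert (HN0 : 0 < N) by lra.
  assert (Q : forall z : C, d * (INR j + 1) <= Cmod z -> Cmod z <= Cmod s + (INR j + 1) ->
    (z / N)%C <> 0 /\ Cmod (z / N) <= 2 /\ Rabs (Im (z / N)) <= 11 / 20 /\ d * (INR j + 1) / N <= Cmod (z / N)).
  { intros z Hz1 Hz2.
    assert (Hz : 0 < Cmod z) by nra.
    assert (E : Cmod (z / N) = Cmod z / N).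
    { rewrite Cmod_div, Cmod_R, Rabs_pos_eq; auto; try lra. apply RtoC_nz; lra. }
    assert (B : Cmod (z / N) <= 11 / 20).
    { rewrite E. apply Rmult_le_reg_r with N; auto. unfold Rdiv at 1.
      rewrite Rmult_assoc, Rinv_l, Rmult_1_r by lra. lra. }
    split. apply Cmod_gt_0. rewrite E. now apply Rdiv_lt_0_compat.
    split. lra. split. eapply Rle_trans. apply Im_le_Cmod. auto.
    rewrite E. apply Rmult_le_compat_r; auto. left; now apply Rinv_0_lt_compat. }
  split; auto. split; apply Q; auto.
  - eapply Rle_trans. apply Cmod_triangle. rewrite Cmod_Ci_INR. lra.
  - unfold Cminus. eapply Rle_trans. apply Cmod_triangle. rewrite Cmod_opp, Cmod_Ci_INR, S_INR. lra.
Qed.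

Lemma Cmod_plus_le (z w : C) (a b : R) : Cmod z <= a -> Cmod w <= b -> Cmod (z + w) <= a + b.
Proof. intros. eapply Rle_trans. apply Cmod_triangle. lra. Qed.

Lemma Cmod_mult_le (z w : C) (a b : R) : Cmod z <= a -> Cmod w <= b -> Cmod (z * w) <= a * b.
Proof. intros. rewrite Cmod_mult. apply Rmult_le_compat; auto; apply Cmod_ge_0. Qed.

Lemma lam2_near : exists K, 0 < K /\ forall u : C, u <> 0 -> Cmod u <= 2 -> Rabs (Im u) <= 11 / 20 ->
  Cmod (lam2 u) <= 9 / Cmod u ^ 2 /\ Cmod (lam2 u - / u ^ 2) <= K.
Proof.
  destruct Csh_inv_near as [K [HK H]]. exists (4 * K). split. lra.
  intros u Hu H2 Hi. destruct (H u Hu H2 Hi) as [Hs [H3 H4]].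
  assert (P : 0 < Cmod u) by (apply Cmod_gt_0; exact Hu). split.
  - unfold lam2. replace (9 / Cmod u ^ 2) with (3 / Cmod u * (3 / Cmod u)) by (field; lra).
    now apply Cmod_mult_le.
  - unfold lam2. replace (/ Csh u * / Csh u - / u ^ 2)%C with ((/ Csh u - / u) * (/ Csh u + / u))%C.
    2: { simpl. field. auto. }
    replace (4 * K) with (K * Cmod u * (3 / Cmod u + 1 / Cmod u)) by (field; lra).
    apply Cmod_mult_le; auto. apply Cmod_plus_le; auto. rewrite Cmod_inv by auto. right; field; lra.
Qed.

(** An error of order $|u|^{-2}$ suffices: with $|u|\ge d/N$ it is $O(N^2)$, and the prefactor
    $N^{-4}$ of the distribution relation brings it down to $O(N^{-2})$. *)
Lemma lam4_near : exists K, 0 < K /\ forall u : C, u <> 0 -> Cmod u <= 2 -> Rabs (Im u) <= 11 / 20 ->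
  Cmod (lam4 u - / u ^ 4) <= K / Cmod u ^ 2.
Proof.
  destruct lam2_near as [K [HK H]]. set (c := Cmod (2 * (PI * PI) / 3)).
  assert (Hc : 0 <= c) by apply Cmod_ge_0.
  exists (10 * K + 9 * c). split. lra.
  intros u Hu H2 Hi. destruct (H u Hu H2 Hi) as [H3 H4].
  assert (P : 0 < Cmod u) by (apply Cmod_gt_0; exact Hu).
  assert (Pn : (u ^ 2)%C <> 0) by now apply Cpow_nz.
  unfold lam4.
  replace (lam2 u * lam2 u + (2 * (PI * PI) / 3) * lam2 u - / u ^ 4)%C
   with ((lam2 u - / u ^ 2) * (lam2 u + / u ^ 2) + (2 * (PI * PI) / 3) * lam2 u)%C.
  2: { simpl. field. auto. }
  replace ((10 * K + 9 * c) / Cmod u ^ 2) with (K * (9 / Cmod u ^ 2 + 1 / Cmod u ^ 2) + c * (9 / Cmod u ^ 2)) by (field; lra).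
  apply Cmod_plus_le. 
  - apply Cmod_mult_le; auto. apply Cmod_plus_le; auto. rewrite Cmod_inv, Cmod_pow by auto. right; field; lra.
  - apply Cmod_mult_le; auto. unfold c. apply Rle_refl.
Qed.

(** In weight 1 an error $O(|u|)$ for each term separately would not add up to something small.
    Pairing helps: $\coth a+\coth b=\sinh(a+b)/(\sinh a\,\sinh b)$ has the factor $u+v$, which in
    the application is of order $1/N$. *)
Lemma kap_pair_near : exists K, 0 < K /\ forall (u v : C) (B : R), u <> 0 -> Cmod u <= 2 -> Rabs (Im u) <= 11 / 20 ->
  v <> 0 -> Cmod v <= 2 -> Rabs (Im v) <= 11 / 20 -> Cmod (u + v) <= 2 ->
  Cmod u <= B * Cmod v -> Cmod v <= B * Cmod u ->
  Cmod (kap u + kap v - (/ u + / v)) <=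
    K * (Cmod (u + v) ^ 3 / (Cmod u * Cmod v) + B * Cmod (u + v)).
Proof.
  destruct Csh_inv_near as [K1 [HK1 H1]]. destruct Csh_near_id as [K2 [HK2 H2]].
  exists (9 * K2 + 4 * K1). split. lra.
  intros u v B Hu Hu2 Hui Hv Hv2 Hvi He Huv Hvu.
  destruct (H1 u Hu Hu2 Hui) as [Su [Su1 Su2]]. destruct (H1 v Hv Hv2 Hvi) as [Sv [Sv1 Sv2]].
  specialize (H2 (u + v)%C He).
  assert (Pu : 0 < Cmod u) by (apply Cmod_gt_0; exact Hu).
  assert (Pv : 0 < Cmod v) by (apply Cmod_gt_0; exact Hv).
  assert (E : (kap u + kap v - (/ u + / v) =
     (Csh (u + v) - (u + v)) * (/ Csh u * / Csh v)
      + (u + v) * ((/ Csh u - / u) * / Csh v + / u * (/ Csh v - / v)))%C).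
  { unfold kap. rewrite Csh_plus. field. auto. }
  rewrite E. set (e := Cmod (u + v)) in *.
  assert (He0 : 0 <= e) by apply Cmod_ge_0.
  assert (HB : 0 <= B) by (apply Rmult_le_reg_r with (Cmod v); nra).
  apply Rle_trans with (K2 * e ^ 3 * (3 / Cmod u * (3 / Cmod v)) + e * (3 * K1 * B + K1 * B)).
  - apply Cmod_plus_le.
    + apply Cmod_mult_le; auto. now apply Cmod_mult_le.
    + apply Cmod_mult_le. apply Rle_refl. apply Cmod_plus_le.
      * eapply Rle_trans. apply (Cmod_mult_le _ _ (K1 * Cmod u) (3 / Cmod v)); auto.
        replace (K1 * Cmod u * (3 / Cmod v)) with ((3 * K1) * (Cmod u / Cmod v)) by (field; lra).
        apply Rmult_le_compat_l. lra. apply Rmult_le_reg_r with (Cmod v); auto.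
        unfold Rdiv. rewrite Rmult_assoc, Rinv_l; lra.
      * eapply Rle_trans. apply (Cmod_mult_le _ _ (/ Cmod u) (K1 * Cmod v)); auto.
        rewrite Cmod_inv by auto. lra.
        replace (/ Cmod u * (K1 * Cmod v)) with (K1 * (Cmod v / Cmod u)) by (field; lra).
        apply Rmult_le_compat_l. lra. apply Rmult_le_reg_r with (Cmod u); auto.
        unfold Rdiv. rewrite Rmult_assoc, Rinv_l; lra.
  - replace (K2 * e ^ 3 * (3 / Cmod u * (3 / Cmod v))) with (9 * K2 * (e ^ 3 / (Cmod u * Cmod v))) by (field; lra).
    assert (A : 0 <= e ^ 3 / (Cmod u * Cmod v)).
    { apply Rmult_le_pos. now apply pow_le. left; apply Rinv_0_lt_compat; nra. }
    assert (0 <= B * e) by nra. nra.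
Qed.

Lemma Cdiv_pow_scale (z : C) (N : R) (k : nat) : N <> 0 -> z <> 0 ->
  (/ z ^ k = / (z / N) ^ k / N ^ k)%C.
Proof.
  intros HN Hz. assert (HN' : RtoC N <> 0) by now apply RtoC_nz.
  unfold Cdiv at 2. rewrite Cpow_mult_l, Cpow_inv by auto.
  assert (H1 := Cpow_nz z k Hz). assert (H2 := Cpow_nz _ k HN'). field. auto.
Qed.

Lemma offlat_term_bound (s : C) (rho : R) (k : nat) : offlat s rho ->
  forall j : nat, Cmod (/ (s + Ci * INR j) ^ S (S k) + / (s - Ci * INR (S j)) ^ S (S k))
   <= (2 / (rho / (rho + Cmod s + 1)) ^ S (S k)) * / (INR j + 1) ^ 2.
Proof.
  intros Hs j. destruct (offlat_lower s rho Hs) as [Hd HL]. set (d := rho / (rho + Cmod s + 1)) in *.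
  destruct (HL j) as [L1 L2]. assert (P := pos_INR j).
  assert (Q : forall z : C, d * (INR j + 1) <= Cmod z -> Cmod (/ z ^ S (S k)) <= / d ^ S (S k) * / (INR j + 1) ^ 2).
  { intros z Hz. assert (Hp : 0 < Cmod z) by nra.
    assert (Hn : z <> 0) by now apply Cmod_gt_0.
    rewrite Cmod_inv, Cmod_pow by now apply Cpow_nz. rewrite <- Rinv_mult.
    apply Rinv_le_contravar. apply Rmult_lt_0_compat; apply pow_lt; lra.
    apply Rle_trans with ((d * (INR j + 1)) ^ S (S k)).
    - rewrite Rpow_mult_distr. apply Rmult_le_compat_l. left; now apply pow_lt.
      apply Rle_pow. lra. lia.
    - apply pow_incr. nra. }
  eapply Rle_trans. apply Cmod_plus_le; apply Q; eauto. right. field.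
  split. lra. apply pow_nonzero; lra.
Qed.

Lemma lam2_lattice (s : C) (rho : R) : Csh s <> 0 -> offlat s rho ->
  csum (fun j => / (s + Ci * INR (S j)) ^ 2 + / (s - Ci * INR (S j)) ^ 2)%C (lam2 s - / s ^ 2)%C.
Proof.
  intros Hs Ho. apply (lattice_sum lam2 1 s rho _ Ho) with (2 := offlat_term_bound s rho 0 Ho).
  destruct lam2_near as [K [HK H]].
  apply distribution_cvg with (2 * K) (20 * (Cmod s + 1)); auto. apply lam2_distribution.
  intros N j HN Hj. destruct (offlat_scaled s rho N j Ho HN Hj) as [[_ HN0] [[U1 [U2 [U3 _]]] [V1 [V2 [V3 _]]]]].
  assert (HNC : RtoC N <> 0) by (apply RtoC_nz; lra).
  destruct (H _ U1 U2 U3) as [_ HU]. destruct (H _ V1 V2 V3) as [_ HV].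
  rewrite (Cdiv_pow_scale (s + Ci * INR j) N) by (try lra; now apply Cmult_nz_l in U1).
  rewrite (Cdiv_pow_scale (s - Ci * INR (S j)) N) by (try lra; now apply Cmult_nz_l in V1).
  set (u := ((s + Ci * INR j) / N)%C) in *. set (v := ((s - Ci * INR (S j)) / N)%C) in *.
  replace ((lam2 u + lam2 v) / N ^ 2 - (/ u ^ 2 / N ^ 2 + / v ^ 2 / N ^ 2))%C
    with (((lam2 u - / u ^ 2) + (lam2 v - / v ^ 2)) / N ^ 2)%C by (unfold Cdiv; ring).
  rewrite Cmod_div, Cmod_pow, Cmod_R, Rabs_pos_eq by (try lra; now apply Cpow_nz).
  replace (N * N) with (N ^ 2) by ring. unfold Rdiv. apply Rmult_le_compat_r.
  left; apply Rinv_0_lt_compat, pow_lt; auto.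
  eapply Rle_trans. apply Cmod_plus_le; eauto. lra.
Qed.

Lemma lam4_lattice (s : C) (rho : R) : Csh s <> 0 -> offlat s rho ->
  csum (fun j => / (s + Ci * INR (S j)) ^ 4 + / (s - Ci * INR (S j)) ^ 4)%C (lam4 s - / s ^ 4)%C.
Proof.
  intros Hs Ho. apply (lattice_sum lam4 3 s rho _ Ho) with (2 := offlat_term_bound s rho 2 Ho).
  destruct lam4_near as [K [HK H]]. set (d := rho / (rho + Cmod s + 1)).
  apply distribution_cvg with (2 * (K / d ^ 2)) (20 * (Cmod s + 1)); auto. apply lam4_distribution.
  intros N j HN Hj. destruct (offlat_scaled s rho N j Ho HN Hj) as [[Hd HN0] [[U1 [U2 [U3 U4]]] [V1 [V2 [V3 V4]]]]].
  fold d in Hd, U4, V4.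
  assert (HNC : RtoC N <> 0) by (apply RtoC_nz; lra).
  assert (HU := H _ U1 U2 U3). assert (HV := H _ V1 V2 V3).
  rewrite (Cdiv_pow_scale (s + Ci * INR j) N) by (try lra; now apply Cmult_nz_l in U1).
  rewrite (Cdiv_pow_scale (s - Ci * INR (S j)) N) by (try lra; now apply Cmult_nz_l in V1).
  set (u := ((s + Ci * INR j) / N)%C) in *. set (v := ((s - Ci * INR (S j)) / N)%C) in *.
  replace ((lam4 u + lam4 v) / N ^ 4 - (/ u ^ 4 / N ^ 4 + / v ^ 4 / N ^ 4))%C
    with (((lam4 u - / u ^ 4) + (lam4 v - / v ^ 4)) / N ^ 4)%C by (unfold Cdiv; ring).
  rewrite Cmod_div, Cmod_pow, Cmod_R, Rabs_pos_eq by (try lra; now apply Cpow_nz).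
  assert (Q : forall x, d * (INR j + 1) / N <= x -> K / x ^ 2 <= K / d ^ 2 * N ^ 2).
  { intros x Hx. assert (P := pos_INR j).
    assert (Hx2 : d / N <= x).
    { eapply Rle_trans. 2: apply Hx. unfold Rdiv. apply Rmult_le_compat_r. left; now apply Rinv_0_lt_compat. nra. }
    assert (Hdn : 0 < d / N) by now apply Rdiv_lt_0_compat.
    replace (K / d ^ 2 * N ^ 2) with (K * / (d / N) ^ 2) by (field; lra).
    apply Rmult_le_compat_l. lra. apply Rinv_le_contravar. now apply pow_lt.
    apply pow_incr. lra. }
  replace (2 * (K / d ^ 2) / (N * N)) with ((K / d ^ 2 * N ^ 2 + K / d ^ 2 * N ^ 2) / N ^ 4) by (field; lra).
  unfold Rdiv at 1 2. apply Rmult_le_compat_r.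
  left; apply Rinv_0_lt_compat, pow_lt; auto.
  apply Cmod_plus_le; (eapply Rle_trans; [eassumption | now apply Q]).
Qed.

Lemma kap_lattice (s : C) (rho : R) : Csh s <> 0 -> offlat s rho ->
  csum (fun j => / (s + Ci * INR (S j)) + / (s - Ci * INR (S j)))%C (kap s - / s)%C.
Proof.
  intros Hs Ho. destruct (offlat_lower s rho Ho) as [Hd HL].
  set (d := rho / (rho + Cmod s + 1)) in *.
  replace (/ s)%C with (/ s ^ 1)%C by (f_equal; simpl; ring).
  apply csum_ext with (fun j => / (s + Ci * INR (S j)) ^ 1 + / (s - Ci * INR (S j)) ^ 1)%C.
  { intro n. rewrite !Cpow_1_r. reflexivity. }
  assert (Hse := Cmod_ge_0 s).
  apply (lattice_sum kap 0 s rho ((2 * Cmod s + 1) / d ^ 2) Ho).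
  - destruct kap_pair_near as [K [HK H]].
    (* [e] bounds $|2s-i|$, which is [N] times $|u+v|$, and [B] bounds the ratio of $|u|$ and $|v|$
       in either direction. *)
    set (e := 2 * Cmod s + 1). set (B := (Cmod s + 1) / d).
    apply distribution_cvg with (K * (e ^ 3 / d ^ 2 + B * e)) (20 * (Cmod s + 1)); auto. apply kap_distribution.
    intros N j HN Hj. destruct (offlat_scaled s rho N j Ho HN Hj) as [[_ HN0] [[U1 [U2 [U3 U4]]] [V1 [V2 [V3 V4]]]]].
    fold d in U4, V4. assert (P := pos_INR j).
    assert (HNC : RtoC N <> 0) by (apply RtoC_nz; lra).
    rewrite (Cdiv_pow_scale (s + Ci * INR j) N) by (try lra; now apply Cmult_nz_l in U1).
    rewrite (Cdiv_pow_scale (s - Ci * INR (S j)) N) by (try lra; now apply Cmult_nz_l in V1).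
    assert (Esum : ((s + Ci * INR j) / N + (s - Ci * INR (S j)) / N)%C = ((2 * s - Ci) / N)%C).
    { rewrite S_INR, RtoC_plus. field. auto. }
    assert (Es : Cmod ((s + Ci * INR j) / N + (s - Ci * INR (S j)) / N) <= e / N).
    { rewrite Esum, Cmod_div, Cmod_R, (Rabs_pos_eq N) by (auto; lra). apply Rmult_le_compat_r.
      left; now apply Rinv_0_lt_compat. unfold Cminus, e.
      apply Cmod_plus_le. rewrite Cmod_mult, Cmod_R, Rabs_pos_eq by lra. lra.
      rewrite Cmod_opp. replace Ci with (Ci * 1)%C by ring. rewrite Cmod_Ci_mult, Cmod_1. lra. }
    assert (Upper : forall z : C, Cmod z <= Cmod s + (INR j + 1) -> Cmod (z / N) <= (Cmod s + 1) * ((INR j + 1) / N)).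
    { intros z Hz. rewrite Cmod_div, Cmod_R, (Rabs_pos_eq N) by (auto; lra).
      replace ((Cmod s + 1) * ((INR j + 1) / N)) with (((Cmod s + 1) * (INR j + 1)) / N) by (field; lra).
      apply Rmult_le_compat_r. left; now apply Rinv_0_lt_compat. nra. }
    assert (UU := Upper (s + Ci * INR j)%C ltac:(eapply Rle_trans; [apply Cmod_triangle | rewrite Cmod_Ci_INR; lra])).
    assert (VV := Upper (s - Ci * INR (S j))%C
       ltac:(unfold Cminus; eapply Rle_trans; [apply Cmod_triangle | rewrite Cmod_opp, Cmod_Ci_INR, S_INR; lra])).
    set (u := ((s + Ci * INR j) / N)%C) in *. set (v := ((s - Ci * INR (S j)) / N)%C) in *.
    assert (Hr : forall x y, d * (INR j + 1) / N <= x -> y <= (Cmod s + 1) * ((INR j + 1) / N) -> y <= B * x).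
    { intros x y Hx Hy. eapply Rle_trans. apply Hy. unfold B.
      replace ((Cmod s + 1) * ((INR j + 1) / N)) with ((Cmod s + 1) / d * (d * (INR j + 1) / N)) by (field; lra).
      apply Rmult_le_compat_l; auto. left. apply Rdiv_lt_0_compat; lra. }
    assert (He2 : e / N <= 2).
    { apply Rmult_le_reg_r with N; auto. unfold Rdiv. rewrite Rmult_assoc, Rinv_l by lra. unfold e; lra. }
    assert (HH := H u v B U1 U2 U3 V1 V2 V3 ltac:(lra) (Hr _ _ V4 UU) (Hr _ _ U4 VV)).
    rewrite !Cpow_1_r.
    replace ((kap u + kap v) / N - (/ u / N + / v / N))%C with ((kap u + kap v - (/ u + / v)) / N)%C by (unfold Cdiv; ring).
    rewrite Cmod_div, Cmod_R, (Rabs_pos_eq N) by (auto; lra).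
    replace (K * (e ^ 3 / d ^ 2 + B * e) / (N * N)) with (K * (e ^ 3 / d ^ 2 * / N + B * (e / N)) / N) by (field; lra).
    apply Rmult_le_compat_r. left; now apply Rinv_0_lt_compat.
    eapply Rle_trans. apply HH. apply Rmult_le_compat_l. lra.
    assert (Hu0 : d / N <= Cmod u).
    { eapply Rle_trans. 2: apply U4. unfold Rdiv. apply Rmult_le_compat_r. left; now apply Rinv_0_lt_compat. nra. }
    assert (Hv0 : d / N <= Cmod v).
    { eapply Rle_trans. 2: apply V4. unfold Rdiv. apply Rmult_le_compat_r. left; now apply Rinv_0_lt_compat. nra. }
    assert (Hdn : 0 < d / N) by now apply Rdiv_lt_0_compat.
    apply Rplus_le_compat.
    + replace (e ^ 3 / d ^ 2 * / N) with ((e / N) ^ 3 * / (d / N * (d / N))) by (field; lra).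
      apply Rmult_le_compat.
      * apply pow_le, Cmod_ge_0.
      * left; apply Rinv_0_lt_compat; nra.
      * apply pow_incr. split; auto. apply Cmod_ge_0.
      * apply Rinv_le_contravar; nra.
    + apply Rmult_le_compat_l; auto. unfold B. left. apply Rdiv_lt_0_compat; lra.
  - intro j. destruct (HL j) as [L1 L2]. assert (P := pos_INR j). rewrite !Cpow_1_r.
    assert (P1 : 0 < Cmod (s + Ci * INR j)) by nra. assert (P2 : 0 < Cmod (s - Ci * INR (S j))) by nra.
    assert (N1 : (s + Ci * INR j)%C <> 0) by now apply Cmod_gt_0.
    assert (N2 : (s - Ci * INR (S j))%C <> 0) by now apply Cmod_gt_0.
    replace (/ (s + Ci * INR j) + / (s - Ci * INR (S j)))%C with ((2 * s - Ci) / ((s + Ci * INR j) * (s - Ci * INR (S j))))%C.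
    2: { replace (2 * s - Ci)%C with ((s + Ci * INR j) + (s - Ci * INR (S j)))%C by (rewrite S_INR, RtoC_plus; ring). field. auto. }
    rewrite Cmod_div by now apply Cmult_neq_0. rewrite Cmod_mult.
    replace ((2 * Cmod s + 1) / d ^ 2 * / (INR j + 1) ^ 2) with ((2 * Cmod s + 1) * / ((d * (INR j + 1)) * (d * (INR j + 1)))) by (field; lra).
    apply Rmult_le_compat. apply Cmod_ge_0. left; apply Rinv_0_lt_compat; nra.
    + unfold Cminus. apply Cmod_plus_le. rewrite Cmod_mult, Cmod_R, Rabs_pos_eq by lra. lra.
      rewrite Cmod_opp. replace Ci with (Ci * 1)%C by ring. rewrite Cmod_Ci_mult, Cmod_1. lra.
    + apply Rinv_le_contravar. nra. apply Rmult_le_compat; nra.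
Qed.

Lemma INR_1_pos (j : nat) : 0 < INR j + 1.
Proof. generalize (pos_INR j); lra. Qed.

Lemma CINR_S_nz (j : nat) : RtoC (INR (S j)) <> 0.
Proof. apply RtoC_nz. rewrite S_INR. generalize (INR_1_pos j); lra. Qed.

Lemma is_lim_seq_inv_shift (c : R) : is_lim_seq (fun n => / (INR n + c)) 0.
Proof.
  replace (Finite 0) with (Rbar_inv p_infty) by reflexivity.
  apply is_lim_seq_inv. 2: discriminate.
  apply (is_lim_seq_plus _ _ p_infty c). apply is_lim_seq_INR. apply is_lim_seq_const. reflexivity.
Qed.

(** At $s=i/2$ the lattice sums run over half-integers. These are the odd integers divided by 2,
    whose sum is $(2^k-1)\zeta(k)$; the second series lacks the term at $1/2$, which accounts for
    $-2^k$. *)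
Lemma half_integer_sum (k : nat) (z : R) : (0 < k)%nat ->
  rsum (fun j => / (INR j + 1) ^ k) z ->
  rsum (fun j => / (INR j + 1 / 2) ^ k + / (INR j + 3 / 2) ^ k) (2 * (2 ^ k - 1) * z - 2 ^ k).
Proof.
  intros Hk Hz. set (h := fun j => / (INR j + 1) ^ k) in *.
  assert (P2 : 2 ^ k <> 0) by (apply pow_nonzero; lra).
  assert (E1 : forall n, Rsum (fun j => / (INR j + 1 / 2) ^ k) n = 2 ^ k * Rsum h (2 * n) - Rsum h n).
  { induction n. simpl; ring.
    replace (2 * S n)%nat with (S (S (2 * n))) by lia. cbn [Rsum]. rewrite IHn. unfold h.
    rewrite !S_INR, mult_INR. simpl (INR 2). replace (1 + 1) with 2 by ring.
    assert (P := INR_1_pos n). assert (P0 := pos_INR n).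
    replace (2 * INR n + 1) with (2 * (INR n + 1 / 2)) by field.
    replace (2 * (INR n + 1 / 2) + 1) with (2 * (INR n + 1)) by field.
    rewrite !Rpow_mult_distr. field. repeat split; auto; apply pow_nonzero; lra. }
  assert (E2 : forall n, Rsum (fun j => / (INR j + 3 / 2) ^ k) n
     = Rsum (fun j => / (INR j + 1 / 2) ^ k) n - 2 ^ k + / (INR n + 1 / 2) ^ k).
  { induction n. simpl. replace (0 + 1 / 2) with (/ 2) by field. rewrite pow_inv. rewrite Rinv_inv. ring.
    cbn [Rsum]. rewrite IHn, S_INR. replace (INR n + 1 + 1 / 2) with (INR n + 3 / 2) by field. ring. }
  assert (H0 : is_lim_seq (fun n => / (INR n + 1 / 2) ^ k) 0).
  { apply is_lim_seq_squeeze0 with (fun n => 2 ^ k * / (INR n + 1 / 2)).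
    - intro n. assert (P := pos_INR n). assert (Pp : 0 < (INR n + 1 / 2) ^ k) by (apply pow_lt; lra).
      split. left; now apply Rinv_0_lt_compat.
      destruct k; [lia|].
      replace (2 ^ S k * / (INR n + 1 / 2)) with (2 * / ((INR n + 1 / 2) * / 2 ^ k)).
      2: { simpl. field. split. lra. apply pow_nonzero; lra. }
      assert (Q : / 2 ^ k <= (INR n + 1 / 2) ^ k).
      { rewrite <- pow_inv. apply pow_incr. lra. }
      assert (Q2 : 0 < / 2 ^ k) by (apply Rinv_0_lt_compat, pow_lt; lra).
      apply Rle_trans with (/ ((INR n + 1 / 2) * / 2 ^ k)).
      + apply Rinv_le_contravar. apply Rmult_lt_0_compat; lra. simpl. apply Rmult_le_compat_l; lra.
      + assert (0 < / ((INR n + 1 / 2) * / 2 ^ k)) by (apply Rinv_0_lt_compat, Rmult_lt_0_compat; lra). lra.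
    - apply is_lim_seq_scal0. apply is_lim_seq_inv_shift. }
  apply is_lim_seq_ext with (fun n => (2 * (2 ^ k * Rsum h (2 * n)) + (-2) * Rsum h n) + (- 2 ^ k + / (INR n + 1 / 2) ^ k)).
  { intro n. rewrite Rsum_plus, E2, E1. ring. }
  replace (2 * (2 ^ k - 1) * z - 2 ^ k) with ((2 * (2 ^ k * z) + (-2) * z) + (- 2 ^ k + 0)) by ring.
  assert (Hz2 : is_lim_seq (fun n => Rsum h (2 * n)) z).
  { apply (is_lim_seq_subseq (Rsum h)); auto. intros P [N HN]. exists N. intros n Hn. apply HN. lia. }
  apply is_lim_seq_plus'. apply is_lim_seq_plus'.
  - apply (is_lim_seq_scal_l _ 2 (2 ^ k * z)). apply (is_lim_seq_scal_l _ (2 ^ k) z). exact Hz2.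
  - apply (is_lim_seq_scal_l _ (-2) z). exact Hz.
  - apply is_lim_seq_plus'. apply is_lim_seq_const. exact H0.
Qed.

Lemma offlat_half_i : offlat (Ci / 2) (1 / 2).
Proof.
  split. lra. intro j. assert (P := pos_INR j).
  replace (Ci / 2 + Ci * INR j)%C with (Ci * RtoC (INR j + 1 / 2))%C by (rewrite RtoC_plus, RtoC_div by lra; field).
  replace (Ci / 2 - Ci * INR j)%C with (Ci * RtoC (1 / 2 - INR j))%C by (rewrite RtoC_minus, RtoC_div by lra; field).
  rewrite !Cmod_Ci_mult, !Cmod_R. split. rewrite Rabs_pos_eq; lra.
  destruct j. simpl. rewrite Rabs_pos_eq; lra. rewrite S_INR, Rabs_left; generalize (pos_INR j); lra.
Qed.

Lemma Csh_half_i_nz : Csh (Ci / 2) <> 0.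
Proof.
  rewrite Csh_half_i. intro E. apply Ci_nz. replace Ci with (Ci / PI * PI)%C by cfield. rewrite E; ring.
Qed.

Lemma lam2_half_i : lam2 (Ci / 2) = RtoC (- (PI * PI)).
Proof.
  unfold lam2. rewrite Csh_half_i, RtoC_opp, RtoC_mult.
  replace (/ (Ci / PI) * / (Ci / PI))%C with (PI * PI * / (Ci * Ci))%C by cfield. rewrite Ci_sq. field.
Qed.

Lemma half_i_points (j : nat) :
  (Ci / 2 + Ci * INR (S j))%C = (Ci * RtoC (INR j + 3 / 2))%C /\
  (Ci / 2 - Ci * INR (S j))%C = (- (Ci * RtoC (INR j + 1 / 2)))%C.
Proof.
  rewrite !S_INR, !RtoC_plus, !RtoC_div by lra. split; field.
Qed.

(** Partial fractions at $s=i/2$, where [lam2] equals $-\pi^2$, leave a linear equation for the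
    value. *)
Lemma zeta2 : rsum (fun j => / (INR j + 1) ^ 2) (PI ^ 2 / 6).
Proof.
  destruct rsum_inv_sq_ex as [z Hz]. replace (PI ^ 2 / 6) with z; auto.
  assert (H := half_integer_sum 2 z ltac:(lia) Hz).
  assert (L := lam2_lattice _ _ Csh_half_i_nz offlat_half_i).
  apply rsum_scal with (k := -1) in H. apply rsum_cvg in H.
  apply csum_ext with (b := fun j => RtoC (-1 * (/ (INR j + 1 / 2) ^ 2 + / (INR j + 3 / 2) ^ 2))) in L.
  - assert (E := csum_unique _ _ _ L H).
    rewrite lam2_half_i in E.
    replace (/ (Ci / 2) ^ 2)%C with (RtoC (-4)) in E.
    + rewrite <- RtoC_minus in E. apply RtoC_inj in E. lra.
    + replace (/ (Ci / 2) ^ 2)%C with (4 * / (Ci * Ci))%C by (simpl; cfield). rewrite Ci_sq. 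
      replace (-4) with (- (4)) by ring. rewrite RtoC_opp. field.
  - intro j. destruct (half_i_points j) as [-> ->]. assert (P := pos_INR j).
    assert (N1 : RtoC (INR j + 1 / 2) <> 0) by (apply RtoC_nz; lra).
    assert (N2 : RtoC (INR j + 3 / 2) <> 0) by (apply RtoC_nz; lra).
    rewrite RtoC_mult, (RtoC_plus (/ _)), !RtoC_inv, !RtoC_pow by (apply pow_nonzero; lra).
    transitivity (/ (Ci * Ci) * (/ RtoC (INR j + 1 / 2) ^ 2 + / RtoC (INR j + 3 / 2) ^ 2))%C.
    simpl. cfield. rewrite Ci_sq. replace (-1) with (- (1)) by ring. rewrite RtoC_opp. simpl; field; auto.
Qed.

Lemma zeta4 : rsum (fun j => / (INR j + 1) ^ 4) (PI ^ 4 / 90).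
Proof.
  assert (HE : exists z, rsum (fun j => / (INR j + 1) ^ 4) z).
  { apply rsum_ex_le with (2 := zeta2). intro n. assert (P := INR_1_pos n). assert (P0 := pos_INR n). split. left; apply Rinv_0_lt_compat, pow_lt; auto.
    apply Rinv_le_contravar. now apply pow_lt. apply Rle_pow; [lra|lia]. }
  destruct HE as [z Hz].
  replace (PI ^ 4 / 90) with z; auto.
  assert (H := half_integer_sum 4 z ltac:(lia) Hz).
  assert (L := lam4_lattice _ _ Csh_half_i_nz offlat_half_i).
  apply rsum_cvg in H.
  apply csum_ext with (b := fun j => RtoC (/ (INR j + 1 / 2) ^ 4 + / (INR j + 3 / 2) ^ 4)) in L.
  - assert (E := csum_unique _ _ _ L H).
    unfold lam4 in E. rewrite lam2_half_i in E.
    replace (/ (Ci / 2) ^ 4)%C with (RtoC 16) in E.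
    + assert (E2 : RtoC ((PI * PI) * (PI * PI) / 3 - 16) = RtoC (2 * (2 ^ 4 - 1) * z - 2 ^ 4)).
      { rewrite <- E. rewrite RtoC_minus, RtoC_div, !RtoC_opp, !RtoC_mult by lra. field. }
      apply RtoC_inj in E2. lra.
    + replace (/ (Ci / 2) ^ 4)%C with (16 * (/ (Ci * Ci) * / (Ci * Ci)))%C by (simpl; cfield). rewrite Ci_sq. field.
  - intro j. destruct (half_i_points j) as [-> ->]. assert (P := pos_INR j).
    assert (N1 : RtoC (INR j + 1 / 2) <> 0) by (apply RtoC_nz; lra).
    assert (N2 : RtoC (INR j + 3 / 2) <> 0) by (apply RtoC_nz; lra).
    rewrite (RtoC_plus (/ _)), !RtoC_inv, !RtoC_pow by (apply pow_nonzero; lra).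
    transitivity (/ (Ci * Ci) * (/ (Ci * Ci)) * (/ RtoC (INR j + 1 / 2) ^ 4 + / RtoC (INR j + 3 / 2) ^ 4))%C.
    simpl. cfield. rewrite Ci_sq. simpl; field; auto.
Qed.

(** * Modularity of the Eisenstein sums *)

Lemma Cmod_Csh_Re (u : C) : Rabs (Re u) <= Cmod (Csh u).
Proof.
  assert (P := PI_RGT_0).
  apply Rsqr_incr_0_var. 2: apply Cmod_ge_0. rewrite <- Rsqr_abs.
  unfold Rsqr. replace (Cmod (Csh u) * Cmod (Csh u)) with (Cmod (Csh u) ^ 2) by ring.
  rewrite Cmod_Csh_sq. assert (A := sinh_sq_ge (PI * Re u)).
  apply Rmult_le_reg_r with (PI ^ 2). apply pow_lt; lra.
  match goal with |- _ <= ?X / _ * _ => replace (X / PI ^ 2 * PI ^ 2) with X by (field; lra) end.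
  generalize (Rle_0_sqr (sin (PI * Im u))). unfold Rsqr. simpl. lra.
Qed.

Lemma lam2_le (u : C) : 0 < Re u -> Cmod (lam2 u) <= / (Re u) ^ 2.
Proof.
  intros H. assert (A := Cmod_Csh_Re u). rewrite Rabs_pos_eq in A by lra.
  unfold lam2. rewrite Cmod_mult, Cmod_inv by now apply Csh_nz_Re. rewrite <- Rinv_mult.
  apply Rinv_le_contravar. now apply pow_lt. simpl; nra.
Qed.

Lemma Re_INR_mult (m : nat) (s : C) : Re (INR m * s) = INR m * Re s.
Proof. apply re_scal_l. Qed.

Lemma lam2_sum_ex (s : C) : 0 < Re s -> exists L, csum (fun m => lam2 (INR (S m) * s)) L.
Proof.
  intros H. apply csum_ex with (fun m => / (Re s) ^ 2 * / (INR m + 1) ^ 2) (/ (Re s) ^ 2 * (PI ^ 2 / 6)).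
  2: apply rsum_scal, zeta2.
  intro m. assert (P := INR_1_pos m).
  eapply Rle_trans. apply lam2_le; rewrite Re_INR_mult, S_INR; nra.
  rewrite Re_INR_mult, S_INR. right. field. lra.
Qed.

Lemma lam4_sum_ex (s : C) : 0 < Re s -> exists L, csum (fun m => lam4 (INR (S m) * s)) L.
Proof.
  intros H. set (c := Cmod (2 * (PI * PI) / 3)).
  assert (Hc : 0 <= c) by apply Cmod_ge_0.
  set (A := / (Re s) ^ 2 * / (Re s) ^ 2 + c * / (Re s) ^ 2).
  apply csum_ex with (fun m => A * / (INR m + 1) ^ 2) (A * (PI ^ 2 / 6)).
  2: apply rsum_scal, zeta2.
  intro m. assert (P := pos_INR m).
  assert (B : Cmod (lam2 (INR (S m) * s)) <= / (Re s) ^ 2 * / (INR m + 1) ^ 2).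
  { eapply Rle_trans. apply lam2_le; rewrite Re_INR_mult, S_INR; nra.
    rewrite Re_INR_mult, S_INR. right. field. lra. }
  assert (Q : 0 < / (Re s) ^ 2) by (apply Rinv_0_lt_compat, pow_lt; auto).
  assert (Q2 : / (INR m + 1) ^ 2 <= 1).
  { rewrite <- Rinv_1. apply Rinv_le_contravar. lra. nra. }
  assert (Q3 : 0 < / (INR m + 1) ^ 2) by (apply Rinv_0_lt_compat, pow_lt; lra).
  unfold lam4. set (x := / (Re s) ^ 2) in *. set (y := / (INR m + 1) ^ 2) in *.
  apply Rle_trans with ((x * y) * (x * y) + c * (x * y)).
  - apply Cmod_plus_le. now apply Cmod_mult_le. apply Cmod_mult_le; auto. apply Rle_refl.
  - unfold A. replace ((x * x + c * x) * y) with ((x * x) * y + c * (x * y)) by ring.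
    apply Rplus_le_compat_r. replace (x * y * (x * y)) with (x * x * y * y) by ring.
    rewrite <- (Rmult_1_r (x * x * y)) at 2. apply Rmult_le_compat_l; auto.
    apply Rmult_le_pos; nra.
Qed.

(** Both $m+1$ and $j+1$ are $O(|z|)$ at the lattice point $z$, so their product is $O(|z|^2)$: this
    decouples the indices and supplies the product majorants for [csum_swap]. The range of [l]
    contains [m+1] and the two midpoints [m+1/2] and [m+3/2]. *)
Lemma lattice_point_lower (s : C) : 0 < Re s -> exists k, 0 < k /\
  forall (m j : nat) (l : R), (INR m + 1) / 2 <= l <= 3 * (INR m + 1) / 2 ->
   (INR m + 1) * (INR j + 1) <= k * Cmod (l * s + Ci * INR (S j)) ^ 2 /\
   (INR m + 1) * (INR j + 1) <= k * Cmod (l * s - Ci * INR (S j)) ^ 2.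
Proof.
  intros H. assert (Hs := Cmod_ge_0 s).
  exists (2 / Re s * (1 + 3 * Cmod s / Re s)). split.
  { apply Rmult_lt_0_compat. apply Rdiv_lt_0_compat; lra.
    assert (0 <= 3 * Cmod s / Re s). { apply Rmult_le_pos. lra. left; now apply Rinv_0_lt_compat. } lra. }
  intros m j l Hl. assert (P := INR_1_pos m). assert (Pj := INR_1_pos j).
  assert (Q : forall X, l * Re s <= X -> INR j + 1 - l * Cmod s <= X ->
    (INR m + 1) * (INR j + 1) <= 2 / Re s * (1 + 3 * Cmod s / Re s) * X ^ 2).
  { intros X H1 H2. assert (HX : 0 < X) by nra.
    assert (A : INR m + 1 <= 2 / Re s * X).
    { apply Rmult_le_reg_r with (Re s); auto. replace (2 / Re s * X * Re s) with (2 * X) by (field; lra). nra. }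
    assert (B : INR j + 1 <= (1 + 3 * Cmod s / Re s) * X).
    { apply Rmult_le_reg_r with (Re s); auto.
      replace ((1 + 3 * Cmod s / Re s) * X * Re s) with (X * Re s + 3 * Cmod s * X) by (field; lra).
      assert ((INR j + 1) * Re s <= (X + l * Cmod s) * Re s) by nra.
      assert (l * Re s * Cmod s <= X * Cmod s) by nra. nra. }
    replace (2 / Re s * (1 + 3 * Cmod s / Re s) * X ^ 2) with ((2 / Re s * X) * ((1 + 3 * Cmod s / Re s) * X)) by ring.
    apply Rmult_le_compat; lra. }
  assert (El : Cmod (l * s) = l * Cmod s) by (rewrite Cmod_mult, Cmod_R, Rabs_pos_eq; lra).
  split; apply Q.
  - eapply Rle_trans; [|apply Re_le_Cmod]. eapply Rle_trans; [|apply Rle_abs]. right. csimpl. ring.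
  - assert (A := Cmod_triangle_rev (l * s) (Ci * INR (S j))). rewrite Cmod_Ci_INR, El in A.
    assert (E := S_INR j). lra.
  - eapply Rle_trans; [|apply Re_le_Cmod]. eapply Rle_trans; [|apply Rle_abs]. right. csimpl. ring.
  - assert (A := Cmod_triangle_rev (l * s) (- (Ci * INR (S j)))). rewrite Cmod_opp, Cmod_Ci_INR, El in A.
    assert (E := S_INR j). unfold Cminus. lra.
Qed.

Lemma Re_plus_Ci (z : C) (x : R) : Re (z + Ci * x) = Re z /\ Re (z - Ci * x) = Re z.
Proof. unfold Re, Ci, RtoC, Cminus, Cplus, Copp, Cmult; simpl. split; ring. Qed.

Lemma Re_inv_pos (s : C) : 0 < Re s -> 0 < Re (/ s).
Proof.
  intros H. replace (Re (/ s)) with (Re s / (Re s ^ 2 + Im s ^ 2)) by (csimpl; reflexivity).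
  apply Rdiv_lt_0_compat; auto. nra.
Qed.

Lemma Re_nz (s : C) : 0 < Re s -> s <> 0.
Proof. intros H E. rewrite E in H. csimpl. lra. Qed.

Lemma Cmod_inv_le (z : C) (k : R) : 0 < k -> k <= Cmod z -> Cmod (/ z) <= / k.
Proof.
  intros Hk H. rewrite Cmod_inv by (apply Cmod_gt_0; lra). now apply Rinv_le_contravar.
Qed.

Lemma Re_INR_S_pos (m : nat) (s : C) : 0 < Re s -> 0 < Re (INR (S m) * s).
Proof. intros H. rewrite Re_INR_mult, S_INR. generalize (INR_1_pos m); nra. Qed.

Lemma dual_point (s : C) (m j : nat) : s <> 0 ->
  (INR (S m) * s + Ci * INR (S j) = Ci * s * (INR (S j) * / s - Ci * INR (S m)))%C /\
  (INR (S m) * s - Ci * INR (S j) = - (Ci * s) * (INR (S j) * / s + Ci * INR (S m)))%C.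
Proof.
  intros Hs. split.
  - transitivity (- (Ci * Ci) * (INR (S m) * s) + Ci * INR (S j))%C. rewrite Ci_sq; ring. field; auto.
  - transitivity (- (Ci * Ci) * (INR (S m) * s) - Ci * INR (S j))%C. rewrite Ci_sq; ring. field; auto.
Qed.

Lemma Cmod_inv_pow4_le (z : C) (p k : R) : 0 < p -> 0 < k -> p <= k * Cmod z ^ 2 ->
  Cmod (/ z ^ 4) <= k ^ 2 / p ^ 2.
Proof.
  intros Hp Hk H.
  assert (Hz : 0 < Cmod z ^ 2) by nra.
  assert (Hz0 : z <> 0). { intro E; rewrite E, Cmod_0 in Hz; lra. }
  replace (k ^ 2 / p ^ 2) with (/ (p / k) ^ 2) by (field; lra).
  apply Cmod_inv_le. apply pow_lt, Rdiv_lt_0_compat; lra.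
  rewrite Cmod_pow. replace (Cmod z ^ 4) with ((Cmod z ^ 2) ^ 2) by ring.
  apply pow_incr. split. left; apply Rdiv_lt_0_compat; lra.
  apply Rmult_le_reg_r with k; auto. unfold Rdiv. rewrite Rmult_assoc, Rinv_l; lra.
Qed.

(** Sum $(ms\pm ij)^{-4}$ over $m,j\ge 1$ by rows and by columns. Factoring out $is$ turns a column
    into a row for $1/s$, and the points on the axes contribute the two terms with $\zeta(4)$. *)
Lemma lam4_modular (s L L' : C) : 0 < Re s ->
  csum (fun m => lam4 (INR (S m) * s)) L -> csum (fun m => lam4 (INR (S m) * / s)) L' ->
  (L - (PI ^ 4 / 90)%R / s ^ 4 = L' / s ^ 4 - (PI ^ 4 / 90)%R)%C.
Proof.
  intros H HL HL'.
  assert (Hs := Re_nz s H). assert (H' := Re_inv_pos s H).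
  assert (Hs4 : (s ^ 4)%C <> 0) by now apply Cpow_nz.
  assert (Z := zeta4). apply rsum_cvg in Z.
  destruct (lattice_point_lower s H) as [k [Hk HB]].
  set (a := fun m j => (/ (INR (S m) * s + Ci * INR (S j)) ^ 4 + / (INR (S m) * s - Ci * INR (S j)) ^ 4)%C).
  assert (Hr : forall m, csum (a m) (lam4 (INR (S m) * s) - / (INR (S m) * s) ^ 4)%C).
  { intro m. apply lam4_lattice with (Re (INR (S m) * s));
        [apply Csh_nz_Re | apply offlat_Re]; now apply Re_INR_S_pos. }
  assert (Hc : forall j, csum (fun m => a m j) (/ s ^ 4 * (lam4 (INR (S j) * / s) - / (INR (S j) * / s) ^ 4))%C).
  { intro j. apply csum_ext with (fun m => / s ^ 4 *
       (/ (INR (S j) * / s + Ci * INR (S m)) ^ 4 + / (INR (S j) * / s - Ci * INR (S m)) ^ 4))%C.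
    - intro m. unfold a. destruct (dual_point s m j Hs) as [-> ->].
      set (u := (INR (S j) * / s + Ci * INR (S m))%C). set (v := (INR (S j) * / s - Ci * INR (S m))%C).
      assert (Hu : u <> 0). { apply Re_nz. unfold u. rewrite (proj1 (Re_plus_Ci _ _)). now apply Re_INR_S_pos. }
      assert (Hv : v <> 0). { apply Re_nz. unfold v. rewrite (proj2 (Re_plus_Ci _ _)). now apply Re_INR_S_pos. }
      transitivity (/ (Ci * Ci) * / (Ci * Ci) * / s ^ 4 * (/ u ^ 4 + / v ^ 4))%C.
      rewrite Ci_sq. simpl. cfield. simpl. cfield.
    - apply csum_scal. apply lam4_lattice with (Re (INR (S j) * / s));
        [apply Csh_nz_Re | apply offlat_Re]; now apply Re_INR_S_pos. }
  assert (Hsr : csum (fun m => lam4 (INR (S m) * s) - / (INR (S m) * s) ^ 4)%C (L - / s ^ 4 * (PI ^ 4 / 90)%R)%C).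
  { apply csum_minus; auto.
    apply csum_ext with (fun m => / s ^ 4 * RtoC (/ (INR m + 1) ^ 4))%C.
    - intro m. rewrite RtoC_inv, RtoC_pow, <- S_INR by (apply pow_nonzero; generalize (INR_1_pos m); lra).
      assert (N := CINR_S_nz m). rewrite Cpow_mult_l. assert ((RtoC (INR (S m)) ^ 4)%C <> 0) by now apply Cpow_nz. cfield.
    - now apply csum_scal. }
  assert (Hsc : csum (fun j => / s ^ 4 * (lam4 (INR (S j) * / s) - / (INR (S j) * / s) ^ 4))%C
      (/ s ^ 4 * L' - (PI ^ 4 / 90)%R)%C).
  { apply csum_ext with (fun j => / s ^ 4 * lam4 (INR (S j) * / s) - RtoC (/ (INR j + 1) ^ 4))%C.
    - intro m. rewrite RtoC_inv, RtoC_pow, <- S_INR by (apply pow_nonzero; generalize (INR_1_pos m); lra).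
      assert (N := CINR_S_nz m). assert ((RtoC (INR (S m)) ^ 4)%C <> 0) by now apply Cpow_nz.
      rewrite Cpow_mult_l, Cpow_inv by auto. cfield. 
    - apply csum_minus; auto. now apply csum_scal. }
  assert (Hd : forall m j, Cmod (a m j) <= (2 * k ^ 2 * / (INR m + 1) ^ 2) * / (INR j + 1) ^ 2).
  { intros m j. assert (P := INR_1_pos m). assert (Pj := INR_1_pos j).
    destruct (HB m j (INR (S m)) ltac:(rewrite S_INR; split; lra)) as [B1 B2].
    replace (2 * k ^ 2 * / (INR m + 1) ^ 2 * / (INR j + 1) ^ 2)
      with (k ^ 2 / ((INR m + 1) * (INR j + 1)) ^ 2 + k ^ 2 / ((INR m + 1) * (INR j + 1)) ^ 2) by (field; lra).
    apply Cmod_plus_le; apply Cmod_inv_pow4_le; auto using Rmult_lt_0_compat. }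
  assert (E := csum_swap a _ _ _ _ _ _ _ Hd (fun m => ltac:(
      apply Rmult_le_pos; [nra | left; apply Rinv_0_lt_compat, pow_lt, INR_1_pos]))
    (fun j => Rlt_le _ _ (Rinv_0_lt_compat _ (pow_lt _ 2 (INR_1_pos j))))
    (rsum_scal _ _ _ zeta2) zeta2 Hr Hc Hsr).
  assert (E3 := csum_unique _ _ _ E Hsc). unfold Cdiv. rewrite !(Cmult_comm _ (/ s ^ 4)). exact E3.
Qed.

Lemma kap_near_PI (u : C) : 0 < Re u -> Cmod (kap u - PI) <= / Re u.
Proof.
  intros H. assert (Hn := Csh_nz_Re u H). assert (L := Cmod_Csh_Re u).
  rewrite Rabs_pos_eq in L by lra.
  replace (kap u - PI)%C with (Cexp (- (PI * u)) / Csh u)%C.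
  2: { unfold kap. replace (Cexp (- (PI * u))) with (Cch u - PI * Csh u)%C. field; auto.
       unfold Cch, Csh. cfield. }
  rewrite Cmod_div, Cmod_Cexp, re_opp, re_scal_l by auto.
  assert (exp (- (PI * Re u)) <= 1).
  { rewrite <- exp_0. apply exp_mono. generalize PI_RGT_0; nra. }
  unfold Rdiv. rewrite <- (Rmult_1_l (/ Re u)).
  apply Rmult_le_compat; auto. left; apply exp_pos. left; apply Rinv_0_lt_compat; lra.
  apply Rinv_le_contravar; lra.
Qed.

Lemma Re_RtoC_mult (x : R) (s : C) : Re (x * s) = x * Re s.
Proof. apply re_scal_l. Qed.

Lemma INR_half_pos (m : nat) : 0 < INR m + 1 / 2.
Proof. generalize (pos_INR m); lra. Qed.

Lemma kap_cvg (s : C) : 0 < Re s -> cvg (fun m => kap (RtoC (INR m + 1 / 2) * s)) PI.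
Proof.
  intros H. apply cvg_bound with (fun m => / Re s * / (INR m + 1 / 2)).
  - intro m. assert (P := INR_half_pos m).
    eapply Rle_trans. apply kap_near_PI; rewrite Re_RtoC_mult; nra.
    rewrite Re_RtoC_mult. right. field. lra.
  - apply is_lim_seq_scal0, is_lim_seq_inv_shift.
Qed.

Lemma inv_half_cvg (s z : C) : 0 < Re s -> Re z = 0 -> cvg (fun m => / (RtoC (INR m + 1 / 2) * s + z))%C 0.
Proof.
  intros H Hz. apply cvg_bound with (fun m => / Re s * / (INR m + 1 / 2)).
  - intro m. assert (P := INR_half_pos m).
    replace (/ (RtoC (INR m + 1 / 2) * s + z) - 0)%C with (/ (RtoC (INR m + 1 / 2) * s + z))%C by ring.
    rewrite <- Rinv_mult. apply Cmod_inv_le. nra.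
    eapply Rle_trans; [|apply Re_le_Cmod]. eapply Rle_trans; [|apply Rle_abs].
    rewrite re_plus, Hz, Re_RtoC_mult. lra.
  - apply is_lim_seq_scal0, is_lim_seq_inv_shift.
Qed.

Lemma Re_Ci_R (x : R) : Re (Ci * x) = 0.
Proof. unfold Re, Ci, RtoC, Cmult; simpl; ring. Qed.

Lemma Cmod_ge_of_sq (z : C) (p k : R) : 0 <= p -> 0 < k -> p <= k * Cmod z ^ 2 -> sqrt (p / k) <= Cmod z.
Proof.
  intros Hp Hk H. rewrite <- (sqrt_Rsqr (Cmod z)) by apply Cmod_ge_0.
  apply sqrt_le_1_alt. apply Rmult_le_reg_r with k; auto. unfold Rdiv.
  rewrite Rmult_assoc, Rinv_l by lra. unfold Rsqr. lra.
Qed.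

(** The midpoint comparison
    [1/z^2 - (1/(z-s/2) - 1/(z+s/2))/s = - (s^2/4) / (z^2 (z-s/2) (z+s/2))]
    turns the conditionally convergent double sum of [1/z^2] into an absolutely convergent one. *)
Lemma midpoint_identity (z s : C) : s <> 0 -> z <> 0 -> (z - s / 2)%C <> 0 -> (z + s / 2)%C <> 0 ->
  (/ z ^ 2 - / s * (/ (z - s / 2) - / (z + s / 2)) = - (s ^ 2 / 4) * (/ z * / z * / (z - s / 2) * / (z + s / 2)))%C.
Proof.
  intros H1 H2 H3 H4.
  assert (H3' : (2 * z - s)%C <> 0) by (intro E; apply H3; replace (z - s / 2)%C with ((2 * z - s) / 2)%C by field; rewrite E; field).
  assert (H4' : (2 * z + s)%C <> 0) by (intro E; apply H4; replace (z + s / 2)%C with ((2 * z + s) / 2)%C by field; rewrite E; field).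
  simpl. field. repeat split; auto; now rewrite (Cmult_comm z 2).
Qed.

Lemma midpoint_bound (z s : C) (p k : R) : 0 < p -> 0 < k ->
  p <= k * Cmod z ^ 2 -> p <= k * Cmod (z - s / 2) ^ 2 -> p <= k * Cmod (z + s / 2) ^ 2 ->
  Cmod (- (s ^ 2 / 4) * (/ z * / z * / (z - s / 2) * / (z + s / 2))) <= Cmod (s ^ 2 / 4) * (k ^ 2 / p ^ 2).
Proof.
  intros Hp Hk H1 H2 H3.
  apply Cmod_ge_of_sq in H1, H2, H3; auto; try lra.
  set (q := sqrt (p / k)) in *.
  assert (Hpk : 0 < p / k) by now apply Rdiv_lt_0_compat.
  assert (Hq : 0 < q) by now apply sqrt_lt_R0.
  assert (Hq2 : q * q = p / k) by (apply sqrt_sqrt; lra).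
  apply Cmod_mult_le. rewrite Cmod_opp; apply Rle_refl.
  replace (k ^ 2 / p ^ 2) with (/ q * / q * / q * / q).
  - repeat apply Cmod_mult_le; now apply Cmod_inv_le.
  - rewrite <- !Rinv_mult. replace (q * q * q * q) with ((q * q) * (q * q)) by ring. rewrite Hq2. field. lra.
Qed.

(** After subtracting the midpoint differences the double sum converges absolutely and may be
    exchanged. The subtracted part is not symmetric: over rows it telescopes to [kp O - PI], over
    columns to [kp O]. The discrepancy, divided by [s], is the quasi-modular correction. *)
Lemma lam2_modular (s L L' : C) : 0 < Re s ->
  csum (fun m => lam2 (INR (S m) * s)) L -> csum (fun m => lam2 (INR (S m) * / s)) L' ->
  (L + L' / s ^ 2 = (PI ^ 2 / 6)%R * (1 + / s ^ 2) - PI / s)%C.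
Proof.
  intros H HL HL'.
  assert (Hs := Re_nz s H). assert (H' := Re_inv_pos s H).
  assert (Hs2 : (s ^ 2)%C <> 0) by now apply Cpow_nz.
  assert (Z := zeta2). apply rsum_cvg in Z.
  destruct (lattice_point_lower s H) as [k [Hk HB]].
  assert (E1 : forall m, (INR (S m) * s - s / 2 = RtoC (INR m + 1 / 2) * s)%C).
  { intro m. rewrite S_INR, !RtoC_plus, RtoC_div by lra. field. }
  assert (E2 : forall m, (INR (S m) * s + s / 2 = RtoC (INR (S m) + 1 / 2) * s)%C).
  { intro m. rewrite RtoC_plus, RtoC_div by lra. field. }
  set (h := fun z : C => (- (s ^ 2 / 4) * (/ z * / z * / (z - s / 2) * / (z + s / 2)))%C).
  set (a := fun m j => (h (INR (S m) * s + Ci * INR (S j)) + h (INR (S m) * s - Ci * INR (S j)))%C).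
  set (w := fun (j m : nat) => (/ (RtoC (INR m + 1 / 2) * s + Ci * INR (S j)) + / (RtoC (INR m + 1 / 2) * s - Ci * INR (S j)))%C).
  assert (Pw : forall m, 0 < Re (RtoC (INR m + 1 / 2) * s)).
  { intro m. rewrite Re_RtoC_mult. generalize (INR_half_pos m); nra. }
  assert (Ea : forall m j, a m j =
     ((/ (INR (S m) * s + Ci * INR (S j)) ^ 2 + / (INR (S m) * s - Ci * INR (S j)) ^ 2)
       - / s * (w j m - w j (S m)))%C).
  { intros m j. unfold a, h, w. rewrite <- E1, <- E2.
    rewrite <- !midpoint_identity; auto.
    - replace (INR (S m) * s + Ci * INR (S j) - s / 2)%C with (INR (S m) * s - s / 2 + Ci * INR (S j))%C by ring.
      replace (INR (S m) * s + Ci * INR (S j) + s / 2)%C with (INR (S m) * s + s / 2 + Ci * INR (S j))%C by ring.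
      replace (INR (S m) * s - Ci * INR (S j) - s / 2)%C with (INR (S m) * s - s / 2 - Ci * INR (S j))%C by ring.
      replace (INR (S m) * s - Ci * INR (S j) + s / 2)%C with (INR (S m) * s + s / 2 - Ci * INR (S j))%C by ring.
      ring.
    - apply Re_nz. rewrite (proj2 (Re_plus_Ci _ _)). now apply Re_INR_S_pos.
    - replace (INR (S m) * s - Ci * INR (S j) - s / 2)%C with (INR (S m) * s - s / 2 - Ci * INR (S j))%C by ring.
      apply Re_nz. rewrite (proj2 (Re_plus_Ci _ _)), E1. apply Pw.
    - replace (INR (S m) * s - Ci * INR (S j) + s / 2)%C with (INR (S m) * s + s / 2 - Ci * INR (S j))%C by ring.
      apply Re_nz. rewrite (proj2 (Re_plus_Ci _ _)), E2. apply Pw.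
    - apply Re_nz. rewrite (proj1 (Re_plus_Ci _ _)). now apply Re_INR_S_pos.
    - replace (INR (S m) * s + Ci * INR (S j) - s / 2)%C with (INR (S m) * s - s / 2 + Ci * INR (S j))%C by ring.
      apply Re_nz. rewrite (proj1 (Re_plus_Ci _ _)), E1. apply Pw.
    - replace (INR (S m) * s + Ci * INR (S j) + s / 2)%C with (INR (S m) * s + s / 2 + Ci * INR (S j))%C by ring.
      apply Re_nz. rewrite (proj1 (Re_plus_Ci _ _)), E2. apply Pw. }
  set (kp := fun m : nat => (kap (RtoC (INR m + 1 / 2) * s) - / (RtoC (INR m + 1 / 2) * s))%C).
  assert (Hw : forall m, csum (fun j => w j m) (kp m)).
  { intro m. apply kap_lattice with (Re (RtoC (INR m + 1 / 2) * s));
        [apply Csh_nz_Re | apply offlat_Re]; apply Pw. }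
  assert (Hr : forall m, csum (a m)
     ((lam2 (INR (S m) * s) - / (INR (S m) * s) ^ 2) - / s * (kp m - kp (S m)))%C).
  { intro m. eapply csum_ext. intro j; symmetry; apply Ea.
    apply csum_minus. 2: apply csum_scal, csum_minus; apply Hw.
    apply lam2_lattice with (Re (INR (S m) * s));
        [apply Csh_nz_Re | apply offlat_Re]; now apply Re_INR_S_pos. }
  assert (Hc : forall j, csum (fun m => a m j)
     (- / s ^ 2 * (lam2 (INR (S j) * / s) - / (INR (S j) * / s) ^ 2) - / s * w j O)%C).
  { intro j. eapply csum_ext. intro m; symmetry; apply Ea.
    apply csum_minus.
    - apply csum_ext with (fun m => - / s ^ 2 *
       (/ (INR (S j) * / s + Ci * INR (S m)) ^ 2 + / (INR (S j) * / s - Ci * INR (S m)) ^ 2))%C.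
      + intro m. destruct (dual_point s m j Hs) as [-> ->].
        set (u := (INR (S j) * / s + Ci * INR (S m))%C). set (v := (INR (S j) * / s - Ci * INR (S m))%C).
        assert (Hu : u <> 0). { apply Re_nz. unfold u. rewrite (proj1 (Re_plus_Ci _ _)). now apply Re_INR_S_pos. }
        assert (Hv : v <> 0). { apply Re_nz. unfold v. rewrite (proj2 (Re_plus_Ci _ _)). now apply Re_INR_S_pos. }
        transitivity (/ (Ci * Ci) * / s ^ 2 * (/ u ^ 2 + / v ^ 2))%C.
        rewrite Ci_sq. simpl. cfield. simpl. cfield.
      + apply csum_scal. apply lam2_lattice with (Re (INR (S j) * / s));
        [apply Csh_nz_Re | apply offlat_Re]; now apply Re_INR_S_pos.
    - apply csum_scal. replace (w j O) with (w j O - 0)%C by ring. apply csum_telescope.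
      unfold w. replace (RtoC 0) with (0 + 0)%C by ring. apply cvg_plus.
      + apply inv_half_cvg; auto. apply Re_Ci_R.
      + unfold Cminus. apply inv_half_cvg; auto. rewrite re_opp, Re_Ci_R. ring. }
  (* Here $\pi$ enters: for a fixed [j] the terms [w j m] tend to 0 with [m], but their sum over [j]
     tends to $\pi$. *)
  assert (Ekp : csum (fun m => kp m - kp (S m))%C (kp O - PI)%C).
  { apply csum_telescope. unfold kp. replace (RtoC PI) with (PI - 0)%C by ring. apply cvg_minus.
    now apply kap_cvg.
    apply cvg_ext with (fun m => / (RtoC (INR m + 1 / 2) * s + 0))%C. intro m; f_equal; ring.
    apply inv_half_cvg; auto. }
  assert (Hsr : csum (fun m => (lam2 (INR (S m) * s) - / (INR (S m) * s) ^ 2) - / s * (kp m - kp (S m)))%C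
     ((L - / s ^ 2 * (PI ^ 2 / 6)%R) - / s * (kp O - PI))%C).
  { apply csum_minus. 2: now apply csum_scal. apply csum_minus; auto.
    apply csum_ext with (fun m => / s ^ 2 * RtoC (/ (INR m + 1) ^ 2))%C.
    - intro m. rewrite RtoC_inv, RtoC_pow, <- S_INR by (apply pow_nonzero; generalize (INR_1_pos m); lra).
      assert (N := CINR_S_nz m). rewrite Cpow_mult_l. assert ((RtoC (INR (S m)) ^ 2)%C <> 0) by now apply Cpow_nz. cfield.
    - now apply csum_scal. }
  assert (Hsc : csum (fun j => - / s ^ 2 * (lam2 (INR (S j) * / s) - / (INR (S j) * / s) ^ 2) - / s * w j O)%C
      ((- / s ^ 2 * L' + (PI ^ 2 / 6)%R) - / s * kp O)%C).
  { apply csum_minus. 2: apply csum_scal, Hw.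
    apply csum_ext with (fun j => - / s ^ 2 * lam2 (INR (S j) * / s) + RtoC (/ (INR j + 1) ^ 2))%C.
    - intro m. rewrite RtoC_inv, RtoC_pow, <- S_INR by (apply pow_nonzero; generalize (INR_1_pos m); lra).
      assert (N := CINR_S_nz m). assert ((RtoC (INR (S m)) ^ 2)%C <> 0) by now apply Cpow_nz.
      rewrite Cpow_mult_l, Cpow_inv by auto. cfield. 
    - apply csum_plus; auto. now apply csum_scal. }
  set (c := Cmod (s ^ 2 / 4)). assert (Hc0 : 0 <= c) by apply Cmod_ge_0.
  assert (Hd : forall m j, Cmod (a m j) <= (2 * c * k ^ 2 * / (INR m + 1) ^ 2) * / (INR j + 1) ^ 2).
  { intros m j. assert (P := INR_1_pos m). assert (P0 := pos_INR m). assert (Pj := INR_1_pos j).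
    destruct (HB m j (INR (S m)) ltac:(rewrite S_INR; split; lra)) as [B1 B2].
    destruct (HB m j (INR m + 1 / 2) ltac:(split; lra)) as [B3 B4].
    destruct (HB m j (INR (S m) + 1 / 2) ltac:(rewrite S_INR; split; lra)) as [B5 B6].
    rewrite <- E1 in B3, B4. rewrite <- E2 in B5, B6.
    replace (2 * c * k ^ 2 * / (INR m + 1) ^ 2 * / (INR j + 1) ^ 2)
      with (c * (k ^ 2 / ((INR m + 1) * (INR j + 1)) ^ 2) + c * (k ^ 2 / ((INR m + 1) * (INR j + 1)) ^ 2)) by (field; lra).
    apply Cmod_plus_le; apply midpoint_bound; auto using Rmult_lt_0_compat.
    - replace (INR (S m) * s + Ci * INR (S j) - s / 2)%C with (INR (S m) * s - s / 2 + Ci * INR (S j))%C by ring. auto.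
    - replace (INR (S m) * s + Ci * INR (S j) + s / 2)%C with (INR (S m) * s + s / 2 + Ci * INR (S j))%C by ring. auto.
    - replace (INR (S m) * s - Ci * INR (S j) - s / 2)%C with (INR (S m) * s - s / 2 - Ci * INR (S j))%C by ring. auto.
    - replace (INR (S m) * s - Ci * INR (S j) + s / 2)%C with (INR (S m) * s + s / 2 - Ci * INR (S j))%C by ring. auto. }
  assert (E := csum_swap a _ _ _ _ _ _ _ Hd (fun m => ltac:(
      apply Rmult_le_pos; [nra | left; apply Rinv_0_lt_compat, pow_lt, INR_1_pos]))
    (fun j => Rlt_le _ _ (Rinv_0_lt_compat _ (pow_lt _ 2 (INR_1_pos j))))
    (rsum_scal _ _ _ zeta2) zeta2 Hr Hc Hsr).
  assert (E3 := csum_unique _ _ _ E Hsc).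
  replace (L + L' / s ^ 2)%C with
    ((L - / s ^ 2 * (PI ^ 2 / 6)%R - / s * (kp O - PI)) - (- / s ^ 2 * L' + (PI ^ 2 / 6)%R - / s * kp O)
      + ((PI ^ 2 / 6)%R * (1 + / s ^ 2) - PI / s))%C.
  rewrite E3; ring. unfold Cdiv. ring.
Qed.

(** * Power sums *)

(** Write $r=t^2$. One factor $t^n$ absorbs one factor $n+1$, since $(n+1)t^n\le\sum_{k\le n}t^k\le
    1/(1-t)$; the other is left to the induction. *)
Lemma INR_pow_geom_bound (p : nat) (r : R) : 0 <= r < 1 ->
  exists K rho, 0 <= K /\ 0 <= rho < 1 /\ forall n : nat, (INR n + 1) ^ p * r ^ n <= K * rho ^ n.
Proof.
  revert r. induction p; intros r Hr.
  - exists 1, r. split. lra. split; auto. intro n; simpl; lra.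
  - assert (Hs : 0 <= sqrt r < 1).
    { split. apply sqrt_pos. rewrite <- sqrt_1. apply sqrt_lt_1_alt; lra. }
    assert (Hss : sqrt r * sqrt r = r) by (apply sqrt_sqrt; lra).
    set (t := sqrt r) in *. destruct (IHp t Hs) as [K [rho [HK [Hrho H]]]].
    assert (H1 : forall n : nat, (INR n + 1) * t ^ n <= / (1 - t)).
    { intro n. apply Rle_trans with (Rsum (fun k => t ^ k) (S n)).
      - rewrite <- S_INR, <- Rsum_const. apply Rsum_le. intros k Hk.
        replace n with (k + (n - k))%nat by lia. rewrite pow_add.
        rewrite <- (Rmult_1_r (t ^ k)) at 2. apply Rmult_le_compat_l. apply pow_le; lra.
        rewrite <- (pow1 (n - k)). apply pow_incr; lra.
      - apply Rmult_le_reg_l with (1 - t). lra. rewrite Rsum_geom, Rinv_r by lra.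
        assert (0 <= t ^ S n) by (apply pow_le; lra). lra. }
    exists (/ (1 - t) * K), rho. split. apply Rmult_le_pos; auto. left; apply Rinv_0_lt_compat; lra.
    split; auto. intro n. rewrite <- Hss, Rpow_mult_distr.
    replace ((INR n + 1) ^ S p * (t ^ n * t ^ n)) with ((INR n + 1) * t ^ n * ((INR n + 1) ^ p * t ^ n)) by (simpl; ring).
    rewrite (Rmult_assoc (/ _)). assert (P := INR_1_pos n). assert (0 <= t ^ n) by (apply pow_le; lra).
    apply Rmult_le_compat; auto. nra. apply Rmult_le_pos; auto. apply pow_le; lra.
Qed.

Lemma rsum_pow_geom (p : nat) (r : R) : 0 <= r < 1 -> exists l, rsum (fun n => (INR n + 1) ^ p * r ^ n) l.
Proof.
  intros Hr. destruct (INR_pow_geom_bound p r Hr) as [K [rho [HK [Hrho H]]]].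
  apply rsum_ex_le with (fun n => K * rho ^ n) (K * / (1 - rho)).
  - intro n. split; auto. apply Rmult_le_pos; apply pow_le. generalize (INR_1_pos n); lra. lra.
  - now apply rsum_scal, rsum_geom.
Qed.

Lemma csum_poly_geom (a : nat -> R) (p : nat) (q : C) : Cmod q < 1 ->
  (forall n, Rabs (a n) <= (INR n + 1) ^ p) -> exists l, csum (fun n => a n * q ^ n)%C l.
Proof.
  intros Hq H. destruct (rsum_pow_geom p (Cmod q)) as [l Hl]. split; auto. apply Cmod_ge_0.
  apply csum_ex with (2 := Hl). intro n. rewrite Cmod_mult, Cmod_R, Cmod_pow.
  apply Rmult_le_compat_r; auto. apply pow_le, Cmod_ge_0.
Qed.

(** [multichoose k n = binomial (n + k) k], the coefficient of [q^n] in [(1 - q)^(-(k+1))]. *)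
Fixpoint multichoose (k : nat) (n : nat) : R :=
  match k with O => 1 | S k' => Rsum (multichoose k') (S n) end.

Lemma multichoose_S (k n : nat) :
  multichoose (S k) (S n) = multichoose (S k) n + multichoose k (S n).
Proof. reflexivity. Qed.

Lemma multichoose_0 (k : nat) : multichoose k 0 = 1.
Proof. induction k; simpl in *; auto. rewrite IHk; ring. Qed.

Lemma multichoose_nonneg (k n : nat) : 0 <= multichoose k n.
Proof.
  revert n. induction k; intro n. simpl; lra.
  apply Rsum_nonneg. intros; apply IHk.
Qed.

Lemma multichoose_le (k n : nat) : multichoose k n <= (INR n + 1) ^ k.
Proof.
  revert n. induction k; intro n. simpl; lra.
  change (multichoose (S k) n) with (Rsum (multichoose k) (S n)).
  apply Rle_trans with (Rsum (fun _ => (INR n + 1) ^ k) (S n)).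
  - apply Rsum_le. intros i Hi. eapply Rle_trans. apply IHk. apply pow_incr. split.
    generalize (pos_INR i); lra. apply Rplus_le_compat_r, le_INR; lia.
  - rewrite Rsum_const, S_INR. simpl; lra.
Qed.

Lemma multichoose_absorb (k n : nat) :
  INR (S n) * multichoose k (S n) = INR (S k) * multichoose (S k) n.
Proof.
  revert n. induction k; intro n.
  - simpl (multichoose 0 _). rewrite Rmult_1_r. 
    assert (E : multichoose 1 n = INR (S n)).
    { induction n. simpl; ring. rewrite multichoose_S, IHn. rewrite (S_INR (S n)). reflexivity. }
    rewrite E. simpl (INR 1). ring.
  - induction n.
    + rewrite multichoose_S, !multichoose_0.
      assert (H := IHk O). rewrite multichoose_0 in H. simpl (INR 1) in *.
      rewrite (S_INR (S k)). lra.
    + rewrite (multichoose_S k), (multichoose_S (S k)).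
      replace (INR (S (S n)) * (multichoose (S k) (S n) + multichoose k (S (S n))))
        with (INR (S n) * multichoose (S k) (S n) + multichoose (S k) (S n) + INR (S (S n)) * multichoose k (S (S n)))
        by (rewrite (S_INR (S n)); ring).
      rewrite IHn, IHk. rewrite (S_INR (S k)). ring.
Qed.

Lemma Cmod_lt_1_nz (q : C) : Cmod q < 1 -> (1 - q)%C <> 0.
Proof.
  intros H E. assert (q = 1) by (replace q with (1 - (1 - q))%C by ring; rewrite E; ring).
  subst q. rewrite Cmod_1 in H; lra.
Qed.

Lemma multichoose_series (k : nat) (q : C) : Cmod q < 1 ->
  csum (fun n => multichoose k n * q ^ n)%C (/ (1 - q) ^ S k)%C.
Proof.
  intros Hq. assert (Hn := Cmod_lt_1_nz q Hq). induction k.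
  - rewrite Cpow_1_r. apply csum_ext with (fun n => q ^ n)%C. intro n; simpl; ring. now apply csum_geom.
  - destruct (csum_poly_geom (multichoose (S k)) (S k) q Hq) as [l Hl].
    { intro n. rewrite Rabs_pos_eq by apply multichoose_nonneg. apply multichoose_le. }
    replace (/ (1 - q) ^ S (S k))%C with l; auto.
    assert (H2 : csum (fun n => multichoose k n * q ^ n)%C (l - q * l)%C).
    { replace (l - q * l)%C with (multichoose (S k) 0 * q ^ 0 +
         ((l - multichoose (S k) 0 * q ^ 0) - q * l))%C by ring.
      assert (E0 : (multichoose k 0 * q ^ 0 = multichoose (S k) 0 * q ^ 0)%C) by now rewrite !multichoose_0.
      rewrite <- E0 at 1. apply -> (csum_incr (fun n => multichoose k n * q ^ n)%C).
      apply csum_ext with (fun n => multichoose (S k) (S n) * q ^ S n - q * (multichoose (S k) n * q ^ n))%C.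
      intro n. rewrite multichoose_S, RtoC_plus, Cpow_S; ring.
      apply csum_minus. 2: now apply csum_scal.
      apply <- (csum_incr (fun n => multichoose (S k) n * q ^ n)%C).
      replace (multichoose (S k) 0 * q ^ 0 + (l - multichoose (S k) 0 * q ^ 0))%C with l by ring. exact Hl. }
    assert (E := csum_unique _ _ _ H2 IHk).
    assert (E2 : ((1 - q) * l)%C = (/ (1 - q) ^ S k)%C) by (rewrite <- E; ring).
    rewrite (Cpow_S _ (S k)). assert (Hp := Cpow_nz _ (S k) Hn).
    replace l with ((1 - q) * l / (1 - q))%C by (field; auto). rewrite E2. field. auto.
Qed.

Definition delay (j : nat) (a : nat -> R) (n : nat) : R := if Nat.leb j n then a (n - j)%nat else 0.

Lemma csum_delay (a : nat -> R) (q l : C) (j : nat) :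
  csum (fun n => a n * q ^ n)%C l -> csum (fun n => delay j a n * q ^ n)%C (q ^ j * l)%C.
Proof.
  intros H. induction j.
  - simpl. replace (1 * l)%C with l by ring. apply csum_ext with (2 := H). intro n. unfold delay; simpl. now rewrite Nat.sub_0_r.
  - replace (q ^ S j * l)%C with (delay (S j) a 0 * q ^ 0 + q * (q ^ j * l))%C by (unfold delay; simpl; ring).
    apply -> (csum_incr (fun n => delay (S j) a n * q ^ n)%C).
    apply csum_ext with (fun n => q * (delay j a n * q ^ n))%C.
    intro n. rewrite Cpow_S. unfold delay. simpl. ring. now apply csum_scal.
Qed.

(** Worpitzky's identity; [e j] is [1/k!] times the [j]-th Eulerian number. *)
Lemma worpitzky (k : nat) : exists e : nat -> R,
  (forall j, 0 <= e j) /\ (forall j, (k < j)%nat -> e j = 0) /\ Rsum e (S k) = 1 /\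
  forall n, (INR n + 1) ^ k / INR (fact k) = Rsum (fun j => e j * delay j (multichoose k) n) (S k).
Proof.
  induction k.
  - exists (fun j => match j with O => 1 | _ => 0 end). repeat split.
    intros [|j]; lra. intros [|j] H; [lia | auto]. simpl; ring.
    intro n. simpl. unfold delay; simpl. field.
  - destruct IHk as [e [He0 [Hez [He1 He]]]].
    assert (Hk : 0 < INR (S k)) by (rewrite S_INR; apply INR_1_pos).
    (* The Eulerian recursion: of the weight at [j], the share $(j+1)/(k+1)$ stays and $(k-j)/(k+1)$
       moves to [j+1]. The total weight remains 1. *)
    set (c := fun j => ((INR j + 1) * e j) / INR (S k)).
    set (d := fun j => ((INR k - INR j) * e j) / INR (S k)).
    assert (Hcd : forall j, c j + d j = e j).
    { intro j. unfold c, d. rewrite S_INR in *. field. lra. }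
    assert (Hc : forall j, 0 <= c j).
    { intro j. apply Rmult_le_pos. apply Rmult_le_pos; auto. generalize (INR_1_pos j); lra.
      left; now apply Rinv_0_lt_compat. }
    assert (Hd : forall j, 0 <= d j).
    { intro j. destruct (le_lt_dec j k) as [L | L].
      - apply Rmult_le_pos. apply Rmult_le_pos; auto. apply le_INR in L; lra. left; now apply Rinv_0_lt_compat.
      - unfold d. rewrite Hez by auto. unfold Rdiv. lra. }
    assert (Hcz : c (S k) = 0) by (unfold c; rewrite Hez by lia; unfold Rdiv; ring).
    exists (fun j => c j + match j with O => 0 | S i => d i end).
    repeat split.
    + intros [|j]. specialize (Hc O); lra. specialize (Hc (S j)); specialize (Hd j); lra.
    + intros [|j] Hj. lia. unfold c, d. rewrite (Hez (S j)) by lia.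
      destruct (Nat.eq_dec j k) as [-> | Hn]. unfold Rdiv; ring. rewrite (Hez j) by lia. unfold Rdiv; ring.
    + rewrite Rsum_plus. change (Rsum c (S (S k))) with (Rsum c (S k) + c (S k)). rewrite Hcz.
      rewrite (Rsum_S (fun j => match j with O => 0 | S i => d i end)).
      transitivity (Rsum c (S k) + Rsum d (S k)). change (fun k0 => d k0) with d; ring.
      rewrite <- Rsum_plus, <- He1. apply Rsum_ext; auto.
    + intro n.
      replace ((INR n + 1) ^ S k / INR (fact (S k))) with ((INR n + 1) / INR (S k) * ((INR n + 1) ^ k / INR (fact k))).
      2: { change (fact (S k)) with (S k * fact k)%nat. rewrite mult_INR. change ((INR n + 1) ^ S k) with ((INR n + 1) * (INR n + 1) ^ k).
           field. split; [apply INR_fact_neq_0 | lra]. }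
      rewrite He, <- Rsum_scal.
      transitivity (Rsum (fun j => c j * delay j (multichoose (S k)) n + d j * delay (S j) (multichoose (S k)) n) (S k)).
      * apply Rsum_ext. intros j Hj. unfold c, d.
        transitivity (e j / INR (S k) * ((INR j + 1) * delay j (multichoose (S k)) n + (INR k - INR j) * delay (S j) (multichoose (S k)) n)).
        2: field; lra.
        replace ((INR n + 1) / INR (S k) * (e j * delay j (multichoose k) n)) with (e j / INR (S k) * ((INR n + 1) * delay j (multichoose k) n)) by (field; lra).
        f_equal. unfold delay.
        destruct (Nat.leb_spec j n) as [L | L]; destruct (Nat.leb_spec (S j) n) as [L' | L']; try lia.
        -- replace n with (j + S (n - S j))%nat by lia. set (m := (n - S j)%nat).
           replace (j + S m - j)%nat with (S m) by lia. replace (j + S m - S j)%nat with m by lia.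
           assert (E := multichoose_absorb k m). rewrite multichoose_S.
           rewrite plus_INR. rewrite !S_INR in *. nra.
        -- replace (n - j)%nat with O by lia. rewrite !multichoose_0. replace n with j by lia. ring.
        -- ring.
      * rewrite Rsum_plus.
        rewrite (Rsum_ext (fun j => (c j + match j with O => 0 | S i => d i end) * delay j (multichoose (S k)) n)
          (fun j => c j * delay j (multichoose (S k)) n + match j with O => 0 | S i => d i end * delay j (multichoose (S k)) n))
          by (intros; apply Rmult_plus_distr_r).
        rewrite Rsum_plus. f_equal.
        -- change (Rsum (fun j => c j * delay j (multichoose (S k)) n) (S (S k))) with
             (Rsum (fun j => c j * delay j (multichoose (S k)) n) (S k) + c (S k) * delay (S k) (multichoose (S k)) n).
           rewrite Hcz; ring.
        -- rewrite (Rsum_S (fun j => match j with O => 0 | S i => d i end * _)). ring.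
Qed.

(** Since the weights are nonnegative with sum 1, the numerator has modulus at most 1 on the unit
    disc and equals 1 at $q=1$; [power_sum_near] uses both facts, uniformly in [k]. *)
Lemma power_sum_rational (k : nat) : exists e : nat -> R,
  (forall j, 0 <= e j) /\ Rsum e (S k) = 1 /\
  forall q : C, Cmod q < 1 ->
   csum (fun n => RtoC ((INR n + 1) ^ k / INR (fact k)) * q ^ n)%C
        (Csum (fun j => e j * q ^ j)%C (S k) / (1 - q) ^ S k)%C.
Proof.
  destruct (worpitzky k) as [e [He0 [_ [He1 He]]]]. exists e. repeat split; auto.
  intros q Hq.
  assert (H : forall m, csum (fun n => RtoC (Rsum (fun j => e j * delay j (multichoose k) n)%R m) * q ^ n)%C
        (Csum (fun j => e j * q ^ j)%C m / (1 - q) ^ S k)%C).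
  { induction m; simpl.
    - replace (0 / _)%C with (Csum (fun n => RtoC 0 * q ^ n) 0)%C. apply csum_fin. intros; ring.
      simpl. unfold Cdiv. ring.
    - apply csum_ext with (fun n => RtoC (Rsum (fun j => e j * delay j (multichoose k) n)%R m) * q ^ n
           + e m * (delay m (multichoose k) n * q ^ n))%C.
      intro n. rewrite RtoC_plus, RtoC_mult. ring.
      unfold Cdiv. rewrite Cmult_plus_distr_r. apply csum_plus. exact IHm.
      rewrite <- Cmult_assoc. apply csum_scal, csum_delay. now apply multichoose_series. }
  apply csum_ext with (2 := H (S k)). intro n. now rewrite He.
Qed.

Lemma multichoose_closed (n : nat) :
  multichoose 1 n = INR n + 1 /\ multichoose 2 n = (INR n + 1) * (INR n + 2) / 2 /\
  multichoose 3 n = (INR n + 1) * (INR n + 2) * (INR n + 3) / 6.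
Proof.
  assert (E1 : forall n, multichoose 1 n = INR n + 1).
  { intro m. assert (H := multichoose_absorb 0 m). simpl (multichoose 0 _) in H. rewrite S_INR in H. simpl (INR 1) in H. lra. }
  assert (E2 : forall n, multichoose 2 n = (INR n + 1) * (INR n + 2) / 2).
  { intro m. assert (H := multichoose_absorb 1 m). rewrite E1, !S_INR in H. simpl (INR 0) in H. lra. }
  repeat split; auto.
  assert (H := multichoose_absorb 2 n). rewrite E2, !S_INR in H. simpl (INR 0) in H. lra.
Qed.

Lemma linear_series (q : C) : Cmod q < 1 ->
  csum (fun n => RtoC (INR n + 1) * q ^ n)%C (/ (1 - q) ^ 2)%C.
Proof.
  intros Hq. apply csum_ext with (2 := multichoose_series 1 q Hq). intro n.
  now rewrite (proj1 (multichoose_closed n)).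
Qed.

Lemma cubic_series (q : C) : Cmod q < 1 ->
  csum (fun n => RtoC ((INR n + 1) ^ 3) * q ^ n)%C ((1 + 4 * q + q * q) / (1 - q) ^ 4)%C.
Proof.
  intros Hq. assert (Hn := Cmod_lt_1_nz q Hq).
  replace ((1 + 4 * q + q * q) / (1 - q) ^ 4)%C with
    (6 * / (1 - q) ^ 4 - 6 * / (1 - q) ^ 3 + / (1 - q) ^ 2)%C by (simpl; field; auto).
  apply csum_ext with (fun n => 6 * (multichoose 3 n * q ^ n) - 6 * (multichoose 2 n * q ^ n) + multichoose 1 n * q ^ n)%C.
  - intro n. destruct (multichoose_closed n) as [-> [-> ->]].
    replace ((INR n + 1) ^ 3) with (6 * ((INR n + 1) * (INR n + 2) * (INR n + 3) / 6) - 6 * ((INR n + 1) * (INR n + 2) / 2) + (INR n + 1)) by field.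
    rewrite (RtoC_plus (_ - _)), RtoC_minus, (RtoC_mult 6), (RtoC_mult 6). ring.
  - apply csum_plus. apply csum_minus; apply csum_scal. all: now apply multichoose_series.
Qed.

(** * The comparison series *)

Lemma Csum_cvg (a : nat -> nat -> C) (l : nat -> C) (n : nat) :
  (forall j, cvg (a j) (l j)) -> cvg (fun J => Csum (fun j => a j J) n) (Csum l n).
Proof.
  intros H. induction n; simpl. apply cvg_const. now apply cvg_plus.
Qed.

Lemma cvg_pow (u : nat -> C) (l : C) (n : nat) : cvg u l -> cvg (fun J => u J ^ n)%C (l ^ n)%C.
Proof.
  intros H. induction n. simpl. apply cvg_const. simpl. now apply cvg_mult.
Qed.

Lemma cvg_over_pow2 (w : C) : cvg (fun J => w / RtoC (2 ^ J))%C 0.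
Proof.
  apply cvg_bound with (fun J => Cmod w * (/ 2) ^ J).
  - intro J. replace (w / RtoC (2 ^ J) - 0)%C with (w / RtoC (2 ^ J))%C by ring.
    rewrite Cmod_div, Cmod_R, Rabs_pos_eq. rewrite pow_inv. apply Rle_refl.
    apply pow_le; lra. apply pow2_C_nz.
  - apply is_lim_seq_scal0, is_lim_seq_pow0. lra.
Qed.

Lemma Cexp_order1 (u : C) : Cmod (Cexp u - 1 - u) <= 2 * exp (2 * Cmod u) * Cmod u ^ 2.
Proof.
  assert (T := Cexp_taylor u 1). unfold Cexp_poly in T. simpl in T.
  rewrite <- Cmod_opp. replace (- (Cexp u - 1 - u))%C with (0 + 1 / 1 + u * 1 / 1 - Cexp u)%C by field.
  eapply Rle_trans. apply T. right. simpl. field.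
Qed.

Lemma Cexp_cvg0 (u : nat -> C) : cvg u 0 -> cvg (fun J => Cexp (u J)) 1.
Proof.
  intros H. 
  apply cvg_ext with (fun J => 1 + (Cexp (u J) - 1))%C. intro; ring.
  apply cvg_eq with (1 + 0)%C. 2: ring. apply cvg_plus. apply cvg_const.
  unfold cvg. apply is_lim_seq_le_le_loc with (fun _ => 0) (fun n => 6 * Cmod (u n - 0)).
  - assert (E := H). apply is_lim_seq_spec in E. destruct (E (mkposreal (1 / 2) ltac:(lra))) as [N HN].
    exists N. intros n Hn. specialize (HN n Hn). simpl in HN.
    rewrite Rminus_0_r, Rabs_pos_eq in HN by apply Cmod_ge_0. split. apply Cmod_ge_0.
    replace (u n - 0)%C with (u n) in * by ring. replace (Cexp (u n) - 1 - 0)%C with (Cexp (u n) - 1)%C by ring.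
    apply Cexp_bound1. lra.
  - apply is_lim_seq_const.
  - now apply is_lim_seq_scal0.
Qed.

Lemma Cexp_ratio_cvg (u : nat -> C) : (forall J, u J <> 0) -> cvg u 0 ->
  cvg (fun J => (1 - Cexp (- u J)) / u J)%C 1.
Proof.
  intros Hn H.
  apply cvg_ext with (fun J => 1 - (Cexp (- u J) - 1 - (- u J)) / u J)%C. intro J; field; auto.
  apply cvg_eq with (1 - 0)%C. 2: ring. apply cvg_minus. apply cvg_const.
  destruct (cvg_norm_bounded u 0 H) as [K [HK0 HK]].
  apply cvg_bound with (fun J => (2 * exp (2 * K)) * Cmod (u J - 0)).
  2: now apply is_lim_seq_scal0.
  intro J. assert (P : 0 < Cmod (u J)) by (apply Cmod_gt_0; apply Hn).
  match goal with |- Cmod ?x <= _ => replace x with ((Cexp (- u J) - 1 - (- u J)) / u J)%C by (unfold Cdiv; ring) end.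
  replace (u J - 0)%C with (u J) by ring.
  rewrite Cmod_div by auto. assert (T := Cexp_order1 (- u J)). rewrite Cmod_opp in T.
  apply Rmult_le_reg_r with (Cmod (u J)); auto. unfold Rdiv. rewrite Rmult_assoc, Rinv_l, Rmult_1_r by lra.
  eapply Rle_trans. apply T.
  replace (2 * exp (2 * K) * Cmod (u J) * Cmod (u J)) with (2 * exp (2 * K) * Cmod (u J) ^ 2) by ring.
  apply Rmult_le_compat_r. apply pow_le; lra. apply Rmult_le_compat_l. lra. apply exp_mono. specialize (HK J); lra.
Qed.

Lemma Cexp_lt_1 (w : C) : 0 < Re w -> Cmod (Cexp (- w)) < 1.
Proof.
  intros H. rewrite Cmod_Cexp, re_opp, <- exp_0. apply exp_increasing. lra.
Qed.

Lemma Cexp_plus_iPI (w : C) : Cexp (- (w + Ci * PI)) = (- Cexp (- w))%C.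
Proof.
  replace (- (w + Ci * PI))%C with (- w + - (PI * (Ci / 2)) + - (PI * (Ci / 2)))%C by field.
  rewrite !Cexp_plus, Cexp_iPI2_opp. rewrite <- Cmult_assoc.
  replace (- Ci * - Ci)%C with (Ci * Ci)%C by ring. rewrite Ci_sq; ring.
Qed.


(** Adding the series at $p$ and $-p$ cancels odd exponents and doubles even ones; $(2j)^k$ supplies
    the other $2^k$. *)
Lemma power_sum_dup (k : nat) (p l m n : C) : Cmod p < 1 ->
  csum (fun n => RtoC ((INR n + 1) ^ k / INR (fact k)) * p ^ n)%C l ->
  csum (fun n => RtoC ((INR n + 1) ^ k / INR (fact k)) * (- p) ^ n)%C m ->
  csum (fun n => RtoC ((INR n + 1) ^ k / INR (fact k)) * (p * p) ^ n)%C n ->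
  (p * l + - p * m)%C = (2 ^ S k * (p * p * n))%C.
Proof.
  intros Hp Hl Hm Hn.
  set (g := fun (p : C) (n : nat) => match n with O => RtoC 0 | S i => (RtoC ((INR i + 1) ^ k / INR (fact k)) * p ^ S i)%C end).
  assert (G : forall q l, csum (fun n => RtoC ((INR n + 1) ^ k / INR (fact k)) * q ^ n)%C l -> csum (g q) (q * l)%C).
  { intros q x Hx. replace (q * x)%C with (g q O + q * x)%C by (simpl; ring).
    apply -> (csum_incr (g q)). apply csum_ext with (fun n => q * (RtoC ((INR n + 1) ^ k / INR (fact k)) * q ^ n))%C.
    intro i. simpl. ring. now apply csum_scal. }
  assert (H1 := csum_plus _ _ _ _ (G _ _ Hl) (G _ _ Hm)).
  assert (H2 := csum_multiples 2 _ _ ltac:(lia) (csum_scal (2 ^ S k) _ _ (G _ _ Hn))).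
  apply (csum_unique _ _ _ H1). apply csum_ext with (2 := H2). clear -k.
  intro i. assert (Hf := INR_fact_neq_0 k).
  destruct (Nat.Even_or_Odd i) as [[j ->] | [j ->]].
  - replace (2 * j)%nat with (j * 2)%nat by lia. rewrite Nat.Div0.mod_mul, Nat.div_mul by lia. simpl (0 =? 0)%nat. cbv iota.
    destruct j as [|j]. simpl; ring.
    assert (E : (S j * 2)%nat = S (S (2 * j))) by lia. rewrite E.
    unfold g. cbv iota beta.
    replace (INR (S (2 * j)) + 1) with (2 * (INR j + 1)) by (rewrite S_INR, mult_INR; simpl; ring).
    rewrite Rpow_mult_distr. rewrite !RtoC_div, !RtoC_mult, !RtoC_pow by auto.
    assert (Ep : forall z : C, (z ^ S (S (2 * j)))%C = ((z * z) ^ S j)%C).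
    { intro z. replace (S (S (2 * j))) with (2 * S j)%nat by lia. rewrite Cpow_mult_r. f_equal. simpl; ring. }
    rewrite !Ep. replace (- p * - p)%C with (p * p)%C by ring. rewrite (Cpow_S _ k). unfold Cdiv. ring.
  - replace (2 * j + 1)%nat with (1 + j * 2)%nat by lia. rewrite Nat.Div0.mod_add. simpl (1 mod 2 =? 0)%nat. cbv iota.
    unfold g. simpl (1 + j * 2)%nat. cbv iota beta.
    assert (Ep : forall z : C, (z ^ S (j * 2))%C = (z * (z * z) ^ j)%C).
    { intro z. rewrite Cpow_S. f_equal. rewrite Nat.mul_comm, Cpow_mult_r. f_equal. simpl; ring. }
    rewrite !Ep. replace (- p * - p)%C with (p * p)%C by ring. ring.
Qed.

(** The difference [f w - w^-(k+1)] is the sum of [2^(-(k+1)i) f (w/2^i + i pi)] over [i >= 1],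
    because [f w = 2^-(k+1) (f (w/2) + f (w/2 + i pi))] and [w^-(k+1)] absorbs the first branch. *)
Lemma power_sum_near (k : nat) (w l : C) : 0 < Re w -> Rabs (Im w) <= PI ->
  csum (fun n => RtoC ((INR n + 1) ^ k / INR (fact k)) * Cexp (- w) ^ n)%C l ->
  Cmod (Cexp (- w) * l - / w ^ S k) <= 1.
Proof.
  intros Hw Hi Hl. destruct (power_sum_rational k) as [e [He0 [He1 He]]].
  set (F := fun q : C => (q * (Csum (fun j => e j * q ^ j) (S k) / (1 - q) ^ S k))%C).
  set (f := fun w : C => F (Cexp (- w))).
  assert (Ef : forall v, 0 < Re v -> (f v) = ((f (v / 2) + f (v / 2 + Ci * PI)) / 2 ^ S k)%C).
  { intros v Hv. assert (Hv2 : 0 < Re (v / 2)).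
    { replace (v / 2)%C with (RtoC (/ 2) * v)%C by (rewrite RtoC_inv by lra; field). rewrite Re_RtoC_mult. lra. }
    assert (Hp := Cexp_lt_1 _ Hv2). unfold f. rewrite Cexp_plus_iPI. set (p := Cexp (- (v / 2))) in *.
    assert (Eq : Cexp (- v) = (p * p)%C) by (unfold p; rewrite <- Cexp_plus; f_equal; field).
    rewrite Eq.
    assert (Hm : Cmod (- p) < 1) by now rewrite Cmod_opp.
    assert (Hq : Cmod (p * p) < 1) by (rewrite <- Eq; now apply Cexp_lt_1).
    assert (D := power_sum_dup k p _ _ _ Hp (He p Hp) (He (- p)%C Hm) (He (p * p)%C Hq)).
    unfold F. rewrite D. field. split; apply Cpow_nz. now apply Cmod_lt_1_nz. apply C2_nz. }
  (* Adding $i\pi$ changes the sign of $p=e^{-v}$, and $\operatorname{Re} p\ge 0$ makes the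
     denominator $|1+p|$ at least 1. The half-width $\pi/2$ is what $|\operatorname{Im} w|\le\pi$
     leaves after one halving. *)
  assert (Bf : forall v, 0 < Re v -> Rabs (Im v) <= PI / 2 -> Cmod (f (v + Ci * PI)%C) <= 1).
  { intros v Hv Hiv. unfold f. rewrite Cexp_plus_iPI. assert (Hp := Cexp_lt_1 v Hv).
    assert (Hr : 0 <= Re (Cexp (- v))).
    { unfold Cexp. rewrite re_opp, im_opp. unfold Re at 1; simpl. apply Rmult_le_pos. left; apply exp_pos.
      apply cos_ge_0; unfold Rabs in Hiv; destruct (Rcase_abs (Im v)); lra. }
    set (p := Cexp (- v)) in *. unfold F.
    assert (H1 : 1 <= Cmod (1 - - p)).
    { eapply Rle_trans; [|apply Re_le_Cmod]. eapply Rle_trans; [|apply Rle_abs].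
      replace (Re (1 - - p)) with (1 + Re p) by (unfold Re; simpl; ring). lra. }
    assert (Hn : (1 - - p)%C <> 0) by (apply Cmod_gt_0; lra).
    rewrite Cmod_mult, Cmod_opp, Cmod_div, Cmod_pow by now apply Cpow_nz.
    assert (H2 : Cmod (Csum (fun j => e j * (- p) ^ j)%C (S k)) <= 1).
    { rewrite <- He1. apply Csum_norm. intros j _. rewrite Cmod_mult, Cmod_R, Cmod_pow, Cmod_opp, Rabs_pos_eq by auto.
      rewrite <- (Rmult_1_r (e j)) at 2. apply Rmult_le_compat_l; auto.
      rewrite <- (pow1 j). apply pow_incr. split. apply Cmod_ge_0. lra. }
    assert (H3 : 1 <= Cmod (1 - - p) ^ S k) by now apply pow_R1_Rle.
    apply Rle_trans with (1 * (1 * 1)). 2: lra.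
    assert (H4 : / Cmod (1 - - p) ^ S k <= 1).
    { eapply Rle_trans. apply (Rinv_le_contravar 1); lra. lra. }
    assert (H5 : 0 < / Cmod (1 - - p) ^ S k) by (apply Rinv_0_lt_compat; lra).
    assert (A := Cmod_ge_0 (Csum (fun j => e j * (- p) ^ j)%C (S k))). assert (A2 := Cmod_ge_0 p).
    apply Rmult_le_compat; auto; try lra. apply Rmult_le_pos; lra.
    apply Rmult_le_compat; lra. }
  set (u := fun J => (w / RtoC (2 ^ J))%C).
  assert (Hwn := Re_nz w Hw).
  assert (Hun : forall J, u J <> 0).
  { intros J E. apply Hwn. replace w with (u J * RtoC (2 ^ J))%C by (unfold u; cfield). rewrite E; ring. }
  assert (Eu : forall J, u J = (RtoC (/ 2 ^ J) * w)%C).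
  { intro J. unfold u. rewrite RtoC_inv by (apply pow_nonzero; lra). cfield. }
  assert (P2 : forall J, 0 < / 2 ^ J <= 1).
  { intro J. assert (1 <= 2 ^ J) by (apply pow_R1_Rle; lra). split. apply Rinv_0_lt_compat; lra.
    rewrite <- Rinv_1. apply Rinv_le_contravar; lra. }
  assert (Hur : forall J, 0 < Re (u J)).
  { intro J. rewrite Eu, Re_RtoC_mult. specialize (P2 J). nra. }
  assert (Hui : forall J, Rabs (Im (u J)) <= PI).
  { intro J. rewrite Eu, im_scal_l, Rabs_mult, (Rabs_pos_eq (/ _)). specialize (P2 J). generalize (Rabs_pos (Im w)). nra.
    specialize (P2 J); lra. }
  assert (Eu2 : forall J, u (S J) = (u J / 2)%C).
  { intro J. unfold u. simpl. rewrite RtoC_mult. cfield. }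
  assert (Hfl : f w = (Cexp (- w) * l)%C).
  { unfold f, F. f_equal. apply (csum_unique _ _ _ (He _ (Cexp_lt_1 w Hw)) Hl). }
  rewrite <- Hfl.
  set (D := fun J => Cmod (f (u J) - / u J ^ S k)).
  assert (Step : forall J, D J <= / 2 ^ S k * (D (S J) + 1)).
  { intro J. unfold D. rewrite (Ef (u J)) by apply Hur. rewrite <- Eu2.
    assert (Hn2 : (u (S J) ^ S k)%C <> 0) by now apply Cpow_nz. 
    assert (H2k : (2 ^ S k)%C <> 0) by apply Cpow_nz, C2_nz.
    replace (/ u J ^ S k)%C with (/ u (S J) ^ S k / 2 ^ S k)%C.
    2: { replace (u J) with (u (S J) * 2)%C by (rewrite Eu2; field). rewrite Cpow_mult_l. field. auto. }
    replace ((f (u (S J)) + f (u (S J) + Ci * PI)) / 2 ^ S k - / u (S J) ^ S k / 2 ^ S k)%C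
      with (/ 2 ^ S k * ((f (u (S J)) - / u (S J) ^ S k) + f (u (S J) + Ci * PI)))%C by (unfold Cdiv; ring).
    replace (/ 2 ^ S k) with (Cmod (/ 2 ^ S k)).
    2: { rewrite Cmod_inv, Cmod_pow, Cmod_R, Rabs_pos_eq; auto; lra. }
    apply Cmod_mult_le. apply Rle_refl. apply Cmod_plus_le. apply Rle_refl. apply Bf. apply Hur.
    rewrite Eu2. specialize (Hui J). replace (u J / 2)%C with (RtoC (/ 2) * u J)%C by (rewrite RtoC_inv by lra; field).
    rewrite im_scal_l, Rabs_mult, Rabs_pos_eq; lra. }
  (* Each halving contributes at most $2^{-(k+1)i}\le 2^{-i}$, and these add up to less than 1 for
     every [k]. *)
  assert (Iter : forall J, D O <= (/ 2 ^ J) ^ S k * D J + (1 - / 2 ^ J)).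
  { induction J.
    - simpl. rewrite Rinv_1. rewrite pow1. lra.
    - eapply Rle_trans. apply IHJ. specialize (Step J). assert (P2S := P2 (S J)). specialize (P2 J).
      assert (Q : 0 < (/ 2 ^ J) ^ S k) by (apply pow_lt; lra).
      apply Rle_trans with ((/ 2 ^ J) ^ S k * (/ 2 ^ S k * (D (S J) + 1)) + (1 - / 2 ^ J)).
      apply Rplus_le_compat_r, Rmult_le_compat_l; lra.
      assert (E : (/ 2 ^ J) ^ S k * / 2 ^ S k = (/ 2 ^ S J) ^ S k).
      { rewrite <- (pow_inv 2 (S k)), <- Rpow_mult_distr. f_equal. simpl. rewrite Rinv_mult. ring. }
      assert (E2 : (/ 2 ^ J) ^ S k * (/ 2 ^ S k * (D (S J) + 1)) = (/ 2 ^ S J) ^ S k * D (S J) + (/ 2 ^ S J) ^ S k).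
      { rewrite <- Rmult_assoc, E. ring. }
      rewrite E2.
      assert (E3 : (/ 2 ^ S J) ^ S k <= / 2 ^ S J).
      { generalize (proj2 P2S) (proj1 P2S). generalize (/ 2 ^ S J). intros x Hx1 Hx0.
        apply Rle_trans with (x * 1). 2: lra.
        change (x ^ S k) with (x * x ^ k). apply Rmult_le_compat_l. lra.
        eapply Rle_trans. apply (pow_incr x 1 k); lra. rewrite pow1; lra. }
      assert (E4 : / 2 ^ S J = / 2 * / 2 ^ J) by (simpl; apply Rinv_mult). lra. }
  (* The scaled defect equals $|w|^{-(k+1)}\,|u^{k+1}f(u)-1|$ at $u=w/2^J$, and $u^{k+1}f(u)\to 1$
     as $u\to 0$. *)
  assert (Lim : is_lim_seq (fun J => (/ 2 ^ J) ^ S k * D J) 0).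
  { assert (Hu0 : cvg u 0) by apply cvg_over_pow2.
    assert (Hq : cvg (fun J => Cexp (- u J)) 1).
    { apply Cexp_cvg0. replace (RtoC 0) with (-(1) * 0)%C by ring.
      apply cvg_ext with (fun J => -(1) * u J)%C. intro; ring. now apply cvg_scal. }
    assert (L1 : cvg (fun J => Cexp (- u J) * (Csum (fun j => e j * Cexp (- u J) ^ j) (S k) * (/ ((1 - Cexp (- u J)) / u J)) ^ S k))%C
       (1 * (1 * (/ 1) ^ S k))%C).
    { apply cvg_mult; auto. apply cvg_mult.
      - replace (RtoC 1) with (Csum (fun j => e j * 1 ^ j)%C (S k)).
        apply (Csum_cvg (fun j J => e j * Cexp (- u J) ^ j)%C). intro j. now apply cvg_scal, cvg_pow.
        transitivity (RtoC (Rsum e (S k))). rewrite RtoC_Rsum. apply Csum_ext. intros j _. rewrite Cpow_1_l. ring.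
        now rewrite He1.
      - apply cvg_pow. apply cvg_inv. apply RtoC_nz; lra. now apply Cexp_ratio_cvg. }
    assert (L2 := is_lim_seq_scal0 (Cmod (/ w ^ S k)) _ L1).
    apply is_lim_seq_ext with (2 := L2). intro J. unfold D.
    rewrite <- Cmod_mult. rewrite <- (Rabs_pos_eq ((/ 2 ^ J) ^ S k)), <- Cmod_R, <- Cmod_mult.
    2: apply pow_le; specialize (P2 J); lra.
    f_equal. rewrite RtoC_pow.
    assert (Hc1 : (1 - Cexp (- u J))%C <> 0) by (apply Cmod_lt_1_nz, Cexp_lt_1, Hur).
    assert (Hpw : (w ^ S k)%C <> 0) by now apply Cpow_nz.
    assert (Hpu : (u J ^ S k)%C <> 0) by now apply Cpow_nz.
    assert (Hpc : ((1 - Cexp (- u J)) ^ S k)%C <> 0) by now apply Cpow_nz.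
    replace (RtoC (/ 2 ^ J) ^ S k)%C with (u J ^ S k * / w ^ S k)%C.
    2: { rewrite Eu at 1. rewrite Cpow_mult_l. field. auto. }
    replace (/ ((1 - Cexp (- u J)) / u J))%C with (u J * / (1 - Cexp (- u J)))%C by (field; auto).
    rewrite Cpow_mult_l, Cpow_inv by auto. unfold f, F.
    replace (/ 1)%C with (RtoC 1) by field. rewrite Cpow_1_l. field. auto. }
  replace w with (u O) by (unfold u; simpl; field).
  assert (Fin : Rbar_le (D O) (0 + 1)).
  { apply (is_lim_seq_le (fun _ => D O) (fun J => (/ 2 ^ J) ^ S k * D J + 1)).
    - intro J. eapply Rle_trans. apply (Iter J). specialize (P2 J). lra.
    - apply is_lim_seq_const.
    - apply is_lim_seq_plus'. exact Lim. apply is_lim_seq_const. }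
  simpl in Fin. unfold D in Fin. lra.
Qed.

(** * The Bessel main term and its generating series *)

Lemma rsum_exp (x : R) : rsum (fun k => x ^ k / INR (fact k)) (exp x).
Proof.
  apply rsum_is_series. unfold exp. destruct (exist_exp x) as [l Hl]. simpl.
  apply is_series_ext with (fun n => / INR (fact n) * x ^ n). intro; apply Rmult_comm.
  apply is_series_Reals. exact Hl.
Qed.

(** [bessel0F1 x = 0F1(; 2; x)], so that [main_term n = (2 pi / sqrt n) I_1 (4 pi sqrt n)]. *)
Definition bessel0F1_coef (k : nat) : R := / (INR (fact k) * INR (fact (S k))).
Definition bessel0F1 (x : R) : R := PSeries bessel0F1_coef x.
Definition main_term (x : R) : R := 4 * PI ^ 2 * bessel0F1 (4 * PI ^ 2 * x).

Lemma bessel0F1_coef_pos (k : nat) : 0 < bessel0F1_coef k.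
Proof. apply Rinv_0_lt_compat, Rmult_lt_0_compat; apply INR_fact_lt_0. Qed.

Lemma INR_fact_ge_1 (k : nat) : 1 <= INR (fact k).
Proof. change 1 with (INR 1). apply le_INR. generalize (lt_O_fact k). lia. Qed.

Lemma bessel0F1_coef_le (k : nat) : bessel0F1_coef k <= / INR (fact k).
Proof.
  apply Rinv_le_contravar. apply INR_fact_lt_0.
  assert (H := INR_fact_ge_1 (S k)). assert (H2 := INR_fact_lt_0 k). nra.
Qed.

Lemma bessel0F1_ex_series (x : R) : ex_series (fun k => Rabs (bessel0F1_coef k * x ^ k)).
Proof.
  apply (ex_series_le (K := R_AbsRing) (V := R_CompleteNormedModule) _ (fun k => Rabs x ^ k / INR (fact k))).
  - intro k. change (Rabs (Rabs (bessel0F1_coef k * x ^ k)) <= Rabs x ^ k / INR (fact k)).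
    rewrite Rabs_Rabsolu, Rabs_mult, <- RPow_abs, Rabs_pos_eq by (left; apply bessel0F1_coef_pos).
    rewrite Rmult_comm. apply Rmult_le_compat_l. apply pow_le, Rabs_pos. apply bessel0F1_coef_le.
  - exists (exp (Rabs x)). apply rsum_is_series, rsum_exp.
Qed.

Lemma bessel0F1_rsum (x : R) : rsum (fun k => bessel0F1_coef k * x ^ k) (bessel0F1 x).
Proof.
  apply rsum_is_series. unfold bessel0F1, PSeries. apply Series_correct.
  apply ex_series_Rabs, bessel0F1_ex_series.
Qed.

(** Expand the Bessel series and sum over [n] first. With $w=2\pi s$ and $A=4\pi^2$ this gives
    $\sum_k b_k f_k$, $b_k=A^{k+1}/(k+1)!$, where $f_k$ is within 1 of $w^{-(k+1)}$. Replacing $f_k$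
    by $w^{-(k+1)}$ yields $e^{A/w}-1=e^{2\pi/s}-1$, at a cost of at most $\sum_k b_k=e^A-1$. *)
Lemma main_series (s : C) : 0 < Re s -> Rabs (Im s) <= 1 / 2 ->
  exists L, csum (fun n => main_term (INR n + 1) * Cexp (- (2 * PI * s)) ^ S n)%C L /\
    Cmod (L - (Cexp (2 * PI / s) - 1)) <= exp (4 * PI ^ 2).
Proof.
  intros Hs Hi. assert (P := PI_RGT_0).
  set (w := (2 * PI * s)%C). set (A := 4 * PI ^ 2).
  assert (HA : 0 < A) by (unfold A; nra).
  assert (Ew : w = (RtoC (2 * PI) * s)%C) by (unfold w; rewrite RtoC_mult; ring).
  assert (Hw : 0 < Re w) by (rewrite Ew, Re_RtoC_mult; nra).
  assert (Hiw : Rabs (Im w) <= PI).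
  { rewrite Ew, im_scal_l, Rabs_mult, Rabs_pos_eq by lra. nra. }
  assert (Hwn := Re_nz w Hw). assert (Hsn := Re_nz s Hs).
  assert (Hq := Cexp_lt_1 w Hw). set (q := Cexp (- w)) in *.
  assert (Hf : forall k, exists l, csum (fun n => RtoC ((INR n + 1) ^ k / INR (fact k)) * q ^ n)%C l).
  { intro k. destruct (power_sum_rational k) as [e [_ [_ He]]]. eexists. now apply He. }
  (* [CSeries] names the sums, which gives a function of [k] without any choice principle. *)
  assert (Hf2 : forall k, { l | csum (fun n => RtoC ((INR n + 1) ^ k / INR (fact k)) * q ^ n)%C l }).
  { intro k. exists (CSeries (fun n => RtoC ((INR n + 1) ^ k / INR (fact k)) * q ^ n)%C).
    destruct (Hf k) as [l Hl]. now rewrite (CSeries_csum _ l Hl). }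
  set (f := fun k => (q * proj1_sig (Hf2 k))%C).
  assert (Near : forall k, Cmod (f k - / w ^ S k) <= 1).
  { intro k. unfold f. destruct (Hf2 k) as [l Hl]. simpl proj1_sig. now apply power_sum_near. }
  set (b := fun k => A ^ S k / INR (fact (S k))).
  assert (Hb : forall k, 0 < b k).
  { intro k. apply Rdiv_lt_0_compat. now apply pow_lt. apply INR_fact_lt_0. }
  assert (Sb : rsum b (exp A - 1)).
  { assert (H := rsum_exp A). apply rsum_cvg in H. apply rsum_cvg. rewrite RtoC_minus.
    apply <- (csum_incr (fun k => RtoC (A ^ k / INR (fact k)))). simpl pow. simpl fact. simpl INR.
    replace (1 / 1) with 1 by field. replace (1 + (exp A - 1))%C with (RtoC (exp A)) by ring. exact H. }
  assert (Sw : csum (fun k => b k * / w ^ S k)%C (Cexp (2 * PI / s) - 1)%C).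
  { assert (H := Cexp_csum (2 * PI / s)).
    assert (Ez : (2 * PI / s)%C = (RtoC A / w)%C).
    { unfold w, A. rewrite RtoC_mult, RtoC_pow. simpl. cfield. }
    assert (H2 : csum (fun k => (2 * PI / s) ^ S k / INR (fact (S k)))%C (Cexp (2 * PI / s) - 1)%C).
    { apply <- (csum_incr (fun k => (2 * PI / s) ^ k / INR (fact k))%C).
      replace ((2 * PI / s) ^ 0 / INR (fact 0) + (Cexp (2 * PI / s) - 1))%C with (Cexp (2 * PI / s)).
      exact H. simpl. field. }
    apply csum_ext with (2 := H2). intro k. rewrite Ez. unfold b, Cdiv.
    rewrite RtoC_div, RtoC_pow, Cpow_mult_l, Cpow_inv by (auto; apply INR_fact_neq_0). unfold Cdiv. ring. }
  assert (Sd : exists d, csum (fun k => b k * (f k - / w ^ S k))%C d).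
  { apply csum_ex with (2 := Sb). intro k. rewrite Cmod_mult, Cmod_R, Rabs_pos_eq by (left; auto).
    rewrite <- (Rmult_1_r (b k)) at 2. apply Rmult_le_compat_l; auto. left; auto. }
  destruct Sd as [d Hd]. exists (Cexp (2 * PI / s) - 1 + d)%C. split.
  - assert (SL : csum (fun k => b k * f k)%C (Cexp (2 * PI / s) - 1 + d)%C).
    { apply csum_ext with (fun k => b k * / w ^ S k + b k * (f k - / w ^ S k))%C. intro; ring. now apply csum_plus. }
    (* The decay of $|q|^{n+1}=e^{-2\mu(n+1)}$ is halved: one half absorbs
       $(n+1)^k/k!\le\mu^{-k}e^{\mu(n+1)}$, the other is a geometric majorant in [n]. *)
    set (mu := Re w / 2). assert (Hmu : 0 < mu) by (unfold mu; lra).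
    set (a := fun k n => (b k * (RtoC ((INR n + 1) ^ k / INR (fact k)) * q ^ S n))%C).
    assert (Bexp : forall x k, 0 <= x -> x ^ k / INR (fact k) <= exp x).
    { intros x k Hx. assert (N : forall j, 0 <= x ^ j / INR (fact j)).
      { intro j. apply Rmult_le_pos. now apply pow_le. left; apply Rinv_0_lt_compat, INR_fact_lt_0. }
      eapply Rle_trans. 2: apply (rsum_partial_le _ _ (S k) N (rsum_exp x)).
      simpl. assert (Q := Rsum_nonneg (fun k => x ^ k / INR (fact k)) k (fun j _ => N j)). lra. }
    assert (Hy : exists Y, rsum (fun k => b k / mu ^ k) Y).
    { apply rsum_ex_le with (fun k => A * ((A / mu) ^ k / INR (fact k))) (A * exp (A / mu)).
      2: apply rsum_scal, rsum_exp.
      intro k. assert (Pm : 0 < mu ^ k) by now apply pow_lt. split.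
      - left. apply Rdiv_lt_0_compat; auto.
      - unfold b. unfold Rdiv at 4. rewrite Rpow_mult_distr, pow_inv.
        replace (A ^ S k / INR (fact (S k)) / mu ^ k) with (A ^ S k / mu ^ k * / INR (fact (S k))) by (field; repeat split; try apply INR_fact_neq_0; lra).
        replace (A * (A ^ k * / mu ^ k / INR (fact k))) with (A ^ S k / mu ^ k * / INR (fact k)) by (simpl pow; field; repeat split; try apply INR_fact_neq_0; lra).
        apply Rmult_le_compat_l. left. apply Rdiv_lt_0_compat; auto. now apply pow_lt.
        apply Rinv_le_contravar. apply INR_fact_lt_0.
        change (fact (S k)) with (S k * fact k)%nat. rewrite mult_INR.
        assert (1 <= INR (S k)) by (rewrite S_INR; generalize (pos_INR k); lra).
        assert (U := INR_fact_lt_0 k). nra. }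
    destruct Hy as [Y HY].
    assert (Hx : rsum (fun n => exp (- mu) * exp (- mu) ^ n) (exp (- mu) * / (1 - exp (- mu)))).
    { apply rsum_scal, rsum_geom. split. left; apply exp_pos. rewrite <- exp_0. apply exp_increasing. lra. }
    assert (Dom : forall k n, Cmod (a k n) <= (b k / mu ^ k) * (exp (- mu) * exp (- mu) ^ n)).
    { intros k n. assert (Pn := INR_1_pos n). assert (Pm : 0 < mu ^ k) by now apply pow_lt.
      unfold a. rewrite !Cmod_mult, !Cmod_R, Cmod_pow, !Rabs_pos_eq.
      2: { apply Rmult_le_pos. apply pow_le; lra. left; apply Rinv_0_lt_compat, INR_fact_lt_0. }
      2: left; auto.
      unfold Rdiv at 2. rewrite Rmult_assoc. apply Rmult_le_compat_l. left; auto.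
      change (exp (- mu) * exp (- mu) ^ n) with (exp (- mu) ^ S n).
      assert (Eq : Cmod q = exp (- mu) * exp (- mu)).
      { unfold q. rewrite Cmod_Cexp, re_opp, <- exp_plus. f_equal. unfold mu; field. }
      rewrite Eq, Rpow_mult_distr. rewrite <- Rmult_assoc. apply Rmult_le_compat_r. apply pow_le; left; apply exp_pos.
      assert (B := Bexp (mu * (INR n + 1)) k ltac:(nra)).
      rewrite Rpow_mult_distr in B.
      assert (E1 : exp (mu * (INR n + 1)) * exp (- mu) ^ S n = 1).
      { assert (E : forall m, exp (- mu) ^ m = exp (- (INR m * mu))).
        { induction m. simpl. rewrite Rmult_0_l, Ropp_0, exp_0; ring.
          simpl pow. rewrite IHm, <- exp_plus. f_equal. rewrite S_INR; ring. }
        rewrite E, <- exp_plus, S_INR, <- exp_0. f_equal. ring. }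
      apply Rmult_le_reg_l with (mu ^ k); auto. rewrite Rinv_r by lra.
      apply Rle_trans with (exp (mu * (INR n + 1)) * exp (- mu) ^ S n). 2: rewrite E1; apply Rle_refl.
      rewrite <- Rmult_assoc. apply Rmult_le_compat_r. apply pow_le; left; apply exp_pos. 
      eapply Rle_trans. 2: apply B. right. unfold Rdiv; ring. }
    assert (Hr : forall k, csum (a k) (b k * f k)%C).
    { intro k. unfold a, f. apply csum_scal. destruct (Hf2 k) as [l Hl]. simpl proj1_sig.
      apply csum_ext with (fun n => q * (RtoC ((INR n + 1) ^ k / INR (fact k)) * q ^ n))%C.
      intro n. rewrite Cpow_S; ring. now apply csum_scal. }
    assert (Hc : forall n, csum (fun k => a k n) (main_term (INR n + 1) * q ^ S n)%C).
    { intro n. unfold a.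
      apply csum_ext with (fun k => q ^ S n * (RtoC (A * (bessel0F1_coef k * (A * (INR n + 1)) ^ k))))%C.
      - intro k. unfold b, bessel0F1_coef.
        replace (A * (/ (INR (fact k) * INR (fact (S k))) * (A * (INR n + 1)) ^ k))
          with (A ^ S k / INR (fact (S k)) * ((INR n + 1) ^ k / INR (fact k))).
        rewrite RtoC_mult; ring.
        rewrite Rpow_mult_distr. change (A ^ S k) with (A * A ^ k). field. split; apply INR_fact_neq_0.
      - rewrite Cmult_comm. apply csum_scal. apply rsum_cvg. apply rsum_scal. apply bessel0F1_rsum. }
    assert (X0 : forall k, 0 <= b k / mu ^ k).
    { intro k. left. apply Rdiv_lt_0_compat; auto. now apply pow_lt. }
    assert (Y0 : forall n, 0 <= exp (- mu) * exp (- mu) ^ n).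
    { intro n. apply Rmult_le_pos. left; apply exp_pos. apply pow_le; left; apply exp_pos. }
    exact (csum_swap a _ _ _ _ _ _ _ Dom X0 Y0 HY Hx Hr Hc SL).
  - replace (Cexp (2 * PI / s) - 1 + d - (Cexp (2 * PI / s) - 1))%C with d by ring.
    apply Rle_trans with (exp A - 1). 2: unfold A; lra.
    apply (csum_norm_le _ b _ _) with (2 := Hd); auto.
    intro k. rewrite Cmod_mult, Cmod_R, Rabs_pos_eq by (left; auto).
    rewrite <- (Rmult_1_r (b k)) at 2. apply Rmult_le_compat_l; auto. left; auto.
Qed.

(** * q-expansions *)

(** With [s = - i tau] this is the nome of [tau]; the inversion [tau -> -1/tau] becomes [s -> 1/s]. *)
Definition qexp (s : C) : C := Cexp (- (2 * PI * s)).

Lemma Re_2PI (s : C) : Re (2 * PI * s) = 2 * PI * Re s.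
Proof. replace (2 * PI * s)%C with (RtoC (2 * PI) * s)%C by (rewrite RtoC_mult; ring). apply re_scal_l. Qed.

Lemma Cmod_qexp (s : C) : Cmod (qexp s) = exp (- (2 * PI * Re s)).
Proof. unfold qexp. now rewrite Cmod_Cexp, re_opp, Re_2PI. Qed.

Lemma qexp_lt_1 (s : C) : 0 < Re s -> Cmod (qexp s) < 1.
Proof. intros H. apply Cexp_lt_1. rewrite Re_2PI. generalize PI_RGT_0; nra. Qed.

Lemma qexp_nz (s : C) : qexp s <> 0.
Proof. apply Cexp_nz. Qed.

Lemma qexp_pow (s : C) (n : nat) : (qexp s ^ n)%C = qexp (INR n * s).
Proof. unfold qexp. rewrite Cexp_pow. f_equal. ring. Qed.

Lemma Cmod_pow_lt_1 (q : C) (n : nat) : Cmod q < 1 -> Cmod (q ^ S n) < 1.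
Proof.
  intros H. rewrite Cmod_pow. assert (P := Cmod_ge_0 q).
  apply Rle_lt_trans with (Cmod q * 1). 2: lra.
  simpl. apply Rmult_le_compat_l; auto. eapply Rle_trans. apply (pow_incr _ 1 n); lra. rewrite pow1; lra.
Qed.

Lemma lam2_qexp (u : C) : 0 < Re u -> lam2 u = (4 * PI ^ 2 * (qexp u / (1 - qexp u) ^ 2))%C.
Proof.
  intros H. assert (H1 := Cmod_lt_1_nz _ (qexp_lt_1 u H)).
  unfold lam2, Csh. assert (E0 := Cexp_nz (PI * u)). rewrite Cexp_opp.
  assert (Eq : qexp u = (/ Cexp (PI * u) * / Cexp (PI * u))%C).
  { unfold qexp. rewrite <- Cexp_opp, <- Cexp_plus. f_equal. ring. }
  rewrite Eq in *. set (E := Cexp (PI * u)) in *.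
  assert (H2 : (E * E - 1)%C <> 0).
  { intro H2. apply H1. replace (1 - / E * / E)%C with ((E * E - 1) / (E * E))%C by (field; auto). rewrite H2. field. auto. }
  field. repeat split; auto using CPI_nz.
Qed.

Lemma lam4_qexp (u : C) : 0 < Re u ->
  lam4 u = (8 * PI ^ 4 / 3 * (qexp u * (1 + 4 * qexp u + qexp u * qexp u) / (1 - qexp u) ^ 4))%C.
Proof.
  intros H. assert (H1 := Cmod_lt_1_nz _ (qexp_lt_1 u H)).
  unfold lam4. rewrite lam2_qexp by auto. simpl. field. auto.
Qed.

(** With $r=\sqrt{|q|}$ this separates the indices of $q^{(d+1)(m+1)}$, as [csum_swap] requires. *)
Lemma Rpow_dm (r : R) (d m : nat) : 0 <= r < 1 -> (r * r) ^ (S d * S m) <= r ^ d * r ^ m.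
Proof.
  intros Hr. rewrite Rpow_mult_distr, <- !pow_add.
  replace (S d * S m + S d * S m)%nat with ((d + m) + (2 * d * m + d + m + 2))%nat by lia.
  rewrite pow_add. rewrite <- (Rmult_1_r (r ^ (d + m))) at 2.
  apply Rmult_le_compat_l. apply pow_le; lra.
  eapply Rle_trans. apply (pow_incr r 1); lra. rewrite pow1; lra.
Qed.

(** The double series $\sum d^p q^{dm}$, summed over [m] first, is a Lambert series. Summed over [d]
    first it gives the values of [lam2] or [lam4] at multiples of [s], by Lipschitz's formula. *)
Lemma lambert_swap (p : nat) (q : C) (g : nat -> C) (L : C) : Cmod q < 1 ->
  (forall m, csum (fun d => RtoC ((INR d + 1) ^ p) * (q ^ S m) ^ S d)%C (g m)) ->
  csum g L -> csum (fun d => RtoC ((INR d + 1) ^ p) * (q ^ S d / (1 - q ^ S d)))%C L.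
Proof.
  intros Hq Hg HL.
  assert (Hs : 0 <= sqrt (Cmod q) < 1).
  { split. apply sqrt_pos. rewrite <- sqrt_1. apply sqrt_lt_1_alt. generalize (Cmod_ge_0 q); lra. }
  assert (Hss : sqrt (Cmod q) * sqrt (Cmod q) = Cmod q) by (apply sqrt_sqrt, Cmod_ge_0).
  set (t := sqrt (Cmod q)) in *.
  destruct (rsum_pow_geom p t Hs) as [Y HY].
  set (a := fun m d => (RtoC ((INR d + 1) ^ p) * (q ^ S m) ^ S d)%C).
  assert (Dom : forall m d, Cmod (a m d) <= t ^ m * ((INR d + 1) ^ p * t ^ d)).
  { intros m d. unfold a. rewrite Cmod_mult, Cmod_R, !Cmod_pow, Rabs_pos_eq.
    2: apply pow_le; generalize (INR_1_pos d); lra.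
    rewrite <- pow_mult, <- Hss. assert (B := Rpow_dm t m d Hs).
    assert (0 <= (INR d + 1) ^ p) by (apply pow_le; generalize (INR_1_pos d); lra).
    replace (t ^ m * ((INR d + 1) ^ p * t ^ d)) with ((INR d + 1) ^ p * (t ^ m * t ^ d)) by ring.
    now apply Rmult_le_compat_l. }
  refine (csum_swap a _ _ _ _ _ _ _ Dom _ _ (rsum_geom t Hs) HY Hg _ HL).
  - intro m. apply pow_le; lra.
  - intro d. apply Rmult_le_pos; apply pow_le. generalize (INR_1_pos d); lra. lra.
  - intro d. unfold a. apply csum_scal.
    apply csum_ext with (fun m => q ^ S d * (q ^ S d) ^ m)%C.
    intro m. rewrite <- Cpow_S, <- !Cpow_mult_r. f_equal. lia.
    apply csum_scal, csum_geom. now apply Cmod_pow_lt_1.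
Qed.

Lemma divisor_sigma_Rsum (k n : nat) :
  INR (divisor_sigma k n) = Rsum (fun d => if Nat.eqb (n mod S d) 0 then (INR d + 1) ^ k else 0) n.
Proof.
  unfold divisor_sigma.
  assert (E : forall (P : nat -> bool) m,
    INR (list_sum (map (fun d => Nat.pow d k) (filter P (seq 1 m))))
     = Rsum (fun d => if P (S d) then (INR d + 1) ^ k else 0) m).
  { intros P m. induction m. reflexivity.
    rewrite seq_S, filter_app, map_app, list_sum_app, plus_INR, IHm. simpl.
    destruct (P (S m)); simpl. rewrite Nat.add_0_r, pow_INR, <- S_INR. reflexivity. ring. }
  apply E.
Qed.

(** Each geometric series in $q^d$ is spread over the multiples of [d], so that column [n] collects
    the divisors of [n+1]. Only [d <= n] contributes, and then $|q|^{n+1}=t^{2n+2}\le t^d t^n$ with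
    $t=\sqrt{|q|}$. *)
Lemma divisor_series (q : C) (L : C) : Cmod q < 1 ->
  csum (fun d => RtoC ((INR d + 1) ^ 3) * (q ^ S d / (1 - q ^ S d)))%C L ->
  csum (fun n => RtoC (INR (divisor_sigma 3 (S n))) * q ^ S n)%C L.
Proof.
  intros Hq HL.
  assert (Hs : 0 <= sqrt (Cmod q) < 1).
  { split. apply sqrt_pos. rewrite <- sqrt_1. apply sqrt_lt_1_alt. generalize (Cmod_ge_0 q); lra. }
  assert (Hss : sqrt (Cmod q) * sqrt (Cmod q) = Cmod q) by (apply sqrt_sqrt, Cmod_ge_0).
  set (t := sqrt (Cmod q)) in *.
  destruct (rsum_pow_geom 3 t Hs) as [Y HY].
  set (a := fun d n => if Nat.eqb (S n mod S d) 0 then (RtoC ((INR d + 1) ^ 3) * q ^ S n)%C else RtoC 0).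
  assert (Z : forall d n, (n < d)%nat -> a d n = 0).
  { intros d n H. unfold a. rewrite Nat.mod_small by lia. reflexivity. }
  assert (Dom : forall d n, Cmod (a d n) <= ((INR d + 1) ^ 3 * t ^ d) * t ^ n).
  { intros d n. assert (P3 : 0 <= (INR d + 1) ^ 3) by (apply pow_le; generalize (INR_1_pos d); lra).
    assert (Pt : 0 <= (INR d + 1) ^ 3 * t ^ d * t ^ n) by (apply Rmult_le_pos; [apply Rmult_le_pos; [exact P3|]|]; apply pow_le; lra).
    destruct (le_lt_dec d n) as [H | H].
    - unfold a. destruct (Nat.eqb _ 0). 2: now rewrite Cmod_0.
      rewrite Cmod_mult, Cmod_R, Cmod_pow, Rabs_pos_eq, Rmult_assoc by auto. apply Rmult_le_compat_l; auto.
      rewrite <- Hss, Rpow_mult_distr, <- !pow_add.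
      replace (S n + S n)%nat with ((d + n) + (n - d + 2))%nat by lia. rewrite pow_add.
      rewrite <- (Rmult_1_r (t ^ (d + n))) at 2. apply Rmult_le_compat_l. apply pow_le; lra.
      eapply Rle_trans. apply (pow_incr t 1); lra. rewrite pow1; lra.
    - rewrite Z by auto. now rewrite Cmod_0. }
  refine (csum_swap a _ _ _ _ _ _ _ Dom _ _ HY (rsum_geom t Hs) _ _ HL).
  - intro d. apply Rmult_le_pos; apply pow_le. generalize (INR_1_pos d); lra. lra.
  - intro n. apply pow_le; lra.
  - intro d. set (b := fun j => match j with O => RtoC 0 | S i => (RtoC ((INR d + 1) ^ 3) * (q ^ S d) ^ S i)%C end).
    assert (Hb : csum b (RtoC ((INR d + 1) ^ 3) * (q ^ S d / (1 - q ^ S d)))%C).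
    { match goal with |- csum b ?x => replace x with (b O + x)%C by (unfold b; ring) end.
      apply -> (csum_incr b). unfold b. apply csum_scal.
      apply csum_ext with (fun m => q ^ S d * (q ^ S d) ^ m)%C. intro; now rewrite <- Cpow_S.
      apply csum_scal, csum_geom. now apply Cmod_pow_lt_1. }
    apply (csum_multiples (S d)) in Hb. 2: lia.
    match type of Hb with csum ?g ?x => replace x with (g O + x)%C in Hb by (rewrite Nat.Div0.mod_0_l, Nat.Div0.div_0_l; simpl; ring) end.
    apply csum_incr in Hb. apply csum_ext with (2 := Hb). intro n. unfold a.
    destruct (Nat.eqb_spec (S n mod S d) 0) as [E | E]; auto.
    apply Nat.Div0.div_exact in E. set (j := (S n / S d)%nat) in *.
    destruct j as [|i]. lia. unfold b. rewrite <- Cpow_mult_r. now rewrite <- E.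
  - intro n. rewrite divisor_sigma_Rsum, RtoC_Rsum.
    replace (Csum (fun k => RtoC (if Nat.eqb (S n mod S k) 0 then (INR k + 1) ^ 3 else 0)) (S n) * q ^ S n)%C
      with (Csum (fun d => a d n) (S n)).
    + apply csum_fin. intros d Hd. apply Z. lia.
    + rewrite Cmult_comm, <- Csum_scal. apply Csum_ext. intros d _. unfold a.
      destruct (Nat.eqb _ 0); ring.
Qed.

Lemma divisor_series_lam4 (s L : C) : 0 < Re s -> csum (fun m => lam4 (INR (S m) * s)) L ->
  csum (fun n => RtoC (INR (divisor_sigma 3 (S n))) * qexp s ^ S n)%C (/ (8 * PI ^ 4 / 3) * L)%C.
Proof.
  intros Hs HL. assert (Hq := qexp_lt_1 s Hs).
  set (c := (8 * PI ^ 4 / 3)%C). assert (Hc : c <> 0).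
  { unfold c. intro E. apply (Cpow_nz _ 4 CPI_nz). replace (PI ^ 4)%C with (8 * PI ^ 4 / 3 * (3 / 8))%C by field. rewrite E; ring. }
  apply divisor_series; auto.
  apply lambert_swap with (fun m => / c * lam4 (INR (S m) * s))%C; auto.
  2: now apply csum_scal.
  intro m. rewrite lam4_qexp by now apply Re_INR_S_pos. fold c. rewrite <- qexp_pow.
  set (x := (qexp s ^ S m)%C). assert (Hx : Cmod x < 1) by now apply Cmod_pow_lt_1.
  replace (/ c * (c * (x * (1 + 4 * x + x * x) / (1 - x) ^ 4)))%C with (x * ((1 + 4 * x + x * x) / (1 - x) ^ 4))%C.
  2: { unfold Cdiv. rewrite (Cmult_assoc (/ c)), Cinv_l by auto. ring. }
  apply csum_ext with (fun d => x * (RtoC ((INR d + 1) ^ 3) * x ^ d))%C. intro; rewrite Cpow_S; ring.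
  apply csum_scal. now apply cubic_series.
Qed.

(** Normalising the lattice sum by $\zeta(4)=\pi^4/90$ produces the coefficient
    $240=(90/\pi^4)(8\pi^4/3)$. *)
Lemma eisenstein4_lam4 (s L : C) : 0 < Re s -> csum (fun m => lam4 (INR (S m) * s)) L ->
  eisenstein4 (qexp s) = (90 / PI ^ 4 * ((PI ^ 4 / 90)%R + L))%C.
Proof.
  intros Hs HL. unfold eisenstein4. rewrite (CSeries_csum _ _ (divisor_series_lam4 s L Hs HL)).
  rewrite RtoC_div, RtoC_pow by lra. field. apply CPI_nz.
Qed.

Lemma eisenstein4_modular (s : C) : 0 < Re s -> eisenstein4 (qexp (/ s)) = (s ^ 4 * eisenstein4 (qexp s))%C.
Proof.
  intros Hs. assert (Hs' := Re_inv_pos s Hs). assert (Hn := Re_nz s Hs).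
  destruct (lam4_sum_ex s Hs) as [L HL]. destruct (lam4_sum_ex (/ s) Hs') as [L' HL'].
  rewrite (eisenstein4_lam4 s L Hs HL), (eisenstein4_lam4 (/ s) L' Hs' HL').
  assert (E := lam4_modular s L L' Hs HL HL').
  assert (H4 : (s ^ 4)%C <> 0) by now apply Cpow_nz.
  assert (E2 : (L' + (PI ^ 4 / 90)%R)%C = (s ^ 4 * (L + (PI ^ 4 / 90)%R))%C).
  { replace L with ((L - (PI ^ 4 / 90)%R / s ^ 4) + (PI ^ 4 / 90)%R / s ^ 4)%C by ring. rewrite E. field. auto. }
  rewrite (Cplus_comm _ L'), E2. ring.
Qed.

Lemma lambert_lam2 (s L : C) : 0 < Re s -> csum (fun m => lam2 (INR (S m) * s)) L ->
  csum (fun d => RtoC (INR d + 1) * (qexp s ^ S d / (1 - qexp s ^ S d)))%C (L / (4 * PI ^ 2))%C.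
Proof.
  intros Hs HL. assert (Hq := qexp_lt_1 s Hs).
  set (c := (4 * PI ^ 2)%C). assert (Hc : c <> 0).
  { unfold c. intro E. apply (Cpow_nz _ 2 CPI_nz). replace (PI ^ 2)%C with (4 * PI ^ 2 / 4)%C by field. rewrite E; field. }
  apply csum_ext with (fun d => RtoC ((INR d + 1) ^ 1) * (qexp s ^ S d / (1 - qexp s ^ S d)))%C.
  { intro d. now rewrite pow_1. }
  apply lambert_swap with (fun m => / c * lam2 (INR (S m) * s))%C; auto.
  2: { unfold Cdiv. rewrite Cmult_comm. now apply csum_scal. }
  intro m. rewrite lam2_qexp by now apply Re_INR_S_pos. fold c. rewrite <- qexp_pow.
  set (x := (qexp s ^ S m)%C). assert (Hx : Cmod x < 1) by now apply Cmod_pow_lt_1.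
  replace (/ c * (c * (x / (1 - x) ^ 2)))%C with (x * / (1 - x) ^ 2)%C.
  2: { unfold Cdiv. rewrite (Cmult_assoc (/ c)), Cinv_l by auto. ring. }
  apply csum_ext with (fun d => x * (RtoC (INR d + 1) * x ^ d))%C. intro; rewrite Cpow_S, pow_1; ring.
  apply csum_scal. now apply linear_series.
Qed.

(** * The discriminant product *)

Fixpoint qprod (q : C) (n : nat) : C :=
  match n with O => 1 | S m => (qprod q m * (1 - q ^ S m))%C end.

Lemma Cprod_snoc (f : nat -> C) (l : list nat) (x : nat) : Cprod f (l ++ x :: nil) = (Cprod f l * f x)%C.
Proof.
  unfold Cprod. induction l; simpl. ring. rewrite IHl. ring.
Qed.

Lemma Cprod_qprod (q : C) (N : nat) : Cprod (fun n => (1 - q ^ n) ^ 24)%C (seq 1 N) = (qprod q N ^ 24)%C.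
Proof.
  induction N. unfold Cprod. simpl fold_right. simpl qprod. now rewrite Cpow_1_l.
  rewrite seq_S, Cprod_snoc, IHN. change (qprod q (S N)) with (qprod q N * (1 - q ^ S N))%C.
  now rewrite Cpow_mult_l.
Qed.

Lemma exp_ge_1_plus (x : R) : 0 <= x -> 1 + x <= exp x.
Proof. intros [H | <-]. left; apply exp_ineq1; lra. rewrite exp_0; lra. Qed.

Lemma Cmod_one_minus_ge (z : C) : 1 - Cmod z <= Cmod (1 - z).
Proof.
  assert (H := Cmod_triangle_rev (- z) 1). rewrite Cmod_opp, Cmod_1 in H.
  replace (- z + 1)%C with (1 - z)%C in H by ring. exact H.
Qed.

Lemma pow_S_le (q r : R) (n : nat) : 0 <= q <= r -> r < 1 -> q ^ S n <= r.
Proof.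
  intros H Hr. apply Rle_trans with (r * 1). 2: lra. simpl. apply Rmult_le_compat; try lra. apply pow_le; lra.
  eapply Rle_trans. apply (pow_incr q 1); lra. rewrite pow1; lra.
Qed.

(** Factors are compared with exponentials by $1+x\le e^x$ and, for $x\le r$, $1/(1-x)\le
    1+x/(1-r)$. Uniformity in [N] of the bound on the inverse is what makes the infinite product
    nonzero. *)
Lemma qprod_bound (q : C) (r : R) (N : nat) : Cmod q <= r -> r < 1 ->
  qprod q N <> 0 /\ Cmod (qprod q N) <= exp (/ (1 - r)) /\ Cmod (/ qprod q N) <= exp (/ (1 - r) * / (1 - r)).
Proof.
  intros Hq Hr. assert (P := Cmod_ge_0 q).
  assert (Hr0 : 0 <= r) by lra. assert (Hi : 0 < / (1 - r)) by (apply Rinv_0_lt_compat; lra).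
  assert (Sum : Rsum (fun k => r ^ S k) N <= / (1 - r)).
  { apply Rle_trans with (r * / (1 - r)).
    - rewrite (Rsum_scal r (fun k => r ^ k)). apply Rmult_le_compat_l; auto.
      apply rsum_partial_le. intro; apply pow_le; lra. apply rsum_geom; lra.
    - rewrite <- (Rmult_1_l (/ (1 - r))) at 2. apply Rmult_le_compat_r; lra. }
  assert (A : qprod q N <> 0 /\ Cmod (qprod q N) <= exp (Rsum (fun k => r ^ S k) N)
      /\ Cmod (/ qprod q N) <= exp (/ (1 - r) * Rsum (fun k => r ^ S k) N)).
  { induction N.
    - simpl. rewrite Rmult_0_r, exp_0. replace (/ 1)%C with (RtoC 1) by field. rewrite Cmod_1.
      repeat split; try lra. apply C1_nz.
    - assert (SumN : Rsum (fun k => r ^ S k) N <= / (1 - r)).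
      { eapply Rle_trans. 2: apply Sum. apply Rsum_mono. intro; apply pow_le; lra. lia. }
      destruct (IHN SumN) as [H1 [H2 H3]].
      assert (Qx : Cmod (q ^ S N) <= r ^ S N) by (rewrite Cmod_pow; apply pow_incr; lra).
      assert (Rx : r ^ S N <= r) by (apply pow_S_le; lra).
      assert (R0 : 0 <= r ^ S N) by (apply pow_le; lra).
      assert (L := Cmod_one_minus_ge (q ^ S N)).
      assert (Hx : (1 - q ^ S N)%C <> 0) by (apply Cmod_gt_0; lra).
      cbn [qprod Rsum]. split. now apply Cmult_neq_0. split.
      + rewrite exp_plus. apply Cmod_mult_le; auto.
        eapply Rle_trans. 2: apply exp_ge_1_plus; auto.
        unfold Cminus. apply Cmod_plus_le. rewrite Cmod_1; lra. rewrite Cmod_opp; auto.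
      + rewrite Rmult_plus_distr_l, exp_plus.
        replace (/ (qprod q N * (1 - q ^ S N)))%C with (/ qprod q N * / (1 - q ^ S N))%C by (field; auto).
        apply Cmod_mult_le; auto.
        eapply Rle_trans. 2: apply exp_ge_1_plus; apply Rmult_le_pos; lra.
        eapply Rle_trans. apply (Cmod_inv_le _ (1 - r ^ S N)); lra.
        apply Rmult_le_reg_l with (1 - r ^ S N). lra. rewrite Rinv_r by lra.
        set (x := r ^ S N) in *. set (i := / (1 - r)) in *.
        assert (Ei : i * (1 - r) = 1) by (unfold i; field; lra). 
        assert (1 <= i * (1 - x)) by nra. nra. }
  destruct A as [H1 [H2 H3]]. split; auto. split.
  - eapply Rle_trans. apply H2. now apply exp_mono.
  - eapply Rle_trans. apply H3. apply exp_mono. apply Rmult_le_compat_l; lra.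
Qed.

Lemma qprod_cvg (q : C) : Cmod q < 1 -> exists P : C, P <> 0 /\ cvg (qprod q) P.
Proof.
  intros Hq. assert (P0 := Cmod_ge_0 q). set (r := Cmod q) in *.
  assert (B := fun N => qprod_bound q r N (Rle_refl _) Hq).
  destruct (csum_ex (fun n => qprod q (S n) - qprod q n)%C (fun n => exp (/ (1 - r)) * r ^ n) (exp (/ (1 - r)) * / (1 - r))) as [l Hl].
  - intro n. cbn [qprod]. replace (qprod q n * (1 - q ^ S n) - qprod q n)%C with (qprod q n * - q ^ S n)%C by ring.
    apply Cmod_mult_le. apply B. rewrite Cmod_opp, Cmod_pow. fold r. simpl.
    rewrite <- (Rmult_1_l (r ^ n)) at 2. apply Rmult_le_compat_r; try lra. apply pow_le; lra.
  - apply rsum_scal, rsum_geom. lra.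
  - assert (C1 : cvg (qprod q) (1 + l)%C).
    { apply cvg_ext with (fun n => 1 + Csum (fun n => qprod q (S n) - qprod q n)%C n)%C.
      - intro n. induction n. simpl; ring. cbn [Csum]. rewrite Cplus_assoc, IHn. ring.
      - apply cvg_plus; auto. apply cvg_const. }
    exists (1 + l)%C. split; auto. intro E. rewrite E in C1.
    set (K := exp (/ (1 - r) * / (1 - r))). assert (HK : 0 < K) by apply exp_pos.
    assert (Lim := C1). apply is_lim_seq_spec in Lim. destruct (Lim (mkposreal (/ K) (Rinv_0_lt_compat _ HK))) as [N HN].
    specialize (HN N (le_n _)). simpl in HN. rewrite Rminus_0_r, Rabs_pos_eq in HN by apply Cmod_ge_0.
    replace (qprod q N - 0)%C with (qprod q N) in HN by ring.
    destruct (B N) as [H1 [_ H3]]. fold K in H3. rewrite Cmod_inv in H3 by auto.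
    assert (Hp : 0 < Cmod (qprod q N)) by now apply Cmod_gt_0.
    apply Rinv_lt_contravar in HN. rewrite Rinv_inv in HN. lra.
    apply Rmult_lt_0_compat; auto. now apply Rinv_0_lt_compat.
Qed.

Lemma euler_prod24_spec (q P : C) : cvg (qprod q) P -> euler_prod24 q = (P ^ 24)%C.
Proof.
  intros H. apply CLim_seq_cvg. apply cvg_ext with (fun N => qprod q N ^ 24)%C.
  intro N; now rewrite Cprod_qprod. now apply cvg_pow.
Qed.

(** Logarithmic derivative without a logarithm, hence without a choice of branch: products add,
    powers scale. *)
Definition lder (f : R -> C) (t : R) (l : C) : Prop := cder f t (f t * l)%C.

Lemma lder_ext (f g : R -> C) (t : R) (l m : C) :
  (forall x, f x = g x) -> l = m -> lder f t l -> lder g t m.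
Proof.
  intros H <- Hf. unfold lder. eapply cder_ext. exact H. rewrite <- H. reflexivity. exact Hf.
Qed.

Lemma lder_mult (f g : R -> C) (t : R) (l m : C) :
  lder f t l -> lder g t m -> lder (fun x => f x * g x)%C t (l + m)%C.
Proof.
  intros Hf Hg. unfold lder. eapply cder_ext. 3: apply (cder_mult _ _ _ _ _ Hf Hg). reflexivity. simpl; ring.
Qed.

Lemma lder_inv (f : R -> C) (t : R) (l : C) : f t <> 0 -> lder f t l -> lder (fun x => / f x)%C t (- l)%C.
Proof.
  intros Hn Hf. unfold lder. eapply cder_ext. 3: apply (cder_inv _ _ _ Hn Hf). reflexivity. field. auto.
Qed.

Lemma lder_pow (f : R -> C) (t : R) (l : C) (n : nat) : lder f t l -> lder (fun x => f x ^ S n)%C t (INR (S n) * l)%C.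
Proof.
  intros Hf. unfold lder. eapply cder_ext. 3: apply (cder_pow _ _ _ n Hf). reflexivity. rewrite Cpow_S. ring.
Qed.

Lemma lder_qexp (u : R -> C) (t : R) (u' : C) : cder u t u' -> lder (fun x => qexp (u x)) t (- (2 * PI) * u')%C.
Proof.
  intros H. unfold lder, qexp. eapply cder_ext.
  3: apply (cder_Cexp (fun x => - (2 * PI * u x))%C).
  reflexivity. 2: { apply (cder_ext (fun x => (- (2 * PI)) * u x)%C _ _ (- (2 * PI) * u')%C (- (2 * PI) * u')%C).
    intro; ring. reflexivity. now apply cder_scal. } ring.
Qed.

Definition lambert_term (q : C) (n : nat) : C := (RtoC (INR n + 1) * (q ^ S n / (1 - q ^ S n)))%C.

Lemma lder_qprod (u : R -> C) (t : R) (u' : C) (N : nat) : cder u t u' -> 0 < Re (u t) ->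
  lder (fun x => qprod (qexp (u x)) N) t (2 * PI * u' * Csum (lambert_term (qexp (u t))) N)%C.
Proof.
  intros H Hr. induction N.
  - unfold lder. simpl. eapply cder_ext. 3: apply (cder_const 1). reflexivity. ring.
  - assert (Hn : (1 - qexp (u t) ^ S N)%C <> 0) by (apply Cmod_lt_1_nz, Cmod_pow_lt_1, qexp_lt_1; auto).
    assert (H1 : lder (fun x => 1 - qexp (u x) ^ S N)%C t (2 * PI * u' * lambert_term (qexp (u t)) N)%C).
    { unfold lder. eapply cder_ext.
      3: { eapply (cder_plus _ _ _ _ _ (cder_const 1 t)). eapply (cder_scal (-(1))).
           apply (lder_pow _ _ _ N (lder_qexp _ _ _ H)). }
      intro x; simpl; ring.
      unfold lambert_term. rewrite S_INR. cbv beta.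
      set (x := (qexp (u t) ^ S N)%C) in *. field. auto. }
    cbn [qprod Csum]. eapply lder_ext. 3: apply (lder_mult _ _ _ _ _ IHN H1). reflexivity. ring.
Qed.

Lemma lambert_term_bound (q : C) (r : R) (n : nat) : Cmod q <= r -> r < 1 ->
  Cmod (lambert_term q n) <= / (1 - r) * ((INR n + 1) ^ 1 * r ^ n).
Proof.
  intros Hq Hr. assert (P := Cmod_ge_0 q). assert (Pn := INR_1_pos n).
  assert (Qx : Cmod (q ^ S n) <= r) by (rewrite Cmod_pow; apply pow_S_le; lra).
  assert (L := Cmod_one_minus_ge (q ^ S n)).
  unfold lambert_term. rewrite pow_1.
  replace (/ (1 - r) * ((INR n + 1) * r ^ n)) with ((INR n + 1) * (r ^ n * / (1 - r))) by ring.
  apply Cmod_mult_le. rewrite Cmod_R, Rabs_pos_eq; lra.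
  unfold Cdiv. apply Cmod_mult_le.
  - rewrite Cmod_pow. simpl. apply Rle_trans with (1 * r ^ n). 2: lra.
    apply Rmult_le_compat; try lra. apply pow_le; lra. apply pow_incr; lra.
  - apply Cmod_inv_le; lra.
Qed.

(** The truncated discriminant. Finite products are differentiated exactly, so no derivative is
    exchanged with a limit; [N] goes to infinity only at the end of [delta_modular]. *)
Definition delta_partial (N : nat) (s : C) : C := (qexp s * qprod (qexp s) N ^ 24)%C.

Lemma lder_delta_partial (u : R -> C) (t : R) (u' : C) (N : nat) : cder u t u' -> 0 < Re (u t) ->
  lder (fun x => delta_partial N (u x)) t
    ((48 * PI * Csum (lambert_term (qexp (u t))) N - 2 * PI) * u')%C.
Proof.
  intros H Hr. unfold delta_partial.
  eapply lder_ext. 3: exact (lder_mult _ _ _ _ _ (lder_qexp _ _ _ H) (lder_pow _ _ _ 23 (lder_qprod _ _ _ N H Hr))).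
  reflexivity. rewrite INR_IZR_INZ. change (IZR (Z.of_nat 24)) with 24. ring.
Qed.

(** The transformation law of $E_2$ in the form that arises from logarithmic derivatives of the
    discriminant; the term $-12/s$ belongs to the weight factor $s^{12}$. *)
Lemma lambert_modular (s T T' : C) : 0 < Re s ->
  csum (lambert_term (qexp s)) T -> csum (lambert_term (qexp (/ s))) T' ->
  (48 * PI * (T + T' / s ^ 2) = 2 * PI * (1 + / s ^ 2) - 12 / s)%C.
Proof.
  intros Hs HT HT'. assert (Hs' := Re_inv_pos s Hs). assert (Hn := Re_nz s Hs).
  assert (H2 : (s ^ 2)%C <> 0) by now apply Cpow_nz.
  destruct (lam2_sum_ex s Hs) as [L HL]. destruct (lam2_sum_ex (/ s) Hs') as [L' HL'].
  assert (E := lam2_modular s L L' Hs HL HL').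
  rewrite (csum_unique _ _ _ HT (lambert_lam2 s L Hs HL)).
  rewrite (csum_unique _ _ _ HT' (lambert_lam2 (/ s) L' Hs' HL')).
  assert (HPI := CPI_nz).
  replace (48 * PI * (L / (4 * PI ^ 2) + L' / (4 * PI ^ 2) / s ^ 2))%C with (12 / PI * (L + L' / s ^ 2))%C.
  2: { simpl. field. auto. }
  rewrite E, RtoC_div, RtoC_pow by lra. simpl. field. auto.
Qed.

Lemma lambert_term_csum (s : C) : 0 < Re s -> exists T, csum (lambert_term (qexp s)) T.
Proof.
  intros Hs. destruct (lam2_sum_ex s Hs) as [L HL].
  exists (L / (4 * PI ^ 2))%C. now apply lambert_lam2.
Qed.

Lemma lambert_tail (r : R) : 0 <= r < 1 -> exists tail : nat -> R, is_lim_seq tail 0 /\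
  forall q T N, Cmod q <= r -> csum (lambert_term q) T -> Cmod (T - Csum (lambert_term q) N) <= tail N.
Proof.
  intros Hr. destruct (rsum_pow_geom 1 r Hr) as [B HB]. apply (rsum_scal (/ (1 - r))) in HB.
  exists (fun N => / (1 - r) * B - Rsum (fun n => / (1 - r) * ((INR n + 1) ^ 1 * r ^ n)) N). split.
  - now apply rsum_tail_lim.
  - intros q T N Hq HT. apply csum_tail_le; auto. intro n. now apply lambert_term_bound.
Qed.

Lemma delta_partial_bound (N : nat) (s : C) (r : R) : 0 < Re s -> Cmod (qexp s) <= r -> r < 1 ->
  delta_partial N s <> 0 /\ Cmod (delta_partial N s) <= exp (/ (1 - r)) ^ 24 /\
  Cmod (/ delta_partial N s) <= exp (2 * PI * Re s) * exp (/ (1 - r) * / (1 - r)) ^ 24.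
Proof.
  intros Hs Hq Hr. destruct (qprod_bound (qexp s) r N Hq Hr) as [H1 [H2 H3]].
  assert (H4 := qexp_nz s). assert (H24 := Cpow_nz _ 24 H1). assert (P := PI_RGT_0).
  unfold delta_partial. split. now apply Cmult_neq_0. split.
  - replace (exp (/ (1 - r)) ^ 24) with (1 * exp (/ (1 - r)) ^ 24) by ring.
    apply Cmod_mult_le. lra. rewrite Cmod_pow. apply pow_incr. split; auto. apply Cmod_ge_0.
  - replace (/ (qexp s * qprod (qexp s) N ^ 24))%C with (/ qexp s * (/ qprod (qexp s) N) ^ 24)%C.
    2: { rewrite Cpow_inv by auto. field. auto. }
    apply Cmod_mult_le. rewrite Cmod_inv, Cmod_qexp, <- exp_Ropp, Ropp_involutive by auto. apply Rle_refl.
    rewrite Cmod_pow. apply pow_incr. split; auto. apply Cmod_ge_0.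
Qed.

(** Follow $\Delta_N(1/u)\,u^{-12}/\Delta_N(u)$ along the segment from $u=1$ to $u=s$. At $u=1$, the
    fixed point of inversion, it is 1, and its logarithmic derivative tends to 0 uniformly by
    [lambert_modular]; so its value at $s$ tends to 1. *)
Lemma delta_modular (s : C) : 0 < Re s ->
  (qexp (/ s) * euler_prod24 (qexp (/ s)) = s ^ 12 * (qexp s * euler_prod24 (qexp s)))%C.
Proof.
  intros Hs. assert (Hs' := Re_inv_pos s Hs). assert (Hn := Re_nz s Hs). assert (PP := PI_RGT_0).
  destruct (qprod_cvg _ (qexp_lt_1 s Hs)) as [P [HP0 HP]].
  destruct (qprod_cvg _ (qexp_lt_1 (/ s) Hs')) as [P' [HP0' HP']].
  rewrite (euler_prod24_spec _ _ HP), (euler_prod24_spec _ _ HP').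
  set (h := (s - 1)%C). set (u := fun t : R => (1 + h * t)%C).
  set (sg := Rmin 1 (Re s)). set (Mx := 1 + Cmod h).
  assert (Hh := Cmod_ge_0 h).
  assert (Hsg : 0 < sg <= 1) by (unfold sg; split; [apply Rmin_glb_lt; lra | apply Rmin_l]).
  assert (HMx : 1 <= Mx) by (unfold Mx; lra).
  assert (Ru : forall t, 0 <= t <= 1 -> sg <= Re (u t)).
  { intros t Ht. unfold u, h. rewrite re_plus, re_scal_r. unfold Cminus. rewrite re_plus, re_opp, re_RtoC.
    assert (sg <= Re s) by apply Rmin_r. nra. }
  assert (Mu : forall t, 0 <= t <= 1 -> Cmod (u t) <= Mx).
  { intros t Ht. unfold u, Mx. apply Cmod_plus_le. rewrite Cmod_1; lra.
    rewrite Cmod_mult, Cmod_R, Rabs_pos_eq by lra. nra. }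
  (* From $\operatorname{Re}(1/u)=\operatorname{Re}u/|u|^2$: this is a common lower bound for the
     real parts of [u] and [/ u] on the segment, so a single [r] bounds both nomes. *)
  set (rho := sg / Mx ^ 2).
  assert (HM2 : 1 <= Mx ^ 2) by (apply pow_R1_Rle; auto).
  assert (Hrho : 0 < rho <= sg).
  { unfold rho. split. apply Rdiv_lt_0_compat; lra.
    apply Rmult_le_reg_r with (Mx ^ 2). lra. unfold Rdiv. rewrite Rmult_assoc, Rinv_l by lra. nra. }
  assert (Riu : forall t, 0 <= t <= 1 -> rho <= Re (/ u t)).
  { intros t Ht. assert (A := Ru t Ht). assert (B := Mu t Ht).
    replace (Re (/ u t)) with (Re (u t) / Cmod (u t) ^ 2) by (rewrite Cmod2_alt; reflexivity).
    assert (C0 : 0 < Cmod (u t)). { eapply Rlt_le_trans. 2: apply Re_le_Cmod. eapply Rlt_le_trans. 2: apply Rle_abs. lra. }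
    unfold rho. apply Rmult_le_compat; try lra. left; apply Rinv_0_lt_compat; lra.
    apply Rinv_le_contravar. now apply pow_lt. apply pow_incr; lra. }
  set (r := exp (- (2 * PI * rho))).
  assert (Hr : 0 <= r < 1).
  { split. left; apply exp_pos. unfold r. rewrite <- exp_0. apply exp_increasing. nra. }
  assert (Qb : forall z, rho <= Re z -> Cmod (qexp z) <= r).
  { intros z Hz. rewrite Cmod_qexp. apply exp_mono. nra. }
  destruct (lambert_tail r Hr) as [tail [Htail Hbound]].
  set (phi := fun (N : nat) (t : R) => (delta_partial N (/ u t) * (/ u t) ^ 12 * / delta_partial N (u t))%C).
  set (K0 := exp (/ (1 - r)) ^ 24 * (/ sg) ^ 12 * (exp (2 * PI * Mx) * exp (/ (1 - r) * / (1 - r)) ^ 24)).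
  set (K1 := Cmod h * (48 * PI * (1 + / sg ^ 2))).
  assert (HK0 : 0 <= K0).
  { assert (Q : forall x n, 0 <= exp x ^ n) by (intros; apply pow_le; left; apply exp_pos).
    unfold K0. apply Rmult_le_pos; [apply Rmult_le_pos; [apply Q|]|apply Rmult_le_pos; [left; apply exp_pos | apply Q]].
    apply pow_le; left; apply Rinv_0_lt_compat; lra. }
  assert (Hisg : 0 < / sg ^ 2) by (apply Rinv_0_lt_compat, pow_lt; lra).
  assert (Main : forall N, Cmod (phi N 1 - phi N 0) <= 2 * (K0 * (K1 * tail N))).
  { intro N.
    set (l := fun t => ((48 * PI * Csum (lambert_term (qexp (/ u t))) N - 2 * PI) * (- h / (u t * u t))
       + 12 * (/ (/ u t) * (- h / (u t * u t)))
       - (48 * PI * Csum (lambert_term (qexp (u t))) N - 2 * PI) * h)%C).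
    apply (cder_mean_value (phi N) (fun t => phi N t * l t)%C). intros t Ht.
    assert (A := Ru t Ht). assert (B := Mu t Ht). assert (D := Riu t Ht).
    assert (Un : u t <> 0) by (apply Re_nz; lra).
    assert (Cu : cder u t h).
    { unfold u. apply cder_ext with (fun x => RtoC 1 + h * RtoC x)%C (0 + h * 1)%C; auto. ring.
      apply cder_plus. apply cder_const. apply cder_scal, cder_RtoC. }
    assert (Ciu := cder_inv u t h Un Cu).
    assert (Iun : (/ u t)%C <> 0).
    { intro E. apply C1_nz. rewrite <- (Cinv_r (u t) Un), E. ring. }
    destruct (delta_partial_bound N (u t) r ltac:(lra) (Qb (u t) ltac:(lra)) (proj2 Hr)) as [E1 [_ E3]].
    destruct (delta_partial_bound N (/ u t) r ltac:(lra) (Qb _ D) (proj2 Hr)) as [F1 [F2 _]].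
    split.
    - assert (L1 := lder_delta_partial (fun x => / u x)%C t _ N Ciu ltac:(lra)).
      assert (L2 := lder_inv _ t _ E1 (lder_delta_partial u t h N Cu ltac:(lra))).
      assert (L3 : lder (fun x => / u x)%C t (/ (/ u t) * (- h / (u t * u t)))%C).
      { unfold lder. eapply cder_ext. 3: exact Ciu. reflexivity. field. repeat split; auto. }
      assert (L4 := lder_mult _ _ _ _ _ (lder_mult _ _ _ _ _ L1 (lder_pow _ _ _ 11 L3)) L2).
      unfold lder in L4. eapply cder_ext. 3: exact L4. reflexivity.
      unfold l. f_equal. rewrite INR_IZR_INZ. change (IZR (Z.of_nat 12)) with 12. ring.
    - destruct (lambert_term_csum (u t) ltac:(lra)) as [T HT].
      destruct (lambert_term_csum (/ u t) ltac:(lra)) as [T' HT'].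
      assert (ML := lambert_modular (u t) T T' ltac:(lra) HT HT').
      (* With the complete Lambert sums the logarithmic derivative would vanish identically; only
         the tails beyond [N] remain. *)
      assert (El : l t = (h * (48 * PI * ((T - Csum (lambert_term (qexp (u t))) N)
           + (T' - Csum (lambert_term (qexp (/ u t))) N) * / u t ^ 2)))%C).
      { unfold l. set (X := Csum (lambert_term (qexp (u t))) N). set (Y := Csum (lambert_term (qexp (/ u t))) N).
        replace (48 * PI * (T - X + (T' - Y) * / u t ^ 2))%C with (48 * PI * (T + T' / u t ^ 2) - 48 * PI * (X + Y * / u t ^ 2))%C by (unfold Cdiv; ring).
        rewrite ML. simpl. field. auto. }
      apply Cmod_mult_le.
      + unfold phi, K0. apply Cmod_mult_le. apply Cmod_mult_le; auto.
        * rewrite Cmod_pow. apply pow_incr. split. apply Cmod_ge_0.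
          apply Cmod_inv_le. lra. eapply Rle_trans. apply A. eapply Rle_trans. apply Rle_abs. apply Re_le_Cmod.
        * eapply Rle_trans. apply E3. apply Rmult_le_compat_r. apply pow_le; left; apply exp_pos.
          apply exp_mono. assert (Re (u t) <= Mx). { eapply Rle_trans. apply Rle_abs. eapply Rle_trans. apply Re_le_Cmod. auto. } nra.
      + rewrite El. unfold K1. rewrite Rmult_assoc. apply Cmod_mult_le. apply Rle_refl.
        rewrite Rmult_assoc.
        apply Cmod_mult_le. rewrite <- RtoC_mult, Cmod_R, Rabs_pos_eq; lra.
        replace ((1 + / sg ^ 2) * tail N) with (tail N + tail N * / sg ^ 2) by ring.
        apply Cmod_plus_le. apply Hbound; auto. apply Qb; lra.
        apply Cmod_mult_le. apply Hbound; auto.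
        apply Cmod_inv_le. apply pow_lt; lra. rewrite Cmod_pow. apply pow_incr. split. lra.
        eapply Rle_trans. apply A. eapply Rle_trans. apply Rle_abs. apply Re_le_Cmod. }
  assert (Phi0 : forall N, phi N 0 = 1).
  { intro N. unfold phi. replace (u 0) with (RtoC 1) by (unfold u; ring).
    destruct (delta_partial_bound N 1 r ltac:(rewrite re_RtoC; lra) ltac:(apply Qb; rewrite re_RtoC; lra) (proj2 Hr)) as [E1 _].
    replace (/ 1)%C with (RtoC 1) by field. rewrite Cpow_1_l. field. auto. }
  assert (L1 : cvg (fun N => phi N 1) 1).
  { apply cvg_bound with (fun N => (2 * K0 * K1) * tail N). 2: now apply is_lim_seq_scal0.
    intro N. rewrite <- (Phi0 N). replace (2 * K0 * K1 * tail N) with (2 * (K0 * (K1 * tail N))) by ring. apply Main. }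
  assert (H24 : (P ^ 24)%C <> 0) by now apply Cpow_nz.
  assert (Hqn := qexp_nz s).
  assert (L2 : cvg (fun N => phi N 1) (qexp (/ s) * P' ^ 24 * (/ s) ^ 12 * / (qexp s * P ^ 24))%C).
  { unfold phi. replace (u 1) with s by (unfold u, h; ring). unfold delta_partial.
    apply cvg_mult. apply cvg_mult. 2: apply cvg_const.
    apply cvg_scal, cvg_pow, HP'. apply cvg_inv. now apply Cmult_neq_0. apply cvg_scal, cvg_pow, HP. }
  assert (E := cvg_unique _ _ _ L1 L2).
  assert (H12 : (s ^ 12)%C <> 0) by now apply Cpow_nz.
  rewrite Cpow_inv in E by auto.
  replace (qexp (/ s) * P' ^ 24)%C with ((qexp (/ s) * P' ^ 24 * / s ^ 12 * / (qexp s * P ^ 24)) * (s ^ 12 * (qexp s * P ^ 24)))%C.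
  2: { set (X := (P ^ 24)%C) in *. set (X' := (P' ^ 24)%C) in *. set (X'' := (s ^ 12)%C) in *. field. auto. }
  rewrite <- E. ring.
Qed.

(** * Coefficients of the modular invariant *)

Definition klein_j (s : C) : C := (eisenstein4 (qexp s) ^ 3 / (qexp s * euler_prod24 (qexp s)))%C.

Lemma euler_prod24_nz (q : C) : Cmod q < 1 -> euler_prod24 q <> 0.
Proof.
  intros Hq. destruct (qprod_cvg q Hq) as [P [HP0 HP]]. rewrite (euler_prod24_spec _ _ HP). now apply Cpow_nz.
Qed.

Lemma klein_j_inv (s : C) : 0 < Re s -> klein_j (/ s) = klein_j s.
Proof.
  intros Hs. assert (Hn := Re_nz s Hs). unfold klein_j.
  rewrite eisenstein4_modular, delta_modular by auto.
  assert (H1 := euler_prod24_nz _ (qexp_lt_1 s Hs)). assert (H2 := qexp_nz s).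
  assert (H3 := Cpow_nz s 12 Hn). rewrite Cpow_mult_l, <- Cpow_mult_r. change (4 * 3)%nat with 12%nat. field. auto.
Qed.

Lemma j_coefficients_series (c : nat -> Z) : is_j_coefficients c -> forall s, 0 < Re s ->
  csum (fun n => IZR (c n) * qexp s ^ n)%C (klein_j s - / qexp s)%C.
Proof.
  intros hc s Hs. apply csum_is_series.
  (* The pair is $\tau=is$. *)
  specialize (hc (- Im s, Re s) Hs).
  assert (E : nome (- Im s, Re s) = qexp s).
  { unfold nome, qexp, Cexp. rewrite re_opp, im_opp, Re_2PI.
    assert (Ei : Im (2 * PI * s) = 2 * PI * Im s).
    { replace (2 * PI * s)%C with (RtoC (2 * PI) * s)%C by (rewrite RtoC_mult; ring). apply im_scal_l. }
    rewrite Ei. destruct s as [x y]. unfold RtoC, Cmult, Re, Im; simpl.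
    replace (2 * PI * - y) with (- (2 * PI * y)) by ring. f_equal; ring. }
  unfold j_invariant in hc. rewrite E in hc. exact hc.
Qed.

Lemma csum_real (a : nat -> R) (l : C) : csum (fun n => RtoC (a n)) l -> l = RtoC (Re l) /\ rsum a (Re l).
Proof.
  intros H.
  assert (E : l = RtoC (Re l)).
  { assert (Hi : Rabs (Im l) <= 0).
    { assert (L : Rbar_le (Rabs (Im l)) 0); auto.
      apply (is_lim_seq_le (fun _ => Rabs (Im l)) (fun n => Cmod (Csum (fun n => RtoC (a n)) n - l)) (Rabs (Im l)) 0).
      - intro n. rewrite <- RtoC_Rsum. eapply Rle_trans. 2: apply Im_le_Cmod.
        unfold Cminus. rewrite im_plus, im_opp, im_RtoC, Rplus_0_l, Rabs_Ropp. apply Rle_refl.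
      - apply is_lim_seq_const.
      - exact H. }
    apply C_ext. now rewrite re_RtoC. rewrite im_RtoC.
    unfold Rabs in Hi. destruct (Rcase_abs (Im l)); lra. }
  split; auto. apply rsum_cvg. now rewrite <- E.
Qed.

(** As $x\to 0^+$ the value tends to the constant coefficient, which therefore vanishes; divide by
    $x$ and repeat. Summability at $1/2$ controls the remainder. This identifies coefficients when
    two series agree only up to $O(x^{N+1})$. *)
Lemma pseries_low_order (N : nat) : forall (d : nat -> R) (K C0 : R),
  rsum (fun n => Rabs (d n) * (/ 2) ^ n) K ->
  (forall x l, 0 < x <= / 2 -> rsum (fun n => d n * x ^ n) l -> Rabs l <= C0 * x ^ S N) ->
  forall n, (n <= N)%nat -> d n = 0.
Proof.
  assert (Ex : forall (d : nat -> R) (K x : R), rsum (fun n => Rabs (d n) * (/ 2) ^ n) K -> 0 < x <= / 2 ->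
    exists l, rsum (fun n => d n * x ^ n) l).
  { intros d K x H Hx. assert (D : forall n, Cmod (RtoC (d n * x ^ n)) <= Rabs (d n) * (/ 2) ^ n).
    { intro n. rewrite Cmod_R, Rabs_mult. apply Rmult_le_compat_l. apply Rabs_pos.
      rewrite Rabs_pos_eq by (apply pow_le; lra). apply pow_incr; lra. }
    destruct (csum_ex _ _ _ D H) as [l Hl].
    exists (Re l). now apply csum_real. }
  assert (Shift : forall (d : nat -> R) (K : R), rsum (fun n => Rabs (d n) * (/ 2) ^ n) K ->
     rsum (fun n => Rabs (d (S n)) * (/ 2) ^ n) (2 * (K - Rabs (d O)))).
  { intros d K H. apply rsum_ext with (fun n => 2 * (Rabs (d (S n)) * (/ 2) ^ S n)). intro; simpl; field.
    apply rsum_scal. apply rsum_cvg in H. apply rsum_cvg. rewrite RtoC_minus.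
    apply <- (csum_incr (fun n => RtoC (Rabs (d n) * (/ 2) ^ n))). 
    replace (RtoC (Rabs (d O) * (/ 2) ^ 0) + (K - Rabs (d O)))%C with (RtoC K). exact H.
    rewrite pow_O, Rmult_1_r. ring. }
  assert (Split : forall (d : nat -> R) (x l : R), x <> 0 -> rsum (fun n => d n * x ^ n) l ->
     rsum (fun n => d (S n) * x ^ n) ((l - d O) / x)).
  { intros d x l Hx H. apply rsum_ext with (fun n => / x * (d (S n) * x ^ S n)). intro n; simpl; field; auto.
    unfold Rdiv. rewrite Rmult_comm. apply rsum_scal. apply rsum_cvg in H. apply rsum_cvg. rewrite RtoC_minus.
    apply <- (csum_incr (fun n => RtoC (d n * x ^ n))).
    replace (RtoC (d O * x ^ 0) + (l - d O))%C with (RtoC l). exact H.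
    rewrite pow_O, Rmult_1_r. ring. }
  assert (Zero : forall N (d : nat -> R) (K C0 : R),
    rsum (fun n => Rabs (d n) * (/ 2) ^ n) K ->
    (forall x l, 0 < x <= / 2 -> rsum (fun n => d n * x ^ n) l -> Rabs l <= C0 * x ^ S N) -> d O = 0).
  { intros M d K C0 HK H.
    set (K' := Rabs C0 + 2 * (K - Rabs (d O))).
    assert (HKd : 0 <= 2 * (K - Rabs (d O))).
    { apply (rsum_nonneg (fun n => Rabs (d (S n)) * (/ 2) ^ n)).
      intro; apply Rmult_le_pos. apply Rabs_pos. apply pow_le; lra. now apply Shift. }
    assert (B : forall x, 0 < x <= / 2 -> Rabs (d O) <= K' * x).
    { intros x Hx. destruct (Ex d K x HK Hx) as [l Hl]. assert (A := H x l Hx Hl).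
      assert (S1 := Split d x l ltac:(lra) Hl).
      assert (B1 : Rabs ((l - d O) / x) <= 2 * (K - Rabs (d O))).
      { rewrite <- Cmod_R. apply (csum_norm_le (fun n => RtoC (d (S n) * x ^ n)) (fun n => Rabs (d (S n)) * (/ 2) ^ n)).
        - intro n. rewrite Cmod_R, Rabs_mult. apply Rmult_le_compat_l. apply Rabs_pos.
          rewrite Rabs_pos_eq by (apply pow_le; lra). apply pow_incr; lra.
        - now apply rsum_cvg.
        - now apply Shift. }
      assert (E : Rabs (l - d O) <= 2 * (K - Rabs (d O)) * x).
      { replace (l - d O) with ((l - d O) / x * x) by (field; lra). rewrite Rabs_mult, (Rabs_pos_eq x) by lra. apply Rmult_le_compat_r; lra. }
      assert (F : C0 * x ^ S M <= Rabs C0 * x).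
      { apply Rle_trans with (Rabs C0 * x ^ S M). apply Rmult_le_compat_r. apply pow_le; lra. apply Rle_abs.
        apply Rmult_le_compat_l. apply Rabs_pos. simpl. apply Rle_trans with (x * 1). 2: lra.
        apply Rmult_le_compat_l. lra. eapply Rle_trans. apply (pow_incr x 1); lra. rewrite pow1; lra. }
      replace (d O) with (l - (l - d O)) by ring. unfold Rminus at 1. eapply Rle_trans. apply Rabs_triang.
      rewrite Rabs_Ropp. unfold K'. lra. }
    assert (HK' : 0 <= K') by (unfold K'; generalize (Rabs_pos C0); lra).
    destruct (Req_dec (d O) 0) as [E | E]; auto. exfalso.
    assert (Pd : 0 < Rabs (d O)) by now apply Rabs_pos_lt.
    set (x := Rmin (/ 2) (Rabs (d O) / (2 * (K' + 1)))).
    assert (Hd : 0 < Rabs (d O) / (2 * (K' + 1))) by (apply Rdiv_lt_0_compat; lra).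
    assert (Hx : 0 < x <= / 2) by (unfold x; split; [apply Rmin_glb_lt; lra | apply Rmin_l]).
    assert (Hx2 : x <= Rabs (d O) / (2 * (K' + 1))) by apply Rmin_r.
    specialize (B x Hx).
    assert (x * (2 * (K' + 1)) <= Rabs (d O)).
    { replace (Rabs (d O)) with (Rabs (d O) / (2 * (K' + 1)) * (2 * (K' + 1))) by (field; lra).
      apply Rmult_le_compat_r; lra. }
    nra. }
  induction N; intros d K C0 HK H n Hn.
  - replace n with O by lia. exact (Zero O d K C0 HK H).
  - assert (Z := Zero (S N) d K C0 HK H). destruct n; auto.
    apply (IHN (fun n => d (S n)) _ C0 (Shift d K HK)); [|lia].
    intros x l Hx Hl.
    assert (Hl2 : rsum (fun n => d n * x ^ n) (x * l)).
    { apply rsum_cvg. apply rsum_cvg in Hl.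
      replace (RtoC (x * l)) with (RtoC (d O * x ^ 0) + x * l)%C by (rewrite Z, Rmult_0_l, RtoC_mult; ring).
      apply -> (csum_incr (fun n => RtoC (d n * x ^ n))).
      apply csum_ext with (fun n => x * RtoC (d (S n) * x ^ n))%C.
      intro i. rewrite <- RtoC_mult. f_equal. simpl; ring. now apply csum_scal. }
    assert (A := H x _ Hx Hl2). rewrite Rabs_mult, Rabs_pos_eq in A by lra.
    apply Rmult_le_reg_l with x. lra. eapply Rle_trans. apply A. right. simpl; ring.
Qed.

(** * Power series with integer coefficients *)

Definition pseries_at (a : nat -> Z) (x l : R) : Prop := rsum (fun n => IZR (a n) * x ^ n) l.

Lemma rsum_minus (a b : nat -> R) (l m : R) : rsum a l -> rsum b m -> rsum (fun n => a n - b n) (l - m).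
Proof.
  intros Ha Hb. apply is_lim_seq_ext with (fun n => Rsum a n - Rsum b n).
  { intro n. replace (Rsum a n - Rsum b n) with (Rsum a n + Rsum (fun k => -1 * b k) n) by (rewrite Rsum_scal; ring).
    rewrite <- Rsum_plus. apply Rsum_ext. intros; ring. }
  now apply is_lim_seq_minus'.
Qed.

Lemma rsum_unique (a : nat -> R) (l m : R) : rsum a l -> rsum a m -> l = m.
Proof.
  intros H1 H2. apply rsum_cvg in H1, H2. apply RtoC_inj. now apply (csum_unique _ _ _ H1 H2).
Qed.

(** [is_j_coefficients] grants plain convergence only; a convergent point further out upgrades it to
    absolute convergence. *)
Lemma rsum_abel (a : nat -> R) (x0 l x : R) : 0 < x0 -> rsum (fun n => a n * x0 ^ n) l -> 0 <= x < x0 ->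
  exists K, rsum (fun n => Rabs (a n) * x ^ n) K.
Proof.
  intros H0 H Hx.
  assert (T : cvg (fun n => RtoC (a n * x0 ^ n)) 0) by (apply csum_term0 with (RtoC l); now apply rsum_cvg).
  destruct (cvg_norm_bounded _ _ T) as [K [HK B]].
  assert (Hr : 0 <= x / x0 < 1).
  { split. apply Rmult_le_pos. lra. left; now apply Rinv_0_lt_compat.
    apply Rmult_lt_reg_r with x0; auto. unfold Rdiv. rewrite Rmult_assoc, Rinv_l; lra. }
  apply rsum_ex_le with (fun n => K * (x / x0) ^ n) (K * / (1 - x / x0)).
  2: now apply rsum_scal, rsum_geom.
  intro n. assert (Px : 0 <= x ^ n) by (apply pow_le; lra). split.
  - apply Rmult_le_pos; auto. apply Rabs_pos.
  - specialize (B n). rewrite Cmod_R, Rabs_mult, (Rabs_pos_eq (x0 ^ n)) in B by (apply pow_le; lra).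
    assert (Pn : 0 < x0 ^ n) by now apply pow_lt.
    unfold Rdiv. rewrite Rpow_mult_distr, pow_inv.
    replace (Rabs (a n) * x ^ n) with (Rabs (a n) * x0 ^ n * (x ^ n * / x0 ^ n)) by (field; lra).
    apply Rmult_le_compat_r; auto. apply Rmult_le_pos; auto. left; now apply Rinv_0_lt_compat.
Qed.

Definition mul_binomial (k : nat) (a : nat -> Z) (n : nat) : Z :=
  (a n - (if Nat.leb k n then a (n - k)%nat else 0))%Z.

Lemma mul_binomial_series (k : nat) (a : nat -> Z) (x l : R) :
  pseries_at a x l -> pseries_at (mul_binomial k a) x ((1 - x ^ k) * l).
Proof.
  unfold pseries_at. intros H. replace ((1 - x ^ k) * l) with (l - x ^ k * l) by ring.
  apply rsum_ext with (fun n => IZR (a n) * x ^ n - delay k (fun i => IZR (a i)) n * x ^ n).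
  { intro n. unfold mul_binomial, delay. rewrite minus_IZR. destruct (Nat.leb k n); ring. }
  apply rsum_minus; auto. apply rsum_cvg.
  rewrite RtoC_mult, RtoC_pow.
  apply csum_ext with (fun n => RtoC (delay k (fun i => IZR (a i)) n) * x ^ n)%C.
  intro n; now rewrite RtoC_mult, RtoC_pow.
  apply csum_delay. apply rsum_cvg in H. apply csum_ext with (2 := H). intro n; now rewrite RtoC_mult, RtoC_pow.
Qed.

Fixpoint Zsum (f : nat -> Z) (n : nat) : Z := match n with O => 0%Z | S m => (Zsum f m + f m)%Z end.
Definition Zconv (a b : nat -> Z) (n : nat) : Z := Zsum (fun i => a i * b (n - i)%nat)%Z (S n).

Lemma IZR_Zsum (f : nat -> Z) (n : nat) : IZR (Zsum f n) = Rsum (fun i => IZR (f i)) n.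
Proof. induction n; simpl; auto. now rewrite plus_IZR, IHn. Qed.

Lemma Rsum_sum_f_R0 (f : nat -> R) (n : nat) : Rsum f (S n) = sum_f_R0 f n.
Proof. induction n. simpl; ring. rewrite tech5, <- IHn. reflexivity. Qed.

Lemma Zconv_series (a b : nat -> Z) (x0 x l m : R) : 0 < x0 -> 0 <= x < x0 ->
  (exists l0, pseries_at a x0 l0) -> (exists m0, pseries_at b x0 m0) ->
  pseries_at a x l -> pseries_at b x m -> pseries_at (Zconv a b) x (l * m).
Proof.
  intros H0 Hx [l0 Ha0] [m0 Hb0] Ha Hb. unfold pseries_at in *.
  destruct (rsum_abel _ _ _ x H0 Ha0 Hx) as [Ka HKa]. destruct (rsum_abel _ _ _ x H0 Hb0 Hx) as [Kb HKb].
  apply rsum_is_series in Ha, Hb, HKa, HKb.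
  assert (Abs : forall (c : nat -> Z) n, Rabs (IZR (c n)) * x ^ n = Rabs (IZR (c n) * x ^ n)).
  { intros c n. rewrite Rabs_mult, (Rabs_pos_eq (x ^ n)); auto. apply pow_le; lra. }
  assert (H := is_series_mult _ _ _ _ Ha Hb).
  apply rsum_is_series. eapply is_series_ext. 2: apply H.
  - intro n. cbv beta. rewrite <- Rsum_sum_f_R0. unfold Zconv. rewrite IZR_Zsum.
    rewrite Rmult_comm, <- Rsum_scal. apply Rsum_ext. intros i Hi. rewrite mult_IZR.
    replace (x ^ n) with (x ^ i * x ^ (n - i)) by (rewrite <- pow_add; f_equal; lia). ring.
  - exists Ka. apply is_series_ext with (2 := HKa). intro; apply Abs.
  - exists Kb. apply is_series_ext with (2 := HKb). intro; apply Abs.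
Qed.

(** Multiplication by [prod_(k <= N) (1 - q^k)^24]. *)
Fixpoint mul_euler (N : nat) (a : nat -> Z) : nat -> Z :=
  match N with O => a | S m => Nat.iter 24 (mul_binomial (S m)) (mul_euler m a) end.

Lemma mul_euler_S (N : nat) (a : nat -> Z) :
  mul_euler (S N) a = Nat.iter 24 (mul_binomial (S N)) (mul_euler N a).
Proof. reflexivity. Qed.

Fixpoint rprod (x : R) (n : nat) : R := match n with O => 1 | S m => rprod x m * (1 - x ^ S m) end.

Lemma iter_mul_binomial_series (k m : nat) (a : nat -> Z) (x l : R) :
  pseries_at a x l -> pseries_at (Nat.iter m (mul_binomial k) a) x ((1 - x ^ k) ^ m * l).
Proof.
  intros H. induction m. now rewrite pow_O, Rmult_1_l.
  rewrite <- tech_pow_Rmult, Rmult_assoc. apply (mul_binomial_series k). exact IHm.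
Qed.

Lemma mul_euler_series (N : nat) (a : nat -> Z) (x l : R) :
  pseries_at a x l -> pseries_at (mul_euler N a) x (rprod x N ^ 24 * l).
Proof.
  intros H. induction N.
  - cbn [mul_euler rprod]. rewrite pow1, Rmult_1_l. exact H.
  - rewrite mul_euler_S. cbn [rprod]. generalize dependent 24%nat. intros m IH.
    rewrite Rpow_mult_distr, (Rmult_comm (rprod x N ^ m)), Rmult_assoc.
    now apply iter_mul_binomial_series.
Qed.

Definition e4_coef (n : nat) : Z :=
  match n with O => 1%Z | _ => (240 * Z.of_nat (divisor_sigma 3 n))%Z end.

Definition e4_cube : nat -> Z := Zconv e4_coef (Zconv e4_coef e4_coef).

(** The coefficients of $q\,j$: the pole becomes an ordinary constant term, and $c(n)$ sits at index
    $n+1$. *)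
Definition j_shifted (c : nat -> Z) (n : nat) : Z := match n with O => 1%Z | S m => c m end.

Lemma qprod_rprod (x : R) (N : nat) : qprod x N = RtoC (rprod x N).
Proof.
  induction N; simpl; auto. rewrite IHN, <- RtoC_pow, <- !RtoC_mult, <- RtoC_minus, <- RtoC_mult. reflexivity.
Qed.

Lemma rprod_decr (x : R) (N : nat) : 0 < x < 1 -> 0 < rprod x N <= 1 /\
  forall M, 0 <= rprod x N - rprod x (N + M) <= Rsum (fun k => x ^ S (N + k)) M.
Proof.
  intros Hx.
  assert (P : forall n, 0 < x ^ S n < 1).
  { intro n. split. now apply pow_lt. apply Rle_lt_trans with x. 2: lra. apply pow_S_le; lra. }
  assert (A : forall n, 0 < rprod x n <= 1).
  { induction n. simpl; lra. cbn [rprod]. specialize (P n). nra. }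
  split; auto. induction M.
  - rewrite Nat.add_0_r. simpl. lra.
  - rewrite Nat.add_succ_r. cbn [rprod Rsum]. specialize (P (N + M)%nat). specialize (A (N + M)%nat). nra.
Qed.

Lemma pow_diff_le (u v : R) (n : nat) : 0 <= v <= u -> u <= 1 -> 0 <= u ^ n - v ^ n <= INR n * (u - v).
Proof.
  intros H Hu. induction n. simpl; lra.
  rewrite S_INR. simpl pow.
  assert (P : 0 <= v ^ n <= 1). { split. apply pow_le; lra. eapply Rle_trans. apply (pow_incr v 1); lra. rewrite pow1; lra. }
  replace (u * u ^ n - v * v ^ n) with (u * (u ^ n - v ^ n) + (u - v) * v ^ n) by ring.
  assert (0 <= u * (u ^ n - v ^ n) <= u ^ n - v ^ n) by nra. nra.
Qed.

Lemma real_nome (x : R) : 0 < x < 1 -> exists s : R, 0 < s /\ qexp s = RtoC x.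
Proof.
  intros Hx. assert (P := PI_RGT_0). exists (- ln x / (2 * PI)).
  assert (Hl : ln x < 0) by (rewrite <- ln_1; apply ln_increasing; lra).
  split. apply Rdiv_lt_0_compat; lra.
  unfold qexp. rewrite <- !RtoC_mult, <- RtoC_opp, Cexp_RtoC. f_equal.
  rewrite <- (exp_ln x) at 2 by lra. f_equal. field. lra.
Qed.

(** The definition of $j$ at real $q$, cleared of its denominator. Real $q$ determines the
    coefficients, and there the partial products decrease and lie in $(0,1]$. *)
Lemma j_product_identity (c : nat -> Z) (x : R) : is_j_coefficients c -> 0 < x < 1 ->
  exists p e g : R, pseries_at (j_shifted c) x p /\ pseries_at e4_coef x e /\ is_lim_seq (rprod x) g /\ p * g ^ 24 = e ^ 3.
Proof.
  intros hc Hx. destruct (real_nome x Hx) as [s [Hs Hq]].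
  assert (Hs' : 0 < Re s) by (rewrite re_RtoC; auto).
  assert (Hj := j_coefficients_series c hc s Hs'). unfold klein_j in Hj. rewrite Hq in Hj.
  destruct (qprod_cvg (RtoC x)) as [P [HP0 HP]]. { rewrite Cmod_R, Rabs_pos_eq; lra. }
  rewrite (euler_prod24_spec _ _ HP) in Hj.
  assert (Hxn : RtoC x <> 0) by (apply RtoC_nz; lra).
  assert (HP24 := Cpow_nz _ 24 HP0).
  assert (Eg : exists g : R, P = RtoC g /\ is_lim_seq (rprod x) g).
  { assert (H1 : csum (fun n => RtoC (rprod x (S n) - rprod x n)) (P - 1)%C).
    { apply cvg_ext with (fun n => qprod x n - 1)%C.
      - intro n. induction n. simpl; ring. cbn [Csum]. rewrite <- IHn, !qprod_rprod, RtoC_minus. ring.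
      - apply cvg_minus; auto. apply cvg_const. }
    apply csum_real in H1. destruct H1 as [E1 E2]. exists (Re (P - 1) + 1). split.
    - rewrite RtoC_plus, <- E1. ring.
    - apply is_lim_seq_ext with (fun n => Rsum (fun n => rprod x (S n) - rprod x n) n + 1).
      + intro n. induction n. simpl; ring. cbn [Rsum]. lra.
      + apply is_lim_seq_plus'. exact E2. apply is_lim_seq_const. }
  destruct Eg as [g [-> Hg]].
  destruct (lam4_sum_ex s Hs') as [L HL]. assert (Hd := divisor_series_lam4 s L Hs' HL).
  set (D := (/ (8 * PI ^ 4 / 3) * L)%C) in *.
  assert (E4 : eisenstein4 x = (1 + 240 * D)%C).
  { rewrite <- Hq. unfold eisenstein4. now rewrite (CSeries_csum _ _ Hd). }
  rewrite Hq in Hd.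
  assert (S4 : csum (fun n => RtoC (IZR (e4_coef n) * x ^ n)) (eisenstein4 x)).
  { rewrite E4. replace (1 + 240 * D)%C with (RtoC (IZR (e4_coef 0) * x ^ 0) + 240 * D)%C.
    2: { simpl. rewrite Rmult_1_r. reflexivity. }
    apply -> (csum_incr (fun n => RtoC (IZR (e4_coef n) * x ^ n))).
    apply csum_ext with (fun n => 240 * (RtoC (INR (divisor_sigma 3 (S n))) * x ^ S n))%C.
    - intro n. unfold e4_coef. rewrite mult_IZR, <- INR_IZR_INZ, !RtoC_mult, RtoC_pow. ring.
    - now apply csum_scal. }
  assert (Sp : csum (fun n => RtoC (IZR (j_shifted c n) * x ^ n)) (eisenstein4 x ^ 3 / RtoC g ^ 24)%C).
  { replace (eisenstein4 x ^ 3 / RtoC g ^ 24)%C with (RtoC (IZR (j_shifted c 0) * x ^ 0)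
       + x * (eisenstein4 x ^ 3 / (x * RtoC g ^ 24) - / x))%C.
    2: { cbn [j_shifted]. rewrite pow_O, Rmult_1_r. set (G := (RtoC g ^ 24)%C) in *. set (e := eisenstein4 x) in *. field. auto. }
    apply -> (csum_incr (fun n => RtoC (IZR (j_shifted c n) * x ^ n))).
    apply csum_ext with (fun n => x * (IZR (c n) * x ^ n))%C.
    - intro n. rewrite RtoC_mult, RtoC_pow, Cpow_S. simpl j_shifted. ring.
    - now apply csum_scal. }
  apply csum_real in S4, Sp. destruct S4 as [E1 S4]. destruct Sp as [E2 Sp].
  exists (Re (eisenstein4 x ^ 3 / RtoC g ^ 24)), (Re (eisenstein4 x)), g. repeat split; auto.
  apply RtoC_inj. rewrite RtoC_mult, !RtoC_pow, <- E1, <- E2.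
  unfold Cdiv. rewrite <- Cmult_assoc, Cinv_l by exact HP24. apply Cmult_1_r.
Qed.

Lemma pseries_at_minus (a b : nat -> Z) (x l m : R) : pseries_at a x l -> pseries_at b x m ->
  rsum (fun n => IZR (a n - b n) * x ^ n) (l - m).
Proof.
  intros Ha Hb. apply rsum_ext with (fun n => IZR (a n) * x ^ n - IZR (b n) * x ^ n).
  intro n; rewrite minus_IZR; ring. now apply rsum_minus.
Qed.

(** The omitted factors of the product are $1+O(q^{N+1})$, so a finite product already reproduces
    $E_4^3$ up to order [N]. *)
Lemma mul_euler_j (c : nat -> Z) (N n : nat) : is_j_coefficients c -> (n <= N)%nat ->
  mul_euler N (j_shifted c) n = e4_cube n.
Proof.
  intros hc Hn.
  assert (Hcube : forall x e, 0 < x < 1 -> pseries_at e4_coef x e -> pseries_at e4_cube x (e ^ 3)).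
  (* Each Cauchy product needs convergence at a larger point; two nested products need two of
     them. *)
  { intros x e Hx He. assert (H1 : 0 < (x + 1) / 2 < 1) by lra. assert (H2 : 0 < (x + 3) / 4 < 1) by lra.
    destruct (j_product_identity c _ hc H1) as [_ [e1 [_ [_ [He1 _]]]]].
    destruct (j_product_identity c _ hc H2) as [_ [e2 [_ [_ [He2 _]]]]].
    replace (e ^ 3) with (e * (e * e)) by ring.
    apply Zconv_series with ((x + 1) / 2); try lra; try (now exists e1); auto.
    - exists (e1 * e1). apply Zconv_series with ((x + 3) / 4); try lra; try (now exists e2); auto.
    - apply Zconv_series with ((x + 1) / 2); try lra; try (now exists e1); auto. }
  set (d := fun n => (mul_euler N (j_shifted c) n - e4_cube n)%Z).
  assert (Hd : forall x p e, 0 < x < 1 -> pseries_at (j_shifted c) x p -> pseries_at e4_coef x e ->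
    rsum (fun n => IZR (d n) * x ^ n) (rprod x N ^ 24 * p - e ^ 3)).
  { intros x p e Hx Hp He. apply pseries_at_minus. now apply mul_euler_series. now apply Hcube. }
  assert (Hh : 0 < 3 / 4 < 1) by lra.
  destruct (j_product_identity c _ hc Hh) as [p1 [e1 [g1 [Hp1 [He1 _]]]]].
  assert (Hd1 := Hd _ _ _ Hh Hp1 He1).
  destruct (rsum_abel _ _ _ (/ 2) (proj1 Hh) Hd1 ltac:(lra)) as [K HK].
  destruct (rsum_abel _ _ _ (/ 2) (proj1 Hh) Hp1 ltac:(lra)) as [Kp HKp].
  assert (Z : IZR (d n) = 0).
  { apply (pseries_low_order N (fun n => IZR (d n)) K (Kp * 48) HK) with (2 := Hn).
    intros x l Hx Hl.
    destruct (j_product_identity c x hc ltac:(lra)) as [p [e [g [Hp [He [Hg E]]]]]].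
    rewrite (rsum_unique _ _ _ Hl (Hd x p e ltac:(lra) Hp He)), <- E.
    replace (rprod x N ^ 24 * p - p * g ^ 24) with (p * (rprod x N ^ 24 - g ^ 24)) by ring.
    rewrite Rabs_mult. rewrite Rmult_assoc.
    destruct (rprod_decr x N ltac:(lra)) as [R1 R2].
    assert (Geo : forall M, Rsum (fun k => x ^ S (N + k)) M <= 2 * x ^ S N).
    { intro M. rewrite (Rsum_ext _ (fun k => x ^ S N * x ^ k)) by (intros; rewrite <- pow_add; f_equal; lia).
      rewrite Rsum_scal. rewrite Rmult_comm. apply Rmult_le_compat_r. apply pow_le; lra.
      apply Rle_trans with (/ (1 - x)). apply rsum_partial_le. intro; apply pow_le; lra. apply rsum_geom; lra.
      replace 2 with (/ (1 - / 2)) by field. apply Rinv_le_contravar; lra. }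
    assert (G1 : 0 <= rprod x N - g <= 2 * x ^ S N).
    { assert (Hg2 : is_lim_seq (fun M => rprod x (N + M)) g).
      { apply is_lim_seq_incr_n with (N := N) in Hg. apply is_lim_seq_ext with (2 := Hg). intro M; f_equal; lia. }
      split.
      - assert (L : Rbar_le g (rprod x N)); [|unfold Rbar_le in L; lra].
        apply (is_lim_seq_le (fun M => rprod x (N + M)) (fun _ => rprod x N)); auto using is_lim_seq_const.
        intro M. specialize (R2 M). lra.
      - assert (L : Rbar_le (rprod x N - 2 * x ^ S N) g); [|unfold Rbar_le in L; lra].
        apply (is_lim_seq_le (fun _ => rprod x N - 2 * x ^ S N) (fun M => rprod x (N + M))); auto using is_lim_seq_const.
        intro M. specialize (R2 M). specialize (Geo M). lra. }
    assert (G0 : 0 <= g).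
    { assert (L : Rbar_le 0 g); auto. apply (is_lim_seq_le (fun _ => 0) (rprod x)); auto using is_lim_seq_const.
      intro M. destruct (rprod_decr x M ltac:(lra)) as [R _]. lra. }
    destruct (pow_diff_le (rprod x N) g 24 ltac:(lra) ltac:(lra)) as [D1 D2].
    rewrite INR_IZR_INZ in D2. simpl (IZR (Z.of_nat 24)) in D2.
    apply Rmult_le_compat; try apply Rabs_pos.
    - rewrite <- Cmod_R. apply (csum_norm_le (fun n => RtoC (IZR (j_shifted c n) * x ^ n)) (fun n => Rabs (IZR (j_shifted c n)) * (/ 2) ^ n)).
      + intro i. rewrite Cmod_R, Rabs_mult. apply Rmult_le_compat_l. apply Rabs_pos.
        rewrite Rabs_pos_eq by (apply pow_le; lra). apply pow_incr; lra.
      + now apply rsum_cvg.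
      + exact HKp.
    - rewrite Rabs_pos_eq by lra. lra. }
  apply eq_IZR in Z. unfold d in Z. lia.
Qed.

(** Division by $1-q^k$ is the recursion $a_n=b_n+a_{n-k}$, which preserves nonnegativity. *)
Lemma mul_binomial_inv_nonneg (k N : nat) (a : nat -> Z) : (0 < k)%nat ->
  (forall n, (n <= N)%nat -> (0 <= mul_binomial k a n)%Z) -> forall n, (n <= N)%nat -> (0 <= a n)%Z.
Proof.
  intros Hk H n. induction n as [n IH] using lt_wf_ind. intros Hn.
  specialize (H n Hn). unfold mul_binomial in H.
  destruct (Nat.leb_spec k n). 2: lia. specialize (IH (n - k)%nat ltac:(lia) ltac:(lia)). lia.
Qed.

Lemma iter_mul_binomial_inv_nonneg (k N i : nat) (a : nat -> Z) : (0 < k)%nat ->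
  (forall n, (n <= N)%nat -> (0 <= Nat.iter i (mul_binomial k) a n)%Z) -> forall n, (n <= N)%nat -> (0 <= a n)%Z.
Proof.
  intros Hk. induction i; intros H. exact H.
  apply IHi. now apply mul_binomial_inv_nonneg with k.
Qed.

Lemma mul_euler_inv_nonneg (N m : nat) (a : nat -> Z) :
  (forall n, (n <= N)%nat -> (0 <= mul_euler m a n)%Z) -> forall n, (n <= N)%nat -> (0 <= a n)%Z.
Proof.
  induction m; intros H. exact H.
  apply IHm. apply (iter_mul_binomial_inv_nonneg (S m) N 24). lia. rewrite <- mul_euler_S. exact H.
Qed.

Lemma Zconv_nonneg (a b : nat -> Z) : (forall n, (0 <= a n)%Z) -> (forall n, (0 <= b n)%Z) ->
  forall n, (0 <= Zconv a b n)%Z.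
Proof.
  intros Ha Hb m. unfold Zconv. generalize (S m) at 1. intro p. induction p; simpl. lia.
  specialize (Ha p). specialize (Hb (m - p)%nat). nia.
Qed.

(** $E_4^3$ has nonnegative coefficients and so does the inverse of the product. In [klein_j_near]
    this lets a real value of $j$ dominate complex ones. *)
Lemma j_coefficients_nonneg (c : nat -> Z) (n : nat) : is_j_coefficients c -> (0 <= c n)%Z.
Proof.
  intros hc.
  assert (E4 : forall n, (0 <= e4_coef n)%Z) by (intros [|m]; unfold e4_coef; lia).
  change (c n) with (j_shifted c (S n)). apply (mul_euler_inv_nonneg (S n) (S n)); auto.
  intros i Hi. rewrite mul_euler_j by auto. unfold e4_cube.
  apply Zconv_nonneg. exact E4. apply Zconv_nonneg; exact E4.
Qed.

(** * The first coefficients *)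

Definition znth (l : list Z) (n : nat) : Z := nth n l 0%Z.

Fixpoint zip_add (l1 l2 : list Z) : list Z :=
  match l1, l2 with
  | a :: t1, b :: t2 => (a + b)%Z :: zip_add t1 t2
  | nil, _ => nil
  | _, nil => l1
  end.

Lemma zip_add_length (l1 l2 : list Z) : length (zip_add l1 l2) = length l1.
Proof. revert l2. induction l1; intros [|b l2]; simpl; auto. Qed.

Lemma zip_add_nth (l1 l2 : list Z) (n : nat) : (n < length l1)%nat ->
  znth (zip_add l1 l2) n = (znth l1 n + znth l2 n)%Z.
Proof.
  unfold znth. revert l2 n. induction l1; intros l2 n H; simpl in H. lia.
  destruct l2 as [|b l2].
  - simpl zip_add. replace (nth n nil 0%Z) with 0%Z by (destruct n; auto). lia.
  - destruct n; simpl. auto. apply IHl1. lia.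
Qed.

(** Multiplication by [1 + q^k]; since [(1 - q^k) (1 + q^k) = 1 - q^(2k)], iterating it over
    [k, 2k, 4k, ...] divides by [1 - q^k] up to the truncation order. *)
Definition add_shift (k : nat) (l : list Z) : list Z := firstn k l ++ zip_add (skipn k l) l.

Lemma add_shift_length (k : nat) (l : list Z) : length (add_shift k l) = length l.
Proof. unfold add_shift. rewrite length_app, zip_add_length, <- length_app. now rewrite firstn_skipn. Qed.

Lemma add_shift_nth (k : nat) (l : list Z) (n : nat) : (n < length l)%nat ->
  znth (add_shift k l) n = (znth l n + (if Nat.leb k n then znth l (n - k) else 0))%Z.
Proof.
  intros H. unfold add_shift.
  destruct (Nat.leb_spec k n) as [L | L].
  - assert (Lk : length (firstn k l) = k) by (rewrite length_firstn; lia).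
    unfold znth at 1. rewrite app_nth2 by lia. rewrite Lk. fold (znth (zip_add (skipn k l) l) (n - k)).
    rewrite zip_add_nth by (rewrite length_skipn; lia). f_equal. unfold znth. rewrite nth_skipn. f_equal. lia.
  - unfold znth. rewrite app_nth1 by (rewrite length_firstn; lia). rewrite nth_firstn.
    destruct (Nat.ltb_spec n k). lia. lia.
Qed.

Fixpoint div_binomial (fuel k : nat) (l : list Z) : list Z :=
  match fuel with
  | O => l
  | S f => if Nat.leb (length l) k then l else add_shift k (div_binomial f (2 * k) l)
  end.

Lemma div_binomial_length (fuel k : nat) (l : list Z) : length (div_binomial fuel k l) = length l.
Proof.
  revert k. induction fuel; intro k; simpl; auto.
  destruct (Nat.leb (length l) k); auto. now rewrite add_shift_length.
Qed.

Lemma div_binomial_correct (fuel k : nat) (l : list Z) (n : nat) : (n < length l)%nat -> (length l <= 2 ^ fuel * k)%nat ->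
  mul_binomial k (znth (div_binomial fuel k l)) n = znth l n.
Proof.
  revert k n. induction fuel; intros k n Hn Hk.
  - simpl. unfold mul_binomial. destruct (Nat.leb_spec k n). simpl in Hk. lia. lia.
  - cbn [div_binomial]. destruct (Nat.leb_spec (length l) k) as [L | L].
    + unfold mul_binomial. destruct (Nat.leb_spec k n). lia. lia.
    + assert (IH := IHfuel (2 * k)%nat n Hn ltac:(simpl in Hk; lia)).
      set (y := div_binomial fuel (2 * k) l) in *.
      assert (Ly : length y = length l) by apply div_binomial_length.
      unfold mul_binomial in *. rewrite add_shift_nth by lia.
      destruct (Nat.leb_spec k n).
      * rewrite add_shift_nth by lia.
        destruct (Nat.leb_spec k (n - k)); destruct (Nat.leb_spec (2 * k) n); try lia.
        replace (n - k - k)%nat with (n - 2 * k)%nat by lia. lia.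
      * destruct (Nat.leb_spec (2 * k) n); lia.
Qed.

Lemma mul_binomial_inj (k N : nat) (a b : nat -> Z) : (0 < k)%nat ->
  (forall n, (n < N)%nat -> mul_binomial k a n = mul_binomial k b n) -> forall n, (n < N)%nat -> a n = b n.
Proof.
  intros Hk H n. induction n as [n IH] using lt_wf_ind. intros Hn.
  specialize (H n Hn). unfold mul_binomial in H.
  destruct (Nat.leb_spec k n). 2: lia. specialize (IH (n - k)%nat ltac:(lia) ltac:(lia)). lia.
Qed.

Fixpoint div_euler (fuel N : nat) (l : list Z) : list Z :=
  match N with O => l | S m => div_euler fuel m (Nat.iter 24 (div_binomial fuel (S m)) l) end.

Lemma div_euler_S (fuel N : nat) (l : list Z) :
  div_euler fuel (S N) l = div_euler fuel N (Nat.iter 24 (div_binomial fuel (S N)) l).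
Proof. reflexivity. Qed.

Lemma iter_div_length (fuel k i : nat) (l : list Z) : length (Nat.iter i (div_binomial fuel k) l) = length l.
Proof. induction i; simpl; auto. now rewrite div_binomial_length. Qed.

Lemma iter_div_correct (fuel k i : nat) (a : nat -> Z) (l : list Z) : (0 < k)%nat -> (length l <= 2 ^ fuel)%nat ->
  (forall n, (n < length l)%nat -> Nat.iter i (mul_binomial k) a n = znth l n) ->
  forall n, (n < length l)%nat -> a n = znth (Nat.iter i (div_binomial fuel k) l) n.
Proof.
  intros Hk. revert a l. induction i; intros a l Hl H m Hm. now apply H.
  rewrite Nat.iter_succ_r. apply IHi; rewrite ?div_binomial_length; auto.
  apply mul_binomial_inj with k; auto.
  intros n Hn. rewrite div_binomial_correct; auto.
  - specialize (H n Hn). rewrite <- H.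
    clear. revert n. induction i. auto. intro n. simpl. unfold mul_binomial at 1 3. now rewrite !IHi.
  - assert (2 ^ fuel * 1 <= 2 ^ fuel * k)%nat by (apply Nat.mul_le_mono_l; lia). lia.
Qed.

Lemma div_euler_length (fuel N : nat) (l : list Z) : length (div_euler fuel N l) = length l.
Proof. revert l. induction N; intro l; auto. rewrite div_euler_S, IHN. apply iter_div_length. Qed.

Lemma div_euler_correct (fuel N : nat) (a : nat -> Z) (l : list Z) :
  (length l <= 2 ^ fuel)%nat -> (forall n, (n < length l)%nat -> mul_euler N a n = znth l n) ->
  forall n, (n < length l)%nat -> a n = znth (div_euler fuel N l) n.
Proof.
  revert l. induction N; intros l Hl H n Hn. now apply H.
  rewrite div_euler_S. apply IHN; rewrite ?iter_div_length; auto.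
  rewrite mul_euler_S in H. apply (iter_div_correct fuel (S N) 24); auto. lia.
Qed.

(** The cubes are formed in binary integers, because [divisor_sigma] would build them in unary
    during evaluation. *)
Definition e4_coef_Z (n : nat) : Z :=
  match n with O => 1%Z | _ =>
   (240 * fold_right (fun d acc => if Nat.eqb (n mod d) 0 then Z.of_nat d * Z.of_nat d * Z.of_nat d + acc else acc) 0 (seq 1 n))%Z end.

Lemma e4_coef_eq (n : nat) : e4_coef_Z n = e4_coef n.
Proof.
  destruct n; auto. unfold e4_coef_Z, e4_coef, divisor_sigma. f_equal.
  generalize (seq 1 (S n)). intro l. induction l as [|d l IH]; auto.
  cbn [fold_right filter]. rewrite IH. destruct (Nat.eqb (S n mod d) 0); auto.
  cbn [map]. cbn [list_sum fold_right]. rewrite Nat2Z.inj_add. unfold list_sum. f_equal.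
  rewrite Nat2Z.inj_pow. change (Z.of_nat 3) with 3%Z. ring.
Qed.

(** Entry [n + 1] is $c(n)$, as the table expands $q\,j$. Going through lists stores the
    coefficients of $E_4$ and $E_4^2$ instead of recomputing them in each convolution. *)
Definition j_table (fuel N : nat) : list Z :=
  let e := map e4_coef_Z (seq 0 (S N)) in
  let e2 := map (Zconv (znth e) (znth e)) (seq 0 (S N)) in
  let e3 := map (Zconv (znth e) (znth e2)) (seq 0 (S N)) in
  div_euler fuel N e3.

Lemma j_table_length (fuel N : nat) : length (j_table fuel N) = S N.
Proof. unfold j_table. now rewrite div_euler_length, length_map, length_seq. Qed.

Lemma znth_map_seq (f : nat -> Z) (N n : nat) : (n < N)%nat -> znth (map f (seq 0 N)) n = f n.
Proof.
  intros H. unfold znth. rewrite nth_indep with (d' := f O) by (rewrite length_map, length_seq; auto).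
  rewrite map_nth, seq_nth; auto.
Qed.

Lemma Zsum_ext (f g : nat -> Z) (n : nat) : (forall i, (i < n)%nat -> f i = g i) -> Zsum f n = Zsum g n.
Proof. induction n; simpl; intros H; auto. rewrite IHn, H; auto. Qed.

Lemma Zconv_ext (a b a' b' : nat -> Z) (n : nat) :
  (forall i, (i <= n)%nat -> a i = a' i) -> (forall i, (i <= n)%nat -> b i = b' i) -> Zconv a b n = Zconv a' b' n.
Proof. intros H1 H2. apply Zsum_ext. intros i Hi. rewrite H1, H2 by lia. auto. Qed.

Lemma j_table_correct (fuel N : nat) (c : nat -> Z) (n : nat) : is_j_coefficients c -> (S N <= 2 ^ fuel)%nat ->
  (S n <= N)%nat -> c n = znth (j_table fuel N) (S n).
Proof.
  intros hc Hf Hn. change (c n) with (j_shifted c (S n)). unfold j_table.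
  set (e := map e4_coef_Z (seq 0 (S N))). set (e2 := map (Zconv (znth e) (znth e)) (seq 0 (S N))).
  assert (He : forall i, (i <= N)%nat -> znth e i = e4_coef i).
  { intros i Hi. unfold e. rewrite znth_map_seq by lia. apply e4_coef_eq. }
  assert (He2 : forall i, (i <= N)%nat -> znth e2 i = Zconv e4_coef e4_coef i).
  { intros i Hi. unfold e2. rewrite znth_map_seq by lia. apply Zconv_ext; intros; apply He; lia. }
  apply div_euler_correct; rewrite ?length_map, ?length_seq; auto. 2: lia.
  intros i Hi. rewrite mul_euler_j by (auto; lia). rewrite znth_map_seq by auto.
  unfold e4_cube. apply Zconv_ext; intros; symmetry; [apply He | apply He2]; lia.
Qed.

(** Bounds for [2^i ln x / ln 2] by repeated squaring with truncated mantissas. *)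
Definition sq_lo (p : Z * Z) : Z * Z :=
  let m2 := (fst p * fst p)%Z in let s := Z.max 0 (Z.log2 m2 - 32) in
  ((m2 / 2 ^ s)%Z, (2 * snd p + s)%Z).
Definition sq_hi (p : Z * Z) : Z * Z :=
  let m2 := (fst p * fst p)%Z in let s := Z.max 0 (Z.log2 m2 - 32) in
  ((m2 / 2 ^ s + 1)%Z, (2 * snd p + s)%Z).
Definition log_lo (i : nat) (x : Z) : Z := let p := Nat.iter i sq_lo (x, 0%Z) in (Z.log2 (fst p) + snd p)%Z.
Definition log_hi (i : nat) (x : Z) : Z := let p := Nat.iter i sq_hi (x, 0%Z) in (Z.log2 (fst p) + 1 + snd p)%Z.

Lemma ln_mono (x y : R) : 0 < x -> x <= y -> ln x <= ln y.
Proof. intros Hx [H | ->]. left; now apply ln_increasing. apply Rle_refl. Qed.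

Lemma ln_2_pow (s : Z) : (0 <= s)%Z -> ln (IZR (2 ^ s)) = IZR s * ln 2.
Proof.
  intros H. rewrite <- (Z2Nat.id s) by auto. generalize (Z.to_nat s). intro n.
  rewrite <- pow_IZR, ln_pow by lra. now rewrite INR_IZR_INZ.
Qed.

Lemma shift_bounds (m : Z) : (0 < m)%Z -> let s := Z.max 0 (Z.log2 m - 32) in
  (0 <= s)%Z /\ (0 < 2 ^ s)%Z /\ (0 < m / 2 ^ s)%Z.
Proof.
  intros Hm s. assert (Hs : (0 <= s)%Z) by (unfold s; lia).
  assert (H2 : (0 < 2 ^ s)%Z) by (apply Z.pow_pos_nonneg; lia). repeat split; auto.
  apply Z.div_str_pos. split; auto.
  assert (L := Z.log2_spec m Hm). assert (L0 := Z.log2_nonneg m).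
  eapply Z.le_trans. 2: apply L. apply Z.pow_le_mono_r; lia.
Qed.

Lemma log_lo_correct (i : nat) (x : Z) : (0 < x)%Z -> IZR (log_lo i x) * ln 2 <= 2 ^ i * ln (IZR x).
Proof.
  intros Hx.
  assert (A : (0 < fst (Nat.iter i sq_lo (x, 0%Z)))%Z /\
     ln (IZR (fst (Nat.iter i sq_lo (x, 0%Z)))) + IZR (snd (Nat.iter i sq_lo (x, 0%Z))) * ln 2 <= 2 ^ i * ln (IZR x)).
  { induction i. simpl. split; auto. lra.
    rewrite Nat.iter_succ. destruct (Nat.iter i sq_lo (x, 0%Z)) as [m e]. cbn [fst snd] in *.
    destruct IHi as [H1 H2]. unfold sq_lo. cbn [fst snd].
    assert (Hm : (0 < m * m)%Z) by nia. destruct (shift_bounds (m * m) Hm) as [S1 [S2 S3]].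
    set (s := Z.max 0 (Z.log2 (m * m) - 32)) in *. split; auto.
    assert (D : IZR (m * m / 2 ^ s) * IZR (2 ^ s) <= IZR m * IZR m).
    { rewrite <- !mult_IZR. apply IZR_le. rewrite Z.mul_comm. apply Z.mul_div_le; auto. }
    apply IZR_lt in S2, S3, H1.
    apply ln_mono in D. 2: now apply Rmult_lt_0_compat.
    rewrite !ln_mult, ln_2_pow in D by auto. rewrite plus_IZR, mult_IZR. simpl pow. lra. }
  destruct A as [H1 H2]. unfold log_lo. destruct (Nat.iter i sq_lo (x, 0%Z)) as [m e]. cbn [fst snd] in *.
  rewrite plus_IZR. assert (L := Z.log2_spec m H1). assert (L0 := Z.log2_nonneg m).
  assert (Hp : (0 < 2 ^ Z.log2 m)%Z) by (apply Z.pow_pos_nonneg; lia).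
  destruct L as [L _]. apply IZR_le in L. apply IZR_lt in Hp. apply ln_mono in L; auto. rewrite ln_2_pow in L by auto. lra.
Qed.

Lemma log_hi_correct (i : nat) (x : Z) : (0 < x)%Z -> 2 ^ i * ln (IZR x) <= IZR (log_hi i x) * ln 2.
Proof.
  intros Hx.
  assert (A : (0 < fst (Nat.iter i sq_hi (x, 0%Z)))%Z /\
     2 ^ i * ln (IZR x) <= ln (IZR (fst (Nat.iter i sq_hi (x, 0%Z)))) + IZR (snd (Nat.iter i sq_hi (x, 0%Z))) * ln 2).
  { induction i. simpl. split; auto. lra.
    rewrite Nat.iter_succ. destruct (Nat.iter i sq_hi (x, 0%Z)) as [m e]. cbn [fst snd] in *.
    destruct IHi as [H1 H2]. unfold sq_hi. cbn [fst snd].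
    assert (Hm : (0 < m * m)%Z) by nia. destruct (shift_bounds (m * m) Hm) as [S1 [S2 S3]].
    set (s := Z.max 0 (Z.log2 (m * m) - 32)) in *. split. lia.
    assert (D : IZR m * IZR m <= IZR (m * m / 2 ^ s + 1) * IZR (2 ^ s)).
    { rewrite <- !mult_IZR. apply IZR_le. assert (B := Z.mod_pos_bound (m * m) (2 ^ s) S2).
      assert (C := Z.div_mod (m * m) (2 ^ s) ltac:(lia)). nia. }
    assert (S4 : (0 < m * m / 2 ^ s + 1)%Z) by lia.
    apply IZR_lt in S2, S4, H1.
    apply ln_mono in D. 2: now apply Rmult_lt_0_compat.
    rewrite !ln_mult, ln_2_pow in D by auto. rewrite (plus_IZR (2 * e)), mult_IZR. simpl pow. lra. }
  destruct A as [H1 H2]. unfold log_hi. destruct (Nat.iter i sq_hi (x, 0%Z)) as [m e]. cbn [fst snd] in *.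
  rewrite plus_IZR. assert (L := Z.log2_spec m H1). assert (L0 := Z.log2_nonneg m).
  destruct L as [_ L]. unfold Z.succ in L. apply Z.lt_le_incl, IZR_le in L. apply IZR_lt in H1. apply ln_mono in L; auto.
  rewrite ln_2_pow in L by lia. lra.
Qed.

(** The inequality $2\ln y/(n+1)\le\ln x/n+\ln z/(n+2)$ multiplied by $n(n+1)(n+2)$, with logarithms
    in units of $2^{-i}\ln 2$, rounded up for [y] and down for [x] and [z]. It is a statement about
    integers only. *)
Fixpoint log_convex_check (i n : nat) (l : list Z) : bool :=
  match l with
  | x :: ((y :: z :: _) as t) =>
     let n1 := Z.of_nat n in
     (((0 <? x) && (0 <? y) && (0 <? z) &&
      (2 * n1 * (n1 + 2) * log_hi i y <=? (n1 + 1) * (n1 + 2) * log_lo i x + n1 * (n1 + 1) * log_lo i z))%Z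
     && log_convex_check i (S n) t)%bool
  | _ => true
  end.

Lemma log_convex_check_correct (i n : nat) (l : list Z) : log_convex_check i n l = true ->
  forall m, (m + 2 < length l)%nat -> let x := znth l m in let y := znth l (m + 1) in let z := znth l (m + 2) in
   let k := INR (n + m) in
   (0 < x /\ 0 < y /\ 0 < z)%Z /\
   2 * k * (k + 2) * ln (IZR y) <= (k + 1) * (k + 2) * ln (IZR x) + k * (k + 1) * ln (IZR z).
Proof.
  revert n. induction l as [|x l IH]; intros n H m Hm; simpl in Hm. lia.
  destruct l as [|y l]; simpl in Hm. lia. destruct l as [|z l]; simpl in Hm. lia.
  cbn [log_convex_check] in H. apply andb_prop in H. destruct H as [H H'].
  destruct m.
  - apply andb_prop in H. destruct H as [H Hc]. apply andb_prop in H. destruct H as [H Hz].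
    apply andb_prop in H. destruct H as [Hx Hy].
    apply Z.ltb_lt in Hx, Hy, Hz. apply Z.leb_le in Hc.
    unfold znth; simpl nth. split; auto. rewrite Nat.add_0_r.
    assert (Lx := log_lo_correct i x Hx). assert (Ly := log_hi_correct i y Hy). assert (Lz := log_lo_correct i z Hz).
    apply IZR_le in Hc. rewrite plus_IZR, !mult_IZR, !plus_IZR, <- INR_IZR_INZ in Hc. set (k := INR n) in *.
    assert (Hk : 0 <= k) by apply pos_INR.
    assert (L2 : 0 < ln 2) by (rewrite <- ln_1; apply ln_increasing; lra).
    assert (P2 : 0 < 2 ^ i) by (apply pow_lt; lra).
    apply Rmult_le_reg_l with (2 ^ i); auto.
    apply Rmult_le_compat_r with (r := ln 2) in Hc. 2: lra.
    assert (K1 : 0 <= (k + 1) * (k + 2)) by nra. assert (K2 : 0 <= k * (k + 1)) by nra. assert (K3 : 0 <= 2 * k * (k + 2)) by nra.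
    apply (Rmult_le_compat_l _ _ _ K1) in Lx. apply (Rmult_le_compat_l _ _ _ K2) in Lz. apply (Rmult_le_compat_l _ _ _ K3) in Ly.
    lra.
  - specialize (IH (S n) H' m ltac:(simpl; lia)). replace (n + S m)%nat with (S n + m)%nat by lia. exact IH.
Qed.

(** The last entry is $c(122)$, so the triples reach $n=120$, just below the analytic range. *)
Definition table_size : nat := 123.

(** The two dropped entries are 1 and $c(0)$, so the list starts at $c(1)$, in accordance with the
    starting index 1. The fuel 8 satisfies $2^8\ge 124$. *)
Lemma j_table_check : log_convex_check 12 1 (skipn 2 (j_table 8 table_size)) = true.
Proof. vm_compute. reflexivity. Qed.

(** * Cauchy estimate for the coefficients *)

Lemma Csum_geom (q : C) (n : nat) : ((1 - q) * Csum (fun k => q ^ k) n = 1 - q ^ n)%C.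
Proof.
  induction n. simpl; ring. cbn [Csum]. rewrite Cmult_plus_distr_l, IHn, Cpow_S. ring.
Qed.

Lemma Cexp_iy_ne_1 (y : R) : 0 < Rabs y < 2 * PI -> Cexp (Ci * y) <> 1.
Proof.
  intros Hy E. apply (f_equal Re) in E.
  assert (E' : cos y = 1).
  { revert E. csimpl. replace (0 * y - 1 * 0) with 0 by ring. replace (0 * 0 + 1 * y) with y by ring.
    rewrite exp_0. lra. }
  assert (E2 : cos (Rabs y) = 1). { unfold Rabs. destruct (Rcase_abs y); auto. now rewrite cos_neg. }
  replace (Rabs y) with (2 * (Rabs y / 2)) in E2 by field. rewrite cos_2a_sin in E2.
  assert (S := sin_gt_0 (Rabs y / 2) ltac:(lra) ltac:(lra)). nra.
Qed.

(** Since $|m-n|<N$, the ratio is an [N]-th root of unity different from 1 unless [m = n], and a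
    full geometric sum over such a root vanishes. *)
Lemma roots_of_unity_sum (N m n : nat) : (m < N)%nat -> (n < N)%nat ->
  Csum (fun k => Cexp (- (Ci * (2 * PI * (INR m - INR n) / INR N)%R)) ^ k)%C N = if Nat.eqb m n then RtoC (INR N) else 0.
Proof.
  intros Hm Hn. assert (P := PI_RGT_0).
  assert (HN : 0 < INR N) by (apply lt_0_INR; lia).
  set (y := 2 * PI * (INR m - INR n) / INR N). set (q := Cexp (- (Ci * y))).
  destruct (Nat.eqb_spec m n) as [<- | D].
  - assert (Q : q = 1). { unfold q, y. rewrite <- Cexp_0. f_equal. apply C_ext; csimpl; field; lra. }
    rewrite Q, (Csum_ext _ (fun _ => RtoC 1)) by (intros; apply Cpow_1_l). rewrite Csum_const. ring.
  - assert (G := Csum_geom q N).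
    assert (QN : (q ^ N)%C = 1).
    { unfold q. rewrite Cexp_pow.
      replace (INR N * - (Ci * y))%C with (INR m * - (Ci * (2 * PI)%R) + INR n * (Ci * (2 * PI)%R))%C.
      2: { unfold y. apply C_ext; csimpl; field; lra. }
      assert (H : Cexp (Ci * (2 * PI)%R) = 1).
      { apply C_ext; csimpl; replace (0 * (2 * PI) - 1 * 0) with 0 by ring; replace (0 * 0 + 1 * (2 * PI)) with (2 * PI) by ring;
        rewrite exp_0, ?cos_2PI, ?sin_2PI; ring. }
      rewrite Cexp_plus, <- !Cexp_pow, Cexp_opp, H.
      replace (/ RtoC 1)%C with (RtoC 1) by (apply C_ext; csimpl; field). rewrite !Cpow_1_l. ring. }
    rewrite QN in G. replace (1 - 1)%C with (RtoC 0) in G by ring.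
    destruct (Ceq_dec (1 - q) 0) as [Z | Z].
    2: { rewrite <- (Cmult_1_l (Csum _ N)), <- (Cinv_l (1 - q)), <- Cmult_assoc, G by exact Z. ring. }
    exfalso.
    apply (Cexp_iy_ne_1 (- y)).
    + assert (B : 0 < Rabs (INR m - INR n) < INR N).
      { assert (Bm := pos_INR m). assert (Bn := pos_INR n). apply lt_INR in Hm, Hn. split.
        - apply Rabs_pos_lt. intro E. apply D, INR_eq. lra.
        - apply Rabs_def1; lra. }
      unfold y. replace (- (2 * PI * (INR m - INR n) / INR N)) with (2 * PI / INR N * (- (INR m - INR n))) by (field; lra).
      rewrite Rabs_mult, Rabs_Ropp, Rabs_pos_eq. 2: { left. apply Rdiv_lt_0_compat; lra. }
      assert (Hc : 0 < 2 * PI / INR N) by (apply Rdiv_lt_0_compat; lra).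
      split. apply Rmult_lt_0_compat; lra.
      replace (2 * PI) with (2 * PI / INR N * INR N) at 2 by (field; lra). apply Rmult_lt_compat_l; lra.
    + replace (Ci * (- y)%R)%C with (- (Ci * y))%C by (rewrite RtoC_opp; ring).
      fold q. replace q with (1 - (1 - q))%C by ring. rewrite Z. ring.
Qed.

(** An average over [N] equally spaced points replaces the contour integral. It extracts the
    coefficient exactly from the series truncated at [N], and the truncation error [tau N]
    disappears in the limit. *)
Lemma cauchy_estimate (a : nat -> R) (sigma E K : R) (n : nat) :
  rsum (fun m => Rabs (a m) * exp (- (2 * PI * sigma)) ^ m) K ->
  (forall s l, Re s = sigma -> Rabs (Im s) <= 1 / 2 -> csum (fun m => a m * qexp s ^ m)%C l -> Cmod l <= E) ->
  Rabs (a n) * exp (- (2 * PI * sigma)) ^ n <= E.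
Proof.
  intros HK HE. set (r := exp (- (2 * PI * sigma))) in *.
  assert (Hr : 0 < r) by apply exp_pos. assert (Hrn : 0 < r ^ n) by now apply pow_lt.
  set (tau := fun N => K - Rsum (fun m => Rabs (a m) * r ^ m) N).
  assert (Ht : is_lim_seq tau 0) by (apply rsum_tail_lim; exact HK).
  assert (M : forall N, (n < N)%nat -> Rabs (a n) * r ^ n <= E + tau N).
  { intros N HN. assert (HN0 : 0 < INR N) by (apply lt_0_INR; lia).
    (* One period of $\operatorname{Im} s$, starting at $-1/2$; each step multiplies $q$ by
       $e^{-2\pi i/N}$. *)
    set (s := fun k : nat => (sigma, INR k / INR N - 1 / 2) : C).
    assert (Hq : forall k, Cmod (qexp (s k)) = r) by (intro; apply Cmod_qexp).
    assert (Ha : forall k m, Cmod (a m * qexp (s k) ^ m) <= Rabs (a m) * r ^ m).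
    { intros k m. rewrite Cmod_mult, Cmod_R, Cmod_pow, Hq. lra. }
    assert (HF : forall k, (k < N)%nat -> Cmod (Csum (fun m => a m * qexp (s k) ^ m)%C N) <= E + tau N).
    { intros k Hk. destruct (csum_ex _ _ _ (Ha k) HK) as [l Hl].
      assert (T := csum_tail_le _ _ _ _ N (Ha k) Hl HK). fold (tau N) in T.
      assert (B : Cmod l <= E).
      { apply HE with (s k); auto. simpl. apply lt_INR in Hk. assert (Bk := pos_INR k).
        assert (D : 0 <= INR k / INR N <= 1).
        { split. apply Rmult_le_pos; auto. left; now apply Rinv_0_lt_compat.
          apply Rmult_le_reg_r with (INR N); auto. unfold Rdiv. rewrite Rmult_assoc, Rinv_l; lra. }
        apply Rabs_le. lra. }
      replace (Csum (fun m => a m * qexp (s k) ^ m)%C N) with (l + - (l - Csum (fun m => a m * qexp (s k) ^ m)%C N))%C by ring.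
      eapply Rle_trans. apply Cmod_triangle. rewrite Cmod_opp. lra. }
    set (w := fun k m => (qexp (s k) ^ m * (/ qexp (s k)) ^ n)%C).
    assert (Hw : forall k m, w k m = (Cexp (RtoC (INR m - INR n) * - (2 * PI * s O)) *
         Cexp (- (Ci * (2 * PI * (INR m - INR n) / INR N)%R)) ^ k)%C).
    { intros k m. unfold w, qexp. rewrite <- Cexp_opp, !Cexp_pow, <- !Cexp_plus. f_equal.
      unfold s. apply C_ext; csimpl; field; lra. }
    assert (S : Csum (fun k => Csum (fun m => a m * qexp (s k) ^ m)%C N * (/ qexp (s k)) ^ n)%C N = (INR N * a n)%C).
    { rewrite (Csum_ext _ (fun k => Csum (fun m => a m * w k m)%C N)).
      2: { intros k Hk. rewrite Cmult_comm, <- Csum_scal. apply Csum_ext. intros m Hm. unfold w. ring. }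
      rewrite Csum_swap.
      rewrite (Csum_ext _ (fun m => if Nat.eqb m n then (INR N * a n)%C else RtoC 0)).
      2: { intros m Hm.
           rewrite (Csum_ext _ (fun k => a m * Cexp (RtoC (INR m - INR n) * - (2 * PI * s O)) *
               Cexp (- (Ci * (2 * PI * (INR m - INR n) / INR N)%R)) ^ k)%C).
           2: { intros k Hk. rewrite Hw. ring. }
           rewrite Csum_scal, roots_of_unity_sum by auto.
           destruct (Nat.eqb_spec m n) as [-> | D]. 2: ring.
           replace (RtoC (INR n - INR n) * - (2 * PI * s O))%C with (RtoC 0). rewrite Cexp_0; ring.
           rewrite Rminus_diag. ring. }
      generalize (INR N * a n)%C. intro v. clear - HN. induction N. lia. cbn [Csum].
      destruct (Nat.eq_dec N n) as [-> | D].
      - rewrite Nat.eqb_refl. rewrite (Csum_ext _ (fun _ => RtoC 0)). rewrite Csum_const. ring.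
        intros k Hk. destruct (Nat.eqb_spec k n); auto. lia.
      - rewrite IHN by lia. destruct (Nat.eqb_spec N n). lia. ring. }
    assert (T : Cmod (INR N * a n) <= INR N * ((E + tau N) * (/ r) ^ n)).
    { rewrite <- S, <- Rsum_const. apply Csum_norm. intros k Hk.
      rewrite Cmod_mult, Cmod_pow, Cmod_inv, Hq. 2: apply qexp_nz.
      apply Rmult_le_compat_r; auto. apply pow_le. left; now apply Rinv_0_lt_compat. }
    rewrite Cmod_mult, !Cmod_R, (Rabs_pos_eq (INR N)) in T by lra.
    apply Rmult_le_reg_l in T; auto.
    apply Rmult_le_compat_r with (r := r ^ n) in T. 2: lra.
    eapply Rle_trans. exact T. rewrite pow_inv, Rmult_assoc, Rinv_l; lra. }
  apply (is_lim_seq_incr_n tau (S n)) in Ht.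
  assert (L : Rbar_le (Rabs (a n) * r ^ n) (E + 0)).
  { apply (is_lim_seq_le (fun _ => Rabs (a n) * r ^ n) (fun i => E + tau (i + S n)%nat)).
    - intro i. apply M. lia.
    - apply is_lim_seq_const.
    - apply is_lim_seq_plus'. apply is_lim_seq_const. exact Ht. }
  unfold Rbar_le in L. lra.
Qed.

(** * Size of the modular invariant near and away from q = 1 *)

Lemma cvg_Cmod (u : nat -> C) (l : C) : cvg u l -> is_lim_seq (fun n => Cmod (u n)) (Cmod l).
Proof.
  intros H.
  assert (H1 : is_lim_seq (fun n => Cmod l - Cmod (u n - l)) (Cmod l - 0)) by (apply is_lim_seq_minus'; [apply is_lim_seq_const | exact H]).
  assert (H2 : is_lim_seq (fun n => Cmod l + Cmod (u n - l)) (Cmod l + 0)) by (apply is_lim_seq_plus'; [apply is_lim_seq_const | exact H]).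
  rewrite Rminus_0_r in H1. rewrite Rplus_0_r in H2.
  apply (is_lim_seq_le_le _ _ _ (Cmod l)) with (2 := H1) (3 := H2).
  intro n. split.
  - assert (T := Cmod_triangle (u n) (- (u n - l))). rewrite Cmod_opp in T.
    replace (u n + - (u n - l))%C with l in T by ring. lra.
  - assert (T := Cmod_triangle l (u n - l)). replace (l + (u n - l))%C with (u n) in T by ring. lra.
Qed.

Lemma eisenstein4_series (s : C) : 0 < Re s ->
  exists D, csum (fun n => RtoC (INR (divisor_sigma 3 (S n))) * qexp s ^ S n)%C D /\ eisenstein4 (qexp s) = (1 + 240 * D)%C.
Proof.
  intros Hs. destruct (lam4_sum_ex s Hs) as [L HL]. assert (Hd := divisor_series_lam4 s L Hs HL).
  eexists. split. exact Hd. unfold eisenstein4. now rewrite (CSeries_csum _ _ Hd).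
Qed.

Lemma qexp_real (x : R) : qexp x = RtoC (exp (- (2 * PI * x))).
Proof. unfold qexp. rewrite <- !RtoC_mult, <- RtoC_opp. apply Cexp_RtoC. Qed.

(** Crude, from $\sigma_3(n)\le n^4\le(2^n)^4$; at $s=4$ the nome is so small that a geometric bound
    is good enough. *)
Lemma divisor_sigma3_le (n : nat) : INR (divisor_sigma 3 (S n)) <= 16 ^ S n.
Proof.
  rewrite divisor_sigma_Rsum.
  assert (H2 : INR (S n) <= 2 ^ S n).
  { clear. induction n. simpl; lra. rewrite S_INR, <- tech_pow_Rmult.
    assert (1 <= 2 ^ S n) by (apply pow_R1_Rle; lra). lra. }
  apply Rle_trans with (Rsum (fun _ => INR (S n) ^ 3) (S n)).
  - apply Rsum_le. intros k Hk. destruct (Nat.eqb (S n mod S k) 0).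
    + apply pow_incr. apply le_INR in Hk. rewrite S_INR in Hk. assert (P := pos_INR k). lra.
    + apply pow_le, pos_INR.
  - rewrite Rsum_const. replace 16 with (2 * (2 * (2 * 2))) by ring. rewrite !Rpow_mult_distr.
    set (a := INR (S n)) in *. set (b := 2 ^ S n) in *. assert (0 <= a) by apply pos_INR.
    replace (a * a ^ 3) with (a ^ 4) by ring. replace (b * (b * (b * b))) with (b ^ 4) by ring.
    apply pow_incr. lra.
Qed.

Lemma exp_ge_2_pow (n : nat) : 2 ^ n <= exp (INR n).
Proof.
  assert (H := exp_ge_1_plus 1). induction n. simpl. rewrite exp_0; lra.
  rewrite S_INR, Rplus_comm, exp_plus, <- tech_pow_Rmult.
  apply Rmult_le_compat; auto; try lra. apply pow_le; lra.
Qed.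

(** Here $q=e^{-8\pi}$ gives $|E_4|\le 2$ and a product above $1/2$, hence $|j|\le 16/q\le
    e^{4+8\pi}$. The looser bound is stated so as to share the constant of [main_series]. *)
Lemma klein_j_4_bound : Cmod (klein_j 4) <= exp (4 * PI ^ 2).
Proof.
  assert (P3 : 3 < PI) by (assert (H := PI2_3_2); lra).
  set (x := exp (- (2 * PI * 4))).
  assert (Hx : 0 < x <= / 16777216).
  { split. apply exp_pos. apply Rle_trans with (exp (- (24))). apply exp_mono; lra.
    rewrite exp_Ropp. apply Rinv_le_contravar. lra. assert (E := exp_ge_2_pow 24). 
    rewrite INR_IZR_INZ in E. simpl (IZR (Z.of_nat 24)) in E. lra. }
  assert (H4 : 0 < Re 4) by (rewrite re_RtoC; lra).
  assert (BE : Cmod (eisenstein4 (qexp 4)) <= 2).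
  { destruct (eisenstein4_series 4 H4) as [D [HD ->]]. rewrite qexp_real in HD. fold x in HD.
    assert (BD : Cmod D <= 16 * x * / (1 - 16 * x)).
    { apply (csum_norm_le _ (fun n => 16 * x * (16 * x) ^ n)) with (2 := HD).
      - intro n. rewrite Cmod_mult, Cmod_pow, !Cmod_R, Rabs_pos_eq, (Rabs_pos_eq x) by (try apply pos_INR; lra).
        apply Rle_trans with (16 ^ S n * x ^ S n).
        apply Rmult_le_compat_r. apply pow_le; lra. apply divisor_sigma3_le.
        rewrite <- Rpow_mult_distr. apply Rle_refl.
      - apply rsum_scal, rsum_geom. lra. }
    assert (BD' : 16 * x * / (1 - 16 * x) <= 16 * x * 2).
    { apply Rmult_le_compat_l. lra. replace 2 with (/ (/ 2)) by field. apply Rinv_le_contravar; lra. }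
    eapply Rle_trans. apply Cmod_triangle. rewrite Cmod_mult, Cmod_1, Cmod_R, Rabs_pos_eq by lra. lra. }
  destruct (qprod_cvg (qexp 4)) as [P [HP0 HP]]. { now apply qexp_lt_1. }
  assert (BP : 1 - 2 * x <= Cmod P).
  { assert (HP' := HP). apply cvg_Cmod in HP'.
    assert (L : Rbar_le (1 - 2 * x) (Cmod P)); [|exact L].
    apply (is_lim_seq_le (fun _ => 1 - 2 * x) (fun n => Cmod (qprod (qexp 4) n))); auto using is_lim_seq_const.
    intro n. rewrite qexp_real. fold x. rewrite qprod_rprod, Cmod_R.
    destruct (rprod_decr x n ltac:(lra)) as [R1 _]. rewrite Rabs_pos_eq by lra.
    destruct (rprod_decr x 0 ltac:(lra)) as [_ R2]. specialize (R2 n). cbn [rprod Nat.add] in R2.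
    assert (G : Rsum (fun k => x ^ S k) n <= x * / (1 - x)).
    { apply rsum_partial_le. intro; apply pow_le; lra. apply rsum_ext with (fun k => x * x ^ k). reflexivity.
      apply rsum_scal, rsum_geom; lra. }
    assert (G' : x * / (1 - x) <= x * 2).
    { apply Rmult_le_compat_l. lra. replace 2 with (/ (/ 2)) by field. apply Rinv_le_contravar; lra. }
    lra. }
  unfold klein_j. rewrite (euler_prod24_spec _ _ HP). 
  rewrite Cmod_div, Cmod_mult, !Cmod_pow. 2: { apply Cmult_neq_0. apply qexp_nz. now apply Cpow_nz. }
  rewrite qexp_real at 2. fold x. rewrite Cmod_R, (Rabs_pos_eq x) by lra.
  assert (B24 : / 2 <= Cmod P ^ 24).
  { apply Rle_trans with ((1 - 2 * x) ^ 24). 2: apply pow_incr; lra.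
    destruct (pow_diff_le 1 (1 - 2 * x) 24 ltac:(lra) ltac:(lra)) as [_ D]. rewrite pow1, INR_IZR_INZ in D.
    simpl (IZR (Z.of_nat 24)) in D. lra. }
  set (Q := Cmod P ^ 24) in *.
  assert (B3 : Cmod (eisenstein4 (qexp 4)) ^ 3 <= 8).
  { replace 8 with (2 ^ 3) by ring. apply pow_incr. split; auto. apply Cmod_ge_0. }
  apply Rle_trans with (16 * / x).
  - unfold Rdiv. rewrite Rinv_mult.
    assert (IQ : / Q <= 2). { replace 2 with (/ / 2) by field. apply Rinv_le_contravar; lra. }
    assert (Ix : 0 < / x) by (apply Rinv_0_lt_compat; lra).
    assert (IQ0 : 0 < / Q) by (apply Rinv_0_lt_compat; lra).
    replace (16 * / x) with (8 * (/ x * 2)) by ring.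
    apply Rmult_le_compat; auto. apply pow_le, Cmod_ge_0. apply Rmult_le_pos; lra.
    apply Rmult_le_compat_l; lra.
  - unfold x. rewrite exp_Ropp, Rinv_inv.
    assert (E := exp_ge_2_pow 4). replace (2 ^ 4) with 16 in E by ring. replace (INR 4) with 4 in E by (simpl; ring).
    apply Rle_trans with (exp 4 * exp (2 * PI * 4)).
    + apply Rmult_le_compat_r; auto. left; apply exp_pos.
    + rewrite <- exp_plus. apply exp_mono. nra.
Qed.

(** After inversion, $e^{2\pi/s}$ is exactly the polar term $1/q$ at $1/s$. The remaining series has
    nonnegative coefficients, so it is largest at the real point $1/4$, where $j(1/4)=j(4)$. *)
Lemma klein_j_near (c : nat -> Z) (s : C) : is_j_coefficients c -> 0 < Re s -> 1 / 4 <= Re (/ s) ->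
  Cmod (klein_j s - Cexp (2 * PI / s)) <= exp (4 * PI ^ 2).
Proof.
  intros hc Hs Ht. assert (P := PI_RGT_0).
  rewrite <- klein_j_inv by auto. assert (Hq : Cexp (2 * PI / s) = (/ qexp (/ s))%C).
  { unfold qexp. rewrite <- Cexp_opp. f_equal. unfold Cdiv. ring. }
  rewrite Hq.
  assert (H1 := j_coefficients_series c hc (/ s)%C ltac:(lra)).
  assert (H4 : 0 < Re (/ 4)%R) by (rewrite re_RtoC; lra).
  assert (H2 := j_coefficients_series c hc (/ 4)%R H4).
  rewrite qexp_real in H2. set (r := exp (- (2 * PI * / 4))) in *.
  assert (Hr : 0 < r) by apply exp_pos.
  assert (H3 : csum (fun n => RtoC (IZR (c n) * r ^ n)) (klein_j (/ 4)%R - / RtoC r)%C).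
  { apply csum_ext with (2 := H2). intro n. now rewrite RtoC_mult, RtoC_pow. }
  apply csum_real in H3. destruct H3 as [_ H3].
  apply Rle_trans with (Re (klein_j (/ 4)%R - / r)).
  - apply csum_norm_le with (2 := H1) (3 := H3). intro n.
    rewrite Cmod_mult, Cmod_pow, Cmod_R, Cmod_qexp, Rabs_pos_eq by (apply IZR_le, j_coefficients_nonneg; auto).
    apply Rmult_le_compat_l. apply IZR_le, j_coefficients_nonneg; auto.
    apply pow_incr. split. left; apply exp_pos. apply exp_mono. nra.
  - apply Rle_trans with (2 := klein_j_4_bound).
    replace (RtoC (/ 4)) with (/ RtoC 4)%C by (rewrite RtoC_inv; auto; lra).
    rewrite klein_j_inv by (rewrite re_RtoC; lra).
    assert (R1 := Re_le_Cmod (klein_j 4)). apply Rabs_le_between in R1.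
    rewrite <- RtoC_inv by lra.
    assert (R2 : Re (klein_j 4 - RtoC (/ r)) = Re (klein_j 4) - / r) by (csimpl; ring).
    rewrite R2. assert (0 < / r) by now apply Rinv_0_lt_compat. lra.
Qed.

(** Compare with the real point on the same circle: $E_4$ has nonnegative coefficients, and
    $|1-q^n|\ge 1-|q|^n$. Only the factor $n=1$ of the product is kept exact; it carries the whole
    gain. *)
Lemma klein_j_far (s : C) : 0 < Re s ->
  Cmod (klein_j s) <= Cmod (klein_j (Re s)) * ((1 - exp (- (2 * PI * Re s))) / Cmod (1 - qexp s)) ^ 24.
Proof.
  intros Hs. assert (Hs' : 0 < Re (RtoC (Re s))) by (rewrite re_RtoC; auto).
  destruct (eisenstein4_series s Hs) as [D [HD ED]].
  destruct (eisenstein4_series (Re s) Hs') as [D' [HD' ED']].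
  destruct (qprod_cvg (qexp s) (qexp_lt_1 s Hs)) as [P [HP0 HP]].
  destruct (qprod_cvg (qexp (Re s)) (qexp_lt_1 _ Hs')) as [P' [HP0' HP']].
  unfold klein_j. rewrite (euler_prod24_spec _ _ HP), (euler_prod24_spec _ _ HP'), ED, ED'.
  rewrite qexp_real in HD', HP'. rewrite qexp_real.
  assert (Hqs := Cmod_qexp s). assert (Hlt := qexp_lt_1 s Hs).
  set (r := exp (- (2 * PI * Re s))) in *. assert (Hr : 0 < r) by apply exp_pos.
  assert (N1 : 0 < Cmod (1 - qexp s)) by (apply Cmod_gt_0, Cmod_lt_1_nz; auto).
  assert (HD2 : csum (fun n => RtoC (INR (divisor_sigma 3 (S n)) * r ^ S n)) D').
  { apply csum_ext with (2 := HD'). intro n. now rewrite RtoC_mult, RtoC_pow. }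
  apply csum_real in HD2. destruct HD2 as [E2 HD2].
  assert (BD : Cmod D <= Re D').
  { apply (csum_norm_le _ _ _ _) with (2 := HD) (3 := HD2). intro n.
    rewrite Cmod_mult, Cmod_pow, Cmod_R, Hqs, Rabs_pos_eq by apply pos_INR. apply Rle_refl. }
  assert (BE : Cmod (1 + 240 * D) <= Cmod (1 + 240 * D')).
  { assert (D0 := Cmod_ge_0 D). rewrite E2, <- RtoC_mult, <- RtoC_plus, Cmod_R, Rabs_pos_eq by lra.
    eapply Rle_trans. apply Cmod_triangle. rewrite Cmod_mult, Cmod_1, Cmod_R, Rabs_pos_eq by lra. lra. }
  assert (BP : Cmod (1 - qexp s) * Cmod P' <= (1 - r) * Cmod P).
  (* Indexed by [S N] so that the first factor is always present; for it the inequality is an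
     equality. *)
  { assert (L : forall N, Cmod (1 - qexp s) * Cmod (qprod r (S N)) <= (1 - r) * Cmod (qprod (qexp s) (S N))).
    { intro N. rewrite qprod_rprod, Cmod_R. destruct (rprod_decr r (S N) ltac:(lra)) as [RP _].
      rewrite Rabs_pos_eq by lra. clear RP. induction N.
      - simpl. rewrite !Cmult_1_l, !Cmult_1_r, Rmult_1_l, Rmult_1_r. lra.
      - change (rprod r (S (S N))) with (rprod r (S N) * (1 - r ^ S (S N))).
        change (qprod (qexp s) (S (S N))) with (qprod (qexp s) (S N) * (1 - qexp s ^ S (S N)))%C.
        rewrite Cmod_mult, <- !Rmult_assoc.
        assert (B1 := Cmod_one_minus_ge (qexp s ^ S (S N))). rewrite Cmod_pow, Hqs in B1.
        assert (B2 : r ^ S (S N) <= r) by (apply pow_S_le; lra).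
        destruct (rprod_decr r (S N) ltac:(lra)) as [RP _].
        apply Rmult_le_compat; auto; try lra. apply Rmult_le_pos; lra. }
    apply cvg_incr, cvg_Cmod in HP, HP'.
    assert (Q : Rbar_le (Cmod (1 - qexp s) * Cmod P') ((1 - r) * Cmod P)); [|exact Q].
    apply (is_lim_seq_le (fun N => Cmod (1 - qexp s) * Cmod (qprod r (S N))) (fun N => (1 - r) * Cmod (qprod (qexp s) (S N)))); auto.
    - apply (is_lim_seq_scal_l _ (Cmod (1 - qexp s)) (Cmod P')). exact HP'.
    - apply (is_lim_seq_scal_l _ (1 - r) (Cmod P)). exact HP. }
  apply Cmod_gt_0 in HP0, HP0'.
  assert (HP1 := HP0). assert (HP1' := HP0').
  rewrite !Cmod_div, !Cmod_mult, !Cmod_pow, Hqs, Cmod_R, (Rabs_pos_eq r) by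
    (try lra; apply Cmult_neq_0; try apply qexp_nz; try (apply RtoC_nz; lra); apply Cpow_nz; now apply Cmod_gt_0).
  set (a := Cmod (1 + 240 * D)) in *. set (b := Cmod (1 + 240 * D')) in *.
  set (p := Cmod P) in *. set (p' := Cmod P') in *. set (v := Cmod (1 - qexp s)) in *.
  assert (Hv : / p <= (1 - r) / v * / p').
  { apply Rmult_le_reg_l with (p * (v * p')). repeat apply Rmult_lt_0_compat; auto.
    replace (p * (v * p') * / p) with (v * p') by (field; lra).
    replace (p * (v * p') * ((1 - r) / v * / p')) with ((1 - r) * p) by (field; lra). exact BP. }
  assert (Hv24 : (/ p) ^ 24 <= ((1 - r) / v * / p') ^ 24).
  { apply pow_incr. split; auto. left; now apply Rinv_0_lt_compat. }
  rewrite Rpow_mult_distr in Hv24. rewrite !pow_inv in Hv24. generalize dependent ((1 - r) / v). intros w _ Hw.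
  assert (Ha : a ^ 3 <= b ^ 3) by (apply pow_incr; split; auto; apply Cmod_ge_0).
  unfold Rdiv. rewrite !Rinv_mult.
  assert (Ir : 0 < / r) by now apply Rinv_0_lt_compat.
  apply Rle_trans with (b ^ 3 * (/ r * (w ^ 24 * / p' ^ 24))).
  - apply Rmult_le_compat; auto. apply pow_le, Cmod_ge_0.
    apply Rmult_le_pos. lra. left. apply Rinv_0_lt_compat. now apply pow_lt.
    apply Rmult_le_compat_l; lra.
  - apply Req_le. generalize (w ^ 24) (/ p' ^ 24) (b ^ 3). intros. ring.
Qed.

Lemma PI_gt_3 : 3 < PI.
Proof. assert (H := PI2_3_2). lra. Qed.

Lemma sin_ge_half (t : R) : 0 <= t <= PI / 2 -> t / 2 <= sin t.
Proof.
  intros Ht. assert (P := PI_lt_7_2).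
  destruct (SIN t ltac:(lra) ltac:(lra)) as [H _].
  unfold sin_lb, sin_approx, sin_term in H. simpl in H.
  assert (E : t / 2 <= t - t * t * t / 6 + t * t * t * t * t / 120 - t * t * t * t * t * t * t / 5040).
  { replace (t - t * t * t / 6 + t * t * t * t * t / 120 - t * t * t * t * t * t * t / 5040)
      with (t / 2 + t * (1 / 2 - (t * t) / 6 + (t * t) * (t * t) * (/ 120 - (t * t) / 5040))) by field.
    assert (Hu : 0 <= t * t <= 49 / 16) by nra. revert Hu. generalize (t * t). intros u Hu.
    assert (H1 : u * u * / 130 <= u * u * (/ 120 - u / 5040)) by (apply Rmult_le_compat_l; [apply Rle_0_sqr | lra]).
    assert (0 <= t * (1 / 2 - u / 6 + u * u * (/ 120 - u / 5040))) by (apply Rmult_le_pos; [lra | nra]).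
    lra. }
  eapply Rle_trans. apply E. eapply Rle_trans. 2: apply H. right. field.
Qed.

Lemma Cmod_one_minus_qexp (s : C) :
  Cmod (1 - qexp s) ^ 2 = (1 - exp (- (2 * PI * Re s))) ^ 2 + 4 * exp (- (2 * PI * Re s)) * sin (PI * Im s) ^ 2.
Proof.
  unfold Cmod. rewrite pow2_sqrt by (apply Rplus_le_le_0_compat; apply pow2_ge_0).
  assert (E1 : Re (qexp s) = exp (- (2 * PI * Re s)) * cos (2 * (PI * Im s))).
  { unfold qexp, Cexp. destruct s as [x y]. simpl. f_equal. f_equal. ring. rewrite <- cos_neg. f_equal. ring. }
  assert (E2 : Im (qexp s) = - (exp (- (2 * PI * Re s)) * sin (2 * (PI * Im s)))).
  { unfold qexp, Cexp. destruct s as [x y]. simpl. rewrite Ropp_mult_distr_r, <- sin_neg. f_equal. f_equal. ring. f_equal. ring. }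
  destruct (qexp s) as [a b]. simpl in E1, E2. simpl fst. simpl snd. rewrite E1, E2.
  generalize (exp (- (2 * PI * Re s))). intro r. rewrite sin_2a, cos_2a_sin.
  assert (T := sin2_cos2 (PI * Im s)). unfold Rsqr in T.
  revert T. generalize (sin (PI * Im s)) (cos (PI * Im s)). intros S K T.
  replace ((1 + - (r * (1 - 2 * S * S))) ^ 2 + (0 + - - (r * (2 * S * K))) ^ 2)
    with ((1 - r * (1 - 2 * S * S)) ^ 2 + 4 * r ^ 2 * S ^ 2 * (K * K)) by ring.
  replace (K * K) with (1 - S * S) by lra. ring.
Qed.

Lemma Re_inv (s : C) : Re (/ s) = Re s / (Re s ^ 2 + Im s ^ 2).
Proof. destruct s; reflexivity. Qed.

(** Outside the disc $\operatorname{Re}(1/s)\ge 1/4$, tangent to the axis at 0, the imaginary part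
    is at least of order $z^{-1/2}$, and so is $|1-q|$, whereas $1-|q|$ is of order $1/z$. The
    squared ratio is $O(1/z)$, so the 24th power has ample room for $z^{-6}$. *)
Lemma far_ratio (z : R) (s : C) : 11 <= z -> Re s = / z -> Rabs (Im s) <= 1 / 2 -> Re (/ s) < 1 / 4 ->
  ((1 - exp (- (2 * PI * Re s))) / Cmod (1 - qexp s)) ^ 24 <= / (8 * z ^ 6).
Proof.
  intros Hz Hs Hi Hf. assert (P3 := PI_gt_3). assert (P7 := PI_lt_7_2).
  assert (Hs0 : 0 < Re s) by (rewrite Hs; apply Rinv_0_lt_compat; lra).
  assert (Hlt := qexp_lt_1 s Hs0). assert (N1 : 0 < Cmod (1 - qexp s)) by (apply Cmod_gt_0, Cmod_lt_1_nz; auto).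
  rewrite Cmod_qexp in Hlt.
  assert (HV := Cmod_one_minus_qexp s). set (v := Cmod (1 - qexp s)) in *. clearbody v.
  rewrite Re_inv in Hf. set (sg := Re s) in *. clearbody sg. set (x := Im s) in *. clearbody x.
  assert (Hx : 4 * sg - sg ^ 2 < x ^ 2).
  { assert (D : 0 < sg ^ 2 + x ^ 2) by nra.
    apply Rmult_lt_compat_r with (r := sg ^ 2 + x ^ 2) in Hf; auto.
    unfold Rdiv in Hf. rewrite Rmult_assoc, Rinv_l in Hf; lra. }
  assert (Hsz : sg * z = 1) by (rewrite Hs; field; lra).
  assert (Hs11 : sg <= / 11) by (rewrite Hs; apply Rinv_le_contravar; lra).
  assert (Hr : 1 - exp (- (2 * PI * sg)) <= 2 * PI * sg) by (assert (H := exp_ineq1_le (- (2 * PI * sg))); lra).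
  set (r := exp (- (2 * PI * sg))) in *. assert (Hr0 : 0 < r) by apply exp_pos. clearbody r.
  assert (Hr4 : 4 / 11 <= r) by nra.
  assert (Hsin : (PI * x / 2) ^ 2 <= sin (PI * x) ^ 2).
  { assert (S := sin_ge_half (PI * Rabs x)). assert (A0 := Rabs_pos x).
    assert (S' : PI * Rabs x / 2 <= sin (PI * Rabs x)) by (apply S; split; [apply Rmult_le_pos | apply Rmult_le_reg_l with 2]; nra).
    assert (E1 : sin (PI * x) ^ 2 = sin (PI * Rabs x) ^ 2).
    { unfold Rabs. destruct (Rcase_abs x); auto. replace (PI * - x) with (- (PI * x)) by ring. rewrite sin_neg. ring. }
    replace ((PI * x / 2) ^ 2) with (PI ^ 2 / 4 * x ^ 2) by field. rewrite E1, <- (pow2_abs x).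
    replace (PI ^ 2 / 4 * Rabs x ^ 2) with ((PI * Rabs x / 2) ^ 2) by field.
    apply pow_incr. split; auto. apply Rmult_le_pos; nra. }
  set (u := (1 - r) ^ 2 / v ^ 2).
  assert (Hv2 : 0 < v ^ 2) by now apply pow_lt.
  (* From $r\ge 1-2\pi/11\ge 4/11$, the sine term of $11v^2$ is at least
     $4\pi^2(4\sigma-\sigma^2)\ge(1-r)^2(4z-1)$; the other term adds $11(1-r)^2$. *)
  assert (HK : (1 - r) ^ 2 * (4 * z + 10) <= 11 * v ^ 2).
  { assert (H1 : (1 - r) ^ 2 <= (2 * PI * sg) ^ 2) by (apply pow_incr; lra).
    assert (H2 : r * (PI * x) ^ 2 <= 4 * r * sin (PI * x) ^ 2).
    { replace (r * (PI * x) ^ 2) with (4 * r * (PI * x / 2) ^ 2) by field. apply Rmult_le_compat_l; lra. }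
    assert (H3 : PI ^ 2 * (4 * sg - sg ^ 2) <= (PI * x) ^ 2).
    { rewrite Rpow_mult_distr. apply Rmult_le_compat_l. apply pow_le; lra. lra. }
    assert (H4 : 4 / 11 * (PI ^ 2 * (4 * sg - sg ^ 2)) <= r * (PI * x) ^ 2).
    { apply Rmult_le_compat; try lra. apply Rmult_le_pos. apply pow_le; lra. nra. }
    assert (H5 : (1 - r) ^ 2 * (4 * z - 1) <= (2 * PI * sg) ^ 2 * (4 * z - 1)) by (apply Rmult_le_compat_r; lra).
    replace ((2 * PI * sg) ^ 2 * (4 * z - 1)) with (4 * (PI ^ 2 * (4 * sg * (sg * z) - sg ^ 2))) in H5 by ring.
    rewrite Hsz, Rmult_1_r in H5. lra. }
  assert (Hu0 : 0 <= u) by (apply Rmult_le_pos; [apply pow2_ge_0 | left; now apply Rinv_0_lt_compat]).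
  assert (Hu : u * (4 * z + 10) <= 11).
  { unfold u. apply Rmult_le_reg_r with (v ^ 2); auto.
    replace ((1 - r) ^ 2 / v ^ 2 * (4 * z + 10) * v ^ 2) with ((1 - r) ^ 2 * (4 * z + 10)) by (field; lra). exact HK. }
  (* One power of $1/z$ is given up here for a clean constant: $8\,(2/3)^6=512/729<1$. *)
  assert (Hu2 : u ^ 2 <= 2 / (3 * z)).
  { assert (H1 : u ^ 2 * (4 * z + 10) ^ 2 <= 11 ^ 2) by (rewrite <- Rpow_mult_distr; apply pow_incr; split; auto; apply Rmult_le_pos; lra).
    apply Rmult_le_reg_r with (3 * z). lra. replace (2 / (3 * z) * (3 * z)) with 2 by (field; lra).
    assert (H2 : 363 / 2 * z <= (4 * z + 10) ^ 2) by nra.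
    apply Rmult_le_compat_l with (r := u ^ 2) in H2. 2: apply pow2_ge_0. lra. }
  replace (((1 - r) / v) ^ 24) with ((u ^ 2) ^ 6).
  2: { unfold u, Rdiv. rewrite <- pow_inv, <- Rpow_mult_distr, <- !pow_mult. reflexivity. }
  apply Rle_trans with ((2 / (3 * z)) ^ 6). apply pow_incr. split; auto. apply pow2_ge_0.
  apply Rmult_le_reg_r with (8 * z ^ 6). apply Rmult_lt_0_compat. lra. apply pow_lt; lra.
  rewrite Rinv_l. 2: { apply Rgt_not_eq, Rmult_lt_0_compat. lra. apply pow_lt; lra. }
  replace ((2 / (3 * z)) ^ 6 * (8 * z ^ 6)) with (512 / 729) by (field; lra). lra.
Qed.

(** Index 0 has no main term, because [main_series] starts at $q^1$. *)
Definition j_error (c : nat -> Z) (n : nat) : R :=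
  match n with O => IZR (c O) | S m => IZR (c n) - main_term (INR m + 1) end.

Lemma j_error_series (c : nat -> Z) (s L : C) : is_j_coefficients c -> 0 < Re s ->
  csum (fun n => main_term (INR n + 1) * Cexp (- (2 * PI * s)) ^ S n)%C L ->
  csum (fun n => j_error c n * qexp s ^ n)%C (klein_j s - / qexp s - L)%C.
Proof.
  intros hc Hs HL. fold (qexp s) in HL.
  apply csum_ext with (fun n => IZR (c n) * qexp s ^ n - match n with O => RtoC 0 | S m => main_term (INR m + 1) * qexp s ^ S m end)%C.
  - intros [|m]. simpl. ring. cbn [j_error]. rewrite RtoC_minus. ring.
  - apply csum_minus. now apply j_coefficients_series. rewrite <- (Cplus_0_l L).
    now apply -> (csum_incr (fun n => match n with O => RtoC 0 | S m => main_term (INR m + 1) * qexp s ^ S m end)%C).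
Qed.

Lemma j_error_bound (c : nat -> Z) (z : R) (s l : C) : is_j_coefficients c -> 11 <= z -> Re s = / z -> Rabs (Im s) <= 1 / 2 ->
  csum (fun n => j_error c n * qexp s ^ n)%C l ->
  Cmod l <= exp (2 * PI * z) / (8 * z ^ 6) + 4 * exp (4 * PI ^ 2).
Proof.
  intros hc Hz Hs Hi Hl. assert (P3 := PI_gt_3). assert (P7 := PI_lt_7_2).
  assert (Hs0 : 0 < Re s) by (rewrite Hs; apply Rinv_0_lt_compat; lra).
  assert (Hs11 : Re s <= / 11) by (rewrite Hs; apply Rinv_le_contravar; lra).
  destruct (main_series s Hs0 Hi) as [L [HL BL]].
  rewrite (csum_unique _ _ _ Hl (j_error_series c s L hc Hs0 HL)).
  set (A := exp (4 * PI ^ 2)) in *.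
  assert (Bq : Cmod (/ qexp s) <= A).
  { rewrite Cmod_inv, Cmod_qexp, <- exp_Ropp, Ropp_involutive by apply qexp_nz. apply exp_mono. nra. }
  assert (B1 : 1 <= A). { unfold A. rewrite <- exp_0. apply exp_mono. nra. }
  assert (Z6 : 0 < z ^ 6) by (apply pow_lt; lra).
  assert (E0 := exp_pos (2 * PI * z)).
  assert (X0 : 0 <= exp (2 * PI * z) / (8 * z ^ 6)).
  { apply Rmult_le_pos. lra. left. apply Rinv_0_lt_compat. lra. }
  destruct (Rle_lt_dec (1 / 4) (Re (/ s))) as [N | F].
  (* Near the real axis the exponentials $e^{2\pi/s}$ in $j$ and in the comparison series cancel,
     leaving four quantities of size at most [A]. *)
  - assert (Bn := klein_j_near c s hc Hs0 N). fold A in Bn.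
    replace (klein_j s - / qexp s - L)%C with ((klein_j s - Cexp (2 * PI / s)) + (- (/ qexp s) + (- (L - (Cexp (2 * PI / s) - 1)) + 1)))%C by ring.
    eapply Rle_trans. apply Cmod_triangle. eapply Rle_trans. apply Rplus_le_compat. apply Bn.
    eapply Rle_trans. apply Cmod_triangle. apply Rplus_le_compat. rewrite Cmod_opp. apply Bq.
    eapply Rle_trans. apply Cmod_triangle. apply Rplus_le_compat. rewrite Cmod_opp. apply BL. rewrite Cmod_1. apply B1. lra.
  - assert (Bf := klein_j_far s Hs0). assert (Br := far_ratio z s Hz Hs Hi F).
    assert (Hr0 : 0 < Re (RtoC (Re s))) by (rewrite re_RtoC; auto).
    assert (Hri : (/ RtoC (Re s))%C = RtoC z) by (rewrite <- RtoC_inv, Hs, Rinv_inv by lra; reflexivity).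
    assert (Bs := klein_j_near c (Re s) hc Hr0). rewrite Hri, re_RtoC in Bs. specialize (Bs ltac:(lra)). fold A in Bs.
    replace (2 * PI / Re s)%C with (RtoC (2 * PI * z)) in Bs.
    2: { unfold Cdiv. rewrite Hri, !RtoC_mult. reflexivity. }
    rewrite Cexp_RtoC in Bs.
    assert (Bk : Cmod (klein_j (Re s)) <= exp (2 * PI * z) + A).
    { replace (klein_j (Re s)) with (RtoC (exp (2 * PI * z)) + (klein_j (Re s) - exp (2 * PI * z)))%C by ring.
      eapply Rle_trans. apply Cmod_triangle. rewrite Cmod_R, Rabs_pos_eq by lra. lra. }
    assert (Bj : Cmod (klein_j s) <= exp (2 * PI * z) / (8 * z ^ 6) + A).
    { eapply Rle_trans. apply Bf. apply Rle_trans with ((exp (2 * PI * z) + A) * / (8 * z ^ 6)).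
      - apply Rmult_le_compat; auto. apply Cmod_ge_0. apply pow_le. apply Rmult_le_pos.
        + assert (exp (- (2 * PI * Re s)) < exp 0) by (apply exp_increasing; nra). rewrite exp_0 in *. lra.
        + left. apply Rinv_0_lt_compat, Cmod_gt_0, Cmod_lt_1_nz. now apply qexp_lt_1.
      - rewrite Rmult_plus_distr_r. apply Rplus_le_compat_l. rewrite <- (Rmult_1_r A) at 2. apply Rmult_le_compat_l. lra.
        rewrite <- Rinv_1. apply Rinv_le_contravar. lra.
        assert (1 <= z ^ 6) by (apply pow_R1_Rle; lra). lra. }
    (* Nothing needs to cancel away from the real axis: $\operatorname{Re}(1/s)<1/4$ already keeps
       the exponential bounded. *)
    assert (BE : Cmod (Cexp (2 * PI / s) - 1) <= A).
    { eapply Rle_trans. apply Cmod_triangle. rewrite Cmod_opp, Cmod_1, Cmod_Cexp.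
      replace (2 * PI / s)%C with (2 * PI * (/ s))%C by reflexivity. rewrite Re_2PI.
      assert (H1 : exp (2 * PI * Re (/ s)) <= exp (2 * PI ^ 2)) by (apply exp_mono; nra).
      assert (H2 : A = exp (2 * PI ^ 2) * exp (2 * PI ^ 2)) by (unfold A; rewrite <- exp_plus; f_equal; ring).
      assert (H3 := exp_ge_1_plus (2 * PI ^ 2)). nra. }
    replace (klein_j s - / qexp s - L)%C with (klein_j s + (- (/ qexp s) + (- (L - (Cexp (2 * PI / s) - 1)) + - (Cexp (2 * PI / s) - 1))))%C by ring.
    eapply Rle_trans. apply Cmod_triangle. eapply Rle_trans. apply Rplus_le_compat. apply Bj.
    eapply Rle_trans. apply Cmod_triangle. apply Rplus_le_compat. rewrite Cmod_opp. apply Bq.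
    eapply Rle_trans. apply Cmod_triangle. apply Rplus_le_compat; rewrite Cmod_opp. apply BL. apply BE. lra.
Qed.

Lemma central_fact_le (k : nat) : 2 * 4 ^ k * (INR (fact k) * INR (fact (S k))) <= INR (fact (2 * k + 2)).
Proof.
  induction k. simpl. lra.
  replace (2 * S k + 2)%nat with (S (S (2 * k + 2))) by lia.
  rewrite (fact_simpl (S (2 * k + 2))), (fact_simpl (2 * k + 2)), (fact_simpl (S k)), (mult_INR (S (S k))).
  rewrite (fact_simpl k) in *. rewrite !mult_INR, !S_INR, plus_INR, mult_INR. rewrite mult_INR, S_INR in IHk.
  replace (INR 2) with 2 by (simpl; ring). rewrite <- tech_pow_Rmult.
  assert (HG := pos_INR (fact (2 * k + 2))). assert (Hn := pos_INR k).
  generalize dependent (INR (fact (2 * k + 2))). generalize (INR (fact k)) (4 ^ k). generalize dependent (INR k).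
  intros n Hn F p G IH HG.
  assert (H1 := Rmult_le_compat_l (4 * (n + 1) * (n + 2)) _ _ ltac:(nra) IH).
  assert (H2 : 4 * (n + 1) * (n + 2) * G <= (2 * n + 4) * (2 * n + 3) * G) by (apply Rmult_le_compat_r; nra).
  lra.
Qed.

(** With $A=4\pi^2z^2$, the terms of $2\cosh(4\pi z)$ are at most those of
    $4A\,{}_0F_1(;2;A)=4z^2M(z^2)$, by [central_fact_le]; the constant term 2 has no partner.
    Against the true size only a factor of order $z^{1/2}$ is lost. *)
Lemma main_term_lower (z : R) : 0 < z -> exp (4 * PI * z) <= 4 * z ^ 2 * main_term (z ^ 2) + 2.
Proof.
  intros Hz. assert (P := PI_RGT_0). set (y := 4 * PI * z).
  set (f := fun n => y ^ n / INR (fact n) + (- y) ^ n / INR (fact n)).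
  assert (Hf : rsum f (exp y + exp (- y))).
  { apply rsum_is_series. apply (is_series_plus (K := R_AbsRing) (V := R_NormedModule)); apply rsum_is_series, rsum_exp. }
  set (A := 4 * PI ^ 2 * z ^ 2).
  assert (HA : 0 < A) by (unfold A; assert (0 < PI ^ 2 /\ 0 < z ^ 2) by (split; now apply pow_lt); nra).
  assert (Hy : y ^ 2 = 4 * A) by (unfold y, A; ring).
  assert (Hodd : forall N, (- y) ^ (2 * N + 3) = - y ^ (2 * N + 3)).
  { intro N. replace (- y) with (-1 * y) by ring. rewrite Rpow_mult_distr.
    replace (2 * N + 3)%nat with (S (2 * (N + 1))) by lia. rewrite pow_1_odd. ring. }
  assert (Heven : forall N, (- y) ^ (2 * N + 2) = y ^ (2 * N + 2)).
  { intro N. replace (- y) with (-1 * y) by ring. rewrite Rpow_mult_distr.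
    replace (2 * N + 2)%nat with (2 * (N + 1))%nat by lia. rewrite pow_1_even. ring. }
  assert (B : forall N, Rsum f (2 * N + 2) <= 2 + 4 * A * Rsum (fun k => bessel0F1_coef k * A ^ k) N).
  { induction N. unfold f; simpl. lra.
    replace (2 * S N + 2)%nat with (S (S (2 * N + 2))) by lia. cbn [Rsum].
    assert (F1 : f (S (2 * N + 2)) = 0).
    { unfold f. replace (S (2 * N + 2)) with (2 * N + 3)%nat by lia. rewrite Hodd. field. apply INR_fact_neq_0. }
    rewrite F1.
    assert (F2 : f (2 * N + 2)%nat <= 4 * A * (bessel0F1_coef N * A ^ N)).
    { unfold f. rewrite Heven. replace (2 * N + 2)%nat with (2 * (N + 1))%nat at 1 3 by lia. rewrite pow_mult, Hy.
      replace (N + 1)%nat with (S N) by lia. simpl pow. rewrite Rpow_mult_distr. unfold bessel0F1_coef.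
      assert (C := central_fact_le N).
      assert (F0 := INR_fact_lt_0 N). assert (F1' := INR_fact_lt_0 (S N)). assert (F2 := INR_fact_lt_0 (2 * N + 2)).
      set (u := INR (fact N) * INR (fact (S N))) in *. assert (Hu : 0 < u) by now apply Rmult_lt_0_compat.
      set (v := INR (fact (2 * N + 2))) in *.
      assert (I : 2 * 4 ^ N * / v <= / u).
      { apply Rmult_le_reg_r with (u * v). now apply Rmult_lt_0_compat.
        replace (2 * 4 ^ N * / v * (u * v)) with (2 * 4 ^ N * u) by (field; lra).
        replace (/ u * (u * v)) with v by (field; lra). exact C. }
      replace (4 * A * (4 ^ N * A ^ N) / v + 4 * A * (4 ^ N * A ^ N) / v) with (4 * A * A ^ N * (2 * 4 ^ N * / v)) by (field; lra).
      replace (4 * A * (/ u * A ^ N)) with (4 * A * A ^ N * / u) by ring.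
      apply Rmult_le_compat_l; auto. apply Rmult_le_pos. lra. apply pow_le; lra. }
    lra. }
  assert (Bs : forall N, Rsum f (2 * N + 2) <= 2 + 4 * A * bessel0F1 A).
  { intro N. eapply Rle_trans. apply B. apply Rplus_le_compat_l, Rmult_le_compat_l. lra.
    apply rsum_partial_le. 2: apply bessel0F1_rsum. intro k. apply Rmult_le_pos. left; apply bessel0F1_coef_pos. apply pow_le; lra. }
  assert (L : Rbar_le (exp y + exp (- y)) (2 + 4 * A * bessel0F1 A)).
  { apply (is_lim_seq_le (fun N => Rsum f (2 * N + 2)) (fun _ => 2 + 4 * A * bessel0F1 A)); auto using is_lim_seq_const.
    apply (is_lim_seq_subseq (Rsum f) _ (fun N => 2 * N + 2)%nat); auto.
    intros Q [N HQ]. exists N. intros n Hn. apply HQ. lia. }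
  unfold Rbar_le in L. assert (E := exp_pos (- y)).
  unfold main_term. fold A. replace (4 * z ^ 2 * (4 * PI ^ 2 * bessel0F1 A)) with (4 * A * bessel0F1 A) by (unfold A; ring). lra.
Qed.

Lemma le_exp_quarter (z : R) : 11 <= z -> z <= exp (z / 4).
Proof.
  intros Hz.
  assert (H1 : 11 <= exp (11 / 4)).
  { replace (11 / 4) with (INR 12 * (11 / 48)) by (simpl; field).
    assert (E : exp (INR 12 * (11 / 48)) = exp (11 / 48) ^ 12).
    { generalize 12%nat. intro n. induction n. simpl. rewrite Rmult_0_l. apply exp_0.
      rewrite S_INR, Rmult_plus_distr_r, exp_plus, IHn, Rmult_1_l. simpl. ring. }
    rewrite E. apply Rle_trans with ((59 / 48) ^ 12). lra.
    apply pow_incr. split. lra. assert (H := exp_ineq1_le (11 / 48)). lra. }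
  replace (z / 4) with (11 / 4 + (z - 11) / 4) by field. rewrite exp_plus.
  assert (H2 := exp_ineq1_le ((z - 11) / 4)).
  apply Rle_trans with (11 * (1 + (z - 11) / 4)). lra.
  apply Rmult_le_compat; lra.
Qed.

(** In [j_coefficient_approx] the constant $32=8\cdot 4$ arises from [j_error_bound]; the extra unit
    pays for the additive 2 of [main_term_lower]. *)
Lemma exp_dominates (z : R) : 11 <= z -> 33 * z ^ 6 * exp (4 * PI ^ 2) <= exp (2 * PI * z).
Proof.
  intros Hz. assert (P3 := PI_gt_3). assert (P7 := PI_lt_7_2).
  assert (H1 := le_exp_quarter z Hz).
  assert (H2 : z ^ 6 <= exp (3 / 2 * z)).
  { replace (exp (3 / 2 * z)) with (exp (z / 4) ^ 6). apply pow_incr; lra.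
    simpl. rewrite Rmult_1_r, <- !exp_plus. f_equal. field. }
  assert (H3 : 33 <= exp 4).
  { replace 4 with (2 + 2) by ring. rewrite exp_plus.
    assert (H := exp_ineq1_le (1 / 2)). assert (E : exp 2 = exp (1 / 2) * exp (1 / 2) * exp (1 / 2) * exp (1 / 2)).
    { rewrite <- !exp_plus. f_equal. field. }
    assert (Q : 9 / 4 <= exp (1 / 2) * exp (1 / 2)) by nra. 
    assert (Hh := exp_ineq1_le (1 / 4)). assert (E2 : exp (1 / 2) = exp (1 / 4) * exp (1 / 4)) by (rewrite <- exp_plus; f_equal; field).
    assert (Q2 : 25 / 16 <= exp (1 / 2)) by nra.
    assert (Q3 : 625 / 256 <= exp (1 / 2) * exp (1 / 2)) by nra. assert (Q4 : 5.9 <= exp 2) by nra. nra. }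
  apply Rle_trans with (exp 4 * exp (3 / 2 * z) * exp (4 * PI ^ 2)).
  - apply Rmult_le_compat_r. left; apply exp_pos. apply Rmult_le_compat; try lra. apply pow_le; lra.
  - rewrite <- !exp_plus. apply exp_mono. nra.
Qed.

Lemma j_error_summable (c : nat -> Z) (s : R) : is_j_coefficients c -> 0 < s ->
  exists K, rsum (fun m => Rabs (j_error c m) * exp (- (2 * PI * s)) ^ m) K.
Proof.
  intros hc Hs. assert (P := PI_RGT_0).
  assert (Hs2 : 0 < Re (RtoC (s / 2))) by (rewrite re_RtoC; lra).
  destruct (main_series (s / 2)%R Hs2) as [L [HL _]]. { simpl. rewrite Rabs_R0. lra. }
  assert (H := j_error_series c _ _ hc Hs2 HL). rewrite qexp_real in H.
  apply (rsum_abel (j_error c) (exp (- (2 * PI * (s / 2)))) (Re (klein_j (s / 2)%R - / RtoC (exp (- (2 * PI * (s / 2)))) - L))).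
  - apply exp_pos.
  - apply csum_real. apply csum_ext with (2 := H). intro n. now rewrite RtoC_mult, RtoC_pow.
  - split. left; apply exp_pos. apply exp_increasing. nra.
Qed.

(** With $z=\sqrt n$ and $X=e^{2\pi z}$, Cauchy's estimate bounds the error by
    $X(X/(8z^6)+4e^{4\pi^2})$, while $M(n)\ge(X^2-2)/(4z^2)$. The leading quotient is $1/(2n^2)$;
    the spare factor 2 covers the lower order terms. *)
Lemma j_coefficient_approx (c : nat -> Z) (n : nat) : is_j_coefficients c -> (121 <= n)%nat ->
  0 < main_term (INR n) /\ Rabs (IZR (c n) - main_term (INR n)) <= main_term (INR n) / INR n ^ 2.
Proof.
  intros hc Hn. assert (P3 := PI_gt_3).
  apply le_INR in Hn. replace (INR 121) with (11 * 11) in Hn by (rewrite INR_IZR_INZ; simpl; lra).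
  set (z := sqrt (INR n)). assert (Hz2 : z * z = INR n) by (apply sqrt_sqrt; lra).
  assert (Hz : 11 <= z). { unfold z. replace 11 with (sqrt (11 * 11)) by (apply sqrt_square; lra). now apply sqrt_le_1_alt. }
  destruct (j_error_summable c (/ z) hc) as [K HK]. { apply Rinv_0_lt_compat; lra. }
  assert (B := cauchy_estimate _ _ _ _ n HK (fun s l => j_error_bound c z s l hc Hz)).
  assert (Ej : j_error c n = IZR (c n) - main_term (INR n)).
  { destruct n. simpl in Hn; lra. cbn [j_error]. now rewrite S_INR. }
  rewrite Ej in B. clear HK.
  assert (Er : exp (- (2 * PI * / z)) ^ n = / exp (2 * PI * z)).
  { rewrite <- exp_Ropp. assert (G : forall m, exp (- (2 * PI * / z)) ^ m = exp (INR m * - (2 * PI * / z))).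
    { induction m. simpl. now rewrite Rmult_0_l, exp_0. rewrite S_INR, Rmult_plus_distr_r, exp_plus, <- IHm, Rmult_1_l. simpl; ring. }
    rewrite G, <- Hz2. f_equal. field. lra. }
  rewrite Er in B.
  assert (M := main_term_lower z ltac:(lra)). replace (z ^ 2) with (INR n) in M by (rewrite <- Hz2; ring).
  replace (4 * PI * z) with (2 * PI * z + 2 * PI * z) in M by ring. rewrite exp_plus in M.
  assert (D := exp_dominates z Hz).
  set (X := exp (2 * PI * z)) in *. set (A := exp (4 * PI ^ 2)) in *.
  assert (A1 : 1 <= A) by (unfold A; rewrite <- exp_0; apply exp_mono; nra).
  assert (Z6 : 1 <= z ^ 6) by (apply pow_R1_Rle; lra). assert (Z2 : 121 <= z ^ 2) by nra.
  set (m := main_term (INR n)) in *.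
  assert (X1 : 33 <= X) by (assert (1 <= z ^ 6 * A) by nra; nra).
  rewrite <- Hz2 in *. 
  assert (Hm : 0 < m) by nra. split; auto.
  assert (B' : Rabs (IZR (c n) - m) <= X * (X / (8 * z ^ 6) + 4 * A)).
  { apply Rmult_le_compat_r with (r := X) in B. 2: lra. rewrite Rmult_assoc, Rinv_l in B by lra. lra. }
  eapply Rle_trans. apply B'.
  assert (Q : X * (X / (8 * z ^ 6) + 4 * A) * (8 * z ^ 6) = X * X + 32 * z ^ 6 * A * X) by (field; lra).
  apply Rmult_le_reg_r with (8 * z ^ 6). lra. rewrite Q.
  replace (m / (z * z) ^ 2 * (8 * z ^ 6)) with (2 * (4 * z ^ 2 * m)) by (field; lra).
  assert (D' : 33 * z ^ 6 * A * X <= X * X) by (apply Rmult_le_compat_r; lra).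
  assert (D'' : 33 <= z ^ 6 * A * X).
  { apply Rle_trans with (1 * 1 * 33). lra. apply Rmult_le_compat; try lra. apply Rmult_le_compat; lra. }
  lra.
Qed.

(** * Convexity of the main term *)

Lemma bessel0F1_CV_radius : CV_radius bessel0F1_coef = p_infty.
Proof.
  assert (H : forall x : R, Rbar_le x (CV_radius bessel0F1_coef)).
  { intro x. apply (proj1 (Lub.Lub_Rbar_correct (CV_disk bessel0F1_coef))). apply bessel0F1_ex_series. }
  destruct (CV_radius bessel0F1_coef) as [r | |]; auto.
  - specialize (H (r + 1)). unfold Rbar_le in H. lra.
  - now specialize (H 0).
Qed.

Definition bessel0F1' (x : R) : R := PSeries (PS_derive bessel0F1_coef) x.
Definition bessel0F1'' (x : R) : R := PSeries (PS_derive (PS_derive bessel0F1_coef)) x.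

Lemma bessel0F1_derive (x : R) : is_derive bessel0F1 x (bessel0F1' x) /\ is_derive bessel0F1' x (bessel0F1'' x).
Proof.
  split; apply is_derive_PSeries; rewrite ?CV_radius_derive, bessel0F1_CV_radius; exact I.
Qed.

Lemma bessel0F1_ex_pseries (x : R) : ex_pseries bessel0F1_coef x /\ ex_pseries (PS_derive bessel0F1_coef) x /\
  ex_pseries (PS_derive (PS_derive bessel0F1_coef)) x.
Proof.
  repeat split; apply CV_radius_inside; rewrite ?CV_radius_derive, bessel0F1_CV_radius; exact I.
Qed.

Lemma bessel0F1_coef_S (n : nat) : (INR n + 1) * (INR n + 2) * bessel0F1_coef (S n) = bessel0F1_coef n.
Proof.
  unfold bessel0F1_coef. rewrite (fact_simpl (S n)), (fact_simpl n), !mult_INR, !S_INR.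
  assert (H := INR_fact_neq_0 n). assert (P := pos_INR n). field. repeat split; lra.
Qed.

Lemma bessel0F1_ode (x : R) : x * bessel0F1'' x + 2 * bessel0F1' x = bessel0F1 x.
Proof.
  destruct (bessel0F1_ex_pseries x) as [_ [E1 E2]].
  unfold bessel0F1, bessel0F1', bessel0F1''.
  rewrite <- PSeries_incr_1, <- (PSeries_scal 2), <- PSeries_plus.
  - apply PSeries_ext. intro n. unfold PS_plus, PS_scal. rewrite <- bessel0F1_coef_S.
    destruct n; unfold PS_incr_1, PS_derive; rewrite ?S_INR; change (@plus _) with Rplus; change (@scal _ _) with Rmult; change (@zero _) with 0; simpl INR; ring.
  - now apply ex_pseries_incr_1.
  - apply ex_pseries_scal; auto. apply Rmult_comm.
Qed.

(* Cauchy-Schwarz: the left-hand side is [sum_n (n - r)^2 a_n x^n]. *)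
Lemma bessel0F1_variance (x r : R) : 0 <= x ->
  0 <= x * (x * bessel0F1'' x) + (1 - 2 * r) * (x * bessel0F1' x) + r ^ 2 * bessel0F1 x.
Proof.
  intros Hx. destruct (bessel0F1_ex_pseries x) as [E0 [E1 E2]].
  unfold bessel0F1, bessel0F1', bessel0F1''.
  assert (F1 := ex_pseries_incr_1 _ x E1). assert (F2 := ex_pseries_incr_1 _ x (ex_pseries_incr_1 _ x E2)).
  assert (G1 := ex_pseries_scal (1 - 2 * r) _ x (Rmult_comm _ _) F1).
  assert (G0 := ex_pseries_scal (r ^ 2) _ x (Rmult_comm _ _) E0).
  rewrite <- !PSeries_incr_1, <- !PSeries_scal, <- PSeries_plus, <- PSeries_plus; auto.
  2: now apply ex_pseries_plus.
  assert (S := PSeries_correct _ x (ex_pseries_plus _ _ x (ex_pseries_plus _ _ x F2 G1) G0)).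
  apply is_pseries_R, rsum_is_series in S. apply rsum_nonneg with (2 := S).
  intro n. apply Rmult_le_pos. 2: now apply pow_le.
  unfold PS_plus, PS_scal. change (@plus _) with Rplus; change (@scal _ _) with Rmult.
  match goal with |- 0 <= ?e => replace e with ((INR n - r) ^ 2 * bessel0F1_coef n) end.
  - apply Rmult_le_pos. apply pow2_ge_0. left; apply bessel0F1_coef_pos.
  - destruct n as [|[|n]]; unfold PS_incr_1, PS_derive; change (@zero _) with 0; rewrite ?S_INR; simpl INR; ring.
Qed.

Lemma bessel0F1_pos (x : R) : 0 <= x -> 0 < bessel0F1 x /\ 0 <= bessel0F1' x.
Proof.
  intros Hx. destruct (bessel0F1_ex_pseries x) as [_ [E1 _]]. split.
  - apply Rlt_le_trans with (Rsum (fun k => bessel0F1_coef k * x ^ k) 1).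
    + simpl. assert (H := bessel0F1_coef_pos 0). lra.
    + apply rsum_partial_le. 2: apply bessel0F1_rsum. intro k. apply Rmult_le_pos. left; apply bessel0F1_coef_pos. now apply pow_le.
  - assert (S := PSeries_correct _ x E1). apply is_pseries_R, rsum_is_series in S. apply rsum_nonneg with (2 := S).
    intro n. apply Rmult_le_pos. 2: now apply pow_le. apply Rmult_le_pos. apply pos_INR. left; apply bessel0F1_coef_pos.
Qed.

(** This is $xM'(x)/M(x)$, also the mean of $n$ under the weights $a_nt^n$ of the Bessel series at
    $t=4\pi^2x$. *)
Definition main_slope (x : R) : R := 4 * PI ^ 2 * x * bessel0F1' (4 * PI ^ 2 * x) / bessel0F1 (4 * PI ^ 2 * x).

Lemma main_slope_bound (x : R) : 0 <= x -> 0 <= main_slope x /\ main_slope x ^ 2 + main_slope x <= 4 * PI ^ 2 * x.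
Proof.
  intros Hx. unfold main_slope. set (t := 4 * PI ^ 2 * x).
  assert (Ht : 0 <= t) by (unfold t; assert (0 <= PI ^ 2) by (apply pow2_ge_0); nra).
  destruct (bessel0F1_pos t Ht) as [H0 H1]. assert (V := fun r => bessel0F1_variance t r Ht). assert (O := bessel0F1_ode t).
  set (g := bessel0F1 t) in *. set (g1 := bessel0F1' t) in *. set (g2 := bessel0F1'' t) in *.
  assert (I : 0 < / g) by now apply Rinv_0_lt_compat. split.
  - apply Rmult_le_pos. apply Rmult_le_pos; lra. lra.
  (* The variance is taken about the mean, where the quadratic in $r$ is smallest; the differential
     equation then removes the second derivative. *)
  - specialize (V (t * g1 / g)). replace (t * g2) with (g - 2 * g1) in V by lra.
    apply Rmult_le_reg_r with g; auto.
    replace (((t * g1 / g) ^ 2 + t * g1 / g) * g) with ((t * g1) ^ 2 / g + t * g1) by (field; lra).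
    replace (t * (g - 2 * g1) + (1 - 2 * (t * g1 / g)) * (t * g1) + (t * g1 / g) ^ 2 * g)
      with (t * g - t * g1 - (t * g1) ^ 2 / g) in V by (field; lra). lra.
Qed.

(** The Bessel equation in Riccati form: $xr'=t-r-r^2$ for the slope $r$ and $t=4\pi^2x$. Second
    derivatives of $\ln M$ thus involve [main_slope] only. *)
Lemma main_term_derive (x : R) : 0 < x ->
  0 < main_term x /\
  is_derive (fun y => ln (main_term y)) x (main_slope x / x) /\
  is_derive main_slope x ((4 * PI ^ 2 * x - main_slope x - main_slope x ^ 2) / x).
Proof.
  intros Hx. unfold main_term, main_slope. assert (P := PI_RGT_0).
  set (A := 4 * PI ^ 2). assert (HA : 0 < A) by (unfold A; assert (0 < PI ^ 2) by (now apply pow_lt); lra).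
  assert (Hp : 0 < A * x) by now apply Rmult_lt_0_compat.
  destruct (bessel0F1_pos (A * x) ltac:(lra)) as [H0 _]. destruct (bessel0F1_derive (A * x)) as [D0 D1].
  assert (O := bessel0F1_ode (A * x)).
  assert (Hlin : is_derive (fun y : R => A * y) x A).
  { auto_derive; auto. ring. }
  assert (C0 : is_derive (fun y => bessel0F1 (A * y)) x (A * bessel0F1' (A * x))).
  { apply (is_derive_comp bessel0F1 (fun y => A * y) x _ _ D0 Hlin). }
  assert (C1 : is_derive (fun y => bessel0F1' (A * y)) x (A * bessel0F1'' (A * x))).
  { apply (is_derive_comp bessel0F1' (fun y => A * y) x _ _ D1 Hlin). }
  assert (U0 := is_derive_unique _ _ _ C0). assert (U1 := is_derive_unique _ _ _ C1).
  assert (V0 : ex_derive (fun y => bessel0F1 (A * y)) x) by now eexists; apply C0.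
  assert (V1 : ex_derive (fun y => bessel0F1' (A * y)) x) by now eexists; apply C1.
  revert C0 C1 U0 U1 V0 V1 H0 O. 
  generalize (bessel0F1'' (A * x)). intro g2.
  set (g := fun y => bessel0F1 (A * y)). set (g1 := fun y => bessel0F1' (A * y)).
  change (bessel0F1 (A * x)) with (g x). change (bessel0F1' (A * x)) with (g1 x).
  intros C0 C1 U0 U1 V0 V1 H0 O.
  split. now apply Rmult_lt_0_compat. split.
  - change (is_derive (fun y => ln (A * g y)) x (A * x * g1 x / g x / x)).
    auto_derive. repeat split; auto. now apply Rmult_lt_0_compat.
    replace (Derive (fun y : R => g y) x) with (A * g1 x) by (symmetry; exact U0). field. repeat split; lra.
  - change (is_derive (fun y => A * y * g1 y / g y) x ((A * x - A * x * g1 x / g x - (A * x * g1 x / g x) ^ 2) / x)).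
    auto_derive. repeat split; auto. lra.
    replace (Derive (fun y : R => g y) x) with (A * g1 x) by (symmetry; exact U0).
    replace (Derive (fun y : R => g1 y) x) with (A * g2) by (symmetry; exact U1).
    replace (A * g2) with ((g x - 2 * g1 x) / x) by (rewrite <- O; field; lra).
    field. repeat split; lra.
Qed.

Lemma second_difference_ge (f f' f'' : R -> R) (a kappa : R) :
  (forall x, a <= x <= a + 2 -> is_derive f x (f' x) /\ is_derive f' x (f'' x) /\ kappa <= f'' x) ->
  kappa <= f a + f (a + 2) - 2 * f (a + 1).
Proof.
  intros H.
  destruct (MVT_cor2 (fun x => f (x + 1) - f x) (fun x => f' (x + 1) - f' x) a (a + 1)) as [b [Eb Hb]]. lra.
  { intros x Hx. apply is_derive_Reals. apply (is_derive_minus (K := R_AbsRing) (V := R_NormedModule)). 2: apply H; lra.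
    rewrite <- (Rmult_1_l (f' (x + 1))). apply (is_derive_comp f (fun y => y + 1)). apply H; lra.
    auto_derive; auto. }
  destruct (MVT_cor2 f' f'' b (b + 1)) as [d [Ed Hd]]. lra.
  { intros x Hx. apply is_derive_Reals. apply H; lra. }
  destruct (H d ltac:(lra)) as [_ [_ K]]. cbv beta in Eb. replace (a + 1 + 1) with (a + 2) in Eb by ring. lra.
Qed.

(** The factor $4z^2$ of [main_term_lower] is absorbed by $z^2\le e^{z/2}$ and $5\le e^2$; having 5
    instead of 4 pays for the additive 2, since $e^{4\pi z}\ge 10$. *)
Lemma ln_main_term_lower (z : R) : 11 <= z -> 4 * PI * z - z / 2 - 2 <= ln (main_term (z ^ 2)).
Proof.
  intros Hz. assert (P3 := PI_gt_3).
  assert (M := main_term_lower z ltac:(lra)). assert (Q := le_exp_quarter z Hz).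
  set (m := main_term (z ^ 2)) in *.
  assert (E2 : 5 <= exp 2).
  { assert (H := exp_ineq1_le (1 / 2)). assert (H2 : exp 1 = exp (1 / 2) * exp (1 / 2)) by (rewrite <- exp_plus; f_equal; field).
    assert (H3 : exp 2 = exp 1 * exp 1) by (rewrite <- exp_plus; f_equal; ring).
    assert (H4 : 9 / 4 <= exp 1) by nra. nra. }
  assert (E4 : 10 <= exp (4 * PI * z)).
  { assert (H := exp_ineq1_le (4 * PI * z)). nra. }
  assert (Qz : z ^ 2 <= exp (z / 2)).
  { replace (z / 2) with (z / 4 + z / 4) by field. rewrite exp_plus. simpl. nra. }
  assert (Em : exp (4 * PI * z - z / 2 - 2) * (exp (z / 2) * exp 2) = exp (4 * PI * z)).
  { rewrite <- !exp_plus. f_equal. field. }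
  set (w := exp (4 * PI * z - z / 2 - 2)) in *. assert (Hw : 0 < w) by apply exp_pos.
  assert (Hm : 0 < m) by (assert (0 < z ^ 2) by (apply pow_lt; lra); nra).
  rewrite <- (ln_exp (4 * PI * z - z / 2 - 2)). fold w. apply ln_mono; auto.
  apply Rmult_le_reg_l with (4 * exp (z / 2)). assert (H := exp_pos (z / 2)); lra.
  assert (H1 : 4 * z ^ 2 * m <= 4 * exp (z / 2) * m) by (apply Rmult_le_compat_r; lra).
  assert (H2 : 4 * exp (z / 2) * w * 5 <= 4 * exp (z / 2) * w * exp 2).
  { apply Rmult_le_compat_l; auto. assert (H := exp_pos (z / 2)). apply Rmult_le_pos; lra. }
  lra.
Qed.

(* With [r = main_slope x] and [t = 4 pi^2 x], the inequality [r^2 + r <= t] bounds the last expression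
   below by [2 ln M(x) - 3 sqrt t], and [ln M(x)] is about [2 sqrt t]. *)
Lemma ln_main_term_convex (x : R) : 121 <= x ->
  is_derive (fun y => ln (main_term y) / y) x ((main_slope x - ln (main_term x)) / x ^ 2) /\
  is_derive (fun y => (main_slope y - ln (main_term y)) / y ^ 2) x
    ((4 * PI ^ 2 * x - 4 * main_slope x - main_slope x ^ 2 + 2 * ln (main_term x)) / x ^ 3) /\
  44 <= 4 * PI ^ 2 * x - 4 * main_slope x - main_slope x ^ 2 + 2 * ln (main_term x).
Proof.
  intros Hx. assert (P3 := PI_gt_3). destruct (main_term_derive x ltac:(lra)) as [_ [D0 D1]].
  destruct (main_slope_bound x ltac:(lra)) as [R0 R1].
  assert (U0 := is_derive_unique _ _ _ D0). assert (U1 := is_derive_unique _ _ _ D1).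
  set (L := fun y => ln (main_term y)) in *. change (ln (main_term x)) with (L x).
  assert (V0 : ex_derive L x) by now eexists; apply D0.
  assert (V1 : ex_derive main_slope x) by now eexists; apply D1.
  assert (X2 : x ^ 2 <> 0) by (apply pow_nonzero; lra).
  split; [|split].
  - change (is_derive (fun y => L y / y) x ((main_slope x - L x) / x ^ 2)).
    auto_derive. repeat split; auto; lra.
    replace (Derive (fun y : R => L y) x) with (main_slope x / x) by (symmetry; exact U0). field. lra.
  - change (is_derive (fun y => (main_slope y - L y) / y ^ 2) x ((4 * PI ^ 2 * x - 4 * main_slope x - main_slope x ^ 2 + 2 * L x) / x ^ 3)).
    set (T := 4 * PI ^ 2 * x - main_slope x - main_slope x ^ 2) in *.
    auto_derive. repeat split; auto.
    replace (Derive (fun y : R => L y) x) with (main_slope x / x) by (symmetry; exact U0).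
    replace (Derive (fun y : R => main_slope y) x) with (T / x) by (symmetry; exact U1).
    unfold T. field. lra.
  - set (z := sqrt x). assert (Hz2 : z ^ 2 = x) by (unfold z; rewrite <- (sqrt_sqrt x) at 2; [ring | lra]).
    assert (Hz : 11 <= z). { unfold z. replace 11 with (sqrt (11 * 11)) by (apply sqrt_square; lra). apply sqrt_le_1_alt; lra. }
    assert (B := ln_main_term_lower z Hz). rewrite Hz2 in B. fold (L x) in B. 
    set (r := main_slope x) in *.
    (* Then $2\ln M-3r\ge(2\pi-1)z-4$, which is at least 51 for $z\ge 11$ and $\pi>3$. *)
    assert (Br : r <= 2 * PI * z).
    { apply Rsqr_incr_0_var. 2: nra. unfold Rsqr. rewrite <- Hz2 in R1. nra. }
    nra.
Qed.

Lemma ln_ratio_bound (u v e : R) : 0 < v -> 0 <= e <= / 2 -> Rabs (u - v) <= v * e ->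
  0 < u /\ Rabs (ln u - ln v) <= 2 * e.
Proof.
  intros Hv He H. apply Rabs_le_between in H.
  assert (Hu : 0 < u) by nra. split; auto.
  assert (E : u = v * (u / v)) by (field; lra).
  assert (Hw : 0 < u / v) by now apply Rdiv_lt_0_compat.
  assert (B : 1 - e <= u / v <= 1 + e) by (rewrite E in H; nra).
  assert (El : ln u - ln v = ln (u / v)) by (rewrite E at 1; rewrite ln_mult by auto; ring). rewrite El.
  apply Rabs_le. split.
  - rewrite <- (ln_exp (- (2 * e))). apply ln_mono. apply exp_pos. apply Rle_trans with (2 := proj1 B).
    rewrite exp_Ropp. assert (G := exp_ineq1_le (2 * e)).
    apply Rle_trans with (/ (1 + 2 * e)). apply Rinv_le_contravar; lra.
    apply Rmult_le_reg_r with (1 + 2 * e). lra. rewrite Rinv_l by lra. nra.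
  - rewrite <- (ln_exp (2 * e)). apply ln_mono; auto. assert (G := exp_ineq1_le (2 * e)). lra.
Qed.

Definition log_root (c : nat -> Z) (n : nat) : R := ln (IZR (c n)) / INR n.

Lemma log_root_approx (c : nat -> Z) (n : nat) : is_j_coefficients c -> (121 <= n)%nat ->
  Rabs (log_root c n - ln (main_term (INR n)) / INR n) <= 2 / INR n ^ 3.
Proof.
  intros hc Hn. destruct (j_coefficient_approx c n hc Hn) as [Hm Ha].
  apply le_INR in Hn. replace (INR 121) with 121 in Hn by (rewrite INR_IZR_INZ; reflexivity). set (x := INR n) in *.
  destruct (ln_ratio_bound (IZR (c n)) (main_term x) (/ x ^ 2) Hm) as [_ H]; auto.
  { split. left. apply Rinv_0_lt_compat, pow_lt; lra. apply Rinv_le_contravar. lra. nra. }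
  unfold log_root. fold x. replace (ln (IZR (c n)) / x - ln (main_term x) / x) with ((ln (IZR (c n)) - ln (main_term x)) * / x) by (field; lra).
  rewrite Rabs_mult, (Rabs_pos_eq (/ x)) by (left; apply Rinv_0_lt_compat; lra).
  replace (2 / x ^ 3) with (2 * / x ^ 2 * / x) by (field; lra).
  apply Rmult_le_compat_r; auto. left; apply Rinv_0_lt_compat; lra.
Qed.

Lemma log_root_convex_large (c : nat -> Z) (n : nat) : is_j_coefficients c -> (121 <= n)%nat ->
  2 * log_root c (n + 1) <= log_root c n + log_root c (n + 2).
Proof.
  intros hc Hn.
  assert (A0 := log_root_approx c n hc Hn). assert (A1 := log_root_approx c (n + 1) hc ltac:(lia)).
  assert (A2 := log_root_approx c (n + 2) hc ltac:(lia)).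
  rewrite !plus_INR in *. simpl (INR 1) in *. simpl (INR 2) in *. replace (1 + 1) with 2 in A2 by ring.
  apply le_INR in Hn. replace (INR 121) with 121 in Hn by (rewrite INR_IZR_INZ; reflexivity). set (x := INR n) in *.
  assert (S := second_difference_ge (fun y => ln (main_term y) / y) (fun y => (main_slope y - ln (main_term y)) / y ^ 2)
    (fun y => (4 * PI ^ 2 * y - 4 * main_slope y - main_slope y ^ 2 + 2 * ln (main_term y)) / y ^ 3) x (44 / (x + 2) ^ 3)).
  cbv beta in S.
  assert (S' := S ltac:(
    intros y Hy; destruct (ln_main_term_convex y ltac:(lra)) as [D0 [D1 B]]; split; [exact D0 | split; [exact D1 |]];
    apply Rmult_le_compat; try lra; [left; apply Rinv_0_lt_compat, pow_lt; lra |
     apply Rinv_le_contravar; [apply pow_lt; lra | apply pow_incr; lra]])). clear S.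
  apply Rabs_le_between in A0, A1, A2.
  assert (I1 : 2 / (x + 1) ^ 3 <= 2 / x ^ 3).
  { apply Rmult_le_compat_l. lra. apply Rinv_le_contravar. apply pow_lt; lra. apply pow_incr; lra. }
  assert (I2 : 2 / (x + 2) ^ 3 <= 2 / x ^ 3).
  { apply Rmult_le_compat_l. lra. apply Rinv_le_contravar. apply pow_lt; lra. apply pow_incr; lra. }
  (* Since $x+2\le 3x/2$, the left side costs at most $8\cdot 27/8=27$ against 44. *)
  assert (I3 : 8 / x ^ 3 <= 44 / (x + 2) ^ 3).
  { assert (X3 : 0 < x ^ 3) by (apply pow_lt; lra). assert (Y3 : 0 < (x + 2) ^ 3) by (apply pow_lt; lra).
    assert (H : (x + 2) ^ 3 <= (3 / 2 * x) ^ 3) by (apply pow_incr; lra).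
    apply Rmult_le_reg_r with (x ^ 3 * (x + 2) ^ 3). now apply Rmult_lt_0_compat.
    replace (8 / x ^ 3 * (x ^ 3 * (x + 2) ^ 3)) with (8 * (x + 2) ^ 3) by (field; lra).
    replace (44 / (x + 2) ^ 3 * (x ^ 3 * (x + 2) ^ 3)) with (44 * x ^ 3) by (field; lra).
    rewrite Rpow_mult_distr in H. lra. }
  lra.
Qed.

Lemma log_root_convex_small (c : nat -> Z) (n : nat) : is_j_coefficients c -> (1 <= n)%nat -> (n + 3 <= table_size)%nat ->
  2 * log_root c (n + 1) <= log_root c n + log_root c (n + 2).
Proof.
  intros hc Hn HN.
  assert (HN8 : (S table_size <= 2 ^ 8)%nat) by (apply Nat.leb_le; reflexivity).
  (* The checked list starts at $c(1)$, so $c(n)$ is its entry [n - 1] and the entry [n + 1] of the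
     whole table. *)
  destruct (log_convex_check_correct 12 1 _ j_table_check (n - 1)) as [_ H]. { rewrite length_skipn, j_table_length. lia. }
  revert H. generalize dependent table_size. intros N HN HN8.
  unfold znth. rewrite !nth_skipn. fold (znth (j_table 8 N)).
  intro H. change (nth ?m ?l 0%Z) with (znth l m) in H.
  replace (2 + (n - 1))%nat with (S n) in H by lia. replace (2 + (n - 1 + 1))%nat with (S (n + 1)) in H by lia.
  replace (2 + (n - 1 + 2))%nat with (S (n + 2)) in H by lia. replace (1 + (n - 1))%nat with n in H by lia.
  rewrite <- !(j_table_correct 8 N c) in H by (auto; lia).
  unfold log_root. rewrite !plus_INR. simpl (INR 1). simpl (INR 2). replace (1 + 1) with 2 by ring.
  apply le_INR in Hn. simpl (INR 1) in Hn. set (k := INR n) in *.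
  apply Rmult_le_reg_r with (k * (k + 1) * (k + 2)). repeat apply Rmult_lt_0_compat; lra.
  replace (2 * (ln (IZR (c (n + 1)%nat)) / (k + 1)) * (k * (k + 1) * (k + 2))) with (2 * k * (k + 2) * ln (IZR (c (n + 1)%nat))) by (field; lra).
  replace ((ln (IZR (c n)) / k + ln (IZR (c (n + 2)%nat)) / (k + 2)) * (k * (k + 1) * (k + 2)))
    with ((k + 1) * (k + 2) * ln (IZR (c n)) + k * (k + 1) * ln (IZR (c (n + 2)%nat))) by (field; lra).
  exact H.
Qed.

Theorem theorem3p3 (c : nat -> Z) (hc : is_j_coefficients c) :
  log_convex_from 1 (fun n : nat => nth_root n (IZR (c n))).
Proof.
  intros n Hn.
  (* Roots become exponentials, so log-convexity of the roots is convexity of [log_root]. *)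
  assert (E : forall m, nth_root m (IZR (c m)) = exp (log_root c m)).
  { intro m. unfold nth_root, Rpower, log_root. f_equal. unfold Rdiv. ring. }
  rewrite !E.
  assert (H : 2 * log_root c (n + 1) <= log_root c n + log_root c (n + 2)).
  { destruct (Nat.le_gt_cases 121 n). now apply log_root_convex_large.
    apply log_root_convex_small; auto. unfold table_size. lia. }
  apply Rle_ge, Rge_le, Rge_minus, Rle_ge. rewrite <- exp_plus. simpl pow. rewrite Rmult_1_r, <- exp_plus.
  apply exp_mono. lra.
Qed.
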